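(* Let $\alpha\in(0,2)$, let $\xi$ be symmetric and regularly varying with index $\alpha$, let $\mathbf{y}_1$ be the associated self-normalized vector, let $\mathbf{A}_n=(a^{(n)}_{ij})_{i,j=1}^n$, $n\ge1$, be random Hermitian matrices independent of $\mathbf{y}_1$, and let $Q_n=\mathbf{y}_1^\top\mathbf{A}_n\mathbf{y}_1$. Assume that $\limsup_{n\to\infty}\max_{1\le i\le n}|a_{ii}^{(n)}|<\infty$ almost surely, that $\frac1n\sum_{i=1}^n\delta_{a_{ii}^{(n)}}$ converges weakly almost surely to a deterministic probability measure $\nu$, and that $$\lim_{n\to\infty}n^{-2}\,\mathbb{E}\big[\|\mathbf{A}_n-\operatorname{diag}(\mathbf{A}_n)\|_F^2\big]=0.$$ Then, as $n\to\infty$, $Q_n$ converges in distribution to a random variable with induced probability measure $\mu_{\nu,\alpha}$, whose Stieltjes transform is given by $$s_{\mu_{\nu,\alpha}}(z)=-\frac{\int_{\mathbb{R}}(z-x)^{\frac{\alpha}{2}-1}\,\nu(dx)}{\int_{\mathbb{R}}(z-x)^{\frac{\alpha}{2}}\,\nu(dx)},\qquad z\in\mathbb{C}\setminus\operatorname{supp}(\nu).$$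
   Context: A real random variable $\xi$ is symmetric if $\xi$ and $-\xi$ have the same law. It is regularly varying with index $\alpha>0$ if $\mathbb{P}(|\xi|>x)=x^{-\alpha}L(x)$ for $x>0$, where $L:(0,\infty)\to(0,\infty)$ is slowly varying at infinity, i.e. $L(tx)/L(x)\to1$ as $x\to\infty$ for every $t>0$. Given i.i.d. copies $X_{11},X_{12},\dots$ of $\xi$, put $Y_{1j}=Y_{1j}^{(n)}=X_{1j}/\sqrt{X_{11}^2+\cdots+X_{1n}^2}$, $1\le j\le n$, and $\mathbf{y}_1=(Y_{11},\dots,Y_{1n})^\top$. For a matrix $\mathbf A$, $\operatorname{diag}(\mathbf A)$ is the diagonal matrix with the same diagonal as $\mathbf A$, and $\|\cdot\|_F$ is the Frobenius norm. The Stieltjes transform of a probability measure $\mu$ on $\mathbb{R}$ is $s_\mu(z)=\int_{\mathbb{R}}\frac{1}{x-z}\mu(dx)$, $z\in\mathbb{C}\setminus\operatorname{supp}(\mu)$. Complex powers are taken with the principal branch, with branch cut along $(-\infty,0]$.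
   Formalization: The Stieltjes formula is stated for z outside supp(ν) and also outside supp(μ_{ν,α}), where the transform is defined; at real z in gaps of supp(ν) inside supp(μ_{ν,α}) the printed formula fails, e.g. ν=(δ_{-1}+δ_1)/2, z=0, where the right side is i·tan(πα/4). *)

(* Defs.v *)
From HB Require Import structures.
From mathcomp Require Import all_boot all_order all_algebra.
From mathcomp Require Import sesquilinear.
From mathcomp Require Import complex.
From mathcomp Require Import all_classical all_reals all_analysis.
Set Implicit Arguments.
Unset Strict Implicit.
Unset Printing Implicit Defensive.
Import Order.TTheory GRing.Theory Num.Theory.
Import numFieldNormedType.Exports.
Local Open Scope classical_set_scope.
Local Open Scope ring_scope.
Local Open Scope complex_scope.

Section real_laws.
Context {d : measure_display} {T : measurableType d} {R : realType}.
Variable P : probability T R.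

(* Laws are compared on Borel sets only: the value of a [measure] on a
   non-measurable set is unconstrained. *)
Definition same_law (f g : T -> R) : Prop :=
  forall B : set R, measurable B -> P (f @^-1` B) = P (g @^-1` B).

Definition symmetric_law (f : T -> R) : Prop := same_law f (fun w => - f w).

Definition slowly_varying (L : R -> R) : Prop :=
  forall t, 0 < t -> L (t * x) / L x @[x --> +oo] --> (1 : R).

Definition regularly_varying (alpha : R) (f : T -> R) : Prop :=
  exists L : R -> R,
    [/\ forall x, 0 < x -> 0 < L x,
        slowly_varying L &
        forall x, 0 < x -> P [set w | x < `|f w|] = (x `^ (- alpha) * L x)%:E].

Definition mutually_independent (X : nat -> T -> R) : Prop :=
  forall (s : seq nat) (B : nat -> set R), uniq s ->
    (forall j, measurable (B j)) ->
    P (\bigcap_(j in [set` s]) X j @^-1` B j) =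
    (\prod_(j <- s) P (X j @^-1` B j))%E.

Definition iid_copies (f : T -> R) (X : nat -> T -> R) : Prop :=
  mutually_independent X /\ forall j, same_law (X j) f.

Definition sigma_generated (F : set (T -> R)) : set (set T) :=
  <<s \bigcup_(f in F) preimage_set_system setT f measurable >>.

Definition independent_families (F G : set (T -> R)) : Prop :=
  forall E H, sigma_generated F E -> sigma_generated G H ->
    P (E `&` H) = (P E * P H)%E.

(* Convergence of the laws of the [Q n], tested on bounded continuous
   functions. *)
Definition cvg_in_distribution (Q : nat -> T -> R) (mu : probability R R) :
    Prop :=
  forall f : R -> R, continuous f -> bounded_fun f ->
    ('E_P[f \o Q n] @[n --> \oo] --> \int[mu]_x (f x)%:E)%E.

End real_laws.

Definition weakly_cvg {R : realType}
    (mu_ : nat -> {measure set R -> \bar R}) (mu : probability R R) : Prop :=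
  forall f : R -> R, continuous f -> bounded_fun f ->
    (\int[mu_ n]_x (f x)%:E @[n --> \oo] --> \int[mu]_x (f x)%:E)%E.

Definition empirical_measure {R : realType} (s : seq R) :
    {measure set R -> \bar R} :=
  mscale ((size s)%:R^-1)%:nng (msum (fun k => \d_(nth 0 s k)) (size s)).

Section random_matrices.
Context {d : measure_display} {T : measurableType d} {R : realType}.

Definition entries n (A : T -> 'M[R[i]]_n) : set (T -> R) :=
  [set f | exists i j, f = (fun w => complex.Re (A w i j)) \/
                       f = (fun w => complex.Im (A w i j))].

Definition coordinates n (y : T -> 'cV[R]_n) : set (T -> R) :=
  [set f | exists j, f = (fun w => y w j 0)].

Definition random_matrix n (A : T -> 'M[R[i]]_n) : Prop :=
  forall f, entries A f -> measurable_fun setT f.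

(* Indices are shifted: [X j] is X_{1,j+1}.  The vector is 0 when
   X_{11} = ... = X_{1n} = 0, since [0^-1 = 0]. *)
Definition self_normalized (X : nat -> T -> R) n (w : T) : 'cV[R]_n :=
  \col_j (X j w / Num.sqrt (\sum_(k < n) X k w ^+ 2)).

End random_matrices.

Section matrices.
Context {R : realType}.

Definition diag_part n (M : 'M[R[i]]_n) : 'M[R[i]]_n :=
  diag_mx (\row_i M i i).

Definition frobenius_norm n (M : 'M[R[i]]_n) : R :=
  Num.sqrt (\sum_i \sum_j Normc.normc (M i j) ^+ 2).

(* The diagonal of a Hermitian matrix is real, so nothing is lost by [Re]. *)
Definition real_diag n (M : 'M[R[i]]_n) : seq R :=
  [seq complex.Re (M i i) | i <- enum 'I_n].

(* For M Hermitian and y real, y^T M y is real, so nothing is lost by [Re]. *)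
Definition quadratic_form n (M : 'M[R[i]]_n) (y : 'cV[R]_n) : R :=
  let yC := map_mx (real_complex R) y in
  complex.Re ((yC^T *m M *m yC) 0 0).

End matrices.

Section stieltjes.
Context {R : realType}.

(* Principal argument, in ]-pi, pi] for z != 0. *)
Definition carg (z : R[i]) : R :=
  let t := acos (complex.Re z / Normc.normc z) in
  if 0 <= complex.Im z then t else - t.

(* Principal branch of z ^ b; on the cut ]-oo, 0[ the argument is pi. *)
Definition cpow (z : R[i]) (b : R) : R[i] :=
  (Normc.normc z `^ b * cos (b * carg z)) +i*
  (Normc.normc z `^ b * sin (b * carg z)).

Definition cintegral (mu : probability R R) (f : R -> R[i]) : R[i] :=
  (\int[mu]_x complex.Re (f x)) +i* (\int[mu]_x complex.Im (f x)).

(* Meaningful only for z off the support of mu (see [off_support]): elsewhere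
   the integrand need not be integrable and the value is junk. *)
Definition stieltjes (mu : probability R R) (z : R[i]) : R[i] :=
  cintegral mu (fun x => (x%:C - z)^-1).

Definition msupport (mu : probability R R) : set R :=
  [set x | forall e, 0 < e -> (0 < mu (ball x e))%E].

Definition off_support (mu : probability R R) (z : R[i]) : Prop :=
  forall x, msupport mu x -> z <> x%:C.

End stieltjes.

(* Main.v *)
Require Import Defs.
From HB Require Import structures.
From mathcomp Require Import all_boot all_order all_algebra.
From mathcomp Require Import sesquilinear.
From mathcomp Require Import complex.
From mathcomp Require Import all_classical all_reals all_analysis.
From mathcomp Require Import measurable_realfun.
From mathcomp Require Import ring lra.
Set Implicit Arguments.
Unset Strict Implicit.
Unset Printing Implicit Defensive.
Import Order.TTheory GRing.Theory Num.Theory.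
Import numFieldNormedType.Exports.
Local Open Scope classical_set_scope.
Local Open Scope ring_scope.
Local Open Scope complex_scope.
Local Notation Re := complex.Re.
Local Notation Im := complex.Im.
Local Notation normc := Normc.normc.

(* Write b = alpha / 2, U_i = X_i^2, S = U_1 + ... + U_n and let
   D = (sum_i a_i U_i) / S be the diagonal part of the quadratic form.  For
   z = re + i y with y > 0 and p_i = i (a_i - z), whose real part is y,

     1 / (D - z) = i S / (sum_i p_i U_i)
                 = i int_0^oo S exp (- s sum_i p_i U_i) ds.

   For deterministic a_i the expectation factorizes over the independent U_i.
   Rescaling s by a quantile of the regularly varying tail of U, each factor is
   evaluated by the gamma integral int v^(-b) exp (- p v) dv, proportional to
   p^(b-1); the integrand tends to s^(b-1) b c Psi exp (- c B s^b), where B and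
   Psi are the means of p^b and p^(b-1) under nu.  Dominating by the same
   integrand with all p_i = y (Pratt's lemma), E[1 / (D - z)] tends to i Psi / B,
   which is the announced ratio up to a rotation of the powers.  Linear
   combinations of resolvents are dense in C([-M, M]), so E[f(D)] converges for
   every continuous f, and Riesz representation yields the limit law.

   Independence reduces random a_i to deterministic ones by Fubini.  The
   off-diagonal part is negligible in L^2: by symmetry E[Y_i Y_j Y_k Y_l]
   vanishes for i <> j and k <> l unless {i, j} = {k, l}, and
   n (n - 1) E[Y_1^2 Y_2^2] <= 1.  Real z off the supports are reached from the
   upper half-plane, the lower half-plane by conjugation. *)

(** * Complex numbers and limits *)

(** The rotation by i puts every p_i on the same vertical line, so all Laplace factors lie in the
    unit disc and the modulus of the integrand in s does not depend on the array. The obstacle is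
    the exchange of the limit in n with the integral in s, for which no majorant uniform in n is at
    hand. For the constant array a_i = re the transform is exactly P(S <> 0) / y: the dominating
    integrals are explicit and their limit 1 / y is the integral of the limit. The same array bounds
    the terms 1 - phi_i uniformly by O(1/n). Convergence is proved for two arrays at once, along
    pairs of indices. This gives both the Cauchy property and the independence of the limit from the
    array, so one law serves almost every realisation of the diagonal. As the bound on the diagonal
    is random, tightness in the final perturbation is read off from the limit law. In the fourth
    moments the denominator S^2 is removed by 1 / S^2 = int_0^oo t exp (- t S) dt; the expectation
    factorizes again and parity acts on each factor. *)

Section complex_arith.
Context {R : realType}.
Implicit Types z w : R[i].

Lemma ReD z w : Re (z + w) = Re z + Re w. Proof. by case: z; case: w. Qed.
Lemma ImD z w : Im (z + w) = Im z + Im w. Proof. by case: z; case: w. Qed.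
Lemma ReN z : Re (- z) = - Re z. Proof. by case: z. Qed.
Lemma ImN z : Im (- z) = - Im z. Proof. by case: z. Qed.
Lemma ReM z w : Re (z * w) = Re z * Re w - Im z * Im w.
Proof. by case: z; case: w. Qed.
Lemma ImM z w : Im (z * w) = Re z * Im w + Im z * Re w.
Proof. by case: z; case: w. Qed.

Lemma Re_sum (I : Type) (r : seq I) (Q : pred I) (F : I -> R[i]) :
  Re (\sum_(i <- r | Q i) F i) = \sum_(i <- r | Q i) Re (F i).
Proof. exact: (big_morph _ ReD erefl). Qed.
Lemma Im_sum (I : Type) (r : seq I) (Q : pred I) (F : I -> R[i]) :
  Im (\sum_(i <- r | Q i) F i) = \sum_(i <- r | Q i) Im (F i).
Proof. exact: (big_morph _ ImD erefl). Qed.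

Lemma complex_ext z w : Re z = Re w -> Im z = Im w -> z = w.
Proof. by case: z => a b; case: w => c e /= -> ->. Qed.

Lemma sqr_normc_def z : normc z ^+ 2 = Re z ^+ 2 + Im z ^+ 2.
Proof. by case: z => a b /=; rewrite sqr_sqrtr// addr_ge0// sqr_ge0. Qed.

Lemma normc_ge0 z : 0 <= normc z.
Proof. by case: z => a b /=; rewrite sqrtr_ge0. Qed.

Lemma le_Re_normc z : `|Re z| <= normc z.
Proof.
by case: z => a b /=; rewrite -sqrtr_sqr ler_wsqrtr// lerDl sqr_ge0.
Qed.

Lemma le_Im_normc z : `|Im z| <= normc z.
Proof.
by case: z => a b /=; rewrite -sqrtr_sqr ler_wsqrtr// lerDr sqr_ge0.
Qed.

Lemma le_normc_ReIm z : normc z <= `|Re z| + `|Im z|.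
Proof.
rewrite -(@ler_pXn2r _ 2) ?nnegrE ?addr_ge0 ?normc_ge0//.
rewrite sqr_normc_def sqrrD !real_normK ?num_real//.
by rewrite addrAC lerDl mulrn_wge0// mulr_ge0.
Qed.

Lemma normcD z w : normc (z + w) <= normc z + normc w.
Proof. exact: le_normcD. Qed.

Lemma normcN z : normc (- z) = normc z.
Proof. by case: z => a b /=; rewrite !sqrrN. Qed.

Lemma normc_sum (I : Type) (r : seq I) (Q : pred I) (F : I -> R[i]) :
  normc (\sum_(i <- r | Q i) F i) <= \sum_(i <- r | Q i) normc (F i).
Proof.
elim/big_rec2 : _ => [|i x y _ xy]; first by rewrite Normc.normc0.
by apply: le_trans (normcD _ _) _; rewrite lerD2l.
Qed.

Lemma normc_prod (I : Type) (r : seq I) (Q : pred I) (F : I -> R[i]) :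
  normc (\prod_(i <- r | Q i) F i) = \prod_(i <- r | Q i) normc (F i).
Proof. by apply: (big_morph _ (@Normc.normcM R)); exact: Normc.normc1. Qed.

Lemma normc_real (x : R) : normc x%:C = `|x|.
Proof. by rewrite /= expr0n/= addr0 sqrtr_sqr. Qed.

Lemma normc_gt0 z : (0 < normc z) = (z != 0).
Proof.
rewrite lt0r normc_ge0 andbT; congr negb; apply/eqP/eqP.
  exact: Normc.eq0_normc.
by move=> ->; rewrite Normc.normc0.
Qed.

Lemma ReV z : Re z^-1 = Re z / normc z ^+ 2.
Proof. by rewrite sqr_normc_def; case: z. Qed.

Lemma ImV z : Im z^-1 = - Im z / normc z ^+ 2.
Proof. by rewrite sqr_normc_def mulNr; case: z. Qed.

Definition cexp z : R[i] :=
  (expR (Re z) * cos (Im z)) +i* (expR (Re z) * sin (Im z)).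

Lemma cexpD z w : cexp (z + w) = cexp z * cexp w.
Proof.
apply: complex_ext; rewrite ?ReM ?ImM /= ReD ImD expRD ?cosD ?sinD; ring.
Qed.

Lemma cexp0 : cexp 0 = 1.
Proof. by apply: complex_ext; rewrite /= expR0 ?cos0 ?sin0 !mul1r. Qed.

Lemma normc_cexp z : normc (cexp z) = expR (Re z).
Proof.
apply/eqP; rewrite -(@eqrXn2 _ 2) ?normc_ge0 ?expR_ge0// sqr_normc_def /=.
by apply/eqP; rewrite !exprMn -mulrDr cos2Dsin2 mulr1.
Qed.

Lemma cexp_neq0 z : cexp z != 0.
Proof. by rewrite -normc_gt0 normc_cexp expR_gt0. Qed.

Lemma cexp_sum (I : Type) (r : seq I) (Q : pred I) (F : I -> R[i]) :
  cexp (\sum_(i <- r | Q i) F i) = \prod_(i <- r | Q i) cexp (F i).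
Proof. by apply: (big_morph _ cexpD); exact: cexp0. Qed.

Lemma cexp_real (x : R) : cexp x%:C = (expR x)%:C.
Proof. by apply: complex_ext; rewrite /= ?cos0 ?sin0 ?mulr1 ?mulr0. Qed.

(** Swapping one factor at a time costs only the difference of the two factors, since all others lie
    in the unit disc. It later replaces products of Laplace transforms by products of
    exponentials. *)
Lemma normc_prod_sub (n : nat) (F H : 'I_n -> R[i]) :
  (forall i, normc (F i) <= 1) -> (forall i, normc (H i) <= 1) ->
  normc (\prod_i F i - \prod_i H i) <= \sum_i normc (F i - H i).
Proof.
elim: n F H => [|n IH] F H F1 H1.
  by rewrite !big_ord0 subrr Normc.normc0.
rewrite !big_ord_recl /=.
set a := F ord0; set b := H ord0; set p := \prod_(i < n) _.
set q := \prod_(i < n) _.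
have -> : a * p - b * q = (a - b) * p + b * (p - q) by ring.
apply: le_trans (normcD _ _) _; rewrite !Normc.normcM lerD//.
  rewrite ler_piMr ?normc_ge0// normc_prod prodr_ile1// => i _.
  by rewrite normc_ge0 F1.
apply: le_trans (ler_piMl (normc_ge0 _) (H1 _)) _.
by apply: IH => i.
Qed.

End complex_arith.

Section complex_limits.
Context {R : realType}.

(** Componentwise, so that limit theorems for real sequences apply; [ccvg_normc] gives the
    equivalent form in modulus. *)
Definition ccvg (u : nat -> R[i]) (l : R[i]) : Prop :=
  (Re (u n) @[n --> \oo] --> Re l) /\ (Im (u n) @[n --> \oo] --> Im l).

Lemma ccvg_normc u l : ccvg u l <-> normc (u n - l) @[n --> \oo] --> (0 : R).
Proof.
split=> [[uR uI]|ul].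
  apply: (@squeeze_cvgr _ _ _ _ (fun=> 0)
    (fun n => `|Re (u n) - Re l| + `|Im (u n) - Im l|)); last 2 first.
  - exact: cvg_cst.
  - rewrite -[X in _ --> X]addr0; apply: cvgD; apply/norm_cvg0P.
    + exact/subr_cvg0.
    + exact/subr_cvg0.
  apply: nearW => n; rewrite normc_ge0 /=.
  by apply: le_trans (le_normc_ReIm _) _; rewrite ReD ImD ReN ImN.
split.
  apply/subr_cvg0/norm_cvg0P.
  apply: (@squeeze_cvgr _ _ _ _ (fun=> 0) (fun n => normc (u n - l))) => //;
    last exact: cvg_cst.
  apply: nearW => n; rewrite normr_ge0 /= -ReN -ReD; exact: le_Re_normc.
apply/subr_cvg0/norm_cvg0P.
apply: (@squeeze_cvgr _ _ _ _ (fun=> 0) (fun n => normc (u n - l))) => //;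
  last exact: cvg_cst.
apply: nearW => n; rewrite normr_ge0 /= -ImN -ImD; exact: le_Im_normc.
Qed.

Lemma ccvg_cst (l : R[i]) : ccvg (fun=> l) l.
Proof. by split; exact: cvg_cst. Qed.

Lemma ccvgD u v l m : ccvg u l -> ccvg v m -> ccvg (fun n => u n + v n) (l + m).
Proof.
move=> [uR uI] [vR vI]; split.
  by rewrite ReD; under eq_fun do rewrite ReD; exact: cvgD.
by rewrite ImD; under eq_fun do rewrite ImD; exact: cvgD.
Qed.

Lemma ccvgM u v l m : ccvg u l -> ccvg v m -> ccvg (fun n => u n * v n) (l * m).
Proof.
move=> [uR uI] [vR vI]; split.
  rewrite ReM; under eq_fun do rewrite ReM.
  by apply: cvgB; apply: cvgM.
rewrite ImM; under eq_fun do rewrite ImM.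
by apply: cvgD; apply: cvgM.
Qed.

Lemma ccvg_sub0 u v l : ccvg v l ->
  normc (u n - v n) @[n --> \oo] --> (0 : R) -> ccvg u l.
Proof.
move=> vl uv; have : ccvg (fun n => u n - v n) 0.
  by apply/ccvg_normc; under eq_fun do rewrite subr0.
move=> /ccvgD/(_ vl); rewrite add0r.
by under eq_fun do rewrite subrK.
Qed.

Lemma ccvg_unique u l m : ccvg u l -> ccvg u m -> l = m.
Proof.
move=> [a b] [c e]; apply: complex_ext.
  exact: (cvg_unique _ a c).
exact: (cvg_unique _ b e).
Qed.

Lemma ccvg_real (u : nat -> R) (l : R) :
  u n @[n --> \oo] --> l -> ccvg (fun n => (u n)%:C) l%:C.
Proof. by move=> ul; split => //=; exact: cvg_cst. Qed.

Lemma ccvg_cexp u l : ccvg u l -> ccvg (fun n => cexp (u n)) (cexp l).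
Proof.
move=> [uR uI]; split => /=; apply: cvgM.
- by apply: continuous_cvg => //; exact: continuous_expR.
- by apply: continuous_cvg => //; exact: continuous_cos.
- by apply: continuous_cvg => //; exact: continuous_expR.
- by apply: continuous_cvg => //; exact: continuous_sin.
Qed.

End complex_limits.

(** * Complex-valued integrals *)

Section limits_of_extrema.
Context {I : Type} {F : set_system I} {FF : Filter F} {R : realType}.
Implicit Types (f g : I -> R) (a b : R).

Lemma cvg_maxr f g a b : f @ F --> a -> g @ F --> b ->
  Num.max (f x) (g x) @[x --> F] --> Num.max a b.
Proof.
move=> fa gb; rewrite maxr_absE; under eq_fun do rewrite maxr_absE.
apply: cvgM; last exact: cvg_cst.
by apply: cvgD; [exact: cvgD|apply: cvg_norm; exact: cvgB].
Qed.

Lemma cvg_minr f g a b : f @ F --> a -> g @ F --> b ->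
  Num.min (f x) (g x) @[x --> F] --> Num.min a b.
Proof.
move=> fa gb; rewrite minr_absE; under eq_fun do rewrite minr_absE.
apply: cvgM; last exact: cvg_cst.
by apply: cvgB; [exact: cvgD|apply: cvg_norm; exact: cvgB].
Qed.

End limits_of_extrema.

Section real_integrals.
Context d (T : measurableType d) (R : realType) (mu : {measure set T -> \bar R}).
Variables (D : set T) (mD : measurable D).
Implicit Types f g : T -> R.

Lemma le_integrable_norm f g : measurable_fun D f ->
  mu.-integrable D (EFin \o g) -> (forall x, D x -> `|f x| <= g x) ->
  mu.-integrable D (EFin \o f).
Proof.
move=> mf ig fg; apply: (le_integrable mD _ _ ig).
  exact/measurable_EFinP.
move=> x Dx /=; rewrite lee_fin; apply: le_trans (fg x Dx) _; exact: ler_norm.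
Qed.

Lemma Rintegral_dct (f_ : nat -> T -> R) f g :
  (forall n, measurable_fun D (f_ n)) -> mu.-integrable D (EFin \o g) ->
  (forall n x, D x -> `|f_ n x| <= g x) ->
  (forall x, D x -> f_ n x @[n --> \oo] --> f x) ->
  mu.-integrable D (EFin \o f) /\
  \int[mu]_(x in D) f_ n x @[n --> \oo] --> \int[mu]_(x in D) f x.
Proof.
move=> mf_ ig fg ff.
have mf : measurable_fun D f.
  by apply: (measurable_fun_cvg mf_) => x Dx; exact: ff.
have [||||| if_ _ cf] := @dominated_convergence _ T R mu D mD
   (fun n => EFin \o f_ n) (EFin \o f) (EFin \o g).
- by move=> n; exact/measurable_EFinP.
- exact/measurable_EFinP.
- by apply: aeW => x Dx; apply: cvg_EFin; [exact: nearW|exact: ff].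
- exact: ig.
- by apply: aeW => x n Dx; rewrite /= lee_fin; exact: fg.
split=> //; apply: fine_cvg; rewrite /= fineK; last exact: integrable_fin_num.
exact: cf.
Qed.

(* Pratt: |h_n - f_n| <= (g_n - g)^+ for the truncation h_n of f_n at +-g. *)
Lemma Rintegral_pratt (f_ g_ : nat -> T -> R) f g :
  (forall n, measurable_fun D (f_ n)) ->
  (forall n, mu.-integrable D (EFin \o g_ n)) ->
  mu.-integrable D (EFin \o g) ->
  (forall n x, D x -> `|f_ n x| <= g_ n x) ->
  (forall x, D x -> f_ n x @[n --> \oo] --> f x) ->
  (forall x, D x -> g_ n x @[n --> \oo] --> g x) ->
  \int[mu]_(x in D) g_ n x @[n --> \oo] --> \int[mu]_(x in D) g x ->
  \int[mu]_(x in D) f_ n x @[n --> \oo] --> \int[mu]_(x in D) f x.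
Proof.
move=> mf_ ig_ ig fg ff gg cg.
have mg_ n : measurable_fun D (g_ n) by apply/measurable_EFinP/measurable_int/ig_.
have mg : measurable_fun D g by apply/measurable_EFinP/measurable_int/ig.
have g_0 n x : D x -> 0 <= g_ n x by move=> Dx; apply: le_trans (fg n x Dx).
have g0 x : D x -> 0 <= g x.
  move=> Dx; have := gg x Dx; move=> /cvg_lim <-//; apply: limr_ge.
    by apply/cvg_ex; exists (g x); exact: gg.
  by apply: nearW => n; exact: g_0.
pose e n x := Num.max 0 (g x - g_ n x).
have me n : measurable_fun D (e n).
  by apply: measurable_maxr => //; exact: measurable_funB.
(* The deficit (g - g_n)^+ is dominated by [g] itself, so its integral tends to 0 without a common
   majorant of the [g_ n]. *)
have [||||ie0 ie] := @Rintegral_dct (fun n => e n) (fun=> 0) g.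
- exact: me.
- exact: ig.
- move=> n x Dx; rewrite ger0_norm ?le_max ?lexx// ge_max g0//=.
  by rewrite gerBl g_0.
- move=> x Dx; rewrite -[X in _ --> X](@maxxx _ R 0).
  apply: cvg_maxr; first exact: cvg_cst.
  rewrite -[X in _ --> X](subrr (g x)); apply: cvgB; first exact: cvg_cst.
  exact: gg.
have iee n : mu.-integrable D (EFin \o e n).
  apply: (le_integrable_norm (me n) ig) => x Dx.
  rewrite ger0_norm ?le_max ?lexx// ge_max g0//=.
  by rewrite gerBl g_0.
pose h n x := Num.max (- g x) (Num.min (f_ n x) (g x)).
have mh n : measurable_fun D (h n).
  by apply: measurable_maxr; [exact: measurableT_comp|exact: measurable_minr].
have hg n x : D x -> `|h n x| <= g x.
  move=> Dx; rewrite /h ler_norml le_max lexx/= ge_max ge_min lexx orbT andbT.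
  by apply: le_trans (g0 x Dx); rewrite oppr_le0 g0.
have [||||if_ ch] := @Rintegral_dct h f g.
- exact: mh.
- exact: ig.
- exact: hg.
- move=> x Dx; have fx : `|f x| <= g x.
    apply: (ler_cvg_to (cvg_norm (ff x Dx)) (gg x Dx)).
    by apply: nearW => n; exact: fg.
  move: fx; rewrite ler_norml => /andP[f1 f2].
  have -> : f x = Num.max (- g x) (Num.min (f x) (g x)).
    by rewrite (min_idPl f2) (max_idPr f1).
  apply: cvg_maxr; first exact: cvg_cst.
  apply: cvg_minr; last exact: cvg_cst.
  exact: ff.
have if_n n : mu.-integrable D (EFin \o f_ n).
  by apply: (le_integrable_norm (mf_ n) (ig_ n)) => x Dx; exact: fg.
have ihn n : mu.-integrable D (EFin \o h n).
  by apply: (le_integrable_norm (mh n) ig) => x Dx; exact: hg.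
(* The truncation loses at most (g_n - g)^+ = (g_n - g) + (g - g_n)^+, and both summands have
   integrals tending to 0. *)
have bnd n x : D x -> `|f_ n x - h n x| <= g_ n x - g x + e n x.
  move=> Dx; have := fg n x Dx; have := g0 x Dx.
  rewrite /h /e /Num.max /Num.min !ler_norml => gx /andP[a1 a2].
  by case: (ltP (f_ n x) (g x)) => ?; case: ltP => ?; case: ltP => ?;
    apply/andP; split; lra.
apply/subr_cvg0; apply: (@squeeze_cvgr _ _ _ _
   (fun n => - (\int[mu]_(x in D) g_ n x - \int[mu]_(x in D) g x
      + \int[mu]_(x in D) e n x)
      + (\int[mu]_(x in D) h n x - \int[mu]_(x in D) f x))
   (fun n => (\int[mu]_(x in D) g_ n x - \int[mu]_(x in D) g x
      + \int[mu]_(x in D) e n x)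
      + (\int[mu]_(x in D) h n x - \int[mu]_(x in D) f x))).
- apply: nearW => n.
  have : `|\int[mu]_(x in D) f_ n x - \int[mu]_(x in D) h n x| <=
     \int[mu]_(x in D) g_ n x - \int[mu]_(x in D) g x + \int[mu]_(x in D) e n x.
    rewrite -!RintegralB// -RintegralD//; last first.
      rewrite (_ : _ \o _ = (EFin \o g_ n) \- (EFin \o g))%E//.
      exact: integrableB.
    have ifh : mu.-integrable D (EFin \o (fun x => f_ n x - h n x)).
      rewrite (_ : _ \o _ = (EFin \o f_ n) \- (EFin \o h n))%E//.
      exact: integrableB.
    apply: le_trans (le_normr_Rintegral _ ifh) _ => //.
    apply: le_Rintegral => //.
      rewrite (_ : _ \o _ = abse \o (EFin \o (fun x => f_ n x - h n x)))//.
      exact: integrable_abse.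
    rewrite (_ : _ \o _ = ((EFin \o g_ n) \- (EFin \o g)) \+ (EFin \o e n))%E//.
      by apply: integrableD => //; exact: integrableB.
    exact: bnd.
  rewrite ler_norml => /andP[]; set A := _ - _ + _; set B := \int[_]_(_ in _) _.
  move=> ? ?; lra.
- rewrite -[X in _ --> X]addr0; apply: cvgD; last exact/subr_cvg0.
  rewrite -[X in _ --> X]oppr0; apply: cvgN.
  rewrite -[X in _ --> X]addr0; apply: cvgD; first exact/subr_cvg0.
  by move: ie; rewrite Rintegral_cst// mul0r.
- rewrite -[X in _ --> X]addr0; apply: cvgD; last exact/subr_cvg0.
  rewrite -[X in _ --> X]addr0; apply: cvgD; first exact/subr_cvg0.
  by move: ie; rewrite Rintegral_cst// mul0r.
Qed.

End real_integrals.

Section complex_integrals.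
Context d (T : measurableType d) (R : realType) (mu : {measure set T -> \bar R}).
Implicit Types (D : set T) (f g : T -> R[i]).

Definition cint D f : R[i] :=
  (\int[mu]_(x in D) Re (f x)) +i* (\int[mu]_(x in D) Im (f x)).

Definition cmeasurable D f :=
  measurable_fun D (fun x => Re (f x)) /\ measurable_fun D (fun x => Im (f x)).

Definition cintegrable D f :=
  mu.-integrable D (EFin \o (fun x => Re (f x))) /\
  mu.-integrable D (EFin \o (fun x => Im (f x))).

Lemma cmeasurable_normc D f : cmeasurable D f ->
  measurable_fun D (fun x => normc (f x)).
Proof.
move=> [mR mI].
rewrite (_ : (fun _ => _) = Num.sqrt \o
   (fun x => Re (f x) ^+ 2 + Im (f x) ^+ 2)); last first.
  by apply/funext => x /=; case: (f x).
apply: measurableT_comp.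
  by apply: continuous_measurable_fun; exact: sqrt_continuous.
by apply: measurable_funD; exact: measurable_funX.
Qed.

Lemma cintegrable_le D f (g : T -> R) : measurable D -> cmeasurable D f ->
  mu.-integrable D (EFin \o g) ->
  (forall x, D x -> normc (f x) <= g x) -> cintegrable D f.
Proof.
move=> mD [mR mI] ig fg; split.
  apply: (le_integrable_norm mD mR ig) => x Dx.
  exact: le_trans (le_Re_normc _) (fg x Dx).
apply: (le_integrable_norm mD mI ig) => x Dx.
exact: le_trans (le_Im_normc _) (fg x Dx).
Qed.

Lemma cintegrable_abs D f : measurable D -> cintegrable D f ->
  mu.-integrable D (EFin \o (fun x => normc (f x))).
Proof.
move=> mD [iR iI].
have mf : cmeasurable D f.
  by split; apply/measurable_EFinP; [exact: measurable_int iR|exact: measurable_int iI].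
have := integrableD mD (integrable_abse iR) (integrable_abse iI).
move=> /(le_integrable mD); apply.
  exact/measurable_EFinP/cmeasurable_normc.
move=> x Dx /=; rewrite lee_fin ger0_norm ?normc_ge0//.
by rewrite [leRHS]ger0_norm ?addr_ge0// le_normc_ReIm.
Qed.

Lemma cmeasurableD D f g : cmeasurable D f -> cmeasurable D g ->
  cmeasurable D (fun x => f x + g x).
Proof.
move=> [fR fI] [gR gI]; split.
  by under eq_fun do rewrite ReD; exact: measurable_funD.
by under eq_fun do rewrite ImD; exact: measurable_funD.
Qed.

Lemma cmeasurableM D f g : cmeasurable D f -> cmeasurable D g ->
  cmeasurable D (fun x => f x * g x).
Proof.
move=> [fR fI] [gR gI]; split.
  by under eq_fun do rewrite ReM; apply: measurable_funB; exact: measurable_funM.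
by under eq_fun do rewrite ImM; apply: measurable_funD; exact: measurable_funM.
Qed.

Lemma cmeasurable_cst D c : cmeasurable D (fun=> c).
Proof. by split; exact: measurable_cst. Qed.

Lemma cmeasurable_real D (f : T -> R) : measurable_fun D f ->
  cmeasurable D (fun x => (f x)%:C).
Proof. by move=> mf; split => //=; exact: measurable_cst. Qed.

Lemma cmeasurable_sum D (I : Type) (r : seq I) (F : I -> T -> R[i]) :
  (forall i, cmeasurable D (F i)) -> cmeasurable D (fun x => \sum_(i <- r) F i x).
Proof.
move=> mF; elim: r => [|i r IH].
  by under eq_fun do rewrite big_nil; exact: cmeasurable_cst.
by under eq_fun do rewrite big_cons; exact: cmeasurableD.
Qed.

Lemma cmeasurable_prod D (I : Type) (r : seq I) (Q : pred I) (F : I -> T -> R[i]) :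
  (forall i, cmeasurable D (F i)) ->
  cmeasurable D (fun x => \prod_(i <- r | Q i) F i x).
Proof.
move=> mF; elim: r => [|i r IH].
  by under eq_fun do rewrite big_nil; exact: cmeasurable_cst.
under eq_fun do rewrite big_cons.
by case: (Q i) => //; exact: cmeasurableM.
Qed.

Lemma cmeasurable_cexp D f : cmeasurable D f -> cmeasurable D (fun x => cexp (f x)).
Proof.
move=> [mR mI]; split => /=; apply: measurable_funM.
- by apply: measurableT_comp => //; exact: measurable_expR.
- by apply: measurableT_comp => //; apply: continuous_measurable_fun; exact: continuous_cos.
- by apply: measurableT_comp => //; exact: measurable_expR.
- by apply: measurableT_comp => //; apply: continuous_measurable_fun; exact: continuous_sin.
Qed.

Lemma cmeasurable_inv D f : cmeasurable D f -> cmeasurable D (fun x => (f x)^-1).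
Proof.
move=> mf; have [mR mI] := mf.
have mi : measurable_fun D (fun x => (normc (f x) ^+ 2)^-1).
  rewrite (_ : (fun _ => _) = (@powR R ^~ (-1)) \o (fun x => normc (f x) ^+ 2)).
    apply: measurableT_comp; first exact: measurable_powR.
    by apply: measurable_funX; exact: cmeasurable_normc.
  by apply/funext => x /=; rewrite powR_inv1// sqr_ge0.
split.
  by under eq_fun do rewrite ReV; exact: measurable_funM.
under eq_fun do rewrite ImV; apply: measurable_funM => //.
exact: measurableT_comp.
Qed.

Lemma cintegrableD D f g : measurable D -> cintegrable D f -> cintegrable D g ->
  cintegrable D (fun x => f x + g x).
Proof.
move=> mD [fR fI] [gR gI]; split.
  rewrite (_ : _ \o _ = (EFin \o (fun x => Re (f x))) \+ (EFin \o (fun x => Re (g x))))%E.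
    exact: integrableD.
  by apply/funext => x /=; rewrite ReD.
rewrite (_ : _ \o _ = (EFin \o (fun x => Im (f x))) \+ (EFin \o (fun x => Im (g x))))%E.
  exact: integrableD.
by apply/funext => x /=; rewrite ImD.
Qed.

Lemma cintD D f g : measurable D -> cintegrable D f -> cintegrable D g ->
  cint D (fun x => f x + g x) = cint D f + cint D g.
Proof.
move=> mD [fR fI] [gR gI]; apply: complex_ext; rewrite ?ReD ?ImD /=.
  by under eq_Rintegral do rewrite ReD; rewrite RintegralD.
by under eq_Rintegral do rewrite ImD; rewrite RintegralD.
Qed.

Lemma cintegrable0 D : cintegrable D (fun=> 0).
Proof. by split; exact: integrable0. Qed.

Lemma integrable_scale D (c : R) (f : T -> R) : measurable D ->
  mu.-integrable D (EFin \o f) -> mu.-integrable D (EFin \o (fun x => c * f x)).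
Proof.
move=> mD i; rewrite (_ : _ \o _ = (fun x => c%:E * (EFin \o f) x)%E)//.
exact: integrableZl.
Qed.

Lemma integrable_add D (f g : T -> R) : measurable D ->
  mu.-integrable D (EFin \o f) -> mu.-integrable D (EFin \o g) ->
  mu.-integrable D (EFin \o (fun x => f x + g x)).
Proof.
move=> mD i j; rewrite (_ : _ \o _ = (EFin \o f) \+ (EFin \o g))%E//.
exact: integrableD.
Qed.

Lemma cintegrableZ D c f : measurable D -> cintegrable D f ->
  cintegrable D (fun x => c * f x).
Proof.
move=> mD [fR fI]; split.
  rewrite (_ : _ \o _ = (EFin \o (fun x => (Re c * Re (f x))%R)) \-
     (EFin \o (fun x => (Im c * Im (f x))%R)))%E.
    by apply: integrableB => //; exact: integrable_scale.
  by apply/funext => x /=; rewrite ReM.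
rewrite (_ : _ \o _ = (EFin \o (fun x => (Re c * Im (f x))%R)) \+
     (EFin \o (fun x => (Im c * Re (f x))%R)))%E.
  by apply: integrableD => //; exact: integrable_scale.
by apply/funext => x /=; rewrite ImM.
Qed.

Lemma cintZ D c f : measurable D -> cintegrable D f ->
  cint D (fun x => c * f x) = c * cint D f.
Proof.
move=> mD [fR fI]; apply: complex_ext; rewrite ?ReM ?ImM /=.
  under eq_Rintegral do rewrite ReM.
  by rewrite RintegralB ?RintegralZl//; exact: integrable_scale.
under eq_Rintegral do rewrite ImM.
by rewrite RintegralD ?RintegralZl//; exact: integrable_scale.
Qed.

Lemma cintegrable_sum D (I : Type) (r : seq I) (F : I -> T -> R[i]) :
  measurable D -> (forall i, cintegrable D (F i)) ->
  cintegrable D (fun x => \sum_(i <- r) F i x).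
Proof.
move=> mD mF; elim: r => [|i r IH].
  by under eq_fun do rewrite big_nil; exact: cintegrable0.
by under eq_fun do rewrite big_cons; exact: cintegrableD.
Qed.

Lemma cint_sum D (I : Type) (r : seq I) (F : I -> T -> R[i]) :
  measurable D -> (forall i, cintegrable D (F i)) ->
  cint D (fun x => \sum_(i <- r) F i x) = \sum_(i <- r) cint D (F i).
Proof.
move=> mD mF; elim: r => [|i r IH].
  rewrite big_nil (_ : (fun _ => _) = (fun=> 0)); last first.
    by apply/funext => x; rewrite big_nil.
  by rewrite /cint /= !Rintegral_cst// !mul0r.
rewrite big_cons -IH -cintD//; last exact: cintegrable_sum.
by congr cint; apply/funext => x; rewrite big_cons.
Qed.

Lemma eq_cint D f g : (forall x, D x -> f x = g x) -> cint D f = cint D g.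
Proof.
move=> fg; apply: complex_ext => /=; apply: eq_Rintegral => x /set_mem Dx;
  by rewrite fg.
Qed.

(* Rotate the integral onto the positive real axis. *)
Lemma le_normc_cint D f : measurable D -> cintegrable D f ->
  normc (cint D f) <= \int[mu]_(x in D) normc (f x).
Proof.
move=> mD fi; have [->|z0] := eqVneq (cint D f) 0.
  by rewrite Normc.normc0; apply: Rintegral_ge0 => x _; exact: normc_ge0.
set z := cint D f in z0 *.
have nz0 : normc z != 0 by rewrite lt0r_neq0// normc_gt0.
pose u : R[i] := (normc z)%:C / z.
have nu : normc u = 1.
  by rewrite Normc.normcM Normc.normcV normc_real ger0_norm ?normc_ge0// divff.
have uz : u * z = (normc z)%:C by rewrite mulfVK.
have := cintZ u mD fi; rewrite -/z uz => /(congr1 (@complex.Re R)) /= <-.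
have [iR _] := cintegrableZ u mD fi.
apply: le_Rintegral => //; first exact: cintegrable_abs.
move=> x Dx; apply: le_trans (ler_norm _) _; apply: le_trans (le_Re_normc _) _.
by rewrite Normc.normcM nu mul1r.
Qed.

Lemma cint_dct D (f_ : nat -> T -> R[i]) f (g : T -> R) : measurable D ->
  (forall n, cmeasurable D (f_ n)) -> mu.-integrable D (EFin \o g) ->
  (forall n x, D x -> normc (f_ n x) <= g x) ->
  (forall x, D x -> ccvg (f_ ^~ x) (f x)) ->
  cintegrable D f /\ ccvg (fun n => cint D (f_ n)) (cint D f).
Proof.
move=> mD mf ig fg ff.
have [|||| iR cR] := @Rintegral_dct _ T R mu D mD (fun n x => Re (f_ n x)) (fun x => Re (f x)) g.
- by move=> n; case: (mf n).
- exact: ig.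
- by move=> n x Dx; apply: le_trans (le_Re_normc _) (fg n x Dx).
- by move=> x Dx; case: (ff x Dx).
have [|||| iI cI] := @Rintegral_dct _ T R mu D mD (fun n x => Im (f_ n x)) (fun x => Im (f x)) g.
- by move=> n; case: (mf n).
- exact: ig.
- by move=> n x Dx; apply: le_trans (le_Im_normc _) (fg n x Dx).
- by move=> x Dx; case: (ff x Dx).
by split.
Qed.

Lemma cint_pratt D (f_ : nat -> T -> R[i]) (g_ : nat -> T -> R) f (g : T -> R) :
  measurable D ->
  (forall n, cmeasurable D (f_ n)) ->
  (forall n, mu.-integrable D (EFin \o g_ n)) ->
  mu.-integrable D (EFin \o g) ->
  (forall n x, D x -> normc (f_ n x) <= g_ n x) ->
  (forall x, D x -> ccvg (f_ ^~ x) (f x)) ->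
  (forall x, D x -> g_ n x @[n --> \oo] --> g x) ->
  \int[mu]_(x in D) g_ n x @[n --> \oo] --> \int[mu]_(x in D) g x ->
  ccvg (fun n => cint D (f_ n)) (cint D f).
Proof.
move=> mD mf ig_ ig fg ff gg cg; split => /=.
  apply: (@Rintegral_pratt _ T R mu D mD _ g_ _ g) => //.
  - by move=> n; case: (mf n).
  - by move=> n x Dx; apply: le_trans (le_Re_normc _) (fg n x Dx).
  - by move=> x Dx; case: (ff x Dx).
apply: (@Rintegral_pratt _ T R mu D mD _ g_ _ g) => //.
- by move=> n; case: (mf n).
- by move=> n x Dx; apply: le_trans (le_Im_normc _) (fg n x Dx).
- by move=> x Dx; case: (ff x Dx).
Qed.

End complex_integrals.

(** * Independence and equality in law *)

Section bounded_expectations.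
Context d (T : measurableType d) (R : realType) (P : probability T R).

Lemma integrable_bounded (f : T -> R) M : measurable_fun setT f ->
  (forall x, `|f x| <= M) -> P.-integrable setT (EFin \o f).
Proof.
move=> mf fM; apply: (le_integrable_norm measurableT mf _ (fun x _ => fM x)).
by apply: finite_measure_integrable_cst.
Qed.

Lemma cintegrable_bounded (f : T -> R[i]) M : cmeasurable setT f ->
  (forall x, normc (f x) <= M) -> cintegrable P setT f.
Proof.
move=> mf fM; apply: (cintegrable_le measurableT mf _ (fun x _ => fM x)).
by apply: finite_measure_integrable_cst.
Qed.

Lemma integral_prob_cst (c : \bar R) : (\int[P]_x c = c)%E.
Proof.
transitivity (c * P setT)%E; first exact: integral_cst.
by rewrite probability_setT mule1.
Qed.

Lemma Rintegral_prob_cst (c : R) : \int[P]_(x in setT) c = c.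
Proof.
by rewrite /Rintegral integral_prob_cst.
Qed.

Lemma cint_cst (c : R[i]) : cint P setT (fun=> c) = c.
Proof.
by apply: complex_ext => /=; rewrite Rintegral_prob_cst.
Qed.

Lemma cint_indic (B : set T) : measurable B ->
  cint P setT (fun w => (\1_B w)%:C) = (fine (P B))%:C.
Proof.
move=> mB; apply: complex_ext => /=; last by rewrite Rintegral_cst// mul0r.
by rewrite /Rintegral integral_indic// setIT.
Qed.

Lemma normc_cint_bounded (f : T -> R[i]) M : cmeasurable setT f ->
  (forall x, normc (f x) <= M) -> normc (cint P setT f) <= M.
Proof.
move=> mf fM; apply: le_trans (le_normc_cint _ _) _ => //.
  exact: cintegrable_bounded fM.
rewrite -[leRHS]Rintegral_prob_cst.
apply: le_Rintegral => //.
- by apply/cintegrable_abs => //; exact: cintegrable_bounded fM.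
- exact: finite_measure_integrable_cst.
Qed.

End bounded_expectations.

Section cmeasurable_composition.
Context d (T : measurableType d) (R : realType).

Lemma cmeasurable_comp (f : R -> R[i]) (X : T -> R) : cmeasurable setT f ->
  measurable_fun setT X -> cmeasurable setT (fun w => f (X w)).
Proof.
move=> [mR mI] mX; split.
  exact: (measurableT_comp mR mX).
exact: (measurableT_comp mI mX).
Qed.

End cmeasurable_composition.

Section independent_slot.
Import HBNNSimple.
Context d (T : measurableType d) (R : realType) (P : probability T R).
Variables (W : T -> R[i]) (X : T -> R) (c : R[i]) (K : R).
Hypotheses (mW : cmeasurable setT W) (WK : forall w, normc (W w) <= K).
Hypothesis mX : measurable_fun setT X.
Hypothesis slot_indic : forall B, measurable B ->
  cint P setT (fun w => W w * (\1_B (X w))%:C) =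
  c * cint P setT (fun w => (\1_B (X w))%:C).

(** Says that [f (X w)] splits off from [W]. It holds for indicators by hypothesis and is extended
    to simple, bounded nonnegative, bounded real and bounded complex functions in turn. *)
Let slot (f : R -> R[i]) :=
  cint P setT (fun w => W w * f (X w)) = c * cint P setT (fun w => f (X w)).

Let K0 : 0 <= K. Proof. exact: le_trans (normc_ge0 _) (WK point). Qed.

Let intW (f : R -> R[i]) M : cmeasurable setT f -> (forall x, normc (f x) <= M) ->
  cintegrable P setT (fun w => W w * f (X w)).
Proof.
move=> mf fM; apply: (@cintegrable_bounded _ _ _ _ _ (K * M)).
  by apply: cmeasurableM => //; exact: cmeasurable_comp.
by move=> x; rewrite Normc.normcM ler_pM ?normc_ge0.
Qed.

Let int1 (f : R -> R[i]) M : cmeasurable setT f -> (forall x, normc (f x) <= M) ->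
  cintegrable P setT (fun w => f (X w)).
Proof.
by move=> mf fM; apply: (@cintegrable_bounded _ _ _ _ _ M) => //; exact: cmeasurable_comp.
Qed.

Let slotD (f g : R -> R[i]) M N :
  cmeasurable setT f -> (forall x, normc (f x) <= M) ->
  cmeasurable setT g -> (forall x, normc (g x) <= N) ->
  slot f -> slot g -> slot (fun x => f x + g x).
Proof.
move=> mf fM mg gN sf sg; rewrite /slot cintD//; [|exact: int1 fM|exact: int1 gN].
rewrite mulrDr -sf -sg -cintD//; [|exact: intW fM|exact: intW gN].
by apply: eq_cint => x _; rewrite mulrDr.
Qed.

Let slotZ (f : R -> R[i]) M a :
  cmeasurable setT f -> (forall x, normc (f x) <= M) ->
  slot f -> slot (fun x => a * f x).
Proof.
move=> mf fM sf; rewrite /slot cintZ//; last exact: int1 fM.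
rewrite mulrCA -sf -cintZ//; last exact: intW fM.
by apply: eq_cint => x _; rewrite mulrCA.
Qed.

Let slot_sum (I : Type) (r : seq I) (F : I -> R -> R[i]) (M : I -> R) :
  (forall i, cmeasurable setT (F i)) -> (forall i x, normc (F i x) <= M i) ->
  (forall i, slot (F i)) -> slot (fun x => \sum_(i <- r) F i x).
Proof.
move=> mF FM sF; rewrite /slot cint_sum//; last by move=> i; exact: int1 (FM i).
rewrite mulr_sumr -(eq_bigr _ (fun i _ => sF i)) -cint_sum//.
  by apply: eq_cint => w _; rewrite mulr_sumr.
by move=> i; exact: intW (FM i).
Qed.

Let slot_nnsfun (h : {nnsfun R >-> R}) : slot (fun x => (h x)%:C).
Proof.
have hE x : (h x)%:C = \sum_(r <- finmap.enum_fset (fset_set (range h)))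
    r%:C * (\1_(h @^-1` [set r]) x)%:C :> R[i].
  rewrite [in LHS]fimfunE fsbig_finite//= rmorph_sum.
  by apply: eq_bigr => r _; rewrite rmorphM.
rewrite (_ : (fun _ => _) = (fun x => \sum_(r <- finmap.enum_fset (fset_set (range h)))
    r%:C * (\1_(h @^-1` [set r]) x)%:C)); last exact/funext.
have mi r : cmeasurable setT (fun x : R => (\1_(h @^-1` [set r]) x)%:C : R[i]).
  by apply: cmeasurable_real; exact: measurable_indic.
have i1 r (x : R) : normc ((\1_(h @^-1` [set r]) x)%:C : R[i]) <= 1.
  by rewrite normc_real indicE; case: (_ \in _); rewrite ?normr1 ?normr0.
apply: (@slot_sum _ _ _ (fun r => `|r|)).
- by move=> r; apply: cmeasurableM => //; exact: cmeasurable_cst.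
- by move=> r x; rewrite Normc.normcM normc_real ler_piMr.
- by move=> r; apply: (slotZ _ (mi r) (i1 r)); apply: slot_indic.
Qed.

Let slot_ge0 (f : R -> R) M : measurable_fun setT f ->
  (forall x, 0 <= f x <= M) -> slot (fun x => (f x)%:C).
Proof.
move=> mf fM; have mfe : measurable_fun setT (EFin \o f) by exact/measurable_EFinP.
pose h := nnsfun_approx measurableT mfe.
have ch x : h n x @[n --> \oo] --> f x.
  have : EFin \o h ^~ x @ \oo --> (f x)%:E.
    apply: (cvg_nnsfun_approx measurableT mfe) => // y _.
    by rewrite lee_fin; case/andP: (fM y).
  by move=> /fine_cvgP[].
have hf n x : 0 <= h n x <= f x.
  apply/andP; split; first exact: fun_ge0.
  rewrite -[leRHS](cvg_lim _ (ch x))//; apply: nondecreasing_cvgn_le.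
    move=> a b ab; have /lefP := nd_nnsfun_approx measurableT mfe ab; exact.
  by apply/cvg_ex; exists (f x); exact: ch.
have hM n x : `|h n x| <= M.
  by have /andP[? ?] := hf n x; have /andP[? ?] := fM x; rewrite ger0_norm//; lra.
have mh n : measurable_fun setT (h n) by [].
have M0 : 0 <= M by exact: le_trans (hM 0%N 0).
have [||||_ cl] := @cint_dct _ T R P setT (fun n w => W w * (h n (X w))%:C)
   (fun w => W w * (f (X w))%:C) (fun=> K * M) measurableT.
- move=> n; apply: cmeasurableM => //; apply: cmeasurable_real.
  exact: (measurableT_comp (mh n) mX).
- exact: finite_measure_integrable_cst.
- by move=> n w _; rewrite Normc.normcM normc_real ler_pM ?normc_ge0.
- by move=> w _; apply: ccvgM; [exact: ccvg_cst|apply: ccvg_real; exact: ch].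
have [||||_ cr] := @cint_dct _ T R P setT (fun n w => (h n (X w))%:C)
   (fun w => (f (X w))%:C) (fun=> M) measurableT.
- move=> n; apply: cmeasurable_real; exact: (measurableT_comp (mh n) mX).
- exact: finite_measure_integrable_cst.
- by move=> n w _; rewrite normc_real.
- by move=> w _; apply: ccvg_real; exact: ch.
apply: (ccvg_unique cl); have := ccvgM (ccvg_cst c) cr.
by under eq_fun do rewrite -slot_nnsfun.
Qed.

Let slot_real (f : R -> R) M : measurable_fun setT f ->
  (forall x, `|f x| <= M) -> slot (fun x => (f x)%:C).
Proof.
move=> mf fM.
have M0 : 0 <= M by exact: le_trans (fM 0).
(* Shifting by the bound makes the function nonnegative; the subtracted constant is a multiple of
   the indicator of the line. *)
have -> : (fun x => (f x)%:C) = (fun x => (f x + M)%:C + (- M)%:C) :> (R -> R[i]).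
  by apply/funext => x; rewrite -rmorphD addrK.
have mfM : measurable_fun setT (fun x => f x + M) by exact: measurable_funD.
apply: (@slotD _ _ (M + M) M).
- exact: cmeasurable_real.
- move=> x; rewrite normc_real; apply: le_trans (ler_normD _ _) _.
  by rewrite (ger0_norm M0) lerD2r.
- exact: cmeasurable_cst.
- by move=> x; rewrite normc_real normrN ger0_norm.
- apply: (@slot_ge0 _ (M + M)) => // x; move: (fM x); rewrite ler_norml => /andP[? ?].
  by apply/andP; split; lra.
- have -> : (fun _ : R => (- M)%:C) = (fun x => (- M)%:C * (\1_setT x)%:C) :> (R -> R[i]).
    by apply/funext => x; rewrite indicT mulr1.
  apply: (@slotZ _ 1); [|by move=> x; rewrite indicT normc_real normr1|exact: slot_indic].
  by apply: cmeasurable_real; exact: measurable_indic.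
Qed.

Lemma cint_slot (f : R -> R[i]) M : cmeasurable setT f ->
  (forall x, normc (f x) <= M) ->
  cint P setT (fun w => W w * f (X w)) = c * cint P setT (fun w => f (X w)).
Proof.
move=> mf fM; have [mR mI] := mf.
rewrite -/(slot f).
have -> : f = (fun x => (Re (f x))%:C + 'i%C * (Im (f x))%:C).
  by apply/funext => x; rewrite -complexE.
have RM x : `|Re (f x)| <= M by exact: le_trans (le_Re_normc _) (fM x).
have IM x : `|Im (f x)| <= M by exact: le_trans (le_Im_normc _) (fM x).
have mIi : cmeasurable setT (fun x => (Im (f x))%:C) by exact: cmeasurable_real.
have ni : normc ('i%C : R[i]) = 1.
  by rewrite /= expr0n expr1n add0r sqrtr1.
apply: (@slotD _ _ M M).
- exact: cmeasurable_real.
- by move=> x; rewrite normc_real.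
- by apply: cmeasurableM => //; exact: cmeasurable_cst.
- by move=> x; rewrite Normc.normcM ni mul1r normc_real.
- exact: slot_real RM.
- by apply: (@slotZ _ M) => //; [move=> x; rewrite normc_real|exact: slot_real IM].
Qed.

End independent_slot.

Section mutual_independence.
Context d (T : measurableType d) (R : realType) (P : probability T R).
Variable X : nat -> T -> R.
Hypothesis mX : forall j, measurable_fun setT (X j).
Hypothesis indX : mutually_independent P X.

(** Independence speaks of events, hence of indicators. The factors are freed one slot at a time
    with [cint_slot], the product of the other factors playing the role of [W]. *)
Lemma cint_prod_independent (n : nat) (f : nat -> R -> R[i]) (M : nat -> R) :
  (forall j, cmeasurable setT (f j)) -> (forall j x, normc (f j x) <= M j) ->
  cint P setT (fun w => \prod_(j < n) f j (X j w)) =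
  \prod_(j < n) cint P setT (fun w => f j (X j w)).
Proof.
move=> mf fM.
(* At stage [k] the slots from [k] on still carry indicators, and [k = 0] is independence itself.
   The bounds are raised to [Num.max 1 (M j)] because every slot may temporarily hold an
   indicator. *)
have key k : (k <= n)%N -> forall g : nat -> R -> R[i],
    (forall j, cmeasurable setT (g j)) -> (forall j x, normc (g j x) <= Num.max 1 (M j)) ->
    (forall j, (k <= j)%N -> exists2 B, measurable B & g j = fun x => (\1_B x)%:C) ->
    cint P setT (fun w => \prod_(j < n) g j (X j w)) =
    \prod_(j < n) cint P setT (fun w => g j (X j w)).
  elim: k => [_|k IH kn] g mg gM gB.
    have /choice[B] : forall j, exists B, measurable B /\ g j = fun x => (\1_B x)%:C.
      by move=> j; have [B mB gE] := gB j isT; exists B.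
    move=> BP; have mB j : measurable (B j) by case: (BP j).
    have mXB j : measurable (X j @^-1` B j).
      by rewrite -[_ @^-1` _]setTI; exact: mX.
    under [RHS]eq_bigr => j _.
      rewrite (_ : (fun w => _) = (fun w => (\1_(X j @^-1` B j) w)%:C)); last first.
        by apply/funext => w; rewrite (BP j).2 !indicE.
      rewrite cint_indic//; over.
    have := indX (iota_uniq 0 n) mB => indB.
    rewrite -rmorph_prod/= -[X in X%:C](_ : fine (\prod_(j <- iota 0 n) P (X j @^-1` B j)) = _).
      rewrite -indB -cint_indic; last first.
        by apply: fin_bigcap_measurable => //; exact: finite_seq.
      apply: eq_cint => w _.
      have [wB|wB] := boolP (w \in \bigcap_(j in [set` iota 0 n]) X j @^-1` B j).
        rewrite indicE wB big1// => j _; rewrite (BP j).2 indicE.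
        rewrite mem_set//; move/set_mem: wB; apply => /=.
        by rewrite mem_iota add0n leq0n ltn_ord.
      rewrite indicE (negbTE wB).
      have [j jB] : exists j : 'I_n, ~ B j (X j w).
        apply/not_existsP => h; move/negP: wB; apply; apply/mem_set => j /=.
        rewrite mem_iota add0n => /= jn; have := h (Ordinal jn).
        by move/contrapT.
      rewrite (bigD1 j)//= (BP j).2 indicE memNset//= mul0r//.
    rewrite -(big_mkord xpredT (fun j => fine (P (X j @^-1` B j)))) /index_iota subn0.
    elim: (iota 0 n) => [|j s IHs]; first by rewrite !big_nil.
    rewrite !big_cons fineM ?IHs//; first exact: fin_num_measure.
    by apply: prode_fin_num => i _; exact: fin_num_measure.
  pose ko := Ordinal kn.
  have splitk (F : 'I_n -> R[i]) : \prod_j F j = (\prod_(j | j != ko) F j) * F ko.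
    by rewrite (bigD1 ko)//= mulrC.
  under [in LHS]eq_fun do rewrite splitk.
  rewrite splitk.
  apply: (@cint_slot _ _ _ P _ _ _ (\prod_(j < n | j != ko) Num.max 1 (M j))
     _ _ (mX k) _ _ (Num.max 1 (M k))) => //.
  - apply: cmeasurable_prod => j; exact: cmeasurable_comp.
  - move=> w; rewrite normc_prod; apply: ler_prod => j _.
    by rewrite normc_ge0 gM.
  - move=> B mB.
    (* The premise of [cint_slot], an indicator in slot [k], is the previous stage applied to
       [g']. *)
    pose g' j := if j == k then (fun x => (\1_B x)%:C) else g j.
    have g'k : g' k = (fun x => (\1_B x)%:C) by rewrite /g' eqxx.
    have g'j (j : 'I_n) : j != ko -> g' j = g j.
      by move=> jk; rewrite /g' -(inj_eq val_inj)/= in jk *; rewrite (negbTE jk).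
    have := IH (ltnW kn) g'; rewrite splitk /= g'k.
    under [X in cint _ _ X]eq_fun do rewrite splitk /= g'k.
    have -> : \prod_(j < n | j != ko) cint P setT (fun w => g' j (X j w)) =
              \prod_(j < n | j != ko) cint P setT (fun w => g j (X j w)).
      by apply: eq_bigr => j jk; rewrite g'j.
    move=> <-.
    - apply: eq_cint => w _; congr (_ * _).
      by apply: eq_bigr => j jk; rewrite g'j.
    - move=> j; rewrite /g'; case: ifP => // _.
      by apply: cmeasurable_real; exact: measurable_indic.
    - move=> j x; rewrite /g'; case: ifP => // _.
      by rewrite normc_real indicE le_max; case: (_ \in _); rewrite ?normr1 ?normr0 ?lexx ?ler01.
    - move=> j kj; rewrite /g'; have [jk|jk] := eqVneq j k; first by exists B.
      by apply: gB; rewrite ltn_neqAle eq_sym jk.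
(* Slots beyond [n] do not occur in the product; filling them with the indicator of the whole line
   meets the condition on [g]. *)
have := key n (leqnn n) (fun j => if (j < n)%N then f j else (fun x => (\1_setT x)%:C)).
under [X in cint _ _ X]eq_fun do under eq_bigr => j _ do rewrite ltn_ord.
under [X in _ = X]eq_bigr => j _ do rewrite ltn_ord.
apply.
- move=> j; case: ifP => // _; apply: cmeasurable_real; exact: measurable_indic.
- move=> j x; case: ifP => _; first by rewrite le_max fM orbT.
  by rewrite normc_real indicT normr1 le_max lexx.
- move=> j; rewrite leqNgt => /negbTE ->; by exists setT.
Qed.

End mutual_independence.

Section equality_in_law.
Context d (T : measurableType d) (R : realType) (P : probability T R).
Variables X Y : {RV P >-> R}.
Hypothesis XY : same_law P X Y.

Lemma same_law_integral (f : R -> \bar R) : measurable_fun setT f ->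
  (forall x, 0 <= f x)%E ->
  (\int[P]_w f (X w) = \int[P]_w f (Y w))%E.
Proof.
move=> mf f0.
have -> : (\int[P]_w f (X w) = \int[distribution P X]_x f x)%E.
  by rewrite ge0_integral_distribution.
have -> : (\int[P]_w f (Y w) = \int[distribution P Y]_x f x)%E.
  by rewrite ge0_integral_distribution.
by apply: eq_measure_integral => A mA _; exact: XY.
Qed.

Lemma same_law_Rintegral (f : R -> R) : measurable_fun setT f ->
  \int[P]_w f (X w) = \int[P]_w f (Y w).
Proof.
move=> mf; rewrite /Rintegral; congr fine.
have mE : measurable_fun setT (EFin \o f) by exact/measurable_EFinP.
rewrite integralE [RHS]integralE; congr (_ - _)%E.
  have h := same_law_integral (measurable_funepos mE) (funepos_ge0 _).
  by under eq_integral do rewrite (funepos_comp (EFin \o f) X);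
    under [RHS]eq_integral do rewrite (funepos_comp (EFin \o f) Y).
have h := same_law_integral (measurable_funeneg mE) (funeneg_ge0 _).
by under eq_integral do rewrite (funeneg_comp (EFin \o f) X);
  under [RHS]eq_integral do rewrite (funeneg_comp (EFin \o f) Y).
Qed.

Lemma same_law_cint (f : R -> R[i]) : cmeasurable setT f ->
  cint P setT (fun w => f (X w)) = cint P setT (fun w => f (Y w)).
Proof.
by move=> [mR mI]; apply: complex_ext => /=; exact: (@same_law_Rintegral (fun x => _ (f x))).
Qed.

End equality_in_law.

(** * Complex derivatives and improper integrals *)

Lemma ReZ {R : realType} (x : R) (w : R[i]) : Re (x%:C * w) = x * Re w.
Proof. by rewrite ReM /= mul0r subr0. Qed.
Lemma ImZ {R : realType} (x : R) (w : R[i]) : Im (x%:C * w) = x * Im w.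
Proof. by rewrite ImM /= mul0r addr0. Qed.

Lemma Re_cexp {R : realType} (w : R[i]) : Re (cexp w) = expR (Re w) * cos (Im w).
Proof. by []. Qed.
Lemma Im_cexp {R : realType} (w : R[i]) : Im (cexp w) = expR (Re w) * sin (Im w).
Proof. by []. Qed.

Definition Rpos {R : realType} : set R := `]0%R, +oo[%classic.

Lemma RposE {R : realType} (x : R) : Rpos x = (0 < x) :> Prop.
Proof. by rewrite /Rpos /= in_itv /= andbT. Qed.

Lemma measurable_Rpos {R : realType} : measurable (@Rpos R).
Proof. exact: measurable_itv. Qed.
(* The same fact for the display carried by the Lebesgue measure. *)
Lemma mRpos {R : realType} : @measurable _ (measurableTypeR R) (Rpos : set R).
Proof. exact: measurable_Rpos. Qed.
#[local] Hint Resolve measurable_Rpos mRpos : core.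

Section improper_FTC.
Context {R : realType}.
Notation mu := (@lebesgue_measure R).
Variables (f F : R -> R).
Hypothesis dF : forall x : R, 0 < x -> is_derive x (1 : R) F (f x).
Hypothesis cf : forall x : R, 0 < x -> {for x, continuous f}.

(** Exhausts the open half-line; the end points are 1 and 2 already at [n = 0], so the interval
    never degenerates. *)
Let I n : set R := `[n.+1%:R^-1, n.+2%:R]%classic.

Let I_bounds n : 0 < n.+1%:R^-1 :> R /\ (n.+1%:R^-1 : R) < n.+2%:R.
Proof.
split; first by rewrite invr_gt0 ltr0n.
apply: (@le_lt_trans _ _ 1); last by rewrite ltr1n.
by rewrite invf_le1 ?ltr0n// ler1n.
Qed.

Let FTC_I n :
  (\int[mu]_(x in I n) (f x)%:E = (F n.+2%:R - F n.+1%:R^-1)%:E)%E.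
Proof.
have [a0 ab] := I_bounds n.
rewrite EFinB; apply: (continuous_FTC2 ab).
- apply: continuous_in_subspaceT => x /set_mem /=; rewrite in_itv/= => /andP[ax _].
  by apply: cf; exact: lt_le_trans ax.
- split.
  + move=> x; rewrite in_itv/= => /andP[ax _].
    by have [] := dF (lt_trans a0 ax).
  + apply: cvg_at_right_filter; apply: differentiable_continuous.
    by apply/derivable1_diffP; have [] := dF a0.
  + apply: cvg_at_left_filter; apply: differentiable_continuous.
    by apply/derivable1_diffP; have [] := dF (lt_trans a0 ab).
- move=> x; rewrite in_itv/= => /andP[ax _].
  by rewrite derive1E; have [_ ->] := dF (lt_trans a0 ax).
Qed.

Let in_I (x : R) : 0 < x -> \forall n \near \oo, I n x.
Proof.
move=> x0; near=> n; rewrite /I /= in_itv /=; apply/andP; split.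
  rewrite -[leRHS]invrK lef_pV2 ?posrE ?invr_gt0 ?ltr0n//.
  apply: (@le_trans _ _ n%:R); last by rewrite ler_nat.
  by near: n; exact: nbhs_infty_ger.
apply: (@le_trans _ _ n%:R); last by rewrite ler_nat leqW.
by near: n; exact: nbhs_infty_ger.
Unshelve. all: by end_near. Qed.

Let mf : measurable_fun Rpos f.
Proof.
apply: open_continuous_measurable_fun; first exact: interval_open.
by move=> x /set_mem; rewrite RposE; exact: cf.
Qed.

Let fI n := f \_ (I n).

Let mfI n : measurable_fun Rpos (fI n).
Proof.
rewrite /fI patch_indic; apply: measurable_funM; first exact: mf.
by apply: measurable_indic; exact: measurable_itv.
Qed.

Let fI_cvg (x : R) : 0 < x -> fI n x @[n --> \oo] --> f x.
Proof.
move=> x0; apply: cvg_near_cst; near=> n.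
rewrite /fI patchE mem_set//.
by near: n; exact: in_I.
Unshelve. all: by end_near. Qed.

Let int_fI n :
  (\int[mu]_(x in Rpos) (fI n x)%:E = (F n.+2%:R - F n.+1%:R^-1)%:E)%E.
Proof.
rewrite -FTC_I.
have -> : (fun x => (fI n x)%:E) = (EFin \o f) \_ (I n).
  by apply/funext => x; rewrite /fI !patchE; case: ifP.
rewrite -integral_mkcondr; congr integral.
apply/seteqP; split => x; first by case.
move=> Ix; split => //; move: Ix; rewrite RposE /I /= in_itv/= => /andP[xa _].
by apply: lt_le_trans xa; case: (I_bounds n).
Qed.

Variables (F0 l : R).
Hypothesis FF0 : F n.+1%:R^-1 @[n --> \oo] --> F0.
Hypothesis Fl : F n.+2%:R @[n --> \oo] --> l.

(** Monotone convergence along the intervals [I n] asks for no integrability, and the finite value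
    then provides it. Majorants are obtained in this way; [improper_FTC] covers the signed functions
    below them. *)
Lemma improper_FTC_ge0 : (forall x : R, 0 < x -> 0 <= f x) ->
  (\int[mu]_(x in Rpos) (f x)%:E = (l - F0)%:E)%E.
Proof.
move=> f0.
have D0 (x : R) : Rpos x -> 0 < x by rewrite RposE.
have h := @cvg_monotone_convergence _ _ R mu Rpos
  measurable_Rpos (fun n x => (fI n x)%:E).
have [] : [/\ (forall n, measurable_fun Rpos (fun x => (fI n x)%:E)),
    (forall n x, Rpos x -> (0 <= (fI n x)%:E)%E) &
    (forall x, Rpos x -> {homo (fun n => (fI n x)%:E) : n m / (n <= m)%N >-> (n <= m)%E})].
  split.
  - by move=> n; apply/measurable_EFinP; exact: mfI.
  - by move=> n x /D0 x0; rewrite lee_fin /fI patchE; case: ifP => // _; exact: f0.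
  - move=> x /D0 x0 n m nm; rewrite lee_fin /fI !patchE.
    case: ifPn => [nI|nI]; last by case: ifP => // _; exact: f0.
    rewrite mem_set//; move/set_mem: nI; rewrite /I/= !in_itv/= => /andP[h1 h2].
    apply/andP; split.
      by apply: le_trans h1; rewrite lef_pV2 ?posrE ?ltr0n// ler_nat.
    by apply: le_trans h2 _; rewrite ler_nat.
move=> /h{}h /h{}h /h{}h.
have : (\int[mu]_(x in Rpos) (fI n x)%:E)%E @[n --> \oo] --> (l - F0)%:E.
  under eq_fun do rewrite int_fI.
  by apply: cvg_EFin; [exact: nearW|exact: cvgB].
move=> /(cvg_unique _ h) <- //.
apply: eq_integral => x /set_mem /D0 x0.
apply/esym/cvg_lim => //; apply: cvg_EFin; first exact: nearW.
exact: fI_cvg.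
Qed.

Lemma improper_FTC_integrable : (forall x : R, 0 < x -> 0 <= f x) ->
  mu.-integrable Rpos (EFin \o f).
Proof.
move=> f0; apply/integrableP; split; first by apply/measurable_EFinP; exact: mf.
have -> : (\int[mu]_(x in Rpos) `|(EFin \o f) x| = \int[mu]_(x in Rpos) (f x)%:E)%E.
  apply: eq_integral.
  move=> x /set_mem; rewrite RposE => x0.
  by rewrite /= ger0_norm ?f0.
by rewrite improper_FTC_ge0// ltry.
Qed.

Lemma improper_FTC : mu.-integrable Rpos (EFin \o f) ->
  \int[mu]_(x in Rpos) f x = l - F0.
Proof.
move=> fi.
have [||||_ h] := @Rintegral_dct _ _ R mu Rpos measurable_Rpos
   fI f (fun x => `|f x|).
- exact: mfI.
- by have := integrable_norm fi.
- move=> n x _; rewrite /fI patchE; case: ifP => // _; by rewrite normr0.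
- by move=> x; rewrite RposE; exact: fI_cvg.
have h2 : \int[mu]_(x in Rpos) fI n x @[n --> \oo] --> l - F0.
  rewrite /Rintegral; under eq_fun do rewrite int_fI/=.
  exact: cvgB.
exact: (cvg_unique _ h h2).
Qed.

End improper_FTC.

Section complex_derivatives.
Context {R : realType}.
Implicit Types (F G : R -> R[i]).

Definition is_cderive F (x : R) (dF : R[i]) :=
  is_derive x 1 (fun t => Re (F t)) (Re dF) /\
  is_derive x 1 (fun t => Im (F t)) (Im dF).

Definition ccontinuous_at F (x : R) :=
  {for x, continuous (fun t => Re (F t))} /\ {for x, continuous (fun t => Im (F t))}.

Lemma is_cderive_continuous F x dF : is_cderive F x dF -> ccontinuous_at F x.
Proof.
move=> [[dR _] [dI _]]; split; apply: differentiable_continuous; exact/derivable1_diffP.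
Qed.

Lemma ccontinuousM F G x : ccontinuous_at F x -> ccontinuous_at G x ->
  ccontinuous_at (fun t => F t * G t) x.
Proof.
move=> [FR FI] [GR GI]; split; rewrite /prop_for /continuous_at.
  rewrite ReM; under eq_fun do rewrite ReM.
  by apply: cvgB; apply: cvgM.
rewrite ImM; under eq_fun do rewrite ImM.
by apply: cvgD; apply: cvgM.
Qed.

Lemma ccontinuousD F G x : ccontinuous_at F x -> ccontinuous_at G x ->
  ccontinuous_at (fun t => F t + G t) x.
Proof.
move=> [FR FI] [GR GI]; split; rewrite /prop_for /continuous_at.
  by rewrite ReD; under eq_fun do rewrite ReD; apply: cvgD.
by rewrite ImD; under eq_fun do rewrite ImD; apply: cvgD.
Qed.

Lemma ccontinuous_cst c x : ccontinuous_at (fun=> c) x.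
Proof. by split; exact: cvg_cst. Qed.

Lemma is_cderive_eq F x a b : is_cderive F x a -> a = b -> is_cderive F x b.
Proof. by move=> ? <-. Qed.

Lemma is_cderive_cst c x : is_cderive (fun=> c) x 0.
Proof. by split; exact: is_derive_cst. Qed.

Lemma is_cderive_real (f : R -> R) (x df : R) : is_derive x (1 : R) f df ->
  is_cderive (fun t => (f t)%:C) x df%:C.
Proof. by split => //=; exact: is_derive_cst. Qed.

Lemma is_cderiveD F G x dF dG : is_cderive F x dF -> is_cderive G x dG ->
  is_cderive (fun t => F t + G t) x (dF + dG).
Proof.
move=> [FR FI] [GR GI]; split.
  rewrite ReD; under eq_fun do rewrite ReD; exact: is_deriveD.
rewrite ImD; under eq_fun do rewrite ImD; exact: is_deriveD.
Qed.

Lemma is_cderiveM F G x dF dG : is_cderive F x dF -> is_cderive G x dG ->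
  is_cderive (fun t => F t * G t) x (dF * G x + F x * dG).
Proof.
move=> [FR FI] [GR GI]; split.
  under eq_fun do rewrite ReM.
  apply: (is_derive_eq (is_deriveB (is_deriveM FR GR) (is_deriveM FI GI))).
  by rewrite /= ReD !ReM /GRing.scale /=; ring.
under eq_fun do rewrite ImM.
apply: (is_derive_eq (is_deriveD (is_deriveM FR GI) (is_deriveM FI GR))).
by rewrite /= ImD !ImM /GRing.scale /=; ring.
Qed.

Lemma is_cderiveZ (c : R[i]) F x dF : is_cderive F x dF ->
  is_cderive (fun t => c * F t) x (c * dF).
Proof.
move=> h; apply: (is_cderive_eq (is_cderiveM (is_cderive_cst c x) h)).
by rewrite mul0r add0r.
Qed.

Lemma is_cderive_cexp F x dF : is_cderive F x dF ->
  is_cderive (fun t => cexp (F t)) x (dF * cexp (F x)).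
Proof.
move=> [FR FI].
have dE := is_derive1_comp (is_derive_expR (Re (F x))) FR.
have dC := is_derive1_comp (is_derive_cos (Im (F x))) FI.
have dS := is_derive1_comp (is_derive_sin (Im (F x))) FI.
split.
  apply: (is_derive_eq (is_deriveM dE dC)).
  by rewrite ReM /= /GRing.scale /=; ring.
apply: (is_derive_eq (is_deriveM dE dS)).
by rewrite ImM /= /GRing.scale /=; ring.
Qed.

Lemma is_cderive_expZ (p : R[i]) (v : R) :
  is_cderive (fun u => cexp (- (p * u%:C))) v (- p * cexp (- (p * v%:C))).
Proof.
apply: is_cderive_cexp.
have := is_cderiveZ (- p) (is_cderive_real (is_derive_id v (1 : R))).
rewrite mulr1; under eq_fun do rewrite mulNr; exact.
Qed.

Lemma ccontinuous_cexp F x : ccontinuous_at F x -> ccontinuous_at (fun t => cexp (F t)) x.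
Proof.
move=> [FR FI]; split; rewrite /prop_for /continuous_at.
  apply: cvgM; apply: continuous_cvg => //; [exact: continuous_expR|exact: continuous_cos].
apply: cvgM; apply: continuous_cvg => //; [exact: continuous_expR|exact: continuous_sin].
Qed.

Lemma is_cderive0_cst F x y : (forall t, is_cderive F t 0) -> F x = F y.
Proof.
move=> h; apply: complex_ext.
  by apply: (@is_derive_0_is_cst _ (fun t => Re (F t))) => t; case: (h t).
by apply: (@is_derive_0_is_cst _ (fun t => Im (F t))) => t; case: (h t).
Qed.

Lemma improper_cFTC (f F : R -> R[i]) (F0 l : R[i]) :
  (forall x : R, 0 < x -> is_cderive F x (f x)) ->
  (forall x : R, 0 < x -> ccontinuous_at f x) ->
  ccvg (fun n => F n.+1%:R^-1) F0 -> ccvg (fun n => F n.+2%:R) l ->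
  cintegrable lebesgue_measure Rpos f ->
  cint lebesgue_measure Rpos f = l - F0.
Proof.
move=> dF cf [F0R F0I] [lR lI] [iR iI].
apply: complex_ext; rewrite /= ?ReD ?ImD ?ReN ?ImN.
  apply: (@improper_FTC _ _ (fun t => Re (F t))) => // x x0.
    by have [] := dF x x0.
  by have [] := cf x x0.
apply: (@improper_FTC _ _ (fun t => Im (F t))) => // x x0.
  by have [] := dF x x0.
by have [] := cf x x0.
Qed.

Lemma cmeasurable_continuous (f : R -> R[i]) :
  (forall x : R, 0 < x -> ccontinuous_at f x) -> cmeasurable Rpos f.
Proof.
move=> cf; split; apply: open_continuous_measurable_fun; try exact: interval_open.
  by move=> x /set_mem; rewrite RposE => x0; case: (cf x x0).
by move=> x /set_mem; rewrite RposE => x0; case: (cf x x0).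
Qed.

End complex_derivatives.

(** * The gamma integral with complex parameter *)

Section complex_power.
Context {R : realType}.
Variable y : R.
Hypothesis y0 : 0 < y.

(** The principal logarithm of [y +i* t]. In the right half-plane the arctangent formula is
    available, which is smooth in [t] along the whole line. *)
Definition clog (t : R) : R[i] := (ln (y ^+ 2 + t ^+ 2) / 2) +i* atan (t / y).

Let n0 t : 0 < y ^+ 2 + t ^+ 2.
Proof. by rewrite ltr_pwDl ?sqr_ge0// exprn_gt0. Qed.

Lemma is_cderive_clog t : is_cderive clog t ('i%C * (y +i* t)^-1).
Proof.
have yt0 := n0 t.
have dq : is_derive t (1 : R) (fun s : R => y ^+ 2 + s ^+ 2) (t *+ 2).
  have := is_deriveD (is_derive_cst (y ^+ 2) t 1) (is_deriveX 2 (is_derive_id t (1 : R))).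
  by move=> h; apply: (is_derive_eq h); rewrite /GRing.scale /= add0r expr1 mulr1 mulr_natl.
have dl := @is_derive1_comp R (@ln R) (fun s => y ^+ 2 + s ^+ 2) t _ _ (is_derive1_ln yt0) dq.
have da : is_derive t (1 : R) (fun s : R => s / y) (y^-1).
  have := is_deriveM (is_derive_id t (1 : R)) (is_derive_cst y^-1 t 1) => h.
  by apply: (is_derive_eq h); rewrite /GRing.scale /= mulr0 add0r mulr1.
have dat := @is_derive1_comp R (@atan R) (fun s => s / y) t _ _ (is_derive1_atan (t / y)) da.
split.
  have := is_deriveM dl (is_derive_cst (2^-1 : R) t 1) => h.
  apply: (is_derive_eq h); rewrite /GRing.scale /= mulr0 add0r.
  by field; rewrite gt_eqF.
apply: (is_derive_eq dat); rewrite /=.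
field; rewrite !gt_eqF//= ?exprn_gt0// addrC//.
Qed.

Lemma cexp_clog t : cexp (clog t) = y +i* t.
Proof.
have yt0 := n0 t.
have e : expR (ln (y ^+ 2 + t ^+ 2) / 2) = Num.sqrt (y ^+ 2 + t ^+ 2).
  by rewrite -powR12_sqrt ?ltW// /powR gt_eqF// mulrC.
have c : cos (atan (t / y)) = y / Num.sqrt (y ^+ 2 + t ^+ 2).
  rewrite cos_atan.
  have -> : 1 + (t / y) ^+ 2 = (y ^+ 2 + t ^+ 2) / y ^+ 2.
    by field; rewrite gt_eqF.
  rewrite sqrtrM ?ltW// sqrtrV ?sqr_ge0// sqrtr_sqr gtr0_norm//.
  by rewrite invfM invrK mulrC.
have s : sin (atan (t / y)) = t / Num.sqrt (y ^+ 2 + t ^+ 2).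
  have : tan (atan (t / y)) = t / y by rewrite atanK.
  rewrite /tan c => h.
  have q0 : Num.sqrt (y ^+ 2 + t ^+ 2) != 0 by rewrite gt_eqF// sqrtr_gt0.
  have := congr1 (fun x => x * (y / Num.sqrt (y ^+ 2 + t ^+ 2))) h.
  rewrite mulfVK; last by rewrite mulf_neq0 ?invr_eq0 ?gt_eqF ?q0// sqrtr_gt0.
  by move=> ->; field; rewrite q0 gt_eqF.
apply: complex_ext => /=; rewrite e ?c ?s mulrC mulfVK// gt_eqF// sqrtr_gt0//.
Qed.

End complex_power.

Section gamma_integral.
Context {R : realType}.
Notation mu := (@lebesgue_measure R).

Lemma powR_inv_cvg0 (h : R) : 0 < h -> (n.+1%:R^-1 : R) `^ h @[n --> \oo] --> (0 : R).
Proof.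
move=> h0; have := powR_cvg0 h0; move=> /cvg_at_rightP; apply.
by split; [move=> n; rewrite invr_gt0|exact: cvg_harmonic].
Qed.

Lemma powR_nat_cvgy (h : R) : 0 < h -> (n.+2%:R : R) `^ h @[n --> \oo] --> +oo.
Proof.
move=> h0; apply/cvgryPge => A; near=> n.
have A1 : 1 <= Num.max 1 A by rewrite le_max lexx.
apply: (@le_trans _ _ (Num.max 1 A)); first by rewrite le_max lexx orbT.
have -> : Num.max 1 A = ((Num.max 1 A) `^ (h^-1)) `^ h.
  by rewrite -powRrM mulVf ?gt_eqF// powRr1// (le_trans ler01).
apply: ge0_ler_powR; rewrite ?nnegrE ?powR_ge0 ?ltW//.
apply: (@le_lt_trans _ _ n%:R); last by rewrite ltr_nat.
by near: n; exact: nbhs_infty_ger.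
Unshelve. all: by end_near. Qed.

Lemma is_derive_stretched_exp (h y v : R) : 0 < v ->
  is_derive v (1 : R) (fun u => - expR (- (y * u `^ h)))
    (y * h * (v `^ (h - 1) * expR (- (y * v `^ h)))).
Proof.
move=> v0.
have d1 := is_derive1_powR h v0.
have d2 := is_deriveN (is_deriveZ y d1).
have d3 := is_deriveN (is_derive1_comp (is_derive_expR _) d2).
by apply: (is_derive_eq d3); rewrite /GRing.scale /=; ring.
Qed.

Lemma stretched_exp_cvg0 (h y : R) : 0 < h -> 0 < y ->
  expR (- (y * n.+2%:R `^ h)) @[n --> \oo] --> 0.
Proof.
move=> h0 y0.
apply: (@cvg_comp _ _ _ (fun n => y * n.+2%:R `^ h) (fun x => expR (- x))); last exact: cvgr_expR.
apply/cvgryPge => A; move: (powR_nat_cvgy h0) => /cvgryPge/(_ (A / y)).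
by apply: filterS => n; rewrite ler_pdivrMr// mulrC.
Qed.

(** Up to the factor y h the integrand is the derivative of - exp (- y v^h), whose boundary values
    are -1 and 0. *)
Lemma integrable_stretched_exp (h y : R) : 0 < h -> 0 < y ->
  mu.-integrable Rpos (EFin \o (fun v => v `^ (h - 1) * expR (- (y * v `^ h)))).
Proof.
move=> h0 y0.
pose f v := y * h * (v `^ (h - 1) * expR (- (y * v `^ h))).
pose F v := - expR (- (y * v `^ h)).
have f_ge0 (x : R) : 0 < x -> 0 <= f x.
  by move=> x0; rewrite !mulr_ge0 ?powR_ge0 ?expR_ge0 ?ltW.
have cf (x : R) : 0 < x -> {for x, continuous f}.
  move=> x0; apply: differentiable_continuous; apply/derivable1_diffP.
  apply: derivableM; first exact: derivable_cst.
  apply: derivableM; first by have [] := is_derive1_powR (h - 1) x0.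
  have d1 := is_derive1_powR h x0.
  have d2 := is_deriveN (is_deriveZ y d1).
  by have [] := is_derive1_comp (is_derive_expR _) d2.
have dF (x : R) : 0 < x -> is_derive x (1 : R) F (f x) by exact: is_derive_stretched_exp.
have F0 : F n.+1%:R^-1 @[n --> \oo] --> (-1 : R).
  have -> : -1 = - expR (- (y * 0)) :> R by rewrite mulr0 oppr0 expR0.
  apply: cvgN; apply: continuous_cvg; first exact: continuous_expR.
  by apply: cvgN; apply: cvgM; [exact: cvg_cst|exact: powR_inv_cvg0].
have Fl : F n.+2%:R @[n --> \oo] --> (0 : R).
  by rewrite -[X in _ --> X]oppr0; apply: cvgN; exact: stretched_exp_cvg0.
have if_ := improper_FTC_integrable dF cf F0 Fl f_ge0.
have := integrable_scale (y * h)^-1 mRpos if_.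
rewrite (_ : (fun v => _) = (fun v => v `^ (h - 1) * expR (- (y * v `^ h)))) //.
apply/funext => v; rewrite /f mulrA mulVf ?mul1r//.
by rewrite mulf_neq0 ?gt_eqF.
Qed.

(** Comparison with the stretched exponential of exponent 1 - g: from v^(1-g) <= 1 + v follows exp
    (- y v) <= exp y exp (- y v^(1-g)). *)
Lemma integrable_Rpos_pow_exp (g y : R) : 0 <= g < 1 -> 0 < y ->
  mu.-integrable Rpos (EFin \o (fun v => v `^ (- g) * expR (- (y * v)))).
Proof.
move=> /andP[g0 g1] y0.
have h0 : 0 < 1 - g by rewrite subr_gt0.
have ig := integrable_scale (expR y) mRpos (integrable_stretched_exp h0 y0).
apply: (le_integrable_norm mRpos _ ig).
  apply: measurable_funM.
    by apply: measurable_funTS; exact: measurable_powR.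
  apply: measurableT_comp; first exact: measurable_expR.
  by apply: measurableT_comp => //; exact: measurable_funM.
move=> x; rewrite RposE => x0.
rewrite ger0_norm ?mulr_ge0 ?powR_ge0 ?expR_ge0//.
have -> : 1 - g - 1 = - g by ring.
rewrite mulrCA ler_pM2l ?powR_gt0// -expRD ler_expR.
suff : x `^ (1 - g) <= 1 + x.
  rewrite -(ler_pM2l y0) mulrDr mulr1 => h.
  by rewrite lerNl opprB lerBlDl.
have [x1|x1] := leP x 1.
  have := @ge0_ler_powR R (1 - g) (ltW h0) x 1.
  rewrite !nnegrE (ltW x0) ler01 powR1 => /(_ isT isT x1); lra.
have := ler1_powR (ltW x1) (_ : 1 - g <= 1); rewrite gerBl => /(_ g0); lra.
Qed.

(** Half of the exponential absorbs the extra power: v exp (- y v / 2) <= 2 / y. The other half is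
    left to the previous case. *)
Lemma integrable_Rpos_pow1_exp (g y : R) : 0 <= g < 1 -> 0 < y ->
  mu.-integrable Rpos (EFin \o (fun v => v `^ (1 - g) * expR (- (y * v)))).
Proof.
move=> g01 y0.
have y20 : 0 < y / 2 by rewrite divr_gt0.
have ig := integrable_scale (2 / y) mRpos (integrable_Rpos_pow_exp g01 y20).
apply: (le_integrable_norm mRpos _ ig).
  apply: measurable_funM.
    by apply: measurable_funTS; exact: measurable_powR.
  apply: measurableT_comp; first exact: measurable_expR.
  by apply: measurableT_comp => //; exact: measurable_funM.
move=> x; rewrite RposE => x0.
rewrite ger0_norm ?mulr_ge0 ?powR_ge0 ?expR_ge0//.
rewrite powRD; last by rewrite (gt_eqF x0) implybT.
rewrite powRr1 ?(ltW x0)//.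
have -> : expR (- (y * x)) = expR (- (y / 2 * x)) * expR (- (y / 2 * x)).
  by rewrite -expRD; congr expR; field.
set E := expR _; set p := x `^ _.
have : x * E <= 2 / y.
  rewrite /E expRN ler_pdivrMr ?expR_gt0//.
  have := expR_ge1Dx (y / 2 * x); move=> h.
  rewrite [leLHS](_ : x = 2 / y * (y / 2 * x)); last by field; rewrite gt_eqF.
  rewrite ler_pM2l ?divr_gt0//; apply: le_trans h; lra.
move=> h; have -> : x * p * (E * E) = x * E * (p * E) by ring.
by rewrite ler_wpM2r// mulr_ge0 ?powR_ge0 ?expR_ge0.
Qed.

Variables (b y : R).
Hypotheses (b01 : 0 < b < 1) (y0 : 0 < y).

(** At p = y + i t the integrals of [gpow0] and [gpow1] are Gamma(1 - b) p^(b-1) and Gamma(2 - b)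
    p^(b-2). *)
Definition gpow0 (t v : R) : R[i] := (v `^ (- b))%:C * cexp (- ((y +i* t) * v%:C)).
Definition gpow1 (t v : R) : R[i] := (v `^ (1 - b))%:C * cexp (- ((y +i* t) * v%:C)).

Let Re_arg t v : Re (- ((y +i* t) * v%:C)) = - (y * v).
Proof. by rewrite /=; ring. Qed.
Let Im_arg t v : Im (- ((y +i* t) * v%:C)) = - (t * v).
Proof. by rewrite /=; ring. Qed.

Let Re_gpow0 t v : Re (gpow0 t v) = v `^ (- b) * (expR (- (y * v)) * cos (- (t * v))).
Proof. by rewrite /gpow0 ReZ Re_cexp Re_arg Im_arg. Qed.
Let Im_gpow0 t v : Im (gpow0 t v) = v `^ (- b) * (expR (- (y * v)) * sin (- (t * v))).
Proof. by rewrite /gpow0 ImZ Im_cexp Re_arg Im_arg. Qed.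
Let Re_gpow1 t v : Re (gpow1 t v) = v `^ (1 - b) * (expR (- (y * v)) * cos (- (t * v))).
Proof. by rewrite /gpow1 ReZ Re_cexp Re_arg Im_arg. Qed.
Let Im_gpow1 t v : Im (gpow1 t v) = v `^ (1 - b) * (expR (- (y * v)) * sin (- (t * v))).
Proof. by rewrite /gpow1 ImZ Im_cexp Re_arg Im_arg. Qed.

Lemma normc_gpow0 t v : normc (gpow0 t v) = v `^ (- b) * expR (- (y * v)).
Proof.
by rewrite /gpow0 Normc.normcM normc_real normc_cexp Re_arg ger0_norm// powR_ge0.
Qed.

Lemma normc_gpow1 t v : normc (gpow1 t v) = v `^ (1 - b) * expR (- (y * v)).
Proof.
by rewrite /gpow1 Normc.normcM normc_real normc_cexp Re_arg ger0_norm// powR_ge0.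
Qed.

Let b01' : 0 <= b < 1. Proof. by case/andP: b01 => /ltW -> ->. Qed.

Let is_cderive_pow (e v : R) : 0 < v -> is_cderive (fun u => (u `^ e)%:C) v ((e * v `^ (e - 1))%:C).
Proof. by move=> v0; apply: is_cderive_real; exact: is_derive1_powR. Qed.

Lemma cintegrable_gpow0 t : cintegrable mu Rpos (gpow0 t).
Proof.
apply: (cintegrable_le mRpos _ (integrable_Rpos_pow_exp b01' y0)).
  apply: cmeasurable_continuous => v v0; apply: ccontinuousM.
    exact: is_cderive_continuous (is_cderive_pow _ v0).
  exact: is_cderive_continuous (is_cderive_expZ (y +i* t) v).
by move=> v _; rewrite normc_gpow0.
Qed.

Lemma cintegrable_gpow1 t : cintegrable mu Rpos (gpow1 t).
Proof.
apply: (cintegrable_le mRpos _ (integrable_Rpos_pow1_exp b01' y0)).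
  apply: cmeasurable_continuous => v v0; apply: ccontinuousM.
    exact: is_cderive_continuous (is_cderive_pow _ v0).
  exact: is_cderive_continuous (is_cderive_expZ (y +i* t) v).
by move=> v _; rewrite normc_gpow1; exact: lexx.
Qed.

(** Integration by parts: [gpow1] has derivative (1 - b) [gpow0] - p [gpow1] and vanishes at both
    ends of the half-line. *)
Lemma cint_gpow1 t :
  (y +i* t) * cint mu Rpos (gpow1 t) = (1 - b)%:C * cint mu Rpos (gpow0 t).
Proof.
have i0 := cintegrableZ (1 - b)%:C mRpos (cintegrable_gpow0 t).
have i1 := cintegrableZ (- (y +i* t)) mRpos (cintegrable_gpow1 t).
apply/eqP; rewrite eq_sym -subr_eq0 -mulNr -!cintZ//; last 2 first.
- exact: cintegrable_gpow1.
- exact: cintegrable_gpow0.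
rewrite -cintD//.
rewrite (@improper_cFTC _ _ (gpow1 t) 0 0) ?subrr//; last exact: cintegrableD.
- move=> v v0; apply: (is_cderive_eq (is_cderiveM (is_cderive_pow (1 - b) v0) (is_cderive_expZ (y +i* t) v))).
  rewrite /gpow0 /gpow1 rmorphM.
  have -> : 1 - b - 1 = - b by ring.
  by ring.
- move=> v v0; apply: ccontinuousD; apply: ccontinuousM; try exact: ccontinuous_cst.
    apply: ccontinuousM; first exact: is_cderive_continuous (is_cderive_pow _ v0).
    exact: is_cderive_continuous (is_cderive_expZ (y +i* t) v).
  apply: ccontinuousM; first exact: is_cderive_continuous (is_cderive_pow _ v0).
  exact: is_cderive_continuous (is_cderive_expZ (y +i* t) v).
- apply/ccvg_normc; under eq_fun do rewrite subr0 normc_gpow1.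
  apply: (@squeeze_cvgr _ _ _ _ (fun=> 0) (fun n => (n.+1%:R^-1 : R) `^ (1 - b))).
  + apply: nearW => n; rewrite mulr_ge0 ?powR_ge0 ?expR_ge0//=.
    by rewrite ler_piMr ?powR_ge0// expR_le1 oppr_le0 mulr_ge0 ?ltW.
  + exact: cvg_cst.
  + have h0 : 0 < 1 - b by rewrite subr_gt0; case/andP: b01.
    have := powR_cvg0 h0; move=> /cvg_at_rightP; apply.
    split; first by move=> n; rewrite invr_gt0.
    exact: cvg_harmonic.
- apply/ccvg_normc; under eq_fun do rewrite subr0 normc_gpow1.
  (* At infinity v^(1-b) <= v and exp (y v) >= (y v)^2 / 2 leave a bound of order 1/v. *)
  apply: (@squeeze_cvgr _ _ _ _ (fun=> 0) (fun n => 2 / y ^+ 2 * n.+1%:R^-1)).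
  + apply: nearW => n; rewrite mulr_ge0 ?powR_ge0 ?expR_ge0//=.
    set v : R := n.+2%:R.
    have v1 : 1 <= v by rewrite ler1n.
    have v0 : 0 < v by rewrite ltr0n.
    apply: (@le_trans _ _ (v * expR (- (y * v)))).
      rewrite ler_wpM2r ?expR_ge0// ler1_powR// gerBl.
      by case/andP: b01' .
    have yv0 : 0 < y * v by rewrite mulr_gt0.
    have := expR_ge1Dxn 1 (ltW yv0); rewrite (_ : 2`!%:R = 2 :> R)// => h.
    rewrite expRN ler_pdivrMr ?expR_gt0//.
    apply: (@le_trans _ _ (2 / y ^+ 2 / n.+1%:R * ((y * v) ^+ 2 / 2))); last first.
      rewrite ler_pM2l; last by rewrite !divr_gt0 ?exprn_gt0 ?ltr0n.
      by apply: le_trans h; rewrite lerDr.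
    have -> : 2 / y ^+ 2 / n.+1%:R * ((y * v) ^+ 2 / 2) = v ^+ 2 / n.+1%:R.
      by field; rewrite gt_eqF //= gt_eqF// ltr0n.
    rewrite ler_pdivlMr ?ltr0n// expr2 ler_pM2l// /v ler_nat//.
  + exact: cvg_cst.
  + rewrite -[X in _ --> X](mulr0 (2 / y ^+ 2)); apply: cvgM; first exact: cvg_cst.
    exact: cvg_harmonic.
Qed.

(** Differentiation under the integral sign. The derivative in t is - i [gpow1], whose modulus is
    independent of t, so one majorant serves a whole neighbourhood. *)
Lemma is_cderive_cint_gpow0 t :
  is_cderive (fun s => cint mu Rpos (gpow0 s)) t (- 'i%C * cint mu Rpos (gpow1 t)).
Proof.
have b1 : 0 < 1 - b by rewrite subr_gt0; case/andP: b01.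
pose G v := v `^ (1 - b) * expR (- (y * v)).
have G0 v : 0 <= G v by rewrite mulr_ge0 ?powR_ge0 ?expR_ge0.
have iG : mu.-integrable Rpos (EFin \o G) by exact: integrable_Rpos_pow1_exp.
have pw (v : R) : 0 < v -> v `^ (1 - b) = v * v `^ (- b).
  by move=> v0; rewrite powRD ?powRr1 ?ltW// (gt_eqF v0) implybT.
have It : `]t - 1, t + 1[%classic t by rewrite /= in_itv /= gtrBl ltrDl ltr01.
have dlin s v : is_derive s (1 : R) (fun x : R => - (x * v)) (- v).
  have := is_deriveN (is_deriveM (is_derive_id s (1 : R)) (is_derive_cst v s 1)) => h.
  by apply: (is_derive_eq h); rewrite /GRing.scale /= mulr0 add0r mulr1.
have dR s v : 0 < v -> is_derive s (1 : R) (fun x => Re (gpow0 x v)) (Im (gpow1 s v)).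
  move=> v0; under eq_fun do rewrite Re_gpow0.
  have dc := @is_derive1_comp R cos (fun x => - (x * v)) s _ _ (is_derive_cos _) (dlin s v).
  have := is_deriveZ (v `^ (- b)) (is_deriveZ (expR (- (y * v))) dc) => h.
  apply: (is_derive_eq h); rewrite Im_gpow1 pw//.
  by rewrite /GRing.scale /=; ring.
have dI s v : 0 < v -> is_derive s (1 : R) (fun x => Im (gpow0 x v)) (- Re (gpow1 s v)).
  move=> v0; under eq_fun do rewrite Im_gpow0.
  have dc := @is_derive1_comp R sin (fun x => - (x * v)) s _ _ (is_derive_sin _) (dlin s v).
  have := is_deriveZ (v `^ (- b)) (is_deriveZ (expR (- (y * v))) dc) => h.
  apply: (is_derive_eq h); rewrite Re_gpow1 pw//.
  by rewrite /GRing.scale /=; ring.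
split.
  have iR s : `]t - 1, t + 1[%classic s -> mu.-integrable Rpos (EFin \o (fun v => Re (gpow0 s v))).
    by move=> _; case: (cintegrable_gpow0 s).
  have der s v : `]t - 1, t + 1[%classic s -> Rpos v -> derivable (fun x => Re (gpow0 x v)) s 1.
    by move=> _; rewrite RposE => v0; have [] := dR s v v0.
  have ub s v : `]t - 1, t + 1[%classic s -> Rpos v -> `|partial1of2 (fun x v => Re (gpow0 x v)) s v| <= G v.
    move=> _; rewrite RposE => v0; rewrite partial1of2E.
    have [_ ->] := dR s v v0; apply: le_trans (le_Im_normc _) _; rewrite normc_gpow1; exact: lexx.
  split.
    exact: (derivable_under_integral mRpos It iR der G0 iG ub).
  rewrite -derive1E (differentiation_under_integral mRpos It iR der G0 iG ub).
  rewrite ReM /= oppr0 mul0r sub0r mulN1r opprK.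
  apply: eq_Rintegral => v /set_mem; rewrite RposE => v0.
  by rewrite partial1of2E; have [_ ->] := dR t v v0.
have iI s : `]t - 1, t + 1[%classic s -> mu.-integrable Rpos (EFin \o (fun v => Im (gpow0 s v))).
  by move=> _; case: (cintegrable_gpow0 s).
have der s v : `]t - 1, t + 1[%classic s -> Rpos v -> derivable (fun x => Im (gpow0 x v)) s 1.
  by move=> _; rewrite RposE => v0; have [] := dI s v v0.
have ub s v : `]t - 1, t + 1[%classic s -> Rpos v -> `|partial1of2 (fun x v => Im (gpow0 x v)) s v| <= G v.
  move=> _; rewrite RposE => v0; rewrite partial1of2E.
  have [_ ->] := dI s v v0; rewrite normrN; apply: le_trans (le_Re_normc _) _; rewrite normc_gpow1; exact: lexx.
split.
  exact: (derivable_under_integral mRpos It iI der G0 iG ub).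
rewrite -derive1E (differentiation_under_integral mRpos It iI der G0 iG ub).
rewrite ImM /= oppr0 mul0r add0r mulN1r.
have [i1 _] := cintegrable_gpow1 t.
rewrite -[RHS]mulN1r -RintegralZl//; last exact: mRpos.
apply: eq_Rintegral => v /set_mem; rewrite RposE => v0.
by rewrite partial1of2E mulN1r; have [_ ->] := dI t v v0.
Qed.

(** Substituting v / y for v shows the value Gamma(1 - b). The constant cancels from the final ratio
    in [cint_laplace_lim]. *)
Definition gamma_cst : R := \int[mu]_(v in Rpos) (v `^ (- b) * expR (- (y * v))) * y `^ (1 - b).

(** A differential equation takes the place of a contour rotation. With I and J the integrals of
    [gpow0] and [gpow1], I' = - i J and p J = (1 - b) I, so I p^(1-b) is constant along the line p =
    y + i t and can be read off at t = 0. *)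
Lemma cint_gpow0 t :
  cint mu Rpos (gpow0 t) = gamma_cst%:C * cexp ((b - 1)%:C * clog y t).
Proof.
pose E s := cexp ((1 - b)%:C * clog y s).
have dE s : is_cderive E s ((1 - b)%:C * ('i%C * (y +i* s)^-1) * E s).
  by apply: is_cderive_cexp; apply: is_cderiveZ; exact: is_cderive_clog.
have y_n0 s : y +i* s != 0 by rewrite eq_complex /= negb_and gt_eqF.
have dIE s : is_cderive (fun s => cint mu Rpos (gpow0 s) * E s) s 0.
  apply: (is_cderive_eq (is_cderiveM (is_cderive_cint_gpow0 s) (dE s))).
  set J := cint mu Rpos (gpow1 s); set I0 := cint mu Rpos (gpow0 s).
  have : I0 * (1 - b)%:C = (y +i* s) * J by rewrite cint_gpow1 mulrC.
  move=> h.
  have -> : I0 * ((1 - b)%:C * ('i%C * (y +i* s)^-1) * E s) =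
     (I0 * (1 - b)%:C) * ('i%C * (y +i* s)^-1 * E s) by ring.
  by rewrite h; field.
have := is_cderive0_cst t 0 dIE.
have -> : cint mu Rpos (gpow0 0) * E 0 = gamma_cst%:C.
  rewrite /E.
  have -> : (1 - b)%:C * clog y 0 = ((1 - b) * ln y)%:C.
    have -> : clog y 0 = (ln y)%:C; last by rewrite rmorphM.
    by rewrite /clog mul0r atan0 expr0n/= addr0 lnXn// -[ln y *+ 2]mulr_natr mulfK.
  rewrite cexp_real.
  have -> : expR ((1 - b) * ln y) = y `^ (1 - b) by rewrite /powR gt_eqF.
  have hR : Re (cint mu Rpos (gpow0 0)) = \int[mu]_(v in Rpos) (v `^ (- b) * expR (- (y * v))).
    by apply: eq_Rintegral => v _; rewrite Re_gpow0 mul0r oppr0 cos0 mulr1.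
  have hI : Im (cint mu Rpos (gpow0 0)) = 0.
    rewrite -[RHS](mul0r (fine (mu Rpos))) -Rintegral_cst//.
    by apply: eq_Rintegral => v _; rewrite Im_gpow0 mul0r oppr0 sin0 !mulr0.
  by rewrite /gamma_cst; apply: complex_ext; rewrite ?ReM ?ImM hR hI /= ?mulr0 ?mul0r ?subr0 ?addr0.
move=> <-; rewrite -mulrA /E -cexpD -mulrDl -rmorphD.
by rewrite (_ : 1 - b + (b - 1) = 0) ?mul0r ?cexp0 ?mulr1//; ring.
Qed.

Lemma gamma_cst_gt0 : 0 < gamma_cst.
Proof.
rewrite mulr_gt0 ?powR_gt0// lt0r; apply/andP; split; last first.
  by apply: Rintegral_ge0 => v _; rewrite mulr_ge0 ?powR_ge0 ?expR_ge0.
apply/negP => /eqP h.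
have i1 := integrable_Rpos_pow_exp b01' y0.
have : (\int[mu]_(v in Rpos) (v `^ (- b) * expR (- (y * v)))%:E = 0)%E.
  by rewrite -[LHS]fineK ?integrable_fin_num// -/(Rintegral mu Rpos _) h.
move=> /eqP; apply/negP; rewrite gt_eqF//.
apply: (@lt_le_trans _ _ (\int[mu]_(v in `]0%R, 1%R]) (expR (- y))%:E)%E).
  by rewrite integral_cst//= lebesgue_measure_itv/= lte_fin ltr01 oppr0 adde0 mule1 lte_fin expR_gt0.
apply: (@le_trans _ _ (\int[mu]_(v in `]0%R, 1%R]) (v `^ (- b) * expR (- (y * v)))%:E)%E).
  apply: ge0_le_integral => //.
  - by apply: (measurable_funS _ _ (measurable_int _ i1)) => // v; rewrite RposE /= in_itv/= => /andP[].
  - move=> v; rewrite /= in_itv/= => /andP[v0 v1]; rewrite lee_fin.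
    rewrite -[leLHS]mul1r ler_pM ?expR_ge0//.
      rewrite powRN invf_ge1 ?powR_gt0//.
      have b0 : 0 <= b by case/andP: b01'.
      have := ge0_ler_powR b0 (_ : v \in Num.nneg) (_ : 1 \in Num.nneg) v1.
      by rewrite powR1 !nnegrE (ltW v0) ler01 => /(_ isT isT).
    by rewrite ler_expR lerN2 (ler_piMr (ltW y0)).
apply: ge0_subset_integral => //.
- exact: measurable_int i1.
- by move=> v _; rewrite lee_fin mulr_ge0 ?powR_ge0 ?expR_ge0.
- by move=> v; rewrite RposE /= in_itv/= => /andP[].
Qed.

End gamma_integral.

(** * Regularly varying tails *)

Section regular_variation.
Context {R : realType}.
Variables (G : R -> R) (b : R).
Hypothesis b0 : 0 < b.
Hypothesis G_gt0 : forall x : R, 0 < x -> 0 < G x.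
Hypothesis G_le1 : forall x : R, 0 < x -> G x <= 1.
Hypothesis G_ni : forall x y : R, 0 < x -> x <= y -> G y <= G x.
Hypothesis G_rv : forall t : R, 0 < t -> G (t * x) / G x @[x --> +oo] --> t `^ (- b).
Hypothesis G_cvg0 : G x @[x --> +oo] --> 0.

(* A form of Potter's bound. *)
Lemma almost_increasing (g : R) : b < g -> exists x0 C : R, [/\ 0 < x0, 0 < C &
  forall u x : R, 0 < u -> u <= x -> x0 <= x -> u `^ g * G u <= C * (x `^ g * G x)].
Proof.
move=> bg; have g0 : 0 < g by exact: lt_trans bg.
have p2 : 0 < (2 : R) `^ g by rewrite powR_gt0.
(* Since b < g, doubling the argument eventually multiplies u^g G u by a factor above 1. *)
have lt2 : (2 : R) `^ (- g) < 2 `^ (- b).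
  rewrite !powRN ltf_pV2 ?posrE ?powR_gt0// /powR !gt_eqF// ltr_expR.
  by rewrite ltr_pM2r// ln_gt0// ltr1n.
have /cvgr_gt/(_ _ lt2) := G_rv (ltr0n R 2).
move=> [x1 [_ hx1]].
pose x0 := Num.max 1 (x1 + 1).
have x0_gt0 : 0 < x0 by rewrite lt_max ltr01.
have step u : x0 <= u -> u `^ g * G u <= (2 * u) `^ g * G (2 * u).
  move=> xu; have u0 : 0 < u by exact: lt_le_trans xu.
  have := hx1 u; have -> : x1 < u.
    by apply: lt_le_trans xu; rewrite lt_max ltrDl ltr01 orbT.
  move=> /(_ isT); rewrite ltr_pdivlMr ?G_gt0// => h.
  rewrite powRM ?(ltW u0)// [leRHS]mulrAC [leRHS]mulrC ler_pM2l ?powR_gt0//.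
  by rewrite -ler_pdivrMl// -powRN ltW.
have iter k u : x0 <= u -> u `^ g * G u <= (2 ^+ k * u) `^ g * G (2 ^+ k * u).
  move=> xu; elim: k => [|k IH]; first by rewrite expr0 mul1r.
  apply: le_trans IH _; rewrite exprS -mulrA; apply: step.
  have u0 : 0 <= u by apply: le_trans xu; exact: ltW.
  by apply: le_trans xu _; rewrite ler_peMl ?exprn_ege1 ?ler1n.
have big u x : x0 <= u -> u <= x -> u `^ g * G u <= 2 `^ g * (x `^ g * G x).
  move=> xu ux; have u0 : 0 < u by exact: lt_le_trans xu.
  have x_gt0 : 0 < x by exact: lt_le_trans ux.
  have ex : exists k, x < 2 ^+ k * u.
    have /filter_ex [k hk] := nbhs_infty_gtr (x / u); exists k.
    rewrite -ltr_pdivrMr//; apply: lt_le_trans hk _.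
    by rewrite -natrX ler_nat ltnW// ltn_expl.
  (* Minimality gives 2^k u <= x < 2^(k+1) u. Passing from 2^(k+1) u down to x costs at most the
     factor 2^g, as G is nonincreasing. *)
  have [[|k] hk hmin] := ex_minnP ex.
    by move: hk; rewrite expr0 mul1r ltNge ux.
  have kx : 2 ^+ k * u <= x.
    by rewrite leNgt; apply/negP => /hmin; rewrite ltnn.
  apply: le_trans (iter k.+1 _ xu) _.
  have -> : 2 ^+ k.+1 * u = 2 * (2 ^+ k * u) by rewrite exprS mulrA.
  rewrite powRM ?mulr_ge0 ?exprn_ge0 ?(ltW u0)// -mulrA ler_pM2l//.
  rewrite ler_pM ?powR_ge0//.
  - by rewrite ltW// G_gt0// !mulr_gt0 ?exprn_gt0.
  - apply: ge0_ler_powR => //; rewrite ?nnegrE ?(ltW g0) ?(ltW x_gt0)//.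
    by rewrite mulr_ge0 ?exprn_ge0 ?(ltW u0).
  - by apply: G_ni => //; rewrite mulrA -exprS ltW.
have m0 : 0 < x0 `^ g * G x0 by rewrite mulr_gt0 ?powR_gt0 ?G_gt0.
(* The first summand serves x0 <= u. The second serves u < x0, where u^g G u <= x0^g while x^g G x
   stays above a fixed multiple of its value at x0. *)
exists x0, (2 `^ g + 2 `^ g * x0 `^ g / (x0 `^ g * G x0)); split => //.
  by rewrite addr_gt0// !mulr_gt0 ?invr_gt0 ?powR_gt0 ?G_gt0.
move=> u x u0 ux x0x.
have x_gt0 : 0 < x by exact: lt_le_trans ux.
have mx0 : 0 < x `^ g * G x by rewrite mulr_gt0 ?powR_gt0 ?G_gt0.
have [xu|ux0] := leP x0 u.
  apply: le_trans (big _ _ xu ux) _; rewrite ler_pM2r// lerDl.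
  by rewrite ltW// !mulr_gt0 ?invr_gt0 ?powR_gt0 ?G_gt0.
have h1 : u `^ g * G u <= x0 `^ g.
  rewrite -[leRHS]mulr1 ler_pM ?powR_ge0 ?G_le1//; first by rewrite ltW// G_gt0.
  by apply: ge0_ler_powR; rewrite ?nnegrE ?ltW.
apply: le_trans h1 _.
apply: (@le_trans _ _ (2 `^ g * x0 `^ g / (x0 `^ g * G x0) * (x `^ g * G x))).
  have := big x0 x (lexx _) x0x; set m := x0 `^ g * G x0.
  move=> h; rewrite -[leLHS](@mulfK _ m) ?gt_eqF//.
  rewrite mulrAC -mulrA [leRHS](_ : _ = x0 `^ g / m * (2 `^ g * (x `^ g * G x))).
    by rewrite mulrA ler_wpM2l// divr_ge0 ?powR_ge0// ltW.
  by field; rewrite gt_eqF.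
by rewrite ler_pM2r// lerDr ltW.
Qed.

(** For v >= 1 monotonicity of G is enough; for v < 1 the almost increasing function u^g G u is
    compared at u = v x and at x. The bound holds for all v > 0, and so dominates integrals over the
    whole half-line. *)
Lemma potter (g : R) : b < g -> exists x0 C : R, [/\ 0 < x0, 0 < C &
  forall v x : R, 0 < v -> x0 <= x -> G (v * x) <= (1 + C * v `^ (- g)) * G x].
Proof.
move=> bg; have [x0 [C [x0_gt0 C0 h]]] := almost_increasing bg.
exists x0, C; split => // v x v0 x0x.
have x_gt0 : 0 < x by exact: lt_le_trans x0x.
have [v1|v1] := leP 1 v.
  apply: (@le_trans _ _ (G x)); first by apply: G_ni => //; rewrite ler_peMl// ltW.
  by rewrite ler_peMl ?(ltW (G_gt0 x_gt0))// lerDl mulr_ge0 ?powR_ge0 ?(ltW C0).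
have vx : 0 < v * x by rewrite mulr_gt0.
have := h (v * x) x vx; rewrite ler_piMl ?(ltW x_gt0) ?(ltW v1)// => /(_ isT x0x).
rewrite powRM ?(ltW v0) ?(ltW x_gt0)// => hh.
apply: (@le_trans _ _ (C * v `^ (- g) * G x)); last first.
  by rewrite ler_pM2r ?G_gt0// lerDr.
rewrite powRN -(ler_pM2l (_ : 0 < v `^ g * x `^ g)) ?mulr_gt0 ?powR_gt0//.
apply: le_trans hh _; rewrite le_eqVlt; apply/orP; left; apply/eqP; field.
by rewrite gt_eqF// powR_gt0.
Qed.

(** The quantile of order 1 - 1/n, as the supremum of the x with n G x >= 1. The point 1 keeps the
    set nonempty and the quantile positive. *)
Definition rv_quantile (n : nat) : R :=
  sup ([set 1] `|` [set x | 0 < x /\ 1 <= n%:R * G x]).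

Let q := rv_quantile.

Let q_sup n : has_sup ([set 1] `|` [set x | 0 < x /\ 1 <= n%:R * G x]).
Proof.
split; first by exists 1; left.
have n1 : 0 < n.+1%:R^-1 :> R by rewrite invr_gt0 ltr0n.
have /cvgr_lt/(_ _ n1) := G_cvg0.
move=> [A [_ hA]]; exists (Num.max 1 (Num.max A 0 + 1)) => x [->|[x0 hx]].
  by rewrite le_max lexx.
rewrite le_max; apply/orP; right; rewrite leNgt; apply/negP => xA.
have := hA x; have -> : A < x.
  by apply: le_lt_trans xA; rewrite (@le_trans _ _ (Num.max A 0)) ?lerDl// le_max lexx.
move=> /(_ isT) h; move: hx; apply/negP; rewrite -ltNge.
have [->|n0] := eqVneq n 0%N; first by rewrite mul0r ltr01.
rewrite mulrC -ltr_pdivlMr ?ltr0n ?lt0n// mul1r; apply: lt_trans h _.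
by rewrite ltf_pV2 ?posrE ?ltr0n ?lt0n// ltr_nat.
Qed.

Lemma rv_quantile_ge1 n : 1 <= q n.
Proof. by apply: sup_upper_bound => //; left. Qed.

Let q_gt0 n : 0 < q n. Proof. by apply: lt_le_trans (rv_quantile_ge1 n). Qed.

Lemma rv_quantile_cvgy : q n @[n --> \oo] --> +oo.
Proof.
apply/cvgryPge => A; pose B := Num.max 1 A.
have B0 : 0 < B by rewrite lt_max ltr01.
near=> n.
apply: (@le_trans _ _ B); first by rewrite le_max lexx orbT.
apply: sup_upper_bound => //; right; split => //.
rewrite -ler_pdivrMr ?G_gt0//.
by near: n; exact: nbhs_infty_ger.
Unshelve. all: by end_near. Qed.

(** G may jump at the quantile, so n G q need not equal 1. For t > 1, however, n G(t q) <= 1 <= n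
    G(q / t) for large n, and regular variation compares both ends with n G q up to factors near t^b
    and t^(-b). *)
Lemma rv_quantile_cvg : n%:R * G (q n) @[n --> \oo] --> (1 : R).
Proof.
have qy := rv_quantile_cvgy.
have upper (t : R) : 1 < t -> forall n, n%:R * G (t * q n) <= 1.
  move=> t1 n; rewrite leNgt; apply/negP => h.
  have tq : 0 < t * q n by rewrite mulr_gt0// (lt_trans ltr01).
  have : t * q n <= q n.
    by apply: sup_upper_bound => //; right; split=> //; exact: ltW.
  by rewrite leNgt ltr_pMl// t1.
have lower (t : R) : 1 < t -> \forall n \near \oo, 1 <= n%:R * G (t^-1 * q n).
  move=> t1; have t0 : 0 < t by exact: lt_trans t1.
  near=> n.
  have tq0 : 0 < t^-1 * q n by rewrite mulr_gt0 ?invr_gt0.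
  have tq1 : 1 <= t^-1 * q n.
    by rewrite ler_pdivlMl// mulr1; near: n; move/cvgryPge : qy; exact.
  have tq : t^-1 * q n < q n.
    by rewrite gtr_pMl// invf_lt1.
  have qs : 0 < q n - t^-1 * q n by rewrite subr_gt0.
  have [x [->|[x0 hx]] xq] := sup_adherent qs (q_sup n).
  - by move: xq; rewrite subKr ltNge tq1.
  - apply: le_trans hx _; rewrite ler_wpM2l//; apply: G_ni => //.
    by move: xq; rewrite subKr => /ltW.
have lam (l : R) : 1 < l -> \forall n \near \oo, l ^- 2 <= n%:R * G (q n) <= l ^+ 2.
  move=> l1; have l0 : 0 < l by exact: lt_trans l1.
  (* With t^b = l the two ratios tend to l^-1 and l; the second factor l in the claim is the slack
     for passing from limits to inequalities. *)
  pose t := l `^ b^-1.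
  have t1 : 1 < t by rewrite /t /powR gt_eqF// expR_gt1 mulr_gt0 ?invr_gt0// ln_gt0.
  have t0 : 0 < t by exact: lt_trans t1.
  have tb : t `^ b = l by rewrite /t -powRrM mulVf ?gt_eqF// powRr1// ltW.
  have r1 : l^-1 < l ^- 2 * l ^+ 2.
    by rewrite mulVf ?gt_eqF ?exprn_gt0// invf_lt1.
  have lim1 := cvg_comp _ _ qy (G_rv t0).
  have ti0 : 0 < t^-1 by rewrite invr_gt0.
  have lim2 := cvg_comp _ _ qy (G_rv ti0).
  have tbi : t^-1 `^ (- b) = l.
    rewrite powRN; have h : t^-1 `^ b * t `^ b = 1.
      by rewrite -powRM ?(ltW ti0) ?(ltW t0)// mulVf ?gt_eqF// powR1.
    rewrite -tb; apply: (mulfI (_ : t^-1 `^ b != 0)).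
      by rewrite gt_eqF// powR_gt0.
    by rewrite h mulfV// gt_eqF// powR_gt0.
  have {}lim1 : \forall n \near \oo, l ^- 2 < G (t * q n) / G (q n).
    apply: (cvgr_gt _ lim1); rewrite powRN tb ltf_pV2 ?posrE ?exprn_gt0//.
    by rewrite expr2 ltr_pMl.
  have {}lim2 : \forall n \near \oo, G (t^-1 * q n) / G (q n) < l ^+ 2.
    by apply: (cvgr_lt _ lim2); rewrite tbi expr2 ltr_pMl.
  have lo := lower t t1.
  near=> n; have Gq := G_gt0 (q_gt0 n); apply/andP; split.
    have : 1 <= n%:R * G (t^-1 * q n) by near: n.
    have : G (t^-1 * q n) / G (q n) < l ^+ 2 by near: n.
    rewrite ltr_pdivrMr// => h1 h2.
    rewrite -(ler_pM2l (_ : 0 < l ^+ 2)) ?exprn_gt0// mulfV ?gt_eqF ?exprn_gt0//.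
    apply: le_trans h2 _; rewrite mulrCA ler_wpM2l//; exact: ltW.
  have h2 := upper t t1 n.
  have : l ^- 2 < G (t * q n) / G (q n) by near: n.
  rewrite ltr_pdivlMr// => h1.
  rewrite -(ler_pM2l (_ : 0 < l ^- 2)) ?invr_gt0 ?exprn_gt0// mulVf ?gt_eqF ?exprn_gt0//.
  apply: le_trans h2; rewrite mulrCA ler_wpM2l//; exact: ltW.
apply/cvgrPdist_le => e e0.
pose d := Num.min (e / 4) (1 / 4).
have d0 : 0 < d by rewrite lt_min; apply/andP; split; lra.
have d1 : d <= e / 4 by rewrite ge_min lexx.
have d2 : d <= 1 / 4 by rewrite ge_min lexx orbT.
have l1 : 1 < 1 + d by rewrite ltrDl.
have := lam _ l1; apply: filterS => n /andP[].
set z := n%:R * _ => h1 h2.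
have h3 : 1 <= (1 + d) ^+ 2 * z.
  rewrite -(ler_pM2l (_ : 0 < (1 + d) ^- 2)) ?invr_gt0 ?exprn_gt0 ?addr_gt0// mulr1.
  by rewrite mulrA mulVf ?mul1r// gt_eqF// exprn_gt0// addr_gt0.
by rewrite ler_norml; apply/andP; split; nra.
Unshelve. all: by end_near. Qed.

End regular_variation.

(** * Layer-cake formula *)

Section real_Fubini.
Context d1 d2 (T1 : measurableType d1) (T2 : measurableType d2) (R : realType).
Variables (m1 : {sigma_finite_measure set T1 -> \bar R})
  (m2 : {sigma_finite_measure set T2 -> \bar R}).

Lemma Rintegral_Fubini (f : T1 * T2 -> R) : measurable_fun setT f ->
  (\int[m1]_x \int[m2]_y `|f (x, y)|%:E < +oo)%E ->
  (forall x, m2.-integrable setT (EFin \o (fun y => f (x, y)))) ->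
  (forall y, m1.-integrable setT (EFin \o (fun x => f (x, y)))) ->
  m1.-integrable setT (EFin \o (fun x => \int[m2]_y f (x, y))) /\
  \int[m1]_x \int[m2]_y f (x, y) = \int[m2]_y \int[m1]_x f (x, y).
Proof.
move=> mf fi i2 i1.
have mE : measurable_fun setT (EFin \o f) by exact/measurable_EFinP.
have ip : (m1 \x m2)%E.-integrable setT (EFin \o f).
  by apply/(integrable12ltyP _ _ mE).
have e1 x : (\int[m2]_y (EFin \o f) (x, y) = (\int[m2]_y f (x, y))%R%:E)%E.
  by rewrite /Rintegral fineK//; exact: (integrable_fin_num measurableT (i2 x)).
have e2 y : (\int[m1]_x (EFin \o f) (x, y) = (\int[m1]_x f (x, y))%R%:E)%E.
  by rewrite /Rintegral fineK//; exact: (integrable_fin_num measurableT (i1 y)).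
split.
- have := integrable_fubini_F ip; rewrite /fubini_F.
  by under eq_fun do rewrite e1.
- rewrite /Rintegral; congr fine.
  under eq_integral do rewrite -e1.
  under [RHS]eq_integral do rewrite -e2.
  exact: Fubini.
Qed.

End real_Fubini.

Section layer_cake.
Context d (T : measurableType d) (R : realType) (P : probability T R).
Notation mu := (@lebesgue_measure R).
Variable U : T -> R.
Hypotheses (mU : measurable_fun setT U) (U0 : forall w, 0 <= U w).

Definition tail (r : R) : R := fine (P [set w | r < U w]).

Let m_tail r : measurable [set w | r < U w].
Proof.
rewrite (_ : mkset _ = U @^-1` `]r, +oo[%classic).
  by rewrite -[_ @^-1` _]setTI; apply: mU => //; exact: measurable_itv.
by apply/seteqP; split => w /=; rewrite in_itv/= andbT.
Qed.

Lemma tail_ge0 r : 0 <= tail r.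
Proof. by apply: fine_ge0. Qed.

Lemma tail_le1 r : tail r <= 1.
Proof.
rewrite -lee_fin fineK ?fin_num_measure//; exact: probability_le1.
Qed.

Lemma tail_ni r s : r <= s -> tail s <= tail r.
Proof.
move=> rs; rewrite /tail fine_le ?fin_num_measure//.
by apply: le_measure; rewrite ?inE// => w /=; exact: le_lt_trans.
Qed.

Lemma measurable_tail : measurable_fun setT tail.
Proof.
apply: nonincreasing_measurable => // r s rs; exact: tail_ni.
Qed.

Let measurable_tail_scaled (r : R) : measurable_fun setT (fun v : R => tail (v * r)).
Proof.
exact: (measurableT_comp measurable_tail (@mulrr_measurable R setT r)).
Qed.

(** [K (U w / x)] is the integral of [k] over ]0, U w / x[. After exchanging the integrals, the
    event v < U w / x has probability [tail (v * x)]. *)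
Lemma layer_cake_real (K k g : R -> R) (x : R) : 0 < x -> K 0 = 0 ->
  (forall v : R, is_derive v (1 : R) K (k v)) -> continuous k ->
  mu.-integrable Rpos (EFin \o g) -> (forall v, Rpos v -> `|k v| <= g v) ->
  \int[P]_w K (U w / x) = \int[mu]_(v in Rpos) (k v * tail (v * x)).
Proof.
move=> x0 K0 dK ck ig kg.
have mk : measurable_fun setT k by exact: continuous_measurable_fun.
have ik : mu.-integrable Rpos (EFin \o k).
  by apply: (le_integrable_norm mRpos _ ig kg); apply: measurable_funTS; exact: mk.
pose kk : measurableTypeR R -> R := k \_ Rpos.
have mkk : measurable_fun setT kk.
  by rewrite /kk patch_indic; apply: measurable_funM; [exact: mk|exact: measurable_indic].
have ikk : mu.-integrable setT (EFin \o kk).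
  by rewrite /kk -restrict_EFin; apply/(integrable_mkcond _ mRpos).
pose f (z : T * measurableTypeR R) : R := kk z.2 * ((z.2 < U z.1 / x)%R)%:R.
have mb : measurable_fun setT (fun z : T * measurableTypeR R => ((z.2 < U z.1 / x)%R)%:R : R).
  rewrite (_ : (fun _ => _) = \1_[set z : T * measurableTypeR R | z.2 < U z.1 / x]); last first.
    by apply/funext => z; rewrite indicE; congr ((nat_of_bool _)%:R); apply/idP/idP => [h|/set_mem//]; exact/mem_set.
  apply: measurable_indic.
  have : measurable_fun setT (fun z : T * measurableTypeR R => z.2 < U z.1 / x).
    apply: measurable_fun_ltr; first exact: measurable_snd.
    apply: measurable_funM => //.
    exact: (measurableT_comp mU measurable_fst).
  by move=> /(_ measurableT [set true]) ; rewrite setTI; apply.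
have mf : measurable_fun setT f.
  by apply: measurable_funM => //; exact: (measurableT_comp mkk measurable_snd).
have fk z : `|f z| <= `|kk z.2|.
  by rewrite normrM ler_piMr// normr_nat; case: (_ < _).
have mfx w : measurable_fun setT (fun v => f (w, v)).
  exact: (measurableT_comp mf (measurable_pair1 w)).
have mfy v : measurable_fun setT (fun w => f (w, v)).
  exact: (measurableT_comp mf (measurable_pair2 v)).
have nk : (\int[mu]_v `|kk v|%:E < +oo)%E by case/integrableP: ikk.
have [|||_ hF] := @Rintegral_Fubini _ _ _ _ _ P mu f mf.
- apply: (@le_lt_trans _ _ (\int[P]_w (\int[mu]_v `|kk v|%:E))%E).
    apply: ge0_le_integral => //.
    + by move=> w _; exact: integral_ge0.
    + apply: (@measurable_fun_fubini_tonelli_F _ _ _ _ _ mu (fun z => `|f z|%:E)) => //.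
      by apply/measurable_EFinP; exact: measurableT_comp.
    + move=> w _; apply: ge0_le_integral => //.
      * by apply/measurable_EFinP; exact: measurableT_comp.
      * by apply/measurable_EFinP; exact: measurableT_comp.
      * by move=> v _; rewrite lee_fin; exact: (fk (w, v)).
  by rewrite integral_prob_cst.
- have ink : mu.-integrable setT (EFin \o (fun v => `|kk v|)) by exact: (integrable_abse ikk).
  by move=> w; apply: (le_integrable_norm measurableT (mfx w) ink) => v _; exact: (fk (w, v)).
- move=> v; apply: (@integrable_bounded _ _ _ _ _ (`|kk v|)) => // w; exact: (fk (w, v)).
have inner w : \int[mu]_v f (w, v) = K (U w / x).
  set u := U w / x; have u0 : 0 <= u by rewrite divr_ge0 ?(ltW x0).
  have -> : \int[mu]_v f (w, v) = \int[mu]_(v in `]0, u[) k v.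
    rewrite [RHS]Rintegral_mkcond; apply: eq_Rintegral => v _.
    rewrite /f /kk /= -/u !patchE.
    have -> : (v \in `]0, u[%classic) = (v \in Rpos) && (v < u).
      apply/idP/andP => [/set_mem|[/set_mem]].
        by rewrite /= in_itv/= => /andP[v0 ->]; split => //; apply/mem_set; rewrite RposE.
      by rewrite RposE => v0 vu; apply/mem_set; rewrite /= in_itv/= v0 vu.
    by case: (v \in Rpos) => /=; rewrite ?mul0r//; case: (v < u); rewrite ?mulr1 ?mulr0.
  have [->|u_neq0] := eqVneq u 0.
    by rewrite K0 set_itv_ge ?Rintegral_set0// bnd_simp ltxx.
  have u_gt0 : 0 < u by rewrite lt0r u_neq0.
  have iu : mu.-integrable `[0, u] (EFin \o k).
    apply: continuous_compact_integrable; first exact: segment_compact.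
    exact: continuous_subspaceT.
  rewrite Rintegral_itv_bndo_bndc; last first.
    by apply: integrableS iu => // v; rewrite /= !in_itv/= => /andP[/ltW -> /ltW ->].
  rewrite Rintegral_itv_obnd_cbnd; last first.
    by apply: integrableS iu => // v; rewrite /= !in_itv/= => /andP[/ltW -> ->].
  rewrite /Rintegral (@continuous_FTC2 _ k K 0 u)//= ?K0 ?subr0//.
  - exact: continuous_subspaceT.
  - split.
    + by move=> v _; have [] := dK v.
    + apply: cvg_at_right_filter; apply: differentiable_continuous.
      by apply/derivable1_diffP; have [] := dK 0.
    + apply: cvg_at_left_filter; apply: differentiable_continuous.
      by apply/derivable1_diffP; have [] := dK u.
  - by move=> v _; rewrite derive1E; have [_ ->] := dK v.
under eq_Rintegral do rewrite -inner.
rewrite hF [RHS]Rintegral_mkcond; apply: eq_Rintegral => v _.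
rewrite (_ : (fun w => f (w, v)) = (fun w => kk v * \1_[set w | v * x < U w] w)); last first.
  apply/funext => w; rewrite /f /= indicE; congr (_ * (nat_of_bool _)%:R).
  by rewrite ltr_pdivlMr//; apply/idP/idP => [h|/set_mem//]; exact/mem_set.
rewrite RintegralZl//; last first.
  apply: (@integrable_bounded _ _ _ _ _ 1); first exact: measurable_indic.
  by move=> w; rewrite indicE normr_nat; case: (_ \in _).
rewrite {1}/Rintegral integral_indic// setIT -/(tail _) /kk !patchE.
by case: ifP => // _; rewrite mul0r.
Qed.

(** The measures n P(U / x_n > v) converge to th v^(-b); the layer-cake formula integrates this
    against the derivatives [k_ n]. Potter's bound with exponent c > b dominates n P(U > v x_n) by a
    multiple of 1 + v^(-c), whence the two integrability conditions on [g]. *)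
Lemma tail_scaling (K_ k_ : nat -> R -> R) (k g : R -> R) (x_ : nat -> R) (b c th : R) :
  0 < b -> b < c -> (forall x : R, 0 < x -> 0 < tail x) ->
  (forall t : R, 0 < t -> tail (t * x) / tail x @[x --> +oo] --> t `^ (- b)) ->
  (forall n, 0 < x_ n) -> x_ n @[n --> \oo] --> +oo ->
  n%:R * tail (x_ n) @[n --> \oo] --> th ->
  (forall n, K_ n 0 = 0) ->
  (forall n (v : R), is_derive v (1 : R) (K_ n) (k_ n v)) ->
  (forall n, continuous (k_ n)) ->
  mu.-integrable Rpos (EFin \o g) ->
  mu.-integrable Rpos (EFin \o (fun v => v `^ (- c) * g v)) ->
  (forall n v, Rpos v -> `|k_ n v| <= g v) ->
  (forall v, Rpos v -> k_ n v @[n --> \oo] --> k v) ->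
  n%:R * (\int[P]_w K_ n (U w / x_ n)) @[n --> \oo] -->
  \int[mu]_(v in Rpos) (k v * (th * v `^ (- b))).
Proof.
move=> b0 bc tail_gt0 rv x_gt0 xy nth K0 dK ck ig igc kg kk.
have [x0 [C [x0_gt0 C0 hp]]] :=
  potter b0 tail_gt0 (fun x _ => tail_le1 x) (fun x y _ => @tail_ni x y) rv bc.
have th0 : 0 <= th.
  apply: (cvgr_to_ge nth); apply: nearW => n.
  by rewrite mulr_ge0// tail_ge0.
have ev : \forall n \near \oo, n%:R * tail (x_ n) <= th + 1 /\ x0 <= x_ n.
  have h1 : \forall n \near \oo, n%:R * tail (x_ n) <= th + 1.
    by apply: (cvgr_le _ nth); rewrite ltrDl.
  have h2 : \forall n \near \oo, x0 <= x_ n by move/cvgryPge : xy; exact.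
  by move: h1 h2; apply: filterS2.
have [N _ hN] := ev.
have kE n : n%:R * (\int[P]_w K_ n (U w / x_ n)) =
    \int[mu]_(v in Rpos) (k_ n v * (n%:R * tail (v * x_ n))).
  have mt : measurable_fun Rpos (fun v => tail (v * x_ n)).
    by apply: measurable_funTS; exact: measurable_tail_scaled.
  have mk : measurable_fun Rpos (k_ n).
    by apply: measurable_funTS; apply: continuous_measurable_fun; exact: ck.
  rewrite (layer_cake_real (x_gt0 n) (K0 n) (dK n) (ck n) ig (kg n)) -RintegralZl//.
    by apply: eq_Rintegral => v _; rewrite mulrCA.
  apply: (le_integrable_norm mRpos _ ig) => [|v vp].
    by apply: measurable_funM; [exact: mk|exact: mt].
  rewrite normrM; apply: le_trans (kg n v vp).
  by rewrite ler_piMr// ger0_norm ?tail_ge0 ?tail_le1.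
rewrite (_ : (fun n => n%:R * _) =
  (fun n => \int[mu]_(v in Rpos) (k_ n v * (n%:R * tail (v * x_ n))))); last exact/funext.
(* Potter's bound is available from index [N] on; after the shift it dominates every term. *)
rewrite -(cvg_shiftn N).
pose bd v := (th + 1) * g v + ((th + 1) * C) * (v `^ (- c) * g v).
apply: (@Rintegral_dct _ _ R mu Rpos mRpos _ _ bd _ _ _ _).2.
- move=> n; apply: measurable_funM.
    by apply: measurable_funTS; apply: continuous_measurable_fun; exact: ck.
  apply: measurable_funM => //; apply: measurable_funTS.
  exact: measurable_tail_scaled.
- by apply: integrable_add => //; exact: integrable_scale.
- move=> n v vp; have v0 : 0 < v by move: vp; rewrite RposE.
  have [h1 h2] := hN (n + N)%N (leq_addl _ _).
  have g0 : 0 <= g v by apply: le_trans (kg 0%N v vp).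
  have h3 : (n + N)%:R * tail (v * x_ (n + N)%N) <= (th + 1) * (1 + C * v `^ (- c)).
    apply: (@le_trans _ _ ((n + N)%:R * ((1 + C * v `^ (- c)) * tail (x_ (n + N)%N)))).
      by rewrite ler_wpM2l// hp.
    rewrite mulrCA [leRHS]mulrC ler_wpM2l// addr_ge0// mulr_ge0 ?powR_ge0//.
    exact: ltW.
  rewrite normrM [X in _ * X]ger0_norm ?mulr_ge0 ?tail_ge0//.
  apply: (@le_trans _ _ (g v * ((th + 1) * (1 + C * v `^ (- c))))).
    by rewrite ler_pM ?mulr_ge0 ?tail_ge0 ?kg.
  by rewrite /bd le_eqVlt; apply/orP; left; apply/eqP; ring.
- move=> v vp; have v0 : 0 < v by move: vp; rewrite RposE.
  have h := cvg_comp _ _ xy (rv v v0).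
  have h2 : k_ n v * (n%:R * tail (v * x_ n)) @[n --> \oo] --> k v * (th * v `^ (- b)).
    apply: cvgM; first exact: kk.
    have -> : (fun n => n%:R * tail (v * x_ n)) =
              (fun n => (n%:R * tail (x_ n)) * (tail (v * x_ n) / tail (x_ n))).
      by apply/funext => n; field; rewrite gt_eqF// tail_gt0.
    exact: cvgM.
  by move: h2; rewrite -(cvg_shiftn N).
Qed.

End layer_cake.

(** * Triangular arrays *)

Lemma is_derive_bigsum (R : realType) (n : nat) (h dh : nat -> R -> R) (v : R) :
  (forall i, is_derive v (1 : R) (h i) (dh i v)) ->
  is_derive v (1 : R) (fun u => \sum_(i < n) h i u) (\sum_(i < n) dh i v).
Proof.
move=> dhi; elim: n => [|n IH].
  rewrite big_ord0 (_ : (fun _ => _) = cst 0); first exact: is_derive_cst.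
  by apply/funext => u; rewrite big_ord0.
rewrite big_ord_recr /= (_ : (fun _ => _) = (fun u => \sum_(i < n) h i u) + h n).
  exact: is_deriveD.
by apply/funext => u; rewrite big_ord_recr.
Qed.

Lemma continuous_bigsum (R : realType) (n : nat) (h : nat -> R -> R) :
  (forall i, continuous (h i)) -> continuous (fun u => \sum_(i < n) h i u).
Proof.
move=> ch; elim: n => [|n IH].
  rewrite (_ : (fun _ => _) = cst 0); first exact: cst_continuous.
  by apply/funext => u; rewrite big_ord0.
rewrite (_ : (fun _ => _) = (fun u => \sum_(i < n) h i u) + h n); last first.
  by apply/funext => u; rewrite big_ord_recr.
by move=> u; apply: continuousD; [exact: IH|exact: ch].
Qed.

Section array_scaling.
Context d (T : measurableType d) (R : realType) (P : probability T R).
Notation mu := (@lebesgue_measure R).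
Variable U : T -> R.
Hypotheses (mU : measurable_fun setT U) (U0 : forall w, 0 <= U w).
Variables (b c : R).
Hypotheses (b0 : 0 < b) (bc : b < c).
Hypothesis tail_gt0 : forall x : R, 0 < x -> 0 < tail P U x.
Hypothesis tail_rv : forall t : R, 0 < t ->
  tail P U (t * x) / tail P U x @[x --> +oo] --> t `^ (- b).
Variables (nu : probability R R) (a : nat -> nat -> R).
Hypothesis a_cvg : forall (f : R -> R) M, continuous f -> (forall x, `|f x| <= M) ->
  n%:R^-1 * (\sum_(i < n) f (a n i)) @[n --> \oo] --> \int[nu]_x f x.

Variables (x_ : nat -> R) (th : R).
Hypotheses (x_gt0 : forall n, 0 < x_ n) (x_y : x_ n @[n --> \oo] --> +oo).
Hypothesis x_th : n%:R * tail P U (x_ n) @[n --> \oo] --> th.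

(** Averaging the kernels over the array comes before the limit: the sum equals n times the
    expectation of one averaged kernel, whose derivative converges for each v by weak convergence to
    nu. [tail_scaling] then applies, and Fubini restores the order of integration. *)
Lemma array_scaling (K k : R -> R -> R) (g : R -> R) (M0 : R) :
  (forall s, K s 0 = 0) ->
  (forall s (v : R), is_derive v (1 : R) (K s) (k s v)) ->
  (forall s, continuous (k s)) ->
  (forall v, continuous (k ^~ v)) ->
  measurable_fun setT (fun z : R * measurableTypeR R => k z.1 z.2) ->
  (forall s v, 0 <= v -> `|K s v| <= M0) ->
  (forall s v, Rpos v -> `|k s v| <= g v) ->
  mu.-integrable Rpos (EFin \o g) ->
  mu.-integrable Rpos (EFin \o (fun v => v `^ (- c) * g v)) ->
  \sum_(i < n) (\int[P]_w K (a n i) (U w / x_ n)) @[n --> \oo] -->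
  \int[nu]_s \int[mu]_(v in Rpos) (th * v `^ (- b) * k s v).
Proof.
move=> K0 dK cv cs mk KM kg ig igc.
have g0 v : Rpos v -> 0 <= g v by move=> vp; apply: le_trans (kg 0 v vp).
have iK s n : P.-integrable setT (EFin \o (fun w => K s (U w / x_ n))).
  apply: (@integrable_bounded _ _ _ _ _ M0).
    have mKs : measurable_fun setT (K s).
      apply: continuous_measurable_fun => v; apply: differentiable_continuous.
      by apply/derivable1_diffP; have [] := dK s v.
    apply: (measurableT_comp mKs); exact: measurable_funM.
  by move=> w; apply: KM; rewrite divr_ge0// ltW.
pose K_ n v := n%:R^-1 * \sum_(i < n) K (a n i) v.
pose k_ n v := n%:R^-1 * \sum_(i < n) k (a n i) v.
have sumE n : \sum_(i < n) (\int[P]_w K (a n i) (U w / x_ n)) =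
    n%:R * (\int[P]_w K_ n (U w / x_ n)).
  have [->|n0] := eqVneq n 0%N; first by rewrite big_ord0 mul0r.
  have sE m : P.-integrable setT (EFin \o (fun w => \sum_(i < m) K (a n i) (U w / x_ n))) /\
     \int[P]_w (\sum_(i < m) K (a n i) (U w / x_ n)) =
      \sum_(i < m) (\int[P]_w K (a n i) (U w / x_ n)).
    elim: m => [|m [IHi IH]].
      have -> : (fun w => \sum_(i < 0) K (a n i) (U w / x_ n)) = cst 0.
        by apply/funext => w; rewrite big_ord0.
      rewrite big_ord0 Rintegral_prob_cst; split => //; exact: integrable0.
    have -> : (fun w => \sum_(i < m.+1) K (a n i) (U w / x_ n)) =
       (fun w => \sum_(i < m) K (a n i) (U w / x_ n) + K (a n m) (U w / x_ n)).
      by apply/funext => w; rewrite big_ord_recr.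
    rewrite big_ord_recr /= RintegralD// IH; split => //; exact: integrable_add.
  have [iS SE] := sE n.
  by rewrite /K_ RintegralZl// SE mulrA mulfV ?mul1r// pnatr_eq0.
rewrite (_ : (fun n => \sum_(i < n) _) = (fun n => n%:R * (\int[P]_w K_ n (U w / x_ n))));
  last exact/funext.
pose kb v := \int[nu]_s k s v.
have lim : n%:R * (\int[P]_w K_ n (U w / x_ n)) @[n --> \oo] -->
    \int[mu]_(v in Rpos) (kb v * (th * v `^ (- b))).
  apply: (@tail_scaling _ _ _ P U mU U0 K_ k_ kb g x_ b c th) => //.
  - by move=> n; rewrite /K_ big1 ?mulr0// => i _; rewrite K0.
  - move=> n v; have := is_deriveZ (n%:R^-1 : R) (@is_derive_bigsum R n (fun i => K (a n i)) (fun i => k (a n i)) v (fun i => dK (a n i) v)).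
    by move=> h; apply: (is_derive_eq h).
  - move=> n v; rewrite /k_; apply: cvgM; first exact: cvg_cst.
    exact: (@continuous_bigsum R n (fun i => k (a n i)) (fun i => cv (a n i)) v).
  - move=> n v vp; rewrite /k_ normrM ger0_norm ?invr_ge0//.
    have [->|n0] := eqVneq n 0%N; first by rewrite invr0 mul0r g0.
    rewrite ler_pdivrMl ?ltr0n ?lt0n//.
    apply: le_trans (ler_norm_sum _ _ _) _.
    apply: (@le_trans _ _ (\sum_(i < n) g v)).
      by apply: ler_sum => i _; exact: kg.
    by rewrite sumr_const card_ord mulr_natl.
  - by move=> v vp; apply: (a_cvg (cs v) (fun s => kg s v vp)).
rewrite [X in _ --> X](_ : _ = \int[mu]_(v in Rpos) (kb v * (th * v `^ (- b)))) //.
have th0 : 0 <= th.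
  apply: (cvgr_to_ge x_th); apply: nearW => n.
  by rewrite mulr_ge0// tail_ge0.
pose q (v : measurableTypeR R) : R := ((fun v => th * v `^ (- b)) \_ Rpos) v.
pose f (z : R * measurableTypeR R) := q z.2 * k z.1 z.2.
pose gg (v : measurableTypeR R) : R := ((fun v => th * v `^ (- b) * g v) \_ Rpos) v.
have mq : measurable_fun setT q.
  rewrite /q patch_indic; apply: measurable_funM; last exact: measurable_indic.
  by apply: measurable_funM => //; exact: measurable_powR.
have mf : measurable_fun setT f.
  by apply: measurable_funM; [exact: (measurableT_comp mq measurable_snd)|exact: mk].
have q0 v : 0 <= q v.
  by rewrite /q patchE; case: ifP => // _; rewrite mulr_ge0 ?powR_ge0.
have fg z : `|f z| <= gg z.2.
  rewrite /f /q /gg !patchE; case: ifPn => [/set_mem vp|_]; last by rewrite mul0r normr0.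
  rewrite normrM ger0_norm ?mulr_ge0 ?powR_ge0// ler_wpM2l ?mulr_ge0 ?powR_ge0//.
  exact: kg.
have igg : mu.-integrable setT (EFin \o gg).
  rewrite /gg -restrict_EFin; apply/(integrable_mkcond _ mRpos).
  have ib : mu.-integrable Rpos (EFin \o (fun v => th * (g v + v `^ (- c) * g v))).
    by apply: integrable_scale => //; exact: integrable_add.
  have mg : measurable_fun Rpos g by apply/measurable_EFinP; exact: measurable_int ig.
  apply: (le_integrable_norm mRpos _ ib).
    apply: measurable_funM => //; apply: measurable_funM => //.
    by apply: measurable_funTS; exact: measurable_powR.
  move=> v vp; rewrite ger0_norm ?mulr_ge0 ?powR_ge0 ?g0//.
  have v0 : 0 < v by move: vp; rewrite RposE.
  rewrite -mulrA ler_wpM2l//.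
  have -> : g v + v `^ (- c) * g v = (1 + v `^ (- c)) * g v by ring.
  rewrite ler_wpM2r ?g0//.
  (* v^(-b) <= 1 + v^(-c): the first term covers v >= 1, the second v < 1 because b < c. *)
  have [v1|v1] := leP 1 v.
    apply: (@le_trans _ _ 1); last by rewrite lerDl powR_ge0.
    by rewrite -[leRHS](powRr0 v) ler_powR// oppr_le0 ltW.
  apply: (@le_trans _ _ (v `^ (- c))); last by rewrite lerDr.
  by apply: ger_powR; rewrite ?v0 ?ltW// ltrN2.
have mfx s : measurable_fun setT (fun v => f (s, v)).
  exact: (measurableT_comp mf (measurable_pair1 s)).
have mfy v : measurable_fun setT (fun s => f (s, v)).
  exact: (measurableT_comp mf (measurable_pair2 v)).
have [|||_ hF] := @Rintegral_Fubini _ _ _ _ _ nu mu f mf.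
- apply: (@le_lt_trans _ _ (\int[nu]_s (\int[mu]_v (gg v)%:E))%E).
    apply: ge0_le_integral => //.
    + by move=> s _; exact: integral_ge0.
    + apply: (@measurable_fun_fubini_tonelli_F _ _ _ _ _ mu (fun z => `|f z|%:E)) => //.
      by apply/measurable_EFinP; exact: measurableT_comp.
    + move=> s _; apply: ge0_le_integral => //.
      * by apply/measurable_EFinP; exact: measurableT_comp.
      * exact: measurable_int igg.
      * by move=> v _; rewrite lee_fin; exact: (fg (s, v)).
  rewrite integral_prob_cst.
  rewrite (_ : (\int[mu]_v (gg v)%:E = \int[mu]_v `|(EFin \o gg) v|)%E).
    by case/integrableP: igg.
  apply: eq_integral => v _; rewrite /= ger0_norm// /gg patchE.
  by case: ifP => // /set_mem vp; rewrite !mulr_ge0 ?powR_ge0 ?g0.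
- by move=> s; apply: (le_integrable_norm measurableT (mfx s) igg) => v _; exact: (fg (s, v)).
- by move=> v; apply: (@integrable_bounded _ _ _ _ _ (gg v)) => // s; exact: (fg (s, v)).
rewrite (_ : \int[nu]_s \int[mu]_(v in Rpos) (th * v `^ (- b) * k s v) =
  \int[nu]_s \int[mu]_v f (s, v)); last first.
  apply: eq_Rintegral => s _; rewrite Rintegral_mkcond; apply: eq_Rintegral => v _.
  by rewrite /f /q /= !patchE; case: ifP => //; rewrite mul0r.
rewrite hF [RHS]Rintegral_mkcond; apply: eq_Rintegral => v _.
rewrite /f /q /= !patchE; case: ifPn => [/set_mem vp|_]; last first.
  under eq_Rintegral do rewrite mul0r.
  by rewrite Rintegral_prob_cst.
rewrite RintegralZl//; first by rewrite mulrC.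
apply: (@integrable_bounded _ _ _ _ _ (g v)); last by move=> s; exact: kg.
by apply: continuous_measurable_fun; exact: cs.
Qed.

End array_scaling.

(** * Laplace kernels *)

Definition clamp {R : realType} (M s : R) : R := Num.max (- M) (Num.min s M).

Lemma clamp_bound {R : realType} (M s : R) : 0 <= M -> `|clamp M s| <= M.
Proof.
move=> M0; rewrite /clamp ler_norml le_max lexx/= ge_max ge_min lexx orbT andbT.
by apply: (@le_trans _ _ 0); rewrite ?oppr_le0.
Qed.

Lemma clamp_id {R : realType} (M s : R) : `|s| <= M -> clamp M s = s.
Proof.
rewrite ler_norml => /andP[h1 h2]; rewrite /clamp (min_idPl h2).
exact/max_idPr.
Qed.

Lemma continuous_clamp {R : realType} (M : R) : continuous (clamp M).
Proof.
move=> s; rewrite /clamp; apply: cvg_maxr; first exact: cvg_cst.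
by apply: cvg_minr; [exact: cvg_id|exact: cvg_cst].
Qed.

Section kernels.
Context {R : realType}.
Variables (re y M : R).
Hypotheses (y0 : 0 < y) (M0 : 0 <= M).
Notation mu := (@lebesgue_measure R).

(* [pole s = i (s - z)] for [z = re + i y], with [s] clamped to [-M, M]. *)
Definition pole (s : R) : R[i] := y +i* (clamp M s - re).

Let B := y + (M + `|re|).
Let B0 : 0 <= B. Proof. by rewrite addr_ge0 ?(ltW y0)// addr_ge0. Qed.
Let Bv0 v : 0 < v -> 0 <= B * v. Proof. by move=> v0; rewrite mulr_ge0 // ltW. Qed.
Let Bv1 v : 0 < v -> 0 <= 1 + B + B * v.
Proof. by move=> v0; rewrite addr_ge0 ?Bv0// addr_ge0. Qed.

Lemma normc_pole s : normc (pole s) <= B.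
Proof.
apply: le_trans (le_normc_ReIm _) _; rewrite /= (gtr0_norm y0) lerD2l.
by apply: le_trans (ler_normB _ _) _; rewrite lerD2r clamp_bound.
Qed.

Lemma ccontinuous_pole s : ccontinuous_at pole s.
Proof.
split => /=; first exact: cvg_cst.
by apply: cvgB; [exact: continuous_clamp|exact: cvg_cst].
Qed.

Lemma ccontinuous_real (s : R) : ccontinuous_at (fun t : R => t%:C) s.
Proof. by split => /=; [exact: cvg_id|exact: cvg_cst]. Qed.

Definition pexp (s v : R) : R[i] := cexp (- (pole s * v%:C)).

Lemma normc_pexp s v : normc (pexp s v) = expR (- (y * v)).
Proof. by rewrite normc_cexp /=; congr expR; ring. Qed.

Lemma is_cderive_pexp s v : is_cderive (pexp s) v (- pole s * pexp s v).
Proof. exact: is_cderive_expZ. Qed.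

Lemma ccontinuous_pexp_l v s : ccontinuous_at (pexp ^~ v) s.
Proof.
apply: ccontinuous_cexp.
rewrite (_ : (fun t => _) = (fun t => (- v)%:C * pole t)); last first.
  by apply/funext => t; rewrite rmorphN mulrC mulNr.
by apply: ccontinuousM; [exact: ccontinuous_cst|exact: ccontinuous_pole].
Qed.

Lemma cmeasurable_pole d (T : measurableType d) (D : set T) (h : T -> R) :
  measurable_fun D h -> cmeasurable D (fun w => pole (h w)).
Proof.
move=> mh; split => /=; first exact: measurable_cst.
apply: measurable_funB; last exact: measurable_cst.
apply: (@measurableT_comp _ _ _ _ _ _ (clamp M)) => //.
by apply: continuous_measurable_fun; exact: continuous_clamp.
Qed.

Lemma cmeasurable_pexp d (T : measurableType d) (D : set T) (h k : T -> R) :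
  measurable_fun D h -> measurable_fun D k -> cmeasurable D (fun w => pexp (h w) (k w)).
Proof.
move=> mh mk; apply: cmeasurable_cexp.
rewrite (_ : (fun t => _) = (fun t => (- 1)%:C * (pole (h t) * (k t)%:C))); last first.
  by apply/funext => t; rewrite rmorphN mulN1r.
apply: cmeasurableM; first exact: cmeasurable_cst.
by apply: cmeasurableM; [exact: cmeasurable_pole|exact: cmeasurable_real].
Qed.

(** [K1] leads to 1 minus a Laplace factor, [K2] to the factor that carries a summand of the
    numerator S. [k1] and [k2] are their derivatives in v, as the layer-cake formula requires. *)
Definition K1 (s v : R) : R[i] := 1 - pexp s v.
Definition k1 (s v : R) : R[i] := pole s * pexp s v.
Definition K2 (s v : R) : R[i] := v%:C * pexp s v.
Definition k2 (s v : R) : R[i] := (1 - pole s * v%:C) * pexp s v.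

Definition kbound (v : R) : R := (1 + B + B * v) * expR (- (y * v)).

Lemma normc_k1 s v : Rpos v -> normc (k1 s v) <= kbound v.
Proof.
rewrite RposE => v0; rewrite Normc.normcM normc_pexp ler_wpM2r ?expR_ge0//.
apply: le_trans (normc_pole s) _; rewrite -addrA addrCA lerDl.
by rewrite addr_ge0// Bv0.
Qed.

Lemma normc_k2 s v : Rpos v -> normc (k2 s v) <= kbound v.
Proof.
rewrite RposE => v0; rewrite Normc.normcM normc_pexp ler_wpM2r ?expR_ge0//.
apply: le_trans (normcD _ _) _; rewrite Normc.normc1 -addrA lerD2l normcN.
rewrite Normc.normcM normc_real gtr0_norm//.
apply: (@le_trans _ _ (B * v)); last by rewrite lerDr; exact: B0.
by rewrite ler_wpM2r ?normc_pole// ltW.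
Qed.

Lemma normc_K1 s v : 0 <= v -> normc (K1 s v) <= 2.
Proof.
move=> v0; apply: le_trans (normcD _ _) _; rewrite Normc.normc1 normcN normc_pexp.
rewrite -[leRHS]/(1 + 1) lerD2l expR_le1 oppr_le0 mulr_ge0// ltW//.
Qed.

Lemma normc_K2 s v : 0 <= v -> normc (K2 s v) <= y^-1.
Proof.
move=> v0; rewrite Normc.normcM normc_real ger0_norm// normc_pexp expRN.
rewrite ler_pdivrMr ?expR_gt0// ler_pdivlMl//.
by apply: le_trans (expR_ge1Dx _); rewrite lerDr.
Qed.

Lemma is_cderive_K1 s v : is_cderive (K1 s) v (k1 s v).
Proof.
have := is_cderiveD (is_cderive_cst 1 v) (is_cderiveZ (-1) (is_cderive_pexp s v)).
rewrite (_ : (fun t => _) = K1 s); last by apply/funext => t; rewrite mulN1r.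
by move=> h; apply: (is_cderive_eq h); rewrite /k1; ring.
Qed.

Lemma is_cderive_K2 s v : is_cderive (K2 s) v (k2 s v).
Proof.
have := is_cderiveM (is_cderive_real (is_derive_id v (1 : R))) (is_cderive_pexp s v).
by move=> h; apply: (is_cderive_eq h); rewrite /k2; ring.
Qed.

Lemma ccontinuous_k1 s v : ccontinuous_at (k1 s) v.
Proof.
by apply: ccontinuousM; [exact: ccontinuous_cst|exact: is_cderive_continuous (is_cderive_pexp s v)].
Qed.

Lemma ccontinuous_k1_l v s : ccontinuous_at (k1 ^~ v) s.
Proof. by apply: ccontinuousM; [exact: ccontinuous_pole|exact: ccontinuous_pexp_l]. Qed.

Let k2E s v : k2 s v = (1 + (-1) * (pole s * v%:C)) * pexp s v.
Proof. by rewrite mulN1r. Qed.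

Lemma ccontinuous_k2 s v : ccontinuous_at (k2 s) v.
Proof.
rewrite (_ : k2 s = (fun v => (1 + (-1) * (pole s * v%:C)) * pexp s v)); last exact/funext.
apply: ccontinuousM; last exact: is_cderive_continuous (is_cderive_pexp s v).
apply: ccontinuousD; first exact: ccontinuous_cst.
apply: ccontinuousM; first exact: ccontinuous_cst.
by apply: ccontinuousM; [exact: ccontinuous_cst|exact: ccontinuous_real].
Qed.

Lemma ccontinuous_k2_l v s : ccontinuous_at (k2 ^~ v) s.
Proof.
rewrite (_ : k2 ^~ v = (fun s => (1 + (-1) * (pole s * v%:C)) * pexp s v)); last exact/funext.
apply: ccontinuousM; last exact: ccontinuous_pexp_l.
apply: ccontinuousD; first exact: ccontinuous_cst.
apply: ccontinuousM; first exact: ccontinuous_cst.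
by apply: ccontinuousM; [exact: ccontinuous_pole|exact: ccontinuous_cst].
Qed.

Lemma cmeasurable_k1 : cmeasurable setT (fun z : R * measurableTypeR R => k1 z.1 z.2).
Proof.
apply: cmeasurableM; first exact: cmeasurable_pole.
by apply: cmeasurable_pexp.
Qed.

Lemma cmeasurable_k2 : cmeasurable setT (fun z : R * measurableTypeR R => k2 z.1 z.2).
Proof.
rewrite (_ : (fun z => _) = (fun z : R * measurableTypeR R =>
  (1 + (-1) * (pole z.1 * z.2%:C)) * pexp z.1 z.2)); last by apply/funext => z; exact: k2E.
apply: cmeasurableM; last exact: cmeasurable_pexp.
apply: cmeasurableD; first exact: cmeasurable_cst.
apply: cmeasurableM; first exact: cmeasurable_cst.
by apply: cmeasurableM; [exact: cmeasurable_pole|exact: cmeasurable_real].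
Qed.

Lemma integrable_kbound : mu.-integrable Rpos (EFin \o kbound).
Proof.
have z01 : 0 <= (0 : R) < 1 by rewrite lexx ltr01.
have i0 := integrable_scale (1 + B) mRpos (integrable_Rpos_pow_exp z01 y0).
have i1 := integrable_scale B mRpos (integrable_Rpos_pow1_exp z01 y0).
apply: (le_integrable_norm mRpos _ (integrable_add mRpos i0 i1)).
  apply: measurable_funTS; apply: continuous_measurable_fun => v.
  apply: cvgM; first by apply: cvgD; [exact: cvg_cst|apply: cvgM; [exact: cvg_cst|exact: cvg_id]].
  apply: continuous_cvg; first exact: continuous_expR.
  by apply: cvgN; apply: cvgM; [exact: cvg_cst|exact: cvg_id].
move=> v; rewrite RposE => v0; rewrite /kbound ger0_norm; last first.
  by rewrite mulr_ge0 ?expR_ge0// Bv1.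
by rewrite oppr0 powRr0 addr0 powRr1 ?(ltW v0)// mul1r mulrDl mulrA.
Qed.

Lemma integrable_pow_kbound c : 0 <= c < 1 ->
  mu.-integrable Rpos (EFin \o (fun v => v `^ (- c) * kbound v)).
Proof.
move=> c01.
have i0 := integrable_scale (1 + B) mRpos (integrable_Rpos_pow_exp c01 y0).
have i1 := integrable_scale B mRpos (integrable_Rpos_pow1_exp c01 y0).
apply: (le_integrable_norm mRpos _ (integrable_add mRpos i0 i1)).
  apply: measurable_funM; first by apply: measurable_funTS; exact: measurable_powR.
  by apply/measurable_EFinP; exact: measurable_int integrable_kbound.
move=> v; rewrite RposE => v0; rewrite /kbound ger0_norm; last first.
  by rewrite !mulr_ge0 ?expR_ge0 ?powR_ge0// Bv1.
rewrite powRD; last by rewrite (gt_eqF v0) implybT.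
by rewrite powRr1 ?(ltW v0)// le_eqVlt; apply/orP; left; apply/eqP; ring.
Qed.

Variables (b : R) (b01 : 0 < b < 1).

(** The pole p multiplies a gamma integral proportional to p^(b-1), which raises the exponent to
    b. *)
Lemma cint_k1 s : cint mu Rpos (fun v => (v `^ (- b))%:C * k1 s v) =
  (gamma_cst b y)%:C * cexp (b%:C * clog y (clamp M s - re)).
Proof.
have -> : (fun v => (v `^ (- b))%:C * k1 s v) =
    (fun v => pole s * gpow0 b y (clamp M s - re) v).
  by apply/funext => v; rewrite /k1 mulrCA.
rewrite cintZ//; last exact: cintegrable_gpow0.
rewrite cint_gpow0// mulrCA; congr (_ * _).
rewrite /pole -(cexp_clog y0) -cexpD; congr cexp.
by rewrite rmorphB mulrBl mul1r addrCA subrr addr0.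
Qed.

(** By [cint_gpow1] the weight 1 - p v leaves 1 - (1 - b) = b times the gamma integral. *)
Lemma cint_k2 s : cint mu Rpos (fun v => (v `^ (- b))%:C * k2 s v) =
  (b * gamma_cst b y)%:C * cexp ((b - 1)%:C * clog y (clamp M s - re)).
Proof.
have i1 := cintegrable_gpow1 b01 y0 (clamp M s - re).
have i0 := cintegrable_gpow0 b01 y0 (clamp M s - re).
transitivity (cint mu Rpos (fun v => gpow0 b y (clamp M s - re) v +
    (- pole s) * gpow1 b y (clamp M s - re) v)).
  apply: eq_cint => v; rewrite RposE => v0.
  rewrite /gpow0 /gpow1 /k2 powRD; last by rewrite (gt_eqF v0) implybT.
  rewrite powRr1 ?(ltW v0)// rmorphM /pexp /pole; ring.
rewrite cintD// ?cintZ//; last exact: cintegrableZ.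
rewrite mulNr cint_gpow1// -mulNr -rmorphN -[X in X + _]mul1r -mulrDl.
have -> : (1 + (- (1 - b))%:C : R[i]) = b%:C.
  by rewrite -[X in X + _]/(1%:C) -rmorphD; congr (_%:C); ring.
rewrite cint_gpow0// mulrA; congr (_ * _).
by apply: complex_ext; rewrite ?ReM ?ImM /=; ring.
Qed.

End kernels.

Section cexp_estimates.
Context {R : realType}.

(** The mean value theorem is applied to the real and imaginary parts at two different points; hence
    the factor 2. *)
Lemma normc_MVT (F dF : R -> R[i]) (K : R) :
  (forall t, is_cderive F t (dF t)) ->
  (forall t, 0 <= t <= 1 -> normc (dF t) <= K) -> normc (F 1 - F 0) <= 2 * K.
Proof.
move=> dFF dK.
have [c c01 Ec] := @MVT_segment R (fun t => Re (F t)) (fun t => Re (dF t)) 0 1 ler01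
  (fun x _ => (dFF x).1) (continuous_subspaceT (fun x => (is_cderive_continuous (dFF x)).1)).
have [e e01 Ee] := @MVT_segment R (fun t => Im (F t)) (fun t => Im (dF t)) 0 1 ler01
  (fun x _ => (dFF x).2) (continuous_subspaceT (fun x => (is_cderive_continuous (dFF x)).2)).
apply: le_trans (le_normc_ReIm _) _.
rewrite ReD ImD ReN ImN Ec Ee subr0 !mulr1 mulr2n mulrDl mul1r lerD//.
  by apply: le_trans (le_Re_normc _) (dK c _); move: c01; rewrite in_itv.
by apply: le_trans (le_Im_normc _) (dK e _); move: e01; rewrite in_itv.
Qed.

Lemma normc_cexpN_le1 (w : R[i]) : 0 <= Re w -> normc (cexp (- w)) <= 1.
Proof. by move=> w0; rewrite normc_cexp ReN expR_le1 oppr_le0. Qed.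

Lemma normc_1_cexp (w : R[i]) : 0 <= Re w -> normc (1 - cexp (- w)) <= 2 * normc w.
Proof.
move=> w0; rewrite -normcN opprB.
have := @normc_MVT (fun t => cexp (- (w * t%:C))) (fun t => - w * cexp (- (w * t%:C)))
  (normc w) (fun t => is_cderive_expZ w t).
rewrite mulr0 mulr1 oppr0 cexp0; apply=> t /andP[t0 _].
rewrite Normc.normcM normcN ler_piMr ?normc_ge0// normc_cexpN_le1//.
by rewrite ReM /= mulr0 subr0 mulr_ge0.
Qed.

(** The path t -> - t w - exp (- t w) has derivative - w (1 - exp (- t w)), of modulus at most 2
    |w|^2 by the first-order estimate. *)
Lemma normc_1_cexp2 (w : R[i]) : 0 <= Re w ->
  normc (1 - w - cexp (- w)) <= 4 * normc w ^+ 2.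
Proof.
move=> w0.
pose F t : R[i] := (- w) * t%:C + (-1) * cexp (- (w * t%:C)).
pose dF t := - w * (1 - cexp (- (w * t%:C))).
have dFF t : is_cderive F t (dF t).
  have := is_cderiveD (is_cderiveZ (- w) (is_cderive_real (is_derive_id t (1 : R))))
    (is_cderiveZ (-1) (is_cderive_expZ w t)).
  by move=> h; apply: (is_cderive_eq h); rewrite /dF; ring.
have := @normc_MVT F dF (2 * normc w ^+ 2) dFF.
rewrite /F !mulr0 !mulr1 oppr0 cexp0 add0r.
have -> : - w + (-1) * cexp (- w) - -1 * 1 = 1 - w - cexp (- w) by ring.
rewrite (_ : 2 * (2 * _) = 4 * normc w ^+ 2); last by ring.
apply=> t /andP[t0 t1]; rewrite /dF Normc.normcM normcN expr2 mulrCA ler_wpM2l ?normc_ge0//.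
apply: le_trans (normc_1_cexp _) _.
  by rewrite ReM /= mulr0 subr0 mulr_ge0.
by rewrite Normc.normcM normc_real ger0_norm// ler_wpM2l// ler_piMr// normc_ge0.
Qed.

End cexp_estimates.

Section kernel_comparison.
Context {R : realType}.
Variables (re y M : R).
Hypotheses (y0 : 0 < y) (M0 : 0 <= M).

Definition kratio : R := 1 + 2 * ((M + `|re|) / y).

Lemma kratio_ge0 : 0 <= kratio.
Proof. by rewrite addr_ge0// mulr_ge0// divr_ge0 ?addr_ge0// ltW. Qed.

(** Writing the pole as y + i t, the kernel is the real one 1 - exp (- y v) plus exp (- y v) (1 -
    exp (- i t v)). The latter is at most 2 |t| v exp (- y v), and y v exp (- y v) <= 1 - exp (- y
    v). All poles are thus controlled by the real one. *)
Lemma normc_K1_le s v : 0 <= v ->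
  normc (K1 re y M s v) <= kratio * (1 - expR (- (y * v))).
Proof.
move=> v0.
pose t := clamp M s - re.
have tM : `|t| <= M + `|re| by apply: le_trans (ler_normB _ _) _; rewrite lerD2r clamp_bound.
have -> : K1 re y M s v = (1 - expR (- (y * v)))%:C +
    (expR (- (y * v)))%:C * (1 - cexp (- ('i%C * (t * v)%:C))).
  rewrite /K1 /pexp /pole -/t -!cexp_real.
  have -> : - ((y +i* t) * v%:C) = (- (y * v))%:C + - ('i%C * (t * v)%:C).
    by apply: complex_ext; rewrite ?ReD ?ImD ?ReN ?ImN ?ReM ?ImM /=; ring.
  rewrite cexpD rmorphB /= cexp_real; ring.
apply: le_trans (normcD _ _) _; rewrite Normc.normcM !normc_real.
have e1 : expR (- (y * v)) <= 1 by rewrite expR_le1 oppr_le0 mulr_ge0// ltW.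
rewrite ger0_norm ?subr_ge0// (ger0_norm (expR_ge0 _)).
rewrite (_ : kratio * _ = 1 - expR (- (y * v)) +
  2 * ((M + `|re|) / y) * (1 - expR (- (y * v)))) ?lerD2l; last by rewrite /kratio; ring.
apply: (@le_trans _ _ (expR (- (y * v)) * (2 * (`|t| * v)))).
  rewrite ler_wpM2l ?expR_ge0//; apply: le_trans (normc_1_cexp _) _.
    by rewrite ReM /= mul0r mul1r subr0.
  by rewrite Normc.normcM normc_real /= expr0n expr1n add0r sqrtr1 mul1r normrM (ger0_norm v0).
have key : expR (- (y * v)) * v <= (1 - expR (- (y * v))) / y.
  rewrite ler_pdivlMr// -mulrA (mulrC v) expRN.
  rewrite ler_pdivrMl ?expR_gt0// mulrBr mulr1 mulfV ?gt_eqF ?expR_gt0//.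
  by rewrite lerBrDr addrC expR_ge1Dx.
apply: (@le_trans _ _ (2 * `|t| * ((1 - expR (- (y * v))) / y))).
  rewrite (_ : _ * (2 * _) = 2 * `|t| * (expR (- (y * v)) * v)); last by ring.
  by rewrite ler_wpM2l// mulr_ge0.
rewrite (_ : 2 * ((M + _) / y) * _ = 2 * (M + `|re|) * ((1 - expR (- (y * v))) / y)); last by ring.
by rewrite ler_wpM2r ?divr_ge0 ?subr_ge0 ?(ltW y0)// ler_wpM2l.
Qed.

Lemma normc_pexp_le1 s v : 0 <= v -> normc (pexp re y M s v) <= 1.
Proof. by move=> v0; rewrite normc_pexp expR_le1 oppr_le0 mulr_ge0// ltW. Qed.

Lemma pexp_re v : `|re| <= M -> pexp re y M re v = (expR (- (y * v)))%:C.
Proof.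
move=> reM; rewrite /pexp /pole clamp_id// subrr -cexp_real; congr cexp.
by apply: complex_ext; rewrite ?ReN ?ImN ?ReM ?ImM /=; ring.
Qed.

End kernel_comparison.

Lemma cmeasurable_cexp_clog {R : realType} (y e : R) (g : R -> R) : 0 < y ->
  measurable_fun setT g -> cmeasurable setT (fun s : R => cexp (e%:C * clog y (g s))).
Proof.
move=> y0 mg; apply: cmeasurable_cexp; apply: cmeasurableM; first exact: cmeasurable_cst.
have cl t := is_cderive_continuous (is_cderive_clog y0 t).
split.
  apply: (measurableT_comp (f := fun t => Re (clog y t))) => //.
  by apply: continuous_measurable_fun => t; exact: (cl t).1.
apply: (measurableT_comp (f := fun t => Im (clog y t))) => //.
by apply: continuous_measurable_fun => t; exact: (cl t).2.
Qed.

Section complex_power_bound.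
Context {R : realType}.
Variables (re y M : R).
Hypotheses (y0 : 0 < y) (M0 : 0 <= M).

Lemma cpow_bounded (e : R) : exists K, forall s,
  normc (cexp (e%:C * clog y (clamp M s - re))) <= K.
Proof.
pose l := ln (y ^+ 2); pose u := ln (y ^+ 2 + (M + `|re|) ^+ 2).
exists (expR (`|e| * ((`|l| + `|u|) / 2))) => s.
rewrite normc_cexp ler_expR ReZ /=; apply: le_trans (ler_norm _) _.
rewrite normrM ler_wpM2l// normrM [X in _ * X]gtr0_norm ?invr_gt0//.
rewrite ler_pM2r ?invr_gt0//; set t := clamp M s - re.
have y20 : 0 < y ^+ 2 by rewrite exprn_gt0.
have lt : l <= ln (y ^+ 2 + t ^+ 2).
  by rewrite ler_ln ?posrE ?lerDl ?sqr_ge0// ltr_wpDr// sqr_ge0.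
have tu : ln (y ^+ 2 + t ^+ 2) <= u.
  rewrite ler_ln ?posrE ?ltr_wpDr// ?sqr_ge0//.
  rewrite lerD2l -(real_normK (num_real t)) lerXn2r ?nnegrE ?addr_ge0//.
  by apply: le_trans (ler_normB _ _) _; rewrite lerD2r clamp_bound.
rewrite ler_norml; apply/andP; split.
  apply: le_trans lt; rewrite lerNl; apply: le_trans (ler_norm _) _.
  by rewrite normrN lerDl.
by apply: le_trans tu _; apply: le_trans (ler_norm u) _; rewrite lerDr.
Qed.

Lemma cmeasurable_cpow (e : R) : cmeasurable setT
  (fun s : R => cexp (e%:C * clog y (clamp M s - re))).
Proof.
apply: (cmeasurable_cexp_clog e y0); apply: measurable_funB; last exact: measurable_cst.
by apply: continuous_measurable_fun; exact: continuous_clamp.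
Qed.

Lemma cintegrable_cpow (nu : probability R R) (e : R) : cintegrable nu setT
  (fun s : R => cexp (e%:C * clog y (clamp M s - re))).
Proof.
have [K hK] := cpow_bounded e.
exact: (@cintegrable_bounded _ _ _ _ _ K (cmeasurable_cpow e)).
Qed.

End complex_power_bound.

Lemma cvg_inv_nat (R : realType) : (n%:R^-1 : R) @[n --> \oo] --> (0 : R).
Proof. by rewrite -(cvg_shiftn 1); under eq_fun do rewrite addn1; exact: cvg_harmonic. Qed.

Lemma Rintegral_dirac (R : realType) (r : R) (f : R -> R) : measurable_fun setT f ->
  \int[\d_r : probability R R]_x f x = f r.
Proof.
move=> mf; rewrite /Rintegral integral_dirac//=; last exact/measurable_EFinP.
by rewrite indicT mul1r.
Qed.

(** * Laplace transforms along a triangular array *)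

Section array_limit.
Context d (T : measurableType d) (R : realType) (P : probability T R).
Notation mu := (@lebesgue_measure R).
Variable U : T -> R.
Hypotheses (mU : measurable_fun setT U) (U0 : forall w, 0 <= U w).
Variables (b : R).
Hypotheses (b01 : 0 < b < 1).
Hypothesis tail_gt0 : forall x : R, 0 < x -> 0 < tail P U x.
Hypothesis tail_rv : forall t : R, 0 < t ->
  tail P U (t * x) / tail P U x @[x --> +oo] --> t `^ (- b).
Variables (re y M : R).
Hypotheses (y0 : 0 < y) (reM : `|re| <= M).
Variables (x_ : nat -> R) (th : R).
Hypotheses (x_gt0 : forall n, 0 < x_ n) (x_y : x_ n @[n --> \oo] --> +oo).
Hypothesis x_th : n%:R * tail P U (x_ n) @[n --> \oo] --> th.

Let M0 : 0 <= M. Proof. exact: le_trans reM. Qed.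
Let b0 : 0 < b. Proof. by case/andP: b01. Qed.

(** The mean of p^c under nu for p = y + i (s - re), with s clamped: B for c = b and Psi for c = b -
    1. *)
Definition cpow_mean (nu : probability R R) (c : R) : R[i] :=
  cint nu setT (fun s => cexp (c%:C * clog y (clamp M s - re))).

(** [phi n s] is the Laplace transform of U / x_n at the pole p of s; [psi n s] is minus its
    derivative in p. *)
Definition phi n s : R[i] := cint P setT (fun w => pexp re y M s (U w / x_ n)).
Definition psi n s : R[i] := cint P setT (fun w => K2 re y M s (U w / x_ n)).

Let U_ge0 n w : 0 <= U w / x_ n. Proof. by rewrite divr_ge0// ltW. Qed.
Let mUx n : measurable_fun setT (fun w => U w / x_ n).
Proof. exact: measurable_funM. Qed.

Let mpexp n s : cmeasurable setT (fun w => pexp re y M s (U w / x_ n)).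
Proof. exact: cmeasurable_pexp. Qed.
Let mK2 n s : cmeasurable setT (fun w => K2 re y M s (U w / x_ n)).
Proof. by apply: cmeasurableM; [exact: cmeasurable_real|exact: mpexp]. Qed.
Let mK1 n s : cmeasurable setT (fun w => K1 re y M s (U w / x_ n)).
Proof.
rewrite (_ : (fun w => _) = (fun w => 1 + (-1) * pexp re y M s (U w / x_ n))).
  by apply: cmeasurableD; [|apply: cmeasurableM => //]; exact: cmeasurable_cst.
by apply/funext => w; rewrite mulN1r.
Qed.

Let cint_K1 n s : cint P setT (fun w => K1 re y M s (U w / x_ n)) = 1 - phi n s.
Proof.
have ip : cintegrable P setT (fun w => pexp re y M s (U w / x_ n)).
  by apply: (@cintegrable_bounded _ _ _ _ _ 1 (mpexp n s)) => w; exact: normc_pexp_le1.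
rewrite (_ : (fun w => _) = (fun w => 1 + (-1) * pexp re y M s (U w / x_ n))); last first.
  by apply/funext => w; rewrite mulN1r.
rewrite cintD ?cintZ// ?cint_cst ?mulN1r//; last exact: cintegrableZ.
by apply: (@cintegrable_bounded _ _ _ _ _ 1 (cmeasurable_cst _ 1)) => w; rewrite Normc.normc1.
Qed.

Lemma phi_le1 n s : normc (phi n s) <= 1.
Proof. by apply: normc_cint_bounded => // w; exact: normc_pexp_le1. Qed.

Section scaling.
Variables (nu : probability R R) (a : nat -> nat -> R).
Hypothesis a_cvg : forall (f : R -> R) K, continuous f -> (forall x, `|f x| <= K) ->
  n%:R^-1 * (\sum_(i < n) f (a n i)) @[n --> \oo] --> \int[nu]_x f x.

(** Any exponent strictly between b and 1: above b for Potter's bound, below 1 for integrability of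
    v^(-c) at 0. *)
Let c := (b + 1) / 2.
Let bc : b < c. Proof. by rewrite /c; case/andP: b01 => ? ?; lra. Qed.
Let c01 : 0 <= c < 1. Proof. by rewrite /c; case/andP: b01 => ? ?; apply/andP; split; lra. Qed.

Let scaling (K k : R -> R -> R[i]) (M1 : R) (g : R) (e : R) :
  (forall s, K s 0 = 0) ->
  (forall s v, is_cderive (K s) v (k s v)) ->
  (forall s v, ccontinuous_at (k s) v) ->
  (forall v s, ccontinuous_at (k ^~ v) s) ->
  cmeasurable setT (fun z : R * measurableTypeR R => k z.1 z.2) ->
  (forall s v, 0 <= v -> normc (K s v) <= M1) ->
  (forall s v, Rpos v -> normc (k s v) <= kbound re y M v) ->
  (forall s, cint mu Rpos (fun v => (v `^ (- b))%:C * k s v) =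
     g%:C * cexp (e%:C * clog y (clamp M s - re))) ->
  (forall s n, cmeasurable setT (fun w => K s (U w / x_ n))) ->
  ccvg (fun n => \sum_(i < n) cint P setT (fun w => K (a n i) (U w / x_ n)))
    ((th * g)%:C * cpow_mean nu e).
Proof.
move=> K0 dK ck ckl mk KM kk cintk mK.
have ig : mu.-integrable Rpos (EFin \o kbound re y M) by exact: integrable_kbound.
have igc := integrable_pow_kbound re y0 M0 c01.
have ik s : cintegrable mu Rpos (fun v => (v `^ (- b))%:C * k s v).
  have b01' : 0 <= b < 1 by case/andP: b01 => ? ?; apply/andP; split => //; exact: ltW.
  apply: (cintegrable_le mRpos _ (integrable_pow_kbound re y0 M0 b01')).
    apply: cmeasurableM; last by apply: cmeasurable_continuous => v _; exact: ck.
    by apply: cmeasurable_real; apply: measurable_funTS; exact: measurable_powR.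
  move=> v vp; rewrite Normc.normcM normc_real ger0_norm ?powR_ge0//.
  by rewrite ler_wpM2l ?powR_ge0// kk.
have iE (s : R) : \int[mu]_(v in Rpos) (th * v `^ (- b) * Re (k s v)) =
    th * Re (g%:C * cexp (e%:C * clog y (clamp M s - re))) /\
    \int[mu]_(v in Rpos) (th * v `^ (- b) * Im (k s v)) =
    th * Im (g%:C * cexp (e%:C * clog y (clamp M s - re))).
  rewrite -cintk; split.
    rewrite -[Re (cint _ _ _)]/(\int[mu]_(v in Rpos) Re ((v `^ (- b))%:C * k s v)).
    rewrite -RintegralZl//; last exact: (ik s).1.
    by apply: eq_Rintegral => v _; rewrite ReZ mulrA.
  rewrite -[Im (cint _ _ _)]/(\int[mu]_(v in Rpos) Im ((v `^ (- b))%:C * k s v)).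
  rewrite -RintegralZl//; last exact: (ik s).2.
  by apply: eq_Rintegral => v _; rewrite ImZ mulrA.
have ie : cintegrable nu setT (fun s => cexp (e%:C * clog y (clamp M s - re))).
  exact: cintegrable_cpow.
have limE : (th * g)%:C * cpow_mean nu e =
    cint nu setT (fun s => (th * g)%:C * cexp (e%:C * clog y (clamp M s - re))).
  by rewrite cintZ.
have hR := array_scaling mU U0 b0 bc tail_gt0 tail_rv a_cvg x_gt0 x_y x_th
   (K := fun s v => Re (K s v)) (k := fun s v => Re (k s v)) (g := kbound re y M) (M0 := M1).
have hI := array_scaling mU U0 b0 bc tail_gt0 tail_rv a_cvg x_gt0 x_y x_th
   (K := fun s v => Im (K s v)) (k := fun s v => Im (k s v)) (g := kbound re y M) (M0 := M1).
rewrite limE; split.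
  have -> : (fun n => Re (\sum_(i < n) cint P setT (fun w => K (a n i) (U w / x_ n)))) =
     (fun n => \sum_(i < n) (\int[P]_w Re (K (a n i) (U w / x_ n)))).
    by apply/funext => n; rewrite Re_sum.
  have -> : Re (cint nu setT (fun s => (th * g)%:C * cexp (e%:C * clog y (clamp M s - re)))) =
     \int[nu]_s \int[mu]_(v in Rpos) (th * v `^ (- b) * Re (k s v)).
    transitivity (\int[nu]_s Re ((th * g)%:C * cexp (e%:C * clog y (clamp M s - re)))) => //.
    by apply: eq_Rintegral => s _; rewrite (iE s).1 !ReZ mulrA.
  apply: hR => //.
  - by move=> s; rewrite K0.
  - by move=> s v; exact: (dK s v).1.
  - by move=> s v; exact: (ck s v).1.
  - by move=> s v; exact: (ckl s v).1.
  - exact: mk.1.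
  - by move=> s v v0; apply: le_trans (le_Re_normc _) (KM _ _ v0).
  - by move=> s v v0; apply: le_trans (le_Re_normc _) (kk _ _ v0).
have -> : (fun n => Im (\sum_(i < n) cint P setT (fun w => K (a n i) (U w / x_ n)))) =
   (fun n => \sum_(i < n) (\int[P]_w Im (K (a n i) (U w / x_ n)))).
  by apply/funext => n; rewrite Im_sum.
have -> : Im (cint nu setT (fun s => (th * g)%:C * cexp (e%:C * clog y (clamp M s - re)))) =
   \int[nu]_s \int[mu]_(v in Rpos) (th * v `^ (- b) * Im (k s v)).
  transitivity (\int[nu]_s Im ((th * g)%:C * cexp (e%:C * clog y (clamp M s - re)))) => //.
    by apply: eq_Rintegral => s _; rewrite (iE s).2 !ImZ mulrA.
apply: hI => //.
- by move=> s; rewrite K0.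
- by move=> s v; exact: (dK s v).2.
- by move=> s v; exact: (ck s v).2.
- by move=> s v; exact: (ckl s v).2.
- exact: mk.2.
- by move=> s v v0; apply: le_trans (le_Im_normc _) (KM _ _ v0).
- by move=> s v v0; apply: le_trans (le_Im_normc _) (kk _ _ v0).
Qed.

Lemma sum_1_phi_cvg :
  ccvg (fun n => \sum_(i < n) (1 - phi n (a n i)))
    ((th * gamma_cst b y)%:C * cpow_mean nu b).
Proof.
have := @scaling (K1 re y M) (k1 re y M) 2 (gamma_cst b y) b.
rewrite (_ : (fun n => \sum_(i < n) _) = (fun n => \sum_(i < n) (1 - phi n (a n i)))); last first.
  by apply/funext => n; apply: eq_bigr => i _; rewrite cint_K1.
apply.
- by move=> s; rewrite /K1 /pexp mulr0 oppr0 cexp0 subrr.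
- exact: is_cderive_K1.
- exact: ccontinuous_k1.
- exact: ccontinuous_k1_l.
- exact: cmeasurable_k1.
- by move=> s v; exact: normc_K1.
- by move=> s v; exact: normc_k1.
- by move=> s; exact: cint_k1.
- by move=> s n; exact: mK1.
Qed.

Lemma sum_psi_cvg :
  ccvg (fun n => \sum_(i < n) psi n (a n i))
    ((th * (b * gamma_cst b y))%:C * cpow_mean nu (b - 1)).
Proof.
apply: (@scaling (K2 re y M) (k2 re y M) (y^-1) (b * gamma_cst b y) (b - 1)).
- by move=> s; rewrite /K2 mul0r.
- exact: is_cderive_K2.
- exact: ccontinuous_k2.
- exact: ccontinuous_k2_l.
- exact: cmeasurable_k2.
- by move=> s v; exact: normc_K2.
- by move=> s v; exact: normc_k2.
- by move=> s; exact: cint_k2.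
- by move=> s n; exact: mK2.
Qed.

End scaling.

Let cint_real (f : T -> R) :
  cint P setT (fun w => (f w)%:C) = (\int[P]_w f w)%:C.
Proof. by apply: complex_ext => //=; rewrite Rintegral_prob_cst. Qed.

Lemma phi_reE n : phi n re = (\int[P]_w expR (- (y * (U w / x_ n))))%:C.
Proof.
by rewrite -cint_real; congr (cint _ _ _); apply/funext => w; rewrite pexp_re.
Qed.

Lemma psi_reE n : psi n re = (\int[P]_w (U w / x_ n * expR (- (y * (U w / x_ n)))))%:C.
Proof.
rewrite -cint_real; congr (cint _ _ _); apply/funext => w.
by rewrite /K2 pexp_re//; apply: complex_ext; rewrite ?ReZ ?ImZ /= ?mulr0.
Qed.

(** Integrated form of [normc_K1_le]. Since n (1 - phi n re) converges, 1 - phi is of order 1/n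
    uniformly over the poles. *)
Lemma normc_1_phi n s : normc (1 - phi n s) <= kratio re y M * normc (1 - phi n re).
Proof.
have ie : P.-integrable setT (EFin \o (fun w => expR (- (y * (U w / x_ n))))).
  apply: (@integrable_bounded _ _ _ _ _ 1).
    apply: measurableT_comp; first exact: measurable_expR.
    by apply: measurableT_comp => //; exact: measurable_funM.
  by move=> w; rewrite ger0_norm ?expR_ge0// expR_le1 oppr_le0 mulr_ge0// ltW.
have i1 : P.-integrable setT (EFin \o (fun _ : T => 1 : R)).
  by apply: (@integrable_bounded _ _ _ _ _ 1) => // w; rewrite normr1.
have i1e : P.-integrable setT (EFin \o (fun w => 1 - expR (- (y * (U w / x_ n))))).
  rewrite (_ : _ \o _ = EFin \o (fun w => 1 + -1 * expR (- (y * (U w / x_ n))))).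
    by apply: integrable_add => //; exact: integrable_scale.
  by apply/funext => w /=; rewrite mulN1r.
have iK : cintegrable P setT (fun w => K1 re y M s (U w / x_ n)).
  by apply: (@cintegrable_bounded _ _ _ _ _ 2 (mK1 n s)) => w; exact: normc_K1.
have E1 : 1 - phi n re = (\int[P]_w (1 - expR (- (y * (U w / x_ n)))))%:C.
  by rewrite RintegralB// Rintegral_prob_cst phi_reE rmorphB.
have p1 : 0 <= \int[P]_w (1 - expR (- (y * (U w / x_ n)))).
  apply: Rintegral_ge0 => // w _.
  by rewrite subr_ge0 expR_le1 oppr_le0 mulr_ge0// ltW.
rewrite E1 normc_real ger0_norm// -RintegralZl// -cint_K1.
apply: le_trans (le_normc_cint _ _) _ => //.
apply: le_Rintegral => //.
- exact: cintegrable_abs.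
- exact: integrable_scale.
- by move=> w _; exact: normc_K1_le.
Qed.

Lemma normc_psi n s : normc (psi n s) <= normc (psi n re).
Proof.
have iK t : cintegrable P setT (fun w => K2 re y M t (U w / x_ n)).
  by apply: (@cintegrable_bounded _ _ _ _ _ y^-1 (mK2 n t)) => w; exact: normc_K2.
have K2E t w : normc (K2 re y M t (U w / x_ n)) = U w / x_ n * expR (- (y * (U w / x_ n))).
  by rewrite Normc.normcM normc_real normc_pexp ger0_norm.
rewrite psi_reE normc_real ger0_norm; last first.
  by apply: Rintegral_ge0 => // w _; rewrite mulr_ge0 ?expR_ge0.
apply: le_trans (le_normc_cint _ (iK s)) _ => //.
by under eq_Rintegral do rewrite K2E.
Qed.

(** The constant array [re] converges to the Dirac mass at [re], so the limits proved for general
    arrays specialise to the comparison array with p_i = y. *)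
Lemma dirac_array_cvg (f : R -> R) (K : R) : continuous f -> (forall x, `|f x| <= K) ->
  n%:R^-1 * (\sum_(i < n) f re) @[n --> \oo] --> \int[\d_re : probability R R]_x f x.
Proof.
move=> cf _; rewrite Rintegral_dirac; last exact: continuous_measurable_fun.
apply: cvg_near_cst; near=> n.
rewrite sumr_const card_ord -[f re *+ n]mulr_natl mulrA mulVf ?mul1r//.
by rewrite pnatr_eq0 -lt0n; near: n; exact: nbhs_infty_gt.
Unshelve. all: by end_near. Qed.

Lemma cpow_mean_dirac c : cpow_mean \d_re c = (y `^ c)%:C.
Proof.
rewrite /cpow_mean; have E : cint \d_re setT (fun s => cexp (c%:C * clog y (clamp M s - re))) =
   cexp (c%:C * clog y (clamp M re - re)).
  have [mR mI] := cmeasurable_cpow re M y0 c.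
  by apply: complex_ext; rewrite [LHS]Rintegral_dirac.
rewrite E clamp_id// subrr /clog mul0r atan0 expr0n addr0.
rewrite (_ : c%:C * _ = (c * ln y)%:C); last first.
  by apply: complex_ext; rewrite ?ReZ ?ImZ /= ?mulr0// lnXn// mulr2n; field.
by rewrite cexp_real /powR (gt_eqF y0).
Qed.

Lemma n_1_phi_cvg :
  n%:R * normc (1 - phi n re) @[n --> \oo] --> th * gamma_cst b y * y `^ b.
Proof.
have th0 : 0 <= th by apply: (cvgr_to_ge x_th); apply: nearW => n; rewrite mulr_ge0// tail_ge0.
have [h _] := sum_1_phi_cvg dirac_array_cvg.
rewrite cpow_mean_dirac ReZ /= in h.
rewrite (_ : (fun n => _) = (fun n => Re (\sum_(i < n) (1 - phi n re)))) //.
apply/funext => n; rewrite Re_sum sumr_const card_ord mulr_natl; congr (_ *+ _).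
have : 0 <= Re (1 - phi n re).
  rewrite ReD ReN /= subr_ge0; apply: le_trans (ler_norm _) _.
  by apply: le_trans (le_Re_normc _) (phi_le1 _ _).
by rewrite phi_reE -[1]/(1%:C) -rmorphB normc_real => /ger0_norm.
Qed.

Lemma n_psi_cvg :
  n%:R * normc (psi n re) @[n --> \oo] --> th * (b * gamma_cst b y) * y `^ (b - 1).
Proof.
have [h _] := sum_psi_cvg dirac_array_cvg.
rewrite cpow_mean_dirac ReZ /= in h.
rewrite (_ : (fun n => _) = (fun n => Re (\sum_(i < n) psi n re))) //.
apply/funext => n; rewrite Re_sum sumr_const card_ord mulr_natl; congr (_ *+ _).
rewrite psi_reE normc_real ger0_norm//.
by apply: Rintegral_ge0 => // w _; rewrite mulr_ge0 ?expR_ge0.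
Qed.

Section products.
Variables (nu : probability R R) (a : nat -> nat -> R).
Hypothesis a_cvg : forall (f : R -> R) K, continuous f -> (forall x, `|f x| <= K) ->
  n%:R^-1 * (\sum_(i < n) f (a n i)) @[n --> \oo] --> \int[nu]_x f x.

Let c0 := kratio re y M.
Let c0_ge0 : 0 <= c0. Proof. exact: kratio_ge0. Qed.

(** Each factor phi differs from exp (- (1 - phi)) by an error of second order in 1 - phi; n errors
    of order 1/n^2 vanish in the limit, and the product of exponentials is governed by
    [sum_1_phi_cvg]. *)
Lemma prod_phi_cvg :
  ccvg (fun n => \prod_(i < n) phi n (a n i))
    (cexp (- ((th * gamma_cst b y)%:C * cpow_mean nu b))).
Proof.
have hS := sum_1_phi_cvg a_cvg.
have hE : ccvg (fun n => \prod_(i < n) cexp (- (1 - phi n (a n i))))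
    (cexp (- ((th * gamma_cst b y)%:C * cpow_mean nu b))).
  have := ccvg_cexp (ccvgM (ccvg_cst (-1)) hS); rewrite mulN1r.
  rewrite (_ : (fun n => cexp _) = (fun n => \prod_(i < n) cexp (- (1 - phi n (a n i))))) //.
  by apply/funext => n; rewrite mulN1r -sumrN cexp_sum.
apply: (ccvg_sub0 hE).
have Re_ge0 n s : 0 <= Re (1 - phi n s).
  rewrite ReD ReN /= subr_ge0; apply: le_trans (ler_norm _) _.
  by apply: le_trans (le_Re_normc _) (phi_le1 _ _).
apply: (@squeeze_cvgr _ _ _ _ (fun=> 0)
  (fun n => 4 * c0 ^+ 2 * (n%:R * normc (1 - phi n re)) * (n%:R * normc (1 - phi n re)) / n%:R)).
- near=> n.
  have n0 : 0 < n%:R :> R by rewrite ltr0n; near: n; exact: nbhs_infty_gt.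
  rewrite normc_ge0 andTb; apply: le_trans (normc_prod_sub _ _) _.
  + by move=> i; exact: phi_le1.
  + by move=> i; exact: normc_cexpN_le1.
  apply: (@le_trans _ _ (\sum_(i < n) 4 * (c0 * normc (1 - phi n re)) ^+ 2)).
    apply: ler_sum => i _.
    have -> : phi n (a n i) - cexp (- (1 - phi n (a n i))) =
      1 - (1 - phi n (a n i)) - cexp (- (1 - phi n (a n i))) by ring.
    apply: le_trans (normc_1_cexp2 (Re_ge0 _ _)) _.
    by rewrite ler_pM2l// lerXn2r ?nnegrE ?normc_ge0 ?mulr_ge0 ?normc_ge0// normc_1_phi.
  rewrite sumr_const card_ord -[X in X <= _]mulr_natl le_eqVlt; apply/orP; left; apply/eqP.
  by field; rewrite gt_eqF.
- exact: cvg_cst.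
- rewrite -(mulr0 (4 * c0 ^+ 2 * (th * gamma_cst b y * y `^ b) * (th * gamma_cst b y * y `^ b))).
  apply: cvgM; last exact: cvg_inv_nat.
  apply: cvgM; last exact: n_1_phi_cvg.
  by apply: cvgM; [exact: cvg_cst|exact: n_1_phi_cvg].
Unshelve. all: by end_near. Qed.

(** Restoring the missing factor of the product costs |1 - phi|, of order 1/n, in each of n terms
    psi of order 1/n. The sum thus behaves as the sum of the psi times the full product. *)
Lemma sum_psi_prod_phi_cvg :
  ccvg (fun n => \sum_(i < n) psi n (a n i) * \prod_(j < n | j != i) phi n (a n j))
    ((th * (b * gamma_cst b y))%:C * cpow_mean nu (b - 1) *
     cexp (- ((th * gamma_cst b y)%:C * cpow_mean nu b))).
Proof.
apply: (ccvg_sub0 (ccvgM (sum_psi_cvg a_cvg) prod_phi_cvg)).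
apply: (@squeeze_cvgr _ _ _ _ (fun=> 0)
  (fun n => c0 * (n%:R * normc (psi n re)) * (n%:R * normc (1 - phi n re)) / n%:R)).
- near=> n.
  have n0 : 0 < n%:R :> R by rewrite ltr0n; near: n; exact: nbhs_infty_gt.
  rewrite normc_ge0 andTb mulr_suml -sumrB; apply: le_trans (normc_sum _ _ _) _.
  apply: (@le_trans _ _ (\sum_(i < n) normc (psi n re) * (c0 * normc (1 - phi n re)))).
    apply: ler_sum => i _.
    rewrite (bigD1 i (P := xpredT))//= -mulrBr.
    rewrite Normc.normcM ler_pM ?normc_ge0 ?normc_psi//.
    rewrite -[X in X - _]mul1r -mulrBl Normc.normcM; apply: le_trans (normc_1_phi _ (a n i)).
    rewrite ler_piMr ?normc_ge0// normc_prod.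
    by apply: prodr_ile1 => j _; rewrite normc_ge0 phi_le1.
  rewrite sumr_const card_ord -[X in X <= _]mulr_natl le_eqVlt; apply/orP; left; apply/eqP.
  by field; rewrite gt_eqF.
- exact: cvg_cst.
- rewrite -(mulr0 (c0 * (th * (b * gamma_cst b y) * y `^ (b - 1)) * (th * gamma_cst b y * y `^ b))).
  apply: cvgM; last exact: cvg_inv_nat.
  by apply: cvgM; [apply: cvgM; [exact: cvg_cst|exact: n_psi_cvg]|exact: n_1_phi_cvg].
Unshelve. all: by end_near. Qed.

End products.

End array_limit.

(** * The mean of the Stieltjes ratio *)

Section stretched_exponential.
Context {R : realType}.
Notation mu := (@lebesgue_measure R).
Variables (b : R) (C : R[i]).
Hypotheses (b0 : 0 < b) (C0 : 0 < Re C).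

Definition stretched (s : R) : R[i] := (s `^ (b - 1))%:C * cexp (- (C * (s `^ b)%:C)).

Lemma normc_stretched s : normc (stretched s) = s `^ (b - 1) * expR (- (Re C * s `^ b)).
Proof.
rewrite Normc.normcM normc_real ger0_norm ?powR_ge0// normc_cexp ReN ReM /=.
by rewrite mulr0 subr0.
Qed.

Let is_cderive_pow (h s : R) : 0 < s ->
  is_cderive (fun t => (t `^ h)%:C) s (h * s `^ (h - 1))%:C.
Proof. by move=> s0; apply: is_cderive_real; exact: is_derive1_powR. Qed.

Let is_cderive_exp (s : R) : 0 < s ->
  is_cderive (fun t => cexp (- (C * (t `^ b)%:C))) s (- C * (b * s `^ (b - 1))%:C * cexp (- (C * (s `^ b)%:C))).
Proof.
move=> s0; have := is_cderive_cexp (is_cderiveZ (- C) (is_cderive_pow b s0)).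
rewrite (_ : (fun t => _) = (fun t => cexp (- (C * (t `^ b)%:C)))) ?mulNr//.
by apply/funext => t; rewrite mulNr.
Qed.

Let ccontinuous_stretched (s : R) : 0 < s -> ccontinuous_at stretched s.
Proof.
move=> s0; apply: ccontinuousM.
  exact: is_cderive_continuous (is_cderive_pow _ s0).
exact: is_cderive_continuous (is_cderive_exp s0).
Qed.

Lemma cintegrable_stretched : cintegrable mu Rpos stretched.
Proof.
apply: (cintegrable_le mRpos _ (integrable_stretched_exp b0 C0)).
  by apply: cmeasurable_continuous => s; exact: ccontinuous_stretched.
by move=> s _; rewrite normc_stretched.
Qed.

(** The function - exp (- C s^b) / (b C) is an antiderivative; it vanishes at infinity because
    [Re C] is positive. *)
Lemma cint_stretched : cint mu Rpos stretched = (b%:C * C)^-1.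
Proof.
have Cn0 : C != 0 by apply: contraTneq C0 => ->; rewrite ltxx.
have bn0 : b%:C != 0 :> R[i] by rewrite -normc_gt0 normc_real normr_gt0 gt_eqF.
pose F s := - (b%:C * C)^-1 * cexp (- (C * (s `^ b)%:C)).
rewrite (@improper_cFTC _ stretched F (- (b%:C * C)^-1) 0) ?sub0r ?opprK//.
- move=> s s0; apply: (is_cderive_eq (is_cderiveZ _ (is_cderive_exp s0))).
  by rewrite /stretched rmorphM /=; field; rewrite bn0 Cn0.
- rewrite -[X in ccvg _ X]mulr1 -cexp0; apply: ccvgM; first exact: ccvg_cst.
  apply: ccvg_cexp; have := ccvgM (ccvg_cst (- C)) (ccvg_real (powR_inv_cvg0 b0)).
  rewrite mulr0 (_ : (fun n => _) = (fun n => - (C * (n.+1%:R^-1 `^ b)%:C))) //.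
  by apply/funext => n; rewrite mulNr.
- rewrite -(mulr0 (- (b%:C * C)^-1)); apply: ccvgM; first exact: ccvg_cst.
  apply/ccvg_normc.
  rewrite (_ : (fun n => _) = (fun n => expR (- (Re C * n.+2%:R `^ b)))).
    exact: stretched_exp_cvg0.
  by apply/funext => n; rewrite subr0 normc_cexp ReN ReM /= mulr0 subr0.
- exact: cintegrable_stretched.
Qed.

End stretched_exponential.

Section complex_Fubini.
Context d1 d2 (T1 : measurableType d1) (T2 : measurableType d2) (R : realType).
Variables (m1 : {sigma_finite_measure set T1 -> \bar R})
  (m2 : {sigma_finite_measure set T2 -> \bar R}).

Lemma cint_Fubini (f : T1 * T2 -> R[i]) : cmeasurable setT f ->
  (\int[m1]_x \int[m2]_y (normc (f (x, y)))%:E < +oo)%E ->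
  (forall x, cintegrable m2 setT (fun y => f (x, y))) ->
  (forall y, cintegrable m1 setT (fun x => f (x, y))) ->
  cintegrable m1 setT (fun x => cint m2 setT (fun y => f (x, y))) /\
  cint m1 setT (fun x => cint m2 setT (fun y => f (x, y))) =
  cint m2 setT (fun y => cint m1 setT (fun x => f (x, y))).
Proof.
move=> mf ff i2 i1; have mn := cmeasurable_normc mf.
have fin (g : T1 * T2 -> R) : measurable_fun setT g -> (forall z, `|g z| <= normc (f z)) ->
    (\int[m1]_x \int[m2]_y `|g (x, y)|%:E < +oo)%E.
  move=> mg gf; apply: le_lt_trans ff; apply: ge0_le_integral => //.
  - by move=> x _; exact: integral_ge0.
  - apply: (@measurable_fun_fubini_tonelli_F _ _ _ _ _ m2 (fun z => `|g z|%:E)) => //.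
    by apply/measurable_EFinP; exact: measurableT_comp.
  - apply: (@measurable_fun_fubini_tonelli_F _ _ _ _ _ m2 (fun z => (normc (f z))%:E)).
      exact/measurable_EFinP.
    by move=> z; rewrite lee_fin normc_ge0.
  - move=> x _; apply: ge0_le_integral => //.
    + apply/measurable_EFinP; apply: measurableT_comp => //.
      exact: (measurableT_comp mg (measurable_pair1 x)).
    + by apply/measurable_EFinP; exact: (measurableT_comp mn (measurable_pair1 x)).
    + by move=> y _; rewrite lee_fin.
have [iR ER] := @Rintegral_Fubini _ _ _ _ _ m1 m2 (fun z => Re (f z)) mf.1
  (fin _ mf.1 (fun z => le_Re_normc (f z))) (fun x => (i2 x).1) (fun y => (i1 y).1).
have [iI EI] := @Rintegral_Fubini _ _ _ _ _ m1 m2 (fun z => Im (f z)) mf.2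
  (fin _ mf.2 (fun z => le_Im_normc (f z))) (fun x => (i2 x).2) (fun y => (i1 y).2).
by split; [split|apply: complex_ext].
Qed.

End complex_Fubini.

Section mkcond.
Context d (T : measurableType d) (R : realType) (mu : {measure set T -> \bar R}).
Variables (D : set T) (mD : measurable D).

Let reE (f : T -> R[i]) : (fun x => Re ((\1_D x)%:C * f x)) = (fun x => Re (f x)) \_ D.
Proof. by apply/funext => x; rewrite ReZ patch_indic mulrC. Qed.
Let imE (f : T -> R[i]) : (fun x => Im ((\1_D x)%:C * f x)) = (fun x => Im (f x)) \_ D.
Proof. by apply/funext => x; rewrite ImZ patch_indic mulrC. Qed.

Lemma cint_mkcond (f : T -> R[i]) : cint mu D f = cint mu setT (fun x => (\1_D x)%:C * f x).
Proof. by apply: complex_ext => /=; rewrite ?reE ?imE Rintegral_mkcond. Qed.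

Lemma cintegrable_mkcond (f : T -> R[i]) :
  cintegrable mu D f <-> cintegrable mu setT (fun x => (\1_D x)%:C * f x).
Proof.
rewrite /cintegrable reE imE -!restrict_EFin.
by split => -[h1 h2]; split; apply/(integrable_mkcond _ mD).
Qed.

End mkcond.

(** Every pole p has |arg p| < pi / 2, so p^b stays in the sector of half-angle b pi / 2 < pi / 2
    and its real part is at least y^b cos (b pi / 2). The denominator of the limit is therefore
    nonzero. *)
Lemma Re_cpow_mean_gt0 {R : realType} (nu : probability R R) (re y M b : R) :
  0 < b < 1 -> 0 < y -> 0 <= M -> 0 < Re (cpow_mean re y M nu b).
Proof.
move=> /andP[b0 b1] y0 M0.
have pb : 0 < b * (pi / 2) by rewrite mulr_gt0// divr_gt0// pi_gt0.
have pb2 : b * (pi / 2) < pi / 2 by rewrite gtr_pMl// divr_gt0// pi_gt0.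
pose c0 := expR (b * (ln (y ^+ 2) / 2)) * cos (b * (pi / 2)).
have cpb : 0 < cos (b * (pi / 2)).
  by apply: cos_gt0_pihalf; rewrite pb2 andbT (lt_trans _ pb)// oppr_lt0 divr_gt0// pi_gt0.
have c00 : 0 < c0 by rewrite mulr_gt0// expR_gt0.
apply: (lt_le_trans c00).
rewrite -(Rintegral_prob_cst nu c0); apply: le_Rintegral => //.
- by apply: (@integrable_bounded _ _ _ _ _ `|c0|).
- exact: (cintegrable_cpow re y0 M0 nu b).1.
move=> s _; rewrite Re_cexp ReZ ImZ /=; set t := clamp M s - re.
have y20 : 0 < y ^+ 2 by rewrite exprn_gt0.
apply: ler_pM; [exact: expR_ge0|exact: ltW| |].
  rewrite ler_expR ler_wpM2l ?(ltW b0)// ler_pM2r ?invr_gt0//.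
  by rewrite ler_ln ?posrE ?lerDl ?sqr_ge0// ltr_wpDr// sqr_ge0.
rewrite -[leRHS]cos_norm; have [h1 h2] := (atan_gtNpi2 (t / y), atan_ltpi2 (t / y)).
have hu : `|b * atan (t / y)| < b * (pi / 2).
  by rewrite normrM gtr0_norm// ltr_pM2l// ltr_norml h1.
have hp : pi / 2 <= pi :> R by have := pi_gt0 R; lra.
apply/ltW; rewrite ltr_cos// in_itv/=.
  by rewrite normr_ge0/= (le_trans (ltW hu))// (le_trans (ltW pb2)).
by rewrite (ltW pb)/= (le_trans (ltW pb2)).
Qed.

(** * The Laplace integral of the resolvent and its limit *)

Section sums.
Context d (T : measurableType d) (R : realType) (P : probability T R).
Variables (xi : {RV P >-> R}) (X : nat -> {RV P >-> R}).
Hypothesis X_iid : iid_copies P xi X.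
Variables (re y M : R).
Hypotheses (y0 : 0 < y) (reM : `|re| <= M).
Let M0 : 0 <= M. Proof. exact: le_trans reM. Qed.
Let U w := xi w ^+ 2.

Definition sqsum n w := \sum_(j < n) X j w ^+ 2.
Definition polesum n (a : nat -> R) w : R[i] :=
  \sum_(j < n) pole re y M (a j) * (X j w ^+ 2)%:C.

Lemma sqsum_ge0 n w : 0 <= sqsum n w.
Proof. by apply: sumr_ge0 => j _; exact: sqr_ge0. Qed.

Lemma measurable_sqsum n : measurable_fun setT (sqsum n).
Proof. by apply: measurable_sum => j; exact: measurable_funX. Qed.

Lemma cmeasurable_polesum n a : cmeasurable setT (polesum n a).
Proof.
apply: cmeasurable_sum => j; apply: cmeasurableM; first exact: cmeasurable_cst.
by apply: cmeasurable_real; exact: measurable_funX.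
Qed.

Lemma Re_polesum n a w : Re (polesum n a w) = y * sqsum n w.
Proof.
rewrite Re_sum mulr_sumr; apply: eq_bigr => j _.
by rewrite ReM /= mulr0 subr0.
Qed.

(** Writing the prefactor as the sum of its n summands gives n products over independent
    coordinates: [K2] in the chosen coordinate, [pexp] in all others. *)
Lemma cint_sum_pexp n (a : nat -> R) (x_ : nat -> R) : 0 < x_ n ->
  cint P setT (fun w => (sqsum n w / x_ n)%:C * cexp (- (polesum n a w * (x_ n)^-1%:C))) =
  \sum_(i < n) psi P U re y M x_ n (a i) * \prod_(j < n | j != i) phi P U re y M x_ n (a j).
Proof.
move=> r0; set r := x_ n.
pose f i j (x : R) := if j == i :> nat then K2 re y M (a j) (x ^+ 2 / r)
  else pexp re y M (a j) (x ^+ 2 / r).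
have v0 x : 0 <= x ^+ 2 / r by rewrite divr_ge0 ?sqr_ge0// ltW.
have mv : measurable_fun setT (fun x : R => x ^+ 2 / r).
  by apply: measurable_funM => //; exact: measurable_funX.
have mpe s : cmeasurable setT (fun x : R => pexp re y M s (x ^+ 2 / r)).
  exact: cmeasurable_pexp.
have mK s : cmeasurable setT (fun x : R => K2 re y M s (x ^+ 2 / r)).
  by apply: cmeasurableM; [exact: cmeasurable_real|exact: mpe].
have mf i j : cmeasurable setT (f i j) by rewrite /f; case: (j == i).
have fM i j x : normc (f i j x) <= 1 + y^-1.
  rewrite /f; case: (j == i).
    by apply: le_trans (normc_K2 _ _ _ _ _) _ => //; rewrite lerDr.
  by apply: le_trans (normc_pexp_le1 _ _ _ _ _) _ => //; rewrite lerDl invr_ge0 ltW.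
have -> : (fun w => (sqsum n w / r)%:C * cexp (- (polesum n a w * r^-1%:C))) =
   (fun w => \sum_(i < n) \prod_(j < n) f i j (X j w)).
  apply/funext => w.
  have -> : cexp (- (polesum n a w * r^-1%:C)) =
      \prod_(j < n) pexp re y M (a j) (X j w ^+ 2 / r).
    rewrite -cexp_sum sumrN mulr_suml; congr (cexp (- _)).
    apply: eq_bigr => j _; rewrite -mulrA; congr (_ * _).
    by apply: complex_ext; rewrite ?ReZ ?ImZ /= ?mulr0.
  rewrite /sqsum mulr_suml rmorph_sum mulr_suml; apply: eq_bigr => i _.
  rewrite (bigD1 i)//= [RHS](bigD1 i)//= {1}/f eqxx mulrA; congr (_ * _).
  by apply: eq_bigr => j ji; rewrite /f ifN.
rewrite cint_sum//; last first.
  move=> i; apply: (@cintegrable_bounded _ _ _ _ _ (\prod_(j < n) (1 + y^-1))).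
    by apply: cmeasurable_prod => j; apply: cmeasurable_comp.
  by move=> w; rewrite normc_prod; apply: ler_prod => j _; rewrite normc_ge0 fM.
apply: eq_bigr => i _.
rewrite (@cint_prod_independent _ _ _ P X (fun j => @measurable_funPT _ _ _ _ (X j)) X_iid.1
  n (f i) (fun=> 1 + y^-1) (mf i) (fM i)).
rewrite (bigD1 i)//=; congr (_ * _).
  rewrite /psi -(same_law_cint (X_iid.2 i) (mK (a i))) //.
  by rewrite /f eqxx.
apply: eq_bigr => j ji; rewrite /phi -(same_law_cint (X_iid.2 j) (mpe (a j))).
by congr (cint _ _ _); apply/funext => w; rewrite /f ifN.
Qed.

Notation mu := (@lebesgue_measure R).

Definition laplace n a (q : R) (s : R) w : R[i] :=
  (sqsum n w / q)%:C * cexp (- (polesum n a w * (s / q)%:C)).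

Lemma polesum_re n w : polesum n (fun=> re) w = (y * sqsum n w)%:C.
Proof.
rewrite /polesum -mulr_sumr /pole clamp_id// subrr.
apply: complex_ext; rewrite ?ReM ?ImM Re_sum Im_sum /=; last first.
  by rewrite big1 ?mulr0 ?mul0r ?addr0.
by rewrite mul0r subr0.
Qed.

Section transform.
Variables (n : nat) (a : nat -> R) (q : R).
Hypothesis q0 : 0 < q.

Lemma normc_laplace s w :
  normc (laplace n a q s w) = sqsum n w / q * expR (- (y * sqsum n w * (s / q))).
Proof.
rewrite Normc.normcM normc_real ger0_norm ?divr_ge0 ?sqsum_ge0 ?(ltW q0)//.
by rewrite normc_cexp ReN mulrC (mulrC (polesum n a w)) ReZ Re_polesum !(mulrC (s / q)) mulrC.
Qed.

Lemma cintegrable_laplace w : cintegrable mu Rpos (fun s => laplace n a q s w).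
Proof.
have [S0|S0] := eqVneq (sqsum n w) 0.
  rewrite (_ : (fun s => _) = (fun=> 0)); first exact: cintegrable0.
  by apply/funext => s; rewrite /laplace S0 mul0r mul0r.
have Sp : 0 < sqsum n w by rewrite lt0r S0 sqsum_ge0.
have z01 : 0 <= (0 : R) < 1 by rewrite lexx ltr01.
have r0 : 0 < y * sqsum n w / q by rewrite divr_gt0// mulr_gt0.
have ig := integrable_scale (sqsum n w / q) mRpos (integrable_Rpos_pow_exp z01 r0).
apply: (cintegrable_le mRpos _ ig).
  apply: cmeasurableM; first exact: cmeasurable_cst.
  apply: cmeasurable_cexp; rewrite (_ : (fun s => _) =
    (fun s => (- polesum n a w) * (s / q)%:C)); last by apply/funext => s; rewrite mulNr.
  apply: cmeasurableM; first exact: cmeasurable_cst.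
  by apply: cmeasurable_real; apply: measurable_funM.
move=> s _; rewrite normc_laplace oppr0 powRr0 mul1r.
by rewrite (_ : y * sqsum n w / q * s = y * sqsum n w * (s / q))// mulrAC mulrA.
Qed.

Lemma cmeasurable_laplace s : cmeasurable setT (laplace n a q s).
Proof.
apply: cmeasurableM.
  by apply: cmeasurable_real; apply: measurable_funM => //; exact: measurable_sqsum.
apply: cmeasurable_cexp; rewrite (_ : (fun s => _) =
    (fun w => (- (s / q))%:C * polesum n a w)); last first.
  by apply/funext => z; rewrite rmorphN mulNr mulrC.
by apply: cmeasurableM; [exact: cmeasurable_cst|exact: cmeasurable_polesum].
Qed.

Lemma cintegrable_laplace_prob s : 0 < s -> cintegrable P setT (laplace n a q s).
Proof.
move=> s0; apply: (@cintegrable_bounded _ _ _ _ _ ((s * y)^-1) (cmeasurable_laplace s)) => w.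
rewrite normc_laplace expRN ler_pdivrMr ?expR_gt0// ler_pdivlMl ?mulr_gt0//.
apply: le_trans (expR_ge1Dx _).
rewrite (_ : y * _ * _ = s * y * (sqsum n w / q)); first by rewrite lerDr.
by ring.
Qed.

Lemma cint_laplace w :
  cint mu Rpos (fun s => laplace n a q s w) = (sqsum n w)%:C / polesum n a w.
Proof.
have [S0|S0] := eqVneq (sqsum n w) 0.
  rewrite S0 mul0r (_ : (fun s => _) = (fun=> 0)).
    by apply: complex_ext; rewrite /= /Rintegral integral0.
  by apply/funext => s; rewrite /laplace S0 mul0r mul0r.
have Sp : 0 < sqsum n w by rewrite lt0r S0 sqsum_ge0.
pose C := polesum n a w * (q^-1)%:C.
have C0 : 0 < Re C by rewrite /C mulrC ReZ Re_polesum mulr_gt0 ?invr_gt0// mulr_gt0.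
(* With exponent 1, [stretched] is a plain exponential. *)
transitivity (cint mu Rpos (fun s => (sqsum n w / q)%:C * stretched 1 C s)).
  apply: eq_cint => s; rewrite RposE => s0.
  rewrite /laplace /stretched subrr powRr0 mul1r powRr1 ?(ltW s0)// /C; congr (_ * cexp (- _)).
  by rewrite -mulrA; congr (_ * _); apply: complex_ext; rewrite ?ReZ ?ImZ /= ?mulr0// mulrC.
rewrite cintZ//; last exact: cintegrable_stretched.
rewrite cint_stretched// mul1r /C.
have qn : q%:C != 0 :> R[i] by rewrite -normc_gt0 normc_real normr_gt0 gt_eqF.
have -> : (q^-1)%:C = (q%:C)^-1 :> R[i] by rewrite fmorphV.
have -> : (sqsum n w / q)%:C = (sqsum n w)%:C * (q%:C)^-1 :> R[i] by rewrite rmorphM /= fmorphV.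
by rewrite invfM invrK mulrACA mulVf ?mulr1.
Qed.

End transform.

Section transform_mean.
Variables (n : nat) (a : nat -> R) (q : R).
Hypothesis q0 : 0 < q.

(** For the constant array the sum of the p_i U_i is y S, so the integral over s is exactly 1 / y
    unless S = 0. This makes the integrals of the dominating sequence explicit. *)
Lemma cint_laplace_re (w : T) :
  cint mu Rpos (fun s => laplace n (fun=> re) q s w) = ((sqsum n w != 0)%:R / y)%:C.
Proof.
rewrite cint_laplace// polesum_re.
have [->|S0] := eqVneq (sqsum n w) 0; first by rewrite !mul0r.
by rewrite -fmorphV -rmorphM /= mul1r invfM mulrCA mulfV ?mulr1.
Qed.

(** The modulus sees only the common real part y of the poles; the constant array therefore
    dominates every other one, with equality. *)
Lemma normc_laplace_re s w :
  normc (laplace n a q s w) = Re (laplace n (fun=> re) q s w).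
Proof.
rewrite normc_laplace// /laplace ReZ polesum_re -rmorphM -rmorphN cexp_real.
by rewrite mulrA.
Qed.

Let jlaplace (z : measurableTypeR R * T) : R[i] := (\1_(Rpos : set R) z.1)%:C * laplace n a q z.1 z.2.

Let mjlaplace : cmeasurable setT jlaplace.
Proof.
have mS : measurable_fun setT (fun z : measurableTypeR R * T => sqsum n z.2).
  exact: (measurableT_comp (measurable_sqsum n) measurable_snd).
have [mWR mWI] := cmeasurable_polesum n a.
apply: cmeasurableM.
  apply: cmeasurable_real.
  exact: (measurableT_comp (@measurable_indic _ _ R setT (Rpos : set R) mRpos) measurable_fst).
apply: cmeasurableM.
  by apply: cmeasurable_real; apply: measurable_funM.
apply: cmeasurable_cexp; rewrite (_ : (fun s => _) =
    (fun z : measurableTypeR R * T => (- (z.1 / q))%:C * polesum n a z.2)); last first.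
  by apply/funext => z; rewrite rmorphN mulNr mulrC.
apply: cmeasurableM.
  apply: cmeasurable_real; apply: measurableT_comp => //.
  by apply: measurable_funM.
by split; [exact: (measurableT_comp mWR measurable_snd)|exact: (measurableT_comp mWI measurable_snd)].
Qed.

Definition laplace_mean s := cint P setT (laplace n a q s).

Lemma cint_laplace_mean :
  cintegrable mu Rpos laplace_mean /\
  cint mu Rpos laplace_mean = cint P setT (fun w => (sqsum n w)%:C / polesum n a w).
Proof.
have i0 (w : T) : cintegrable mu setT (fun s => jlaplace (s, w)).
  by apply/(cintegrable_mkcond _ mRpos); exact: cintegrable_laplace.
have iP s : cintegrable P setT (fun w => jlaplace (s, w)).
  rewrite (_ : (fun w => _) = (fun w => (\1_(Rpos : set R) s)%:C * laplace n a q s w))//.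
  rewrite indicE; case: (boolP (s \in _)) => [/set_mem|_].
    rewrite RposE => s0; under eq_fun do rewrite mul1r.
    exact: cintegrable_laplace_prob.
  by under eq_fun do rewrite mul0r; exact: cintegrable0.
(* Integrating the modulus over [s] first gives at most 1 / y for every [w]. *)
have fin : (\int[mu]_s \int[P]_w (normc (jlaplace (s, w)))%:E < +oo)%E.
  have mn := cmeasurable_normc mjlaplace.
  rewrite (@fubini_tonelli _ _ _ _ _ mu P (fun z => (normc (jlaplace z))%:E)); last 2 first.
  - exact/measurable_EFinP.
  - by move=> z; rewrite lee_fin normc_ge0.
  apply: (@le_lt_trans _ _ (\int[P]_w (y^-1)%:E)%E); last by rewrite integral_prob_cst ltry.
  apply: ge0_le_integral => //.
  - by move=> w _; apply: integral_ge0 => s _; rewrite lee_fin normc_ge0.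
  - apply: (@measurable_fun_fubini_tonelli_G _ _ _ _ _ mu (fun z => (normc (jlaplace z))%:E)).
      exact/measurable_EFinP.
    by move=> z; rewrite lee_fin normc_ge0.
  move=> w _; have ia := cintegrable_abs measurableT (i0 w).
  rewrite -[X in (X <= _)%E]fineK; last exact: integrable_fin_num.
  rewrite lee_fin.
  rewrite (_ : fine _ = \int[mu]_(s in Rpos) Re (laplace n (fun=> re) q s w)); last first.
    rewrite Rintegral_mkcond; apply: eq_Rintegral => s _.
    rewrite (_ : jlaplace (s, w) = (\1_(Rpos : set R) s)%:C * laplace n a q s w)//.
    by rewrite Normc.normcM normc_real normc_laplace_re patch_indic mulrC ger0_norm.
  rewrite -[leLHS]/(Re (cint mu Rpos (fun s => laplace n (fun=> re) q s w))).
  rewrite cint_laplace_re ler_piMl ?invr_ge0 ?(ltW y0)//.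
  by case: (sqsum n w != 0).
have [h1 h2] := @cint_Fubini _ _ _ _ _ mu P jlaplace mjlaplace fin (fun s => iP s) (fun w => i0 w).
have E s : cint P setT (fun w => jlaplace (s, w)) = (\1_(Rpos : set R) s)%:C * laplace_mean s.
  rewrite (_ : (fun w => _) = (fun w => (\1_(Rpos : set R) s)%:C * laplace n a q s w))//.
  rewrite /laplace_mean indicE; case: (s \in _).
    by rewrite mul1r; under eq_fun do rewrite mul1r.
  rewrite mul0r -[RHS](cint_cst P); congr (cint _ _ _).
  by apply/funext => w; rewrite mul0r.
split.
  by apply/(cintegrable_mkcond _ mRpos); move: h1; under eq_fun do rewrite E.
rewrite cint_mkcond; move: h2; rewrite (_ : (fun s => _) = (fun s => (\1_(Rpos : set R) s)%:C * laplace_mean s)); last exact/funext.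
move=> ->; congr (cint _ _ _); apply/funext => w.
by rewrite -(cint_laplace n a q0 w) [RHS]cint_mkcond.
Qed.

End transform_mean.

Lemma integrable_sqsum_eq0 n :
  P.-integrable setT (EFin \o (fun w => (sqsum n w == 0)%:R : R)).
Proof.
apply: (@integrable_bounded _ _ _ _ _ 1); last first.
  by move=> w; case: (_ == _); rewrite ?normr1 ?normr0.
rewrite (_ : (fun w => _) = (\1_([set 0] : set R) : R -> R) \o sqsum n).
  apply: measurableT_comp; last exact: measurable_sqsum.
  by apply: measurable_indic; exact: measurable_set1.
apply/funext => w /=; rewrite indicE; congr ((nat_of_bool _)%:R).
by apply/idP/idP => [/eqP ->|/set_mem ->]; rewrite ?mem_set.
Qed.

Section zero_sum.
Hypothesis tail_gt0 : forall x : R, 0 < x -> 0 < tail P U x.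

(** By independence the probability is the n-th power of P(xi = 0), which is below 1 because the
    tail is positive at 1. *)
Lemma sqsum_eq0_cvg :
  \int[P]_w (sqsum n w == 0)%:R @[n --> \oo] --> (0 : R).
Proof.
pose Z : set R := [set 0]; pose p := fine (P (xi @^-1` Z)).
have mZ : measurable (xi @^-1` Z).
  by apply: measurable_funPTI; exact: measurable_set1.
have E n : \int[P]_w (sqsum n w == 0)%:R = p ^+ n.
  have e (w : T) : ((sqsum n w == 0)%:R)%:C = \prod_(j < n) (\1_Z (X j w))%:C :> R[i].
    rewrite -rmorph_prod; congr (_%:C).
    have [S0|S0] := eqVneq (sqsum n w) 0.
      rewrite big1// => j _; rewrite indicE mem_set// /Z /=.
      move/eqP: S0; rewrite psumr_eq0; last by move=> k _; exact: sqr_ge0.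
      by move=> /allP/(_ j (mem_index_enum j)); rewrite sqrf_eq0 => /eqP.
    have /existsP[j j0] : [exists j : 'I_n, X j w != 0].
      apply: contraNT S0; rewrite negb_exists => /forallP h.
      by apply/eqP/big1 => j _; have := h j; rewrite negbK => /eqP ->; rewrite expr0n.
    rewrite (bigD1 j)//= indicE memNset ?mul0r// /Z /= => /eqP.
    by rewrite (negbTE j0).
  have : cint P setT (fun w => ((sqsum n w == 0)%:R)%:C) = (p ^+ n)%:C.
    under eq_fun do rewrite e.
    rewrite (@cint_prod_independent _ _ _ P X (fun j => @measurable_funPT _ _ _ _ (X j)) X_iid.1
      n (fun j x => (\1_Z x)%:C) (fun=> 1)).
    - rewrite rmorphXn -[in RHS](card_ord n) -prodr_const; apply: eq_bigr => j _.
      rewrite (@same_law_cint _ _ _ _ _ _ (X_iid.2 j) (fun x => (\1_Z x)%:C)).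
        exact: (cint_indic P mZ).
      by apply: cmeasurable_real; apply: measurable_indic; exact: measurable_set1.
    - by move=> j; apply: cmeasurable_real; apply: measurable_indic; exact: measurable_set1.
    - by move=> j x; rewrite normc_real indicE; case: (x \in Z); rewrite ?normr1 ?normr0.
  by move=> /(congr1 (@complex.Re R)).
have p0 : 0 <= p by rewrite fine_ge0.
have p1 : p < 1.
  have mt : measurable [set w | 1 < U w].
    rewrite (_ : [set w | 1 < U w] = U @^-1` `]1, +oo[); last first.
      by apply/seteqP; split => w /=; rewrite in_itv/= andbT.
    have mU : measurable_fun setT U by exact: measurable_funX.
    by rewrite -[X in measurable X]setTI; exact: mU.
  have : p + tail P U 1 <= 1.
    rewrite -lerBrDl; apply: (@le_trans _ _ (fine (P (~` (xi @^-1` Z))))).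
      rewrite /tail fine_le ?fin_num_measure//; first exact: measurableC.
      apply: le_measure; rewrite ?inE//; first exact: measurableC.
      by move=> w /=; rewrite /U /Z /preimage /= => U1 x0; move: U1; rewrite x0 expr0n ltr10.
    by rewrite probability_setC// fineB ?fin_num_measure.
  by apply: lt_le_trans; rewrite ltrDl tail_gt0.
under eq_fun do rewrite E.
by apply: cvg_expr; rewrite ger0_norm.
Qed.

End zero_sum.

Section stieltjes_limit.
Variable b : R.
Hypothesis b01 : 0 < b < 1.
Hypothesis tail_gt0 : forall x : R, 0 < x -> 0 < tail P U x.
Hypothesis tail_rv : forall t : R, 0 < t ->
  tail P U (t * x) / tail P U x @[x --> +oo] --> t `^ (- b).
Hypothesis tail_cvg0 : tail P U x @[x --> +oo] --> (0 : R).
Let q := rv_quantile (tail P U).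
Let mU : measurable_fun setT U. Proof. exact: measurable_funX. Qed.
Let U0 w : 0 <= U w. Proof. exact: sqr_ge0. Qed.
Let b0 : 0 < b. Proof. by case/andP: b01. Qed.
Let q_gt0 n : 0 < q n. Proof. by apply: (lt_le_trans ltr01); exact: rv_quantile_ge1. Qed.

Let q_cvgy : q n @[n --> \oo] --> +oo.
Proof. exact: rv_quantile_cvgy. Qed.
Let q_cvg : n%:R * tail P U (q n) @[n --> \oo] --> (1 : R).
Proof. by apply: (rv_quantile_cvg b0) => // x z _; exact: tail_ni. Qed.

Section array.
Variables (nu : probability R R) (a : nat -> nat -> R).
Hypothesis a_cvg : forall (f : R -> R) K, continuous f -> (forall x, `|f x| <= K) ->
  n%:R^-1 * (\sum_(i < n) f (a n i)) @[n --> \oo] --> \int[nu]_x f x.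

Lemma laplace_mean_cvg s : 0 < s ->
  ccvg (fun n => laplace_mean n (a n) (q n) s)
    ((b * gamma_cst b y)%:C * cpow_mean re y M nu (b - 1) *
     stretched b ((gamma_cst b y)%:C * cpow_mean re y M nu b) s).
Proof.
(* The Laplace variable is absorbed into the scale: n P(U > q_n / s) tends to s^b, which becomes the
   parameter [th]. The prefactor S / x_n = s S / q_n accounts for the factor 1 / s. *)
move=> s0; pose x_ n := q n / s.
have x_gt0 n : 0 < x_ n by rewrite divr_gt0.
have x_y : x_ n @[n --> \oo] --> +oo.
  apply/cvgryPge => A; move: q_cvgy => /cvgryPge/(_ (A * s)); apply: filterS => n.
  by rewrite ler_pdivlMr.
have x_th : n%:R * tail P U (x_ n) @[n --> \oo] --> s `^ b.
  have si : 0 < s^-1 by rewrite invr_gt0.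
  have h : n%:R * tail P U (q n) * (tail P U (s^-1 * q n) / tail P U (q n)) @[n --> \oo] -->
      1 * s^-1 `^ (- b).
    by apply: cvgM => //; exact: (cvg_comp _ _ q_cvgy (tail_rv si)).
  rewrite (_ : s `^ b = 1 * s^-1 `^ (- b)); last first.
    by rewrite mul1r -powR_inv1 ?(ltW s0)// -powRrM mulN1r opprK.
  rewrite (_ : (fun n => _) = (fun n => n%:R * tail P U (q n) *
    (tail P U (s^-1 * q n) / tail P U (q n)))) //.
  apply/funext => n; rewrite /x_ (mulrC (q n)).
  by field; rewrite gt_eqF// tail_gt0.
have := sum_psi_prod_phi_cvg mU U0 b01 tail_gt0 tail_rv y0 reM x_gt0 x_y x_th a_cvg.
move=> /(ccvgM (ccvg_cst (s^-1)%:C)).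
have -> : (s^-1)%:C * ((s `^ b * (b * gamma_cst b y))%:C * cpow_mean re y M nu (b - 1) *
     cexp (- ((s `^ b * gamma_cst b y)%:C * cpow_mean re y M nu b))) =
   ((b * gamma_cst b y)%:C * cpow_mean re y M nu (b - 1) *
     stretched b ((gamma_cst b y)%:C * cpow_mean re y M nu b) s).
  rewrite /stretched.
  have -> : s `^ (b - 1) = s^-1 * s `^ b.
    by rewrite powRD ?(gt_eqF s0) ?implybT// powR_inv1 ?(ltW s0)// mulrC.
  have -> : (s `^ b * gamma_cst b y)%:C * cpow_mean re y M nu b =
    (gamma_cst b y)%:C * cpow_mean re y M nu b * (s `^ b)%:C by rewrite rmorphM /=; ring.
  by rewrite !rmorphM /=; ring.
rewrite (_ : (fun n => _) = (fun n => laplace_mean n (a n) (q n) s)) //.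
apply/funext => n; rewrite -(cint_sum_pexp _ (x_gt0 n)).
have -> : (fun w => (sqsum n w / x_ n)%:C * cexp (- (polesum n (a n) w * ((x_ n)^-1)%:C))) =
    (fun w => s%:C * laplace n (a n) (q n) s w).
  apply/funext => w; rewrite /laplace /x_ invf_div mulrA -rmorphM; congr (_%:C * _).
  by field; rewrite !gt_eqF.
rewrite cintZ//; last exact: cintegrable_laplace_prob.
by rewrite mulrA -rmorphM mulVf ?gt_eqF// mul1r.
Qed.

Let Gb0 : 0 < gamma_cst b y. Proof. exact: gamma_cst_gt0. Qed.

Let ReC_gt0 : 0 < Re ((gamma_cst b y)%:C * cpow_mean re y M nu b).
Proof. by rewrite ReZ mulr_gt0// Re_cpow_mean_gt0. Qed.

Definition laplace_lim s : R[i] := (b * gamma_cst b y)%:C * cpow_mean re y M nu (b - 1) *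
     stretched b ((gamma_cst b y)%:C * cpow_mean re y M nu b) s.

Lemma cintegrable_laplace_lim : cintegrable mu Rpos laplace_lim.
Proof. by apply: cintegrableZ => //; exact: cintegrable_stretched. Qed.

Lemma cint_laplace_lim : cint mu Rpos laplace_lim =
  cpow_mean re y M nu (b - 1) / cpow_mean re y M nu b.
Proof.
rewrite cintZ//; last exact: cintegrable_stretched.
have B0 : cpow_mean re y M nu b != 0.
  apply/eqP => B0; have := Re_cpow_mean_gt0 nu re b01 y0 M0.
  by rewrite B0 ltxx.
have bn0 : b%:C != 0 :> R[i] by rewrite -normc_gt0 normc_real normr_gt0 gt_eqF.
have gn0 : (gamma_cst b y)%:C != 0 :> R[i] by rewrite -normc_gt0 normc_real normr_gt0 gt_eqF.
rewrite cint_stretched// rmorphM /=; field; rewrite bn0 gn0 B0//.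
Qed.

End array.

Section array2.
Variables (nu : probability R R) (a : nat -> nat -> R).
Hypothesis a_cvg : forall (f : R -> R) K, continuous f -> (forall x, `|f x| <= K) ->
  n%:R^-1 * (\sum_(i < n) f (a n i)) @[n --> \oo] --> \int[nu]_x f x.

(** Pratt's lemma with the constant array as dominating sequence: its integrals (1 - P(S = 0)) / y
    tend to 1 / y, and 1 / y is also the integral y^(b-1) / y^b of the dominating limit. *)
Lemma ratio_mean_cvg :
  ccvg (fun n => cint P setT (fun w => (sqsum n w)%:C / polesum n (a n) w))
    (cpow_mean re y M nu (b - 1) / cpow_mean re y M nu b).
Proof.
rewrite -(cint_laplace_lim nu).
rewrite (_ : (fun n => _) = (fun n => cint mu Rpos (laplace_mean n (a n) (q n)))); last first.
  by apply/funext => n; rewrite (cint_laplace_mean _ _ _).2.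
pose g_ n s := Re (laplace_mean n (fun=> re) (q n) s).
pose g s := Re (laplace_lim \d_re s).
have dc : forall (f : R -> R) K, continuous f -> (forall x, `|f x| <= K) ->
    n%:R^-1 * (\sum_(i < n) f re) @[n --> \oo] --> \int[\d_re : probability R R]_x f x.
  exact: dirac_array_cvg.
apply: (@cint_pratt _ _ _ mu Rpos _ g_ _ g mRpos).
- move=> n; have [[h1 h2] _] := cint_laplace_mean n (a n) (q_gt0 n).
  by split; apply/measurable_EFinP; [exact: measurable_int h1|exact: measurable_int h2].
- by move=> n; have [[h1 h2] _] := cint_laplace_mean n (fun=> re) (q_gt0 n).
- exact: (cintegrable_laplace_lim _).1.
- move=> n s; rewrite RposE => s0.
  apply: le_trans (le_normc_cint measurableT _) _.
    exact: cintegrable_laplace_prob.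
  rewrite le_eqVlt; apply/orP; left; apply/eqP.
  by apply: eq_Rintegral => w _; rewrite normc_laplace_re.
- by move=> s; rewrite RposE => s0; exact: laplace_mean_cvg.
- move=> s; rewrite RposE => s0.
  by have [h _] := @laplace_mean_cvg \d_re (fun _ _ => re) dc s s0.
have -> : \int[mu]_(x in Rpos) g x = y^-1.
  rewrite -[LHS]/(Re (cint mu Rpos (laplace_lim \d_re))) cint_laplace_lim.
  rewrite !cpow_mean_dirac// -fmorphV -rmorphM /= powRD ?(gt_eqF y0) ?implybT//.
  by rewrite powR_inv1 ?(ltW y0)// mulrC mulrA mulVf ?mul1r// gt_eqF// powR_gt0.
have -> : (fun n => \int[mu]_(x in Rpos) g_ n x) =
    (fun n => (1 - \int[P]_w (sqsum n w == 0)%:R) / y).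
  apply/funext => n; rewrite -[LHS]/(Re (cint mu Rpos (laplace_mean n (fun=> re) (q n)))).
  rewrite (cint_laplace_mean _ _ _).2// -[LHS]/(\int[P]_w Re ((sqsum n w)%:C / polesum n (fun=> re) w)).
  have iz := integrable_sqsum_eq0 n.
  have mz : measurable_fun setT (fun w => (sqsum n w == 0)%:R : R).
    by apply/measurable_EFinP; exact: measurable_int iz.
  have i1 : P.-integrable setT (EFin \o (fun _ : T => 1 : R)).
    by apply: (@integrable_bounded _ _ _ _ _ 1) => // w; rewrite normr1.
  rewrite -[X in (X - _) / y](Rintegral_prob_cst P) -RintegralB// mulrC -RintegralZl//.
    apply: eq_Rintegral => w _; rewrite -(cint_laplace n (fun=> re) (q_gt0 n)).
    rewrite cint_laplace_re// mulrC /=.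
    by case: (_ == 0); rewrite ?subrr ?subr0.
  apply: (@integrable_bounded _ _ _ _ _ 1); first exact: measurable_funB.
  by move=> w; case: (_ == _); rewrite ?subrr ?subr0 ?normr1 ?normr0.
rewrite -[X in _ --> X]mul1r; apply: cvgM; last exact: cvg_cst.
rewrite -[X in _ --> X]subr0; apply: cvgB; first exact: cvg_cst.
exact: sqsum_eq0_cvg.
Qed.

End array2.
End stieltjes_limit.

End sums.

(** * Density of resolvents *)

Section Bernstein.
Context {R : realType}.

(* [bern n g t] is the mean of [g] under the binomial law with parameters
   [n] and [t]; the recursion conditions on one of the trials. *)
Fixpoint bern (n : nat) (g : nat -> R) (t : R) : R :=
  if n is m.+1 then t * bern m (fun j => g j.+1) t + (1 - t) * bern m g t else g 0%N.

Lemma bern_le n (g h : nat -> R) t : 0 <= t <= 1 ->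
  (forall j, (j <= n)%N -> g j <= h j) -> bern n g t <= bern n h t.
Proof.
move=> t01; have /andP[t0 t1] := t01; elim: n g h => [|n IH] g h gh /=; first exact: gh.
rewrite lerD// ler_wpM2l ?subr_ge0// IH// => j jn; apply: gh => //.
exact: leqW.
Qed.

Lemma bern_affine n (g : nat -> R) (a c t : R) :
  bern n (fun j => a * g j + c) t = a * bern n g t + c.
Proof.
elim: n g => [|n IH] g //=; rewrite (IH (fun j => g j.+1)) IH; ring.
Qed.

(** Variance plus squared bias of the binomial law. The centre is arbitrary because the recursion
    shifts it by one. *)
Lemma bern_var n (c t : R) :
  bern n (fun j => (j%:R - c) ^+ 2) t = n%:R * t * (1 - t) + (n%:R * t - c) ^+ 2.
Proof.
elim: n c => [|n IH] c /=; first by ring.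
have -> : (fun j : nat => (j.+1%:R - c) ^+ 2) = (fun j : nat => (j%:R - (c - 1)) ^+ 2).
  by apply/funext => j; rewrite -natr1; ring.
rewrite !IH -natr1; ring.
Qed.

Lemma bern_horner n (g : nat -> R) (a c : R) :
  exists p : {poly R}, forall x, bern n g (a * x + c) = p.[x].
Proof.
elim: n g => [|n IH] g /=; first by exists (g 0%N)%:P => x; rewrite hornerC.
have [p hp] := IH (fun j => g j.+1); have [r hr] := IH g.
exists ((a *: 'X + c%:P) * p + (1 - (a *: 'X + c%:P)) * r) => x.
by rewrite hp hr !hornerE.
Qed.

(** Near the diagonal uniform continuity gives e; away from it a large multiple of the squared
    distance exceeds the oscillation. This form can be integrated directly against second
    moments. *)
Lemma uniform_modulus (M e : R) (f : R -> R) : continuous f -> 0 < e ->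
  exists2 K, 0 <= K & forall s t, `|s| <= M -> `|t| <= M ->
    `|f t - f s| <= e + K * (t - s) ^+ 2.
Proof.
move=> cf e0.
have [M0|M0] := ltP M 0.
  by exists 0 => // s t sM; have := le_lt_trans sM M0; rewrite ltNge normr_ge0.
have cK : compact (`[- M, M]%classic : set R) by exact: segment_compact.
have [n hn] : exists n : nat, forall s, `[- M, M]%classic s -> forall t,
    `|t - s| < n.+1%:R^-1 -> `|f t - f s| <= e.
  have [|N _ hN] := (compact_near_coveringP _).1 cK nat \oo
    (fun n s => forall t, `|t - s| < n.+1%:R^-1 -> `|f t - f s| <= e) _; last first.
    by exists N => s sK; exact: (hN N (leqnn N)).
  move=> s sK.
  have e2 : 0 < e / 2 by rewrite divr_gt0.
  have /cvgrPdist_lt/(_ _ e2) := cf s.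
  move=> /nbhs_ballP[r /= r0 hr].
  have r2 : 0 < r / 2 by rewrite divr_gt0.
  near=> s' n => t ts'.
  have s'r : `|s - s'| < r / 2.
    by near: s'; apply/nbhs_ballP; exists (r / 2) => // u; rewrite /ball/=.
  have nr : n.+1%:R^-1 < r / 2.
    by near: n; exact: near_infty_natSinv_lt (PosNum r2).
  have h1 : `|f s - f s'| < e / 2 by apply: hr; rewrite /ball/= (lt_trans s'r)//; lra.
  have h2 : `|f s - f t| < e / 2.
    apply: hr; rewrite /ball/= -(subrK s' s) -addrA.
    rewrite (le_lt_trans (ler_normD _ _))// (splitr r) ltrD// distrC (lt_trans ts')//.
  rewrite -(subrK (f s) (f t)) -addrA (le_trans (ler_normD _ _))// (splitr e).
  by rewrite lerD ?(ltW h1)// distrC ltW.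
have cw : {within `[- M, M], continuous (fun x => `|f x|)}.
  by apply: continuous_subspaceT => x; apply: cvg_norm; exact: cf.
have MM : - M <= M by rewrite ge0_cp.
have [c _ hc] := EVT_max MM cw.
(* Twice the maximum of |f| on the interval, divided by the square of the distance 1 / (n + 1) below
   which continuity is used. *)
pose K := (`|f c| + `|f c|) * n.+1%:R ^+ 2.
exists K => [|s t sM tM]; first by rewrite mulr_ge0// addr_ge0.
have K0 : 0 <= K by rewrite mulr_ge0// addr_ge0.
have mem x : `|x| <= M -> x \in `[- M, M] by rewrite in_itv/= ler_norml.
have [ts|ts] := ltP `|t - s| n.+1%:R^-1.
  rewrite (le_trans (hn s _ t ts))//; first exact: mem.
  by rewrite lerDl mulr_ge0// sqr_ge0.
apply: (@le_trans _ _ (`|f c| + `|f c|)).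
  by rewrite (le_trans (ler_normB _ _))// lerD// hc// mem.
apply: (@le_trans _ _ (K * (t - s) ^+ 2)); last by rewrite lerDr ltW.
rewrite /K -mulrA ler_peMr ?addr_ge0// -exprMn -[leLHS](expr1n _ 2).
rewrite -[X in _ <= X]real_normK ?num_real// lerXn2r ?nnegrE//.
by rewrite normrM ger0_norm// -ler_pdivrMl// mulr1.
Unshelve. all: by end_near. Qed.

(** Bernstein polynomials, transported from [0, 1] to [-M, M] by x = M (2 t - 1). Averaging the
    quadratic modulus over the binomial law leaves e / 2 plus 4 M^2 K t (1 - t) / n. *)
Lemma Weierstrass (M e : R) (f : R -> R) : continuous f -> 0 < e ->
  exists p : {poly R}, forall x, `|x| <= M -> `|f x - p.[x]| <= e.
Proof.
move=> cf e0; have [M0|M0] := leP M 0.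
  exists (f 0)%:P => x xM; rewrite hornerC.
  have -> : x = 0 by apply/normr0_eq0/eqP; rewrite eq_le normr_ge0 (le_trans xM).
  by rewrite subrr normr0 ltW.
have e2 : 0 < e / 2 by rewrite divr_gt0.
have [K K0 hK] := uniform_modulus M cf e2.
pose n := (Num.trunc ((e / 2)^-1 * (4 * M ^+ 2 * K))).+1.
have hn : 4 * M ^+ 2 * K / n%:R <= e / 2.
  rewrite ler_pdivrMr ?ltr0n// -ler_pdivrMl//.
  by apply/ltW; exact: truncnS_gt.
pose g (j : nat) := f (M * (2 * (j%:R / n%:R) - 1)).
have [p hp] := bern_horner n g (2 * M)^-1 (2^-1).
exists p => x xM; rewrite -hp.
pose t := (2 * M)^-1 * x + 2^-1.
have /andP[xM1 xM2] : - M <= x <= M by rewrite -ler_norml.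
have M2 : 0 < 2 * M by rewrite mulr_gt0.
have t01 : 0 <= t <= 1.
  apply/andP; split; rewrite -(ler_pM2l M2) /t mulrDr mulVKf ?gt_eqF//; lra.
have xt : x = M * (2 * t - 1) by rewrite /t; field; rewrite gt_eqF.
have n0 : n%:R != 0 :> R by rewrite pnatr_eq0.
pose k := 4 * M ^+ 2 * K / n%:R ^+ 2.
have hg (j : nat) : (j <= n)%N -> `|g j - f x| <= k * (j%:R - n%:R * t) ^+ 2 + e / 2.
  move=> jn; have := hK x (M * (2 * (j%:R / n%:R) - 1)) xM.
  rewrite -/(g j) [k * _ + _]addrC.
  have -> : K * (M * (2 * (j%:R / n%:R) - 1) - x) ^+ 2 =
    k * (j%:R - n%:R * t) ^+ 2 by rewrite [in LHS]xt /k; field.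
  apply; rewrite normrM gtr0_norm// ler_piMr ?(ltW M0)//.
  have h12 : (0 <= j%:R / n%:R :> R) && (j%:R / n%:R <= 1 :> R).
    by rewrite divr_ge0//= ler_pdivrMr ?ltr0n// mul1r ler_nat.
  by case/andP: h12 => h1 h2; rewrite ler_norml; apply/andP; split; lra.
have hv : bern n (fun j => k * (j%:R - n%:R * t) ^+ 2 + e / 2) t <= e.
  rewrite bern_affine bern_var subrr expr0n addr0 /k [leRHS](splitr e) lerD2r.
  apply: le_trans hn; rewrite (_ : _ * _ = 4 * M ^+ 2 * K / n%:R * (t * (1 - t))); last by field.
  have /andP[t0 t1] := t01.
  rewrite ler_piMr ?divr_ge0 ?mulr_ge0 ?sqr_ge0//; nra.
rewrite distrC ler_norml; apply/andP; split.
  rewrite lerNl (le_trans _ hv)// -/t.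
  have -> : - (bern n g t - f x) = bern n (fun j => -1 * g j + f x) t.
    by rewrite bern_affine mulN1r opprB addrC.
  by apply: bern_le => // j /hg; rewrite ler_norml mulN1r => /andP[h _]; rewrite addrC -opprB lerNl.
apply: le_trans hv; rewrite -/t.
have -> : bern n g t - f x = bern n (fun j => 1 * g j - f x) t by rewrite bern_affine mul1r.
by apply: bern_le => // j /hg; rewrite ler_norml mul1r => /andP[].
Qed.

End Bernstein.

Section density.
Context {R : realType}.
Variables (C : (R -> R) -> Prop) (M : R).
Hypothesis M0 : 0 <= M.
Hypothesis C_lin : forall c f g, continuous f -> continuous g -> C f -> C g ->
  C (fun x => c * f x + g x).
Hypothesis C_unif : forall f, continuous f ->
  (forall e, 0 < e -> exists g, [/\ continuous g, C g & forall x, `|x| <= M -> `|f x - g x| <= e]) ->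
  C f.
Hypothesis C_im : forall w, 0 < w -> C (fun x => w / (x ^+ 2 + w ^+ 2)).
Hypothesis C_re : forall w, 0 < w -> C (fun x => x / (x ^+ 2 + w ^+ 2)).

(** Tends to x^k uniformly on [-M, M] as w grows; for k = 0 and k = 1 it is a multiple of one of the
    two given kernels. *)
Let h k w x : R := w ^+ 2 * x ^+ k / (x ^+ 2 + w ^+ 2).

Let den (w x : R) : 0 < w -> 0 < x ^+ 2 + w ^+ 2.
Proof. by move=> w0; rewrite ltr_wpDl ?sqr_ge0// exprn_gt0. Qed.

Let ch k w : 0 < w -> continuous (h k w).
Proof.
move=> w0 x; apply: cvgM.
  by apply: cvgM; [exact: cvg_cst|exact: exprn_continuous].
apply: cvgV; first by rewrite gt_eqF// den.
by apply: cvgD; [exact: exprn_continuous|exact: cvg_cst].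
Qed.

Let cX k : continuous (fun x : R => x ^+ k). Proof. exact: exprn_continuous. Qed.

Let C_cst0 : C (fun=> 0).
Proof.
have w1 : 0 < (1 : R) by exact: ltr01.
have := @C_lin (-1) (h 0 1) (h 0 1) (@ch 0%N 1 w1) (@ch 0%N 1 w1).
have E : (fun x : R => 1 / (x ^+ 2 + 1 ^+ 2)) = h 0 1.
  by apply/funext => x; rewrite /h expr1n expr0 mulr1.
have CE := C_im w1; rewrite E in CE.
have -> : (fun x => -1 * h 0 1 x + h 0 1 x) = (fun=> 0).
  by apply/funext => x; rewrite mulN1r addNr.
by apply.
Qed.

Let C_scale c f : continuous f -> C f -> C (fun x => c * f x).
Proof.
move=> cf Cf; have := C_lin c cf (@cst_continuous _ _ (0 : R)) Cf C_cst0.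
by rewrite (_ : (fun x => _) = (fun x => c * f x))//; apply/funext => x; rewrite addr0.
Qed.

(** The identity h (k+2) w = w^2 x^k - w^2 h k w raises the degree by two once x^k belongs to the
    class as a uniform limit of the [h k v]. Hence two consecutive degrees are carried in the
    induction. *)
Let C_h k w : 0 < w -> C (fun x => x ^+ k) /\ C (h k w).
Proof.
have mono k' : (forall v', 0 < v' -> C (h k' v')) -> C (fun x => x ^+ k').
  move=> Ch; apply: C_unif; first exact: cX.
  (* The error is x^(k'+2) / (x^2 + v^2); since v >= 1, v^2 >= v, and e v >= M^(k'+2). *)
  move=> e e0; pose v := M ^+ k'.+2 / e + 1.
  have v0 : 0 < v by rewrite ltr_wpDl// divr_ge0 ?exprn_ge0// ltW.
  have v1 : 1 <= v by rewrite lerDr divr_ge0 ?exprn_ge0// ltW.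
  exists (h k' v); split; [exact: ch|exact: Ch|] => x xM.
  have -> : x ^+ k' - h k' v x = x ^+ k'.+2 / (x ^+ 2 + v ^+ 2).
    by rewrite /h !exprS; field; rewrite -expr2 gt_eqF// den.
  rewrite normrM normfV (gtr0_norm (den x v0)) ler_pdivrMr ?den//.
  rewrite normrX; apply: (@le_trans _ _ (M ^+ k'.+2)); first by rewrite lerXn2r ?nnegrE.
  apply: (@le_trans _ _ (e * v)).
    by rewrite /v mulrDr mulrCA mulfV ?gt_eqF// mulr1 mulr1 lerDl ltW.
  rewrite ler_pM2l//; apply: (@le_trans _ _ (v ^+ 2)).
    by rewrite expr2 ler_peMr// ltW.
  by rewrite lerDr sqr_ge0.
suff : (forall w', 0 < w' -> C (h k w')) /\ (forall w', 0 < w' -> C (h k.+1 w')).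
  by move=> [h1 _] w0; split; [exact: mono|exact: h1].
elim: k => [|k [IH1 IH2]].
  split => w' w'0.
    have c0 : continuous (fun x : R => w' / (x ^+ 2 + w' ^+ 2)).
      move=> x; apply: cvgM; first exact: cvg_cst.
      apply: cvgV; first by rewrite gt_eqF// den.
      by apply: cvgD; [exact: exprn_continuous|exact: cvg_cst].
    have := C_scale w' c0 (C_im w'0).
    rewrite (_ : (fun x => _) = h 0 w')//; apply/funext => x.
    by rewrite /h expr0 mulr1 mulrA -expr2.
  have c0 : continuous (fun x : R => x / (x ^+ 2 + w' ^+ 2)).
    move=> x; apply: cvgM; first exact: cvg_id.
    apply: cvgV; first by rewrite gt_eqF// den.
    by apply: cvgD; [exact: exprn_continuous|exact: cvg_cst].
  have := C_scale (w' ^+ 2) c0 (C_re w'0).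
  by rewrite (_ : (fun x => _) = h 1 w')//; apply/funext => x; rewrite /h expr1 mulrA.
split=> // w' w'0.
have cE : continuous (fun x => (- w' ^+ 2) * h k w' x).
  by move=> x; apply: cvgM; [exact: cvg_cst|exact: ch].
have := C_lin (w' ^+ 2) (@cX k) cE (mono _ IH1) (C_scale (- w' ^+ 2) (@ch k w' w'0) (IH1 _ w'0)).
rewrite (_ : (fun x => _) = h k.+2 w')//; apply/funext => x.
by rewrite /h !exprS; field; rewrite -expr2 gt_eqF// den.
Qed.

(** Stated for an abstract class closed under linear combinations and uniform limits on [-M, M], so
    that it applies to the class of test functions along which two array means approach each other.
    Resolvents on the imaginary axis suffice: they generate the monomials. *)
Lemma resolvent_dense f : continuous f -> C f.
Proof.
move=> cf; apply: C_unif => // e e0; have [p hp] := Weierstrass M cf e0.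
have cp (q : {poly R}) : continuous (fun x => q.[x]) by exact: continuous_horner.
exists (fun x => p.[x]); split; [exact: cp| |exact: hp].
have -> : (fun x => p.[x]) = (fun x => \sum_(i < size p) p`_i * x ^+ i).
  by apply/funext => x; rewrite horner_coef.
have ck n : continuous (fun x : R => \sum_(i < n) p`_i * x ^+ i).
  apply: (@continuous_bigsum R n (fun i x => p`_i * x ^+ i)) => i x.
  by apply: cvgM; [exact: cvg_cst|exact: cX].
elim: (size p) => [|n IH].
  by rewrite (_ : (fun x => _) = (fun=> 0))//; apply/funext => x; rewrite big_ord0.
have := C_lin p`_n (@cX n) (ck n) (C_h n ltr01).1 IH.
by rewrite (_ : (fun x => _) = (fun x => \sum_(i < n.+1) p`_i * x ^+ i))//;
  apply/funext => x; rewrite big_ord_recr addrC.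
Qed.

End density.

(** * Riesz representation on a compact interval *)

Section ramps.
Context {R : realType}.

(** A continuous stand-in for the indicator of a left half-line with end point between [a] and
    [b]. *)
Definition ramp (a b t : R) : R := Num.max 0 (Num.min 1 ((b - t) / (b - a))).

Lemma ramp_ge0 a b t : 0 <= ramp a b t. Proof. by rewrite le_max lexx. Qed.

Lemma ramp_le1 a b t : ramp a b t <= 1.
Proof. by rewrite ge_max ler01 ge_min lexx. Qed.

Lemma ramp_eq1 a b t : a < b -> t <= a -> ramp a b t = 1.
Proof.
move=> ab ta; rewrite /ramp (min_idPl _) ?(max_idPr _)//.
by rewrite ler_pdivlMr ?subr_gt0// mul1r lerB.
Qed.

Lemma ramp_eq0 a b t : a < b -> b <= t -> ramp a b t = 0.
Proof.
move=> ab bt; apply/max_idPl; rewrite ge_min; apply/orP; right.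
by rewrite ler_pdivrMr ?subr_gt0// mul0r subr_le0.
Qed.

Lemma continuous_ramp a b : continuous (ramp a b).
Proof.
move=> t; apply: cvg_maxr; first exact: cvg_cst.
apply: cvg_minr; first exact: cvg_cst.
apply: cvgM; last exact: cvg_cst.
by apply: cvgB; [exact: cvg_cst|exact: cvg_id].
Qed.

Lemma ramp_le a b a' b' t : a < b -> b <= a' -> a' < b' -> ramp a b t <= ramp a' b' t.
Proof.
move=> ab ba ab'; have [bt|tb] := leP b t.
  by rewrite ramp_eq0// ramp_ge0.
by rewrite [leRHS]ramp_eq1 ?ramp_le1// (le_trans (ltW tb)).
Qed.

End ramps.

Lemma clamp_lip {R : realType} (M s t : R) : 0 <= M -> `|clamp M s - clamp M t| <= `|s - t|.
Proof.
move=> M0; wlog st : s t / s <= t.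
  move=> h; have [st|/ltW ts] := leP s t; first exact: h.
  by rewrite distrC [leRHS]distrC; exact: h.
have mono : clamp M s <= clamp M t.
  by rewrite /clamp ge_max !le_max lexx/= le_min !ge_min lexx orbT st/= orbT.
rewrite ler0_norm ?subr_le0// [leRHS]ler0_norm ?subr_le0// !opprB /clamp.
by rewrite /Num.max /Num.min; do ![case: ifP => //]; lra.
Qed.

Definition bounded_continuous {R : realType} (f : R -> R) :=
  continuous f /\ exists B, forall x, `|f x| <= B.

Section Riesz.
Context {R : realType}.
Variables (M : R) (L : (R -> R) -> R).
Hypothesis M0 : 0 <= M.
Hypothesis L_lin : forall c f g, bounded_continuous f -> bounded_continuous g ->
  L (fun x => c * f x + g x) = c * L f + L g.
Hypothesis L_mono : forall f g, bounded_continuous f -> bounded_continuous g ->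
  (forall t, `|t| <= M -> f t <= g t) -> L f <= L g.
Hypothesis L_one : L (fun=> 1) = 1.

Let bc_ramp (a b : R) : bounded_continuous (ramp a b).
Proof.
split; first exact: continuous_ramp.
by exists 1 => x; rewrite ger0_norm ?ramp_ge0// ramp_le1.
Qed.

Let bc_cst c : bounded_continuous (fun _ : R => c).
Proof. by split; [exact: cst_continuous|exists `|c|]. Qed.

Let bc_lin (c : R) (f g : R -> R) : bounded_continuous f -> bounded_continuous g ->
  bounded_continuous (fun x => c * f x + g x).
Proof.
move=> [cf [B hB]] [cg [B' hB']]; split.
  by move=> x; apply: cvgD; [apply: cvgM; [exact: cvg_cst|exact: cf]|exact: cg].
exists (`|c| * B + B') => x; apply: le_trans (ler_normD _ _) _.
by rewrite lerD// normrM ler_wpM2l.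
Qed.

Let L_cst c : L (fun=> c) = c.
Proof.
have L0 : L (fun=> 0) = 0.
  have := L_lin (-1) (bc_cst 0) (bc_cst 0).
  by rewrite (_ : (fun x => _) = (fun=> 0)) ?mulN1r ?addNr//; apply/funext => x; rewrite mulr0 addr0.
have := L_lin c (bc_cst 1) (bc_cst 0); rewrite L_one L0 mulr1 addr0 => E; rewrite -[RHS]E.
by congr L; apply/funext => x; rewrite mulr1 addr0.
Qed.

Let L_ramp_ge0 a b : 0 <= L (ramp a b).
Proof. by rewrite -[X in X <= _](L_cst 0); apply: L_mono => // t _; exact: ramp_ge0. Qed.

Let L_ramp_le1 a b : L (ramp a b) <= 1.
Proof. by rewrite -[X in _ <= X](L_cst 1); apply: L_mono => // t _; exact: ramp_le1. Qed.

Let S x := [set L (ramp p.1 p.2) | p in [set p : R * R | x < p.1 /\ p.1 < p.2]].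

(** The mass of ]-oo, x] approximated from above by ramps. Requiring the ramps to start strictly to
    the right of [x] makes the infimum right continuous. *)
Definition riesz_cdf (x : R) : R := inf (S x).
Let F := riesz_cdf.

Let S_lb x : has_lbound (S x).
Proof. by exists 0 => _ [p _ <-]; exact: L_ramp_ge0. Qed.

Let S_n0 x : S x !=set0.
Proof. by exists (L (ramp (x + 1) (x + 2))), (x + 1, x + 2) => //=; split; lra. Qed.

Let F_le x a b : x < a -> a < b -> F x <= L (ramp a b).
Proof. by move=> xa ab; apply: ge_inf => //; exists (a, b). Qed.

Let F_ge x a b : a < b -> b <= x -> L (ramp a b) <= F x.
Proof.
move=> ab bx; apply: lb_le_inf => // _ [[a' b']/= [xa ab'] <-].
by apply: L_mono => // t _; apply: ramp_le => //; rewrite (le_trans bx)// ltW.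
Qed.

Let F_nd : nondecreasing F.
Proof.
move=> x x' xx; apply: lb_le_inf => // _ [[a b]/= [xa ab] <-].
by apply: F_le => //; exact: le_lt_trans xa.
Qed.

Let F_ge0 x : 0 <= F x.
Proof. by apply: lb_le_inf => // _ [p _ <-]; exact: L_ramp_ge0. Qed.

Let F_le1 x : F x <= 1.
Proof. by apply: le_trans (L_ramp_le1 (x + 1) (x + 2)); apply: F_le; lra. Qed.

Let F_eq0 x : x < - M -> F x = 0.
Proof.
move=> xM; apply/eqP; rewrite eq_le F_ge0 andbT.
apply: (@le_trans _ _ (L (ramp ((x - M) / 2) (- M)))); first by apply: F_le; lra.
rewrite -[leRHS](L_cst 0); apply: L_mono => // t; rewrite ler_norml => /andP[t1 _].
by rewrite ramp_eq0//; lra.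
Qed.

Let F_eq1 x : M <= x -> F x = 1.
Proof.
move=> Mx; apply/eqP; rewrite eq_le F_le1; apply: lb_le_inf => // _ [[a b]/= [xa ab] <-].
rewrite -[leLHS](L_cst 1); apply: L_mono => // t; rewrite ler_norml => /andP[_ t2].
by rewrite ramp_eq1// (le_trans t2)// (le_trans Mx)// ltW.
Qed.

Let F_rc : right_continuous F.
Proof.
move=> x; apply/cvgrPdist_le => e e0.
have [_ [[a b]/= [xa ab] <-] Lab] := inf_adherent e0 (conj (S_n0 x) (S_lb x)).
near=> t.
have xt : x < t by near: t; exact: nbhs_right_gt.
have ta : t < a by near: t; exact: nbhs_right_lt.
rewrite distrC ger0_norm ?subr_ge0 ?F_nd ?(ltW xt)// lerBlDl.
by apply: le_trans (ltW Lab); exact: F_le.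
Unshelve. all: by end_near. Qed.

#[local] HB.instance Definition _ := isCumulative.Build R _ R riesz_cdf F_nd F_rc.

Let F_Ny0 : F @ -oo --> (0 : R).
Proof.
apply: cvg_near_cst; near=> x; apply: F_eq0.
by near: x; apply: nbhs_ninfty_lt; rewrite num_real.
Unshelve. all: by end_near. Qed.

Let F_y1 : F @ +oo --> (1 : R).
Proof.
apply: cvg_near_cst; near=> x; apply: F_eq1.
by near: x; apply: nbhs_pinfty_ge; rewrite num_real.
Unshelve. all: by end_near. Qed.

#[local] HB.instance Definition _ := isCumulativeBounded.Build R 0 1 riesz_cdf F_Ny0 F_y1.

Let idTR : measurableTypeR R -> R := idfun.

#[local] HB.instance Definition _ :=
  @isMeasurableFun.Build _ _ _ _ idTR (@measurable_id _ _ setT).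

Let lsf := lebesgue_stieltjes_measure riesz_cdf.

(** The Lebesgue-Stieltjes measure is carried by [measurableTypeR R]; its image under the identity
    lives on the measurable structure of [R] in which the laws are stated. *)
Definition riesz_measure : probability R R := distribution lsf (idTR : {RV lsf >-> R}).
Let mu := riesz_measure.

Let muE r : mu `]-oo, r]%classic = (F r)%:E.
Proof. exact: (@cdf_lebesgue_stieltjes_id _ riesz_cdf). Qed.

Let bc_measurable (f : R -> R) : bounded_continuous f -> measurable_fun setT f.
Proof. by move=> [cf _]; exact: continuous_measurable_fun. Qed.

Let bc_integrable (f : R -> R) : bounded_continuous f -> mu.-integrable setT (EFin \o f).
Proof.
move=> bf; have [_ [B hB]] := bf.
by apply: (@integrable_bounded _ _ _ _ _ B) => //; exact: bc_measurable.
Qed.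

Let I (f : R -> R) := \int[mu]_x f x.

Let I_lin c f g : bounded_continuous f -> bounded_continuous g ->
  I (fun x => c * f x + g x) = c * I f + I g.
Proof.
move=> bf bg; rewrite /I RintegralD//; last 2 first.
- by apply: integrable_scale => //; exact: bc_integrable.
- exact: bc_integrable.
by rewrite RintegralZl//; exact: bc_integrable.
Qed.

Let I_indic r : I (\1_(`]-oo, r]%classic)) = F r.
Proof.
transitivity (fine (mu `]-oo, r]%classic)); last by rewrite muE.
by rewrite /I /Rintegral integral_indic// setIT.
Qed.

Let I_cst c : I (fun=> c) = c. Proof. exact: Rintegral_prob_cst. Qed.

Let I_ramp_ge a b : a < b -> F a <= I (ramp a b).
Proof.
move=> ab; rewrite -I_indic; apply: le_Rintegral => //.
- by apply: (@integrable_bounded _ _ _ _ _ 1) => [|x]; [|rewrite indicE; case: (_ \in _); rewrite ?normr1 ?normr0].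
- exact: bc_integrable.
move=> x _; rewrite indicE; case: (boolP (x \in _)) => [/set_mem/= |_]; last exact: ramp_ge0.
by rewrite in_itv/= => xa; rewrite ramp_eq1.
Qed.

Let I_ramp_le a b : a < b -> I (ramp a b) <= F b.
Proof.
move=> ab; rewrite -I_indic; apply: le_Rintegral => //.
- exact: bc_integrable.
- by apply: (@integrable_bounded _ _ _ _ _ 1) => [|x]; [|rewrite indicE; case: (_ \in _); rewrite ?normr1 ?normr0].
move=> x _; rewrite indicE; case: (boolP (x \in _)) => [_|/negP xb]; first exact: ramp_le1.
rewrite ramp_eq0// leNgt; apply/negP => h; apply: xb; apply/mem_set; rewrite /= in_itv/=.
exact: ltW.
Qed.

Section interpolation.
Variables (f : R -> R) (A h e : R).
Hypotheses (bf : bounded_continuous f) (h0 : 0 < h) (e0 : 0 <= e).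
Hypothesis fe : forall s t, `|s - t| <= h -> `|f s - f t| <= e.

Let x_ (k : nat) := A + k%:R * h.
Let xS k : x_ k.+1 = x_ k + h. Proof. by rewrite /x_ -natr1; ring. Qed.
Let xlt k : x_ k < x_ k.+1. Proof. by rewrite xS ltrDl. Qed.

Let c_ k := f (x_ k.+1) - f (x_ k.+2).

(** Piecewise linear interpolation of [f] at the nodes from [x_ 1] to [x_ k.+1], constant beyond
    them, written as a combination of ramps so that [L] and the integral can be compared term by
    term. *)
Fixpoint interpol (k : nat) (t : R) : R := if k is m.+1 then
  c_ m * ramp (x_ m.+1) (x_ m.+2) t + (interpol m t - c_ m) else f (x_ 1).

Let c_e k : `|c_ k| <= e.
Proof.
apply: fe; rewrite ler_norml [x_ k.+2]xS; have := ltW h0; move=> ?; apply/andP; split; lra.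
Qed.

Lemma bc_interpol k : bounded_continuous (interpol k).
Proof.
elim: k => [|k IH]; first exact: bc_cst.
apply: bc_lin; first exact: bc_ramp.
have := bc_lin 1 IH (bc_cst (- c_ k)).
by rewrite (_ : (fun x => _) = (fun x => interpol k x - c_ k))//; apply/funext => x; rewrite mul1r.
Qed.

Lemma interpol_close k : (forall t, t <= x_ 1 -> f t = f (x_ 1)) ->
  forall t, (t <= x_ k.+1 -> `|interpol k t - f t| <= e) /\
    (x_ k.+1 <= t -> interpol k t = f (x_ k.+1)).
Proof.
move=> fA; elim: k => [|k IH] t /=.
  by split=> // t1; rewrite (fA t t1) subrr normr0.
have [IH1 IH2] := IH t; split => [t2|t2]; last first.
  rewrite ramp_eq0// mulr0 add0r IH2; last by rewrite (le_trans (ltW (xlt _))).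
  by rewrite /c_; ring.
have [t1|t1] := leP t (x_ k.+1).
  by rewrite ramp_eq1// mulr1 [c_ k + _]addrC subrK IH1.
rewrite IH2 ?(ltW t1)//; set r := ramp _ _ _.
have r0 : 0 <= r by exact: ramp_ge0.
have r1 : 0 <= 1 - r by rewrite subr_ge0 ramp_le1.
have -> : c_ k * r + (f (x_ k.+1) - c_ k) - f t =
  r * (f (x_ k.+1) - f t) + (1 - r) * (f (x_ k.+2) - f t) by rewrite /c_; ring.
apply: le_trans (ler_normD _ _) _; rewrite !normrM (ger0_norm r0) (ger0_norm r1).
have hx := xS k.+1.
have f1 : `|f (x_ k.+1) - f t| <= e by apply: fe; rewrite ler_norml; apply/andP; split; lra.
have f2 : `|f (x_ k.+2) - f t| <= e by apply: fe; rewrite ler_norml; apply/andP; split; lra.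
have : e = r * e + (1 - r) * e by ring.
by move=> ->; rewrite lerD// ler_wpM2l.
Qed.

(** On the ramp from [x_ k.+1] to [x_ k.+2] both functionals take values between [F (x_ k)] and
    [F (x_ k.+2)]. These differences telescope, so the total error is e times a bounded quantity,
    however many nodes there are. *)
Lemma interpol_diff k :
  `|L (interpol k) - I (interpol k)| <= e * (F (x_ k.+1) + F (x_ k) - F (x_ 1) - F (x_ 0)).
Proof.
elim: k => [|k IH].
  rewrite /= L_cst I_cst subrr normr0 (_ : _ - F (x_ 0) = 0) ?mulr0//.
  by ring.
have bk : bounded_continuous (fun t => interpol k t - c_ k).
  have := bc_lin 1 (bc_interpol k) (bc_cst (- c_ k)).
  by rewrite (_ : (fun x => _) = (fun x => interpol k x - c_ k))//; apply/funext => x; rewrite mul1r.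
have br := bc_ramp (x_ k.+1) (x_ k.+2).
have E : (fun x => interpol k x - c_ k) = (fun x => 1 * interpol k x + (- c_ k)).
  by apply/funext => x; rewrite mul1r.
have bi := bc_interpol k; have bc := bc_cst (- c_ k).
have ES : interpol k.+1 = (fun x => c_ k * ramp (x_ k.+1) (x_ k.+2) x + (interpol k x - c_ k)) by [].
rewrite ES (L_lin _ br bk) (I_lin _ br bk) E (L_lin _ bi bc) (I_lin _ bi bc) L_cst I_cst !mul1r.
have -> : c_ k * L (ramp (x_ k.+1) (x_ k.+2)) + (L (interpol k) + - c_ k) -
   (c_ k * I (ramp (x_ k.+1) (x_ k.+2)) + (I (interpol k) + - c_ k)) =
   c_ k * (L (ramp (x_ k.+1) (x_ k.+2)) - I (ramp (x_ k.+1) (x_ k.+2))) +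
   (L (interpol k) - I (interpol k)) by ring.
apply: le_trans (ler_normD _ _) _.
have -> : e * (F (x_ k.+2) + F (x_ k.+1) - F (x_ 1) - F (x_ 0)) =
   e * (F (x_ k.+2) - F (x_ k)) + e * (F (x_ k.+1) + F (x_ k) - F (x_ 1) - F (x_ 0)) by ring.
rewrite lerD// normrM ler_pM//.
have l1 := F_le (xlt k) (xlt k.+1).
have l2 := F_ge (xlt k.+1) (lexx _).
have l3 := I_ramp_ge (xlt k.+1).
have l4 := I_ramp_le (xlt k.+1).
have l5 := F_nd (ltW (xlt k)).
by rewrite ler_norml; apply/andP; split; lra.
Qed.

End interpolation.

Let functional_close (V : (R -> R) -> R) (f p : R -> R) e :
  (forall f g, bounded_continuous f -> bounded_continuous g -> (forall t, f t <= g t) -> V f <= V g) ->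
  (forall c f g, bounded_continuous f -> bounded_continuous g ->
    V (fun x => c * f x + g x) = c * V f + V g) -> (forall c, V (fun=> c) = c) ->
  bounded_continuous f -> bounded_continuous p -> (forall t, `|p t - f t| <= e) ->
  `|V p - V f| <= e.
Proof.
move=> Vm Vl Vc bf bp pf.
have h (g k : R -> R) : bounded_continuous g -> bounded_continuous k ->
    (forall t, `|g t - k t| <= e) -> V g - V k <= e.
  move=> bg bk gk; rewrite lerBlDl -[X in _ <= _ + X](Vc e) -[X in _ <= X + _]mul1r -Vl//.
  apply: Vm => //; first exact: bc_lin.
  by move=> t; have := gk t; rewrite ler_norml mul1r => /andP[_]; lra.
rewrite ler_norml h// andbT lerNl opprB h// => t.
by rewrite distrC.
Qed.

(** [F] is known to vanish strictly to the left of -M, where an atom may sit; the margin 1 ensures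
    that [F (- M1)] is 0. *)
Let M1 := M + 1.
Let M1_ge0 : 0 <= M1. Proof. by rewrite addr_ge0. Qed.

Let bc_clamp (f : R -> R) : bounded_continuous f -> bounded_continuous (fun t => f (clamp M1 t)).
Proof.
move=> [cf [B hB]]; split; last by exists B.
by move=> t; apply: (continuous_comp (@continuous_clamp R M1 t)); exact: cf.
Qed.

(** Clamping makes the function constant outside a compact interval, so that finitely many nodes
    interpolate it uniformly on the whole line. The error 4 e is e + 2 e + e. *)
Let riesz_clamp f : bounded_continuous f ->
  I (fun t => f (clamp M1 t)) = L (fun t => f (clamp M1 t)).
Proof.
move=> bf; have bf' := bc_clamp bf; set f' := fun t => _ in bf' *.
have main e : 0 < e -> `|L f' - I f'| <= 4 * e.
  move=> e0; have e2 : 0 < e / 2 by rewrite divr_gt0.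
  have [K K0 hK] := uniform_modulus M1 bf.1 e2.
  (* As h <= 1, h^2 <= h, and K h^2 <= e / 2 follows: steps of length h move the function by at most
     e. *)
  pose h := Num.min 1 (e / 2 / (K + 1)).
  have K1 : 0 < K + 1 by rewrite ltr_wpDl.
  have h0 : 0 < h by rewrite lt_min ltr01 divr_gt0.
  have h1 : h <= 1 by rewrite ge_min lexx.
  have hK2 : K * h ^+ 2 <= e / 2.
    have : h <= e / 2 / (K + 1) by rewrite ge_min lexx orbT.
    rewrite ler_pdivlMr// => hh; have : K * h ^+ 2 <= K * h.
      by rewrite ler_wpM2l// expr2 ler_piMl// ltW.
    by have := ltW h0; nra.
  have fe s t : `|s - t| <= h -> `|f' s - f' t| <= e.
    move=> st; apply: le_trans (hK _ _ (clamp_bound t M1_ge0) (clamp_bound s M1_ge0)) _.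
    rewrite [leRHS](splitr e) lerD2l; apply: le_trans hK2; rewrite ler_wpM2l//.
    rewrite -[X in X <= _]real_normK ?num_real// lerXn2r ?nnegrE ?(ltW h0)//.
    exact: le_trans (clamp_lip _ _ M1_ge0) _.
  (* The nodes start one step to the left of -M1, so that [x_ 1] is -M1 and the clamped function is
     constant before the first and after the last interpolation node. *)
  pose A := - M1 - h; pose N := (Num.trunc (2 * M1 / h)).+1.
  have x1 : A + 1%:R * h = - M1 by rewrite /A; ring.
  have xN : M1 <= A + N.+1%:R * h.
    have : 2 * M1 / h < N%:R by exact: truncnS_gt.
    by rewrite ltr_pdivrMr// /A -natr1; lra.
  pose p := interpol f' A h N.
  have bp : bounded_continuous p by exact: bc_interpol.
  have clow t : t <= - M1 -> clamp M1 t = - M1.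
    move=> tM; rewrite /clamp (min_idPl _) ?(max_idPl _)//.
    by rewrite (le_trans tM)// ge0_cp.
  have chigh t : M1 <= t -> clamp M1 t = M1.
    move=> tM; rewrite /clamp (min_idPr _)// (max_idPr _)//.
    by rewrite ge0_cp.
  have pf t : `|p t - f' t| <= e.
    have [|c1 c2] := @interpol_close f' A h e h0 (ltW e0) fe N _ t.
      by move=> u; rewrite x1 => uM; rewrite /f' !clow.
    have [tN|tN] := leP t (A + N.+1%:R * h); first exact: c1.
    rewrite /p c2 ?(ltW tN)// /f' !chigh ?subrr ?normr0 ?(ltW e0)//.
    by rewrite (le_trans xN)// ltW.
  have dL := functional_close (fun f g bf bg fg => L_mono bf bg (fun t _ => fg t)) L_lin L_cst bf' bp pf.
  have I_mono g k : bounded_continuous g -> bounded_continuous k -> (forall t, g t <= k t) -> I g <= I k.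
    by move=> bg bk gk; apply: le_Rintegral => //; exact: bc_integrable.
  have dI := functional_close I_mono I_lin I_cst bf' bp pf.
  have d := @interpol_diff f' A h e h0 fe N.
  have d2 : `|L p - I p| <= 2 * e.
    apply: le_trans d _; rewrite mulrC ler_wpM2r ?(ltW e0)//.
    have := F_le1 (A + N.+1%:R * h); have := F_le1 (A + N%:R * h).
    have := F_ge0 (A + 1%:R * h); have := F_ge0 (A + 0%:R * h); lra.
  have -> : L f' - I f' = (L f' - L p) + (L p - I p) + (I p - I f') by ring.
  rewrite (le_trans (ler_normD _ _))// (_ : 4 * e = e + 2 * e + e); last by ring.
  rewrite lerD// (le_trans (ler_normD _ _))// lerD// distrC//.
apply/esym/eqP; rewrite -subr_eq0 -normr_le0; apply/ler_addgt0Pl => e e0.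
rewrite addr0; have := main (e / 4); rewrite mulrCA mulfV// mulr1; apply.
by rewrite divr_gt0.
Qed.

Lemma riesz_representation f : bounded_continuous f -> \int[mu]_x f x = L f.
Proof.
move=> bf; have bf' := bc_clamp bf.
have -> : L f = L (fun t => f (clamp M1 t)).
  have cM t : `|t| <= M -> clamp M1 t = t.
    by move=> tM; rewrite clamp_id// (le_trans tM)// lerDl.
  by apply/eqP; rewrite eq_le; apply/andP; split; apply: L_mono => // t /cM ->.
rewrite -riesz_clamp//; have [_ [B hB]] := bf.
(* A majorant of the effect of clamping, supported off ]-M1, M1]; its integral is 2 B (F (- M1) + 1
   - F M1) = 0. *)
pose g x := 2 * B * (\1_(`]-oo, (- M1)%R]%classic) x + (1 - \1_(`]-oo, M1]%classic) x)) : R.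
have i1 r : mu.-integrable setT (EFin \o (\1_(`]-oo, r]%classic) : R -> R)).
  apply: (@integrable_bounded _ _ _ _ _ 1) => [|x]; first exact: measurable_indic.
  by rewrite indicE; case: (_ \in _); rewrite ?normr1 ?normr0.
have ic : mu.-integrable setT (EFin \o (fun _ : R => 1 : R)) by exact: bc_integrable.
have i2 : mu.-integrable setT (EFin \o (fun x => 1 - \1_(`]-oo, M1]%classic) x : R)).
  apply: (@integrable_bounded _ _ _ _ _ 1) => [|x].
    by apply: measurable_funB => //; exact: measurable_indic.
  by rewrite indicE; case: (_ \in _); rewrite ?subrr ?subr0 ?normr1 ?normr0.
have ig : mu.-integrable setT (EFin \o g).
  by apply: integrable_scale => //; exact: integrable_add.
have g0 : \int[mu]_x g x = 0.
  rewrite RintegralZl//; last exact: integrable_add.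
  rewrite RintegralD// -/(I _) I_indic F_eq0; last by rewrite ltrN2 /M1; lra.
  rewrite RintegralB// -/(I (\1_(`]-oo, M1]%classic))) I_indic F_eq1; last by rewrite /M1; lra.
  by rewrite Rintegral_prob_cst subrr addr0 mulr0.
apply/eqP; rewrite -subr_eq0 -normr_le0 -/(I f) -RintegralB//; try exact: bc_integrable.
have ib := bc_integrable bf; have ib' := bc_integrable bf'.
have iB : mu.-integrable setT (EFin \o (fun x => f x - f (clamp M1 x))).
  rewrite (_ : _ \o _ = EFin \o (fun x => f x + -1 * f (clamp M1 x))).
    by apply: integrable_add => //; exact: integrable_scale.
  by apply/funext => x /=; rewrite mulN1r.
rewrite -g0; apply: le_trans (le_normr_Rintegral measurableT iB) _.
apply: le_Rintegral => //; first exact: integrable_norm.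
move=> x _; rewrite /g !indicE.
have B0 : 0 <= B by exact: le_trans (hB 0).
have BB : `|f x - f (clamp M1 x)| <= 2 * B.
  by rewrite (le_trans (ler_normB _ _))// mulr2n mulrDl mul1r lerD.
case: (boolP (x \in `]-oo, (- M1)%R]%classic)) => h1.
  rewrite (le_trans BB)// ler_peMr ?mulr_ge0// lerDl subr_ge0.
  by case: (x \in _).
case: (boolP (x \in `]-oo, M1]%classic)) => h2; last by rewrite add0r subr0 mulr1.
rewrite add0r subrr mulr0 clamp_id ?subrr ?normr0//.
move/negP: h1 => h1; move/set_mem: h2; rewrite /= in_itv/= => h2.
rewrite ler_norml h2 andbT leNgt; apply/negP => h; apply: h1; apply/mem_set.
by rewrite /= in_itv/= ltW.
Qed.

End Riesz.

(** * Limit law for deterministic diagonals *)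

Definition array_cvg {R : realType} (nu : probability R R) (a : nat -> nat -> R) :=
  forall f : R -> R, bounded_continuous f ->
    n%:R^-1 * (\sum_(i < n) f (a n i)) @[n --> \oo] --> \int[nu]_x f x.

Lemma array_cvgE {R : realType} (nu : probability R R) (a : nat -> nat -> R) :
  array_cvg nu a -> forall (f : R -> R) (K : R), continuous f -> (forall x, `|f x| <= K) ->
    n%:R^-1 * (\sum_(i < n) f (a n i)) @[n --> \oo] --> \int[nu]_x f x.
Proof. by move=> ha f K cf fK; apply: ha; split => //; exists K. Qed.

Section resolvent_functions.
Context {R : realType}.
Variables (re y : R).
Hypothesis y0 : 0 < y.

Definition resolvent (x : R) : R[i] := (x%:C - (re +i* y))^-1.

Let den (x : R) : 0 < (x - re) ^+ 2 + y ^+ 2.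
Proof. by rewrite ltr_wpDl ?sqr_ge0// exprn_gt0. Qed.

Lemma Re_resolvent x : Re (resolvent x) = (x - re) / ((x - re) ^+ 2 + y ^+ 2).
Proof. by rewrite ReV sqr_normc_def /= sub0r sqrrN. Qed.

Lemma Im_resolvent x : Im (resolvent x) = y / ((x - re) ^+ 2 + y ^+ 2).
Proof. by rewrite ImV sqr_normc_def /= sub0r sqrrN opprK. Qed.

Lemma normc_resolvent x : normc (resolvent x) <= y^-1.
Proof.
rewrite Normc.normcV lef_pV2 ?posrE ?normc_gt0//; last first.
  by apply/eqP => /(congr1 (@complex.Im R)) /= /eqP; rewrite sub0r oppr_eq0 gt_eqF.
apply: le_trans (le_Im_normc _); rewrite /= sub0r normrN.
exact: ler_norm.
Qed.

Let c2 : continuous (fun x : R => ((x - re) ^+ 2 + y ^+ 2)^-1).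
Proof.
move=> x; apply: cvgV; first by rewrite gt_eqF// den.
apply: cvgD; last exact: cvg_cst.
apply: (@continuous_comp _ _ _ (fun x : R => x - re) (fun x => x ^+ 2)).
  by apply: cvgB; [exact: cvg_id|exact: cvg_cst].
exact: exprn_continuous.
Qed.

Lemma bc_Re_resolvent : bounded_continuous (fun x => Re (resolvent x)).
Proof.
split; last by exists y^-1 => x; exact: le_trans (le_Re_normc _) (normc_resolvent x).
rewrite (_ : (fun x => _) = (fun x => (x - re) * ((x - re) ^+ 2 + y ^+ 2)^-1)); last first.
  by apply/funext => x; exact: Re_resolvent.
move=> x.
by apply: cvgM; [apply: cvgB; [exact: cvg_id|exact: cvg_cst]|exact: c2].
Qed.

Lemma bc_Im_resolvent : bounded_continuous (fun x => Im (resolvent x)).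
Proof.
split; last by exists y^-1 => x; exact: le_trans (le_Im_normc _) (normc_resolvent x).
rewrite (_ : (fun x => _) = (fun x => y * ((x - re) ^+ 2 + y ^+ 2)^-1)); last first.
  by apply/funext => x; exact: Im_resolvent.
move=> x.
by apply: cvgM; [exact: cvg_cst|exact: c2].
Qed.

End resolvent_functions.

Lemma cvg_sub_prod {R : realType} (u v : nat -> R) (l : R) :
  u n @[n --> \oo] --> l -> v n @[n --> \oo] --> l ->
  u p.1 - v p.2 @[p --> filter_prod \oo \oo] --> (0 : R).
Proof.
move=> ul vl; rewrite -[X in _ --> X](subrr l); apply: cvgB.
  exact: (cvg_comp _ _ cvg_fst ul).
exact: (cvg_comp _ _ cvg_snd vl).
Qed.

Section array_law.
Context d (T : measurableType d) (R : realType) (P : probability T R).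
Variables (xi : {RV P >-> R}) (X : nat -> {RV P >-> R}).
Hypothesis X_iid : iid_copies P xi X.
Let U w := xi w ^+ 2.
Variable b : R.
Hypothesis b01 : 0 < b < 1.
Hypothesis tail_gt0 : forall x : R, 0 < x -> 0 < tail P U x.
Hypothesis tail_rv : forall t : R, 0 < t ->
  tail P U (t * x) / tail P U x @[x --> +oo] --> t `^ (- b).
Hypothesis tail_cvg0 : tail P U x @[x --> +oo] --> (0 : R).

Definition diagform n (a : nat -> R) (w : T) : R :=
  (\sum_(i < n) a i * X i w ^+ 2) / sqsum X n w.

Lemma measurable_diagform n a : measurable_fun setT (diagform n a).
Proof.
rewrite (_ : diagform n a = (fun w => (\sum_(i < n) a i * X i w ^+ 2) * (sqsum X n w) `^ (-1))); last first.
  by apply/funext => w; rewrite /diagform powR_inv1// sqsum_ge0.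
apply: measurable_funM.
  by apply: measurable_sum => i; apply: measurable_funM => //; exact: measurable_funX.
apply: (measurableT_comp (f := (fun x : R => x `^ (-1)))); first exact: measurable_powR.
exact: measurable_sqsum.
Qed.

Lemma diagform_bound n a M w : 0 <= M -> (forall i, `|a i| <= M) -> `|diagform n a w| <= M.
Proof.
move=> M0 aM; rewrite normrM normfV (ger0_norm (sqsum_ge0 X n w)).
have [->|S0] := eqVneq (sqsum X n w) 0; first by rewrite invr0 mulr0.
rewrite ler_pdivrMr; last by rewrite lt0r S0 sqsum_ge0.
apply: le_trans (ler_norm_sum _ _ _) _; rewrite mulr_sumr; apply: ler_sum => i _.
by rewrite normrM [X in _ * X]ger0_norm ?sqr_ge0// ler_wpM2r ?sqr_ge0.
Qed.

(** On S = 0 the two sides disagree: by the convention on inverses the left is the resolvent at 0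
    and the right is 0. *)
Lemma resolvent_diagform re y M n a w : 0 < y -> (forall i, `|a i| <= M) ->
  sqsum X n w != 0 ->
  resolvent re y (diagform n a w) = 'i%C * ((sqsum X n w)%:C / polesum X re y M n a w).
Proof.
move=> y0 aM S0.
have E : polesum X re y M n a w =
    'i%C * (sqsum X n w)%:C * ((diagform n a w)%:C - (re +i* y)).
  have e1 : polesum X re y M n a w =
     (y * sqsum X n w) +i* (\sum_(i < n) a i * X i w ^+ 2 - re * sqsum X n w).
    apply: complex_ext; first by rewrite Re_polesum.
    rewrite Im_sum /= /sqsum mulr_sumr -sumrB; apply: eq_bigr => i _.
    by rewrite mulr0 add0r clamp_id// mulrBl.
  rewrite e1; apply: complex_ext; rewrite /diagform /=; field; exact: S0.
have S0' : (sqsum X n w)%:C != 0 :> R[i] by rewrite -normc_gt0 normc_real normr_gt0.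
have i0 : 'i%C != 0 :> R[i] by rewrite -normc_gt0 /= expr0n add0r sqrtr_gt0 expr1n.
rewrite E /resolvent !invfM; set q := _ - _.
transitivity ('i%C * ('i%C)^-1 * ((sqsum X n w)%:C * ((sqsum X n w)%:C)^-1) * q^-1).
  by rewrite !mulfV// !mul1r.
by ring.
Qed.

Section one_array.
Variables (re y M : R) (nu : probability R R) (a : nat -> nat -> R).
Hypotheses (y0 : 0 < y) (reM : `|re| <= M) (aM : forall n i, `|a n i| <= M).
Hypothesis a_cvg : array_cvg nu a.

Let M0 : 0 <= M. Proof. exact: le_trans reM. Qed.

Lemma resolvent_mean_cvg :
  ccvg (fun n => cint P setT (fun w => resolvent re y (diagform n (a n) w)))
    ('i%C * (cpow_mean re y M nu (b - 1) / cpow_mean re y M nu b)).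
Proof.
have h := ratio_mean_cvg X_iid y0 reM b01 tail_gt0 tail_rv tail_cvg0 (array_cvgE a_cvg).
apply: (ccvg_sub0 (ccvgM (ccvg_cst 'i%C) h)).
have S0 n : P.-integrable setT (EFin \o (fun w => (sqsum X n w == 0)%:R : R)).
  exact: integrable_sqsum_eq0.
have mr n : cmeasurable setT (fun w => resolvent re y (diagform n (a n) w)).
  apply: (@cmeasurable_comp _ _ _ (resolvent re y)); last exact: measurable_diagform.
  split; apply: continuous_measurable_fun.
    exact: (bc_Re_resolvent re y0).1.
  exact: (bc_Im_resolvent re y0).1.
have mq n : cmeasurable setT (fun w => (sqsum X n w)%:C / polesum X re y M n (a n) w).
  apply: cmeasurableM; first by apply: cmeasurable_real; exact: measurable_sqsum.
  by apply: cmeasurable_inv; exact: cmeasurable_polesum.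
have qle n w : normc ((sqsum X n w)%:C / polesum X re y M n (a n) w) <= y^-1.
  have [->|Sn0] := eqVneq (sqsum X n w) 0; first by rewrite mul0r Normc.normc0 invr_ge0 ltW.
  have Sp : 0 < sqsum X n w by rewrite lt0r Sn0 sqsum_ge0.
  rewrite Normc.normcM Normc.normcV normc_real gtr0_norm//.
  have hW : y * sqsum X n w <= normc (polesum X re y M n (a n) w).
    rewrite -(Re_polesum X re y M n (a n)).
    by apply: le_trans (ler_norm _) (le_Re_normc _).
  rewrite ler_pdivrMr; last by apply: lt_le_trans hW; rewrite mulr_gt0.
  by rewrite ler_pdivlMl.
(* The resolvent and the rotated ratio coincide off S = 0, so their means differ by at most P(S = 0)
   / y. *)
apply: (@squeeze_cvgr _ _ _ _ (fun=> 0) (fun n => y^-1 * \int[P]_w (sqsum X n w == 0)%:R)).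
- apply: nearW => n; rewrite normc_ge0 andTb.
  have ir : cintegrable P setT (fun w => resolvent re y (diagform n (a n) w)).
    by apply: (@cintegrable_bounded _ _ _ _ _ y^-1 (mr n)) => w; exact: normc_resolvent.
  have iq : cintegrable P setT (fun w => (sqsum X n w)%:C / polesum X re y M n (a n) w).
    exact: (@cintegrable_bounded _ _ _ _ _ y^-1 (mq n)).
  have -> : cint P setT (fun w => resolvent re y (diagform n (a n) w)) -
      'i%C * cint P setT (fun w => (sqsum X n w)%:C / polesum X re y M n (a n) w) =
    cint P setT (fun w => resolvent re y (diagform n (a n) w) +
      (- 'i%C) * ((sqsum X n w)%:C / polesum X re y M n (a n) w)).
    by rewrite cintD// ?cintZ// ?mulNr//; exact: cintegrableZ.
  have id : cintegrable P setT (fun w => resolvent re y (diagform n (a n) w) +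
      (- 'i%C) * ((sqsum X n w)%:C / polesum X re y M n (a n) w)).
    by apply: cintegrableD => //; exact: cintegrableZ.
  apply: le_trans (le_normc_cint measurableT id) _.
  rewrite -RintegralZl//; apply: le_Rintegral => //.
  + exact: cintegrable_abs.
  + exact: integrable_scale.
  move=> w _; have [Sn0|Sn0] := eqVneq (sqsum X n w) 0.
    by rewrite Sn0 mul0r mulr0 addr0 mulr1 normc_resolvent.
  rewrite (resolvent_diagform _ y0 (aM n))// mulNr subrr Normc.normc0 mulr0//.
- exact: cvg_cst.
- by rewrite -[X in _ --> X](mulr0 y^-1); apply: cvgM; [exact: cvg_cst|exact: (sqsum_eq0_cvg X_iid tail_gt0)].
Qed.

End one_array.

Definition array_mean n (a : nat -> R) (f : R -> R) := \int[P]_w f (diagform n a w).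

Section array_mean.
Variables (n : nat) (a : nat -> R) (M : R).
Hypotheses (M0 : 0 <= M) (aM : forall i, `|a i| <= M).

Let D w := diagform n a w.

Lemma integrable_diagform (f : R -> R) : continuous f -> P.-integrable setT (EFin \o (fun w => f (D w))).
Proof.
(* The modulus with e = 1, taken from the point 0, serves as a bound of [f] on [-M, M]. *)
move=> cf; have [K K0 hK] := uniform_modulus M cf ltr01.
apply: (@integrable_bounded _ _ _ _ _ (`|f 0| + 1 + K * M ^+ 2)).
  by apply: measurableT_comp; [exact: continuous_measurable_fun|exact: measurable_diagform].
move=> w; have DM := @diagform_bound n a M w M0 aM.
have := hK 0 (D w); rewrite normr0 subr0 => /(_ M0 DM) h.
rewrite -(subrK (f 0) (f _)) addrC (le_trans (ler_normD _ _))// -addrA lerD2l.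
apply: le_trans h _; rewrite lerD2l ler_wpM2l// -[X in X <= _]real_normK ?num_real//.
by rewrite lerXn2r ?nnegrE.
Qed.

Lemma array_mean_lin (c : R) (f g : R -> R) : continuous f -> continuous g ->
  array_mean n a (fun x => c * f x + g x) = c * array_mean n a f + array_mean n a g.
Proof.
move=> cf cg; have i1 := integrable_diagform cf; have i2 := integrable_diagform cg.
rewrite /array_mean RintegralD//; last exact: integrable_scale.
by rewrite RintegralZl.
Qed.

Lemma array_mean_le (f g : R -> R) : continuous f -> continuous g ->
  (forall t, `|t| <= M -> f t <= g t) -> array_mean n a f <= array_mean n a g.
Proof.
move=> cf cg fg; apply: le_Rintegral => //; [exact: integrable_diagform..|].
by move=> w _; apply: fg; exact: diagform_bound.
Qed.

Lemma array_mean_cst c : array_mean n a (fun=> c) = c.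
Proof. exact: Rintegral_prob_cst. Qed.

Lemma array_mean_close (f g : R -> R) e : continuous f -> continuous g ->
  (forall t, `|t| <= M -> `|f t - g t| <= e) -> `|array_mean n a f - array_mean n a g| <= e.
Proof.
move=> cf cg fg.
have h (f' g' : R -> R) : continuous f' -> continuous g' -> (forall t, `|t| <= M -> `|f' t - g' t| <= e) ->
    array_mean n a f' - array_mean n a g' <= e.
  move=> cf' cg' fg'; have ce : continuous (fun _ : R => e) by exact: cst_continuous.
  rewrite lerBlDl -[X in _ <= _ + X](array_mean_cst e) -[X in _ <= X + _]mul1r.
  rewrite -array_mean_lin//; apply: array_mean_le => //.
    move=> x; apply: cvgD; last exact: cvg_cst.
    by apply: cvgM; [exact: cvg_cst|exact: cg'].
  by move=> t /fg'; rewrite ler_norml mul1r => /andP[_]; lra.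
rewrite ler_norml h// andbT lerNl opprB h// => t tM.
by rewrite distrC fg.
Qed.

End array_mean.

(** The limits of the resolvent means depend on nu alone, and density carries this over to
    continuous functions. With equal arrays the statement is the Cauchy property; along the diagonal
    of index pairs it identifies the limits of two arrays. *)
Lemma array_pair (nu : probability R R) (M : R) (a a' : nat -> nat -> R) :
  0 <= M -> (forall n i, `|a n i| <= M) -> (forall n i, `|a' n i| <= M) ->
  array_cvg nu a -> array_cvg nu a' -> forall f, continuous f ->
  array_mean p.1 (a p.1) f - array_mean p.2 (a' p.2) f @[p --> filter_prod \oo \oo] --> (0 : R).
Proof.
move=> M0 aM aM' ha ha'.
apply: (@resolvent_dense R (fun f =>
  array_mean p.1 (a p.1) f - array_mean p.2 (a' p.2) f @[p --> filter_prod \oo \oo] --> (0 : R)) M) => //.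
- move=> c f g cf cg hf hg.
  rewrite (_ : (fun p => _) = (fun p => c * (array_mean p.1 (a p.1) f - array_mean p.2 (a' p.2) f) +
     (array_mean p.1 (a p.1) g - array_mean p.2 (a' p.2) g))); last first.
    apply/funext => p; rewrite !(@array_mean_lin _ _ M)//; ring.
  by rewrite -[X in _ --> X]addr0 -[X in _ --> X + _](mulr0 c); apply: cvgD => //; apply: cvgM => //; exact: cvg_cst.
- move=> f cf hf; apply/cvgrPdist_le => e e0.
  have e3 : 0 < e / 3 by rewrite divr_gt0.
  have [g [cg hg fg]] := hf _ e3.
  move/cvgrPdist_le/(_ _ e3): hg; apply: filterS => p.
  rewrite !sub0r !normrN => hp.
  have := array_mean_close p.1 M0 (aM p.1) cf cg fg.
  have := array_mean_close p.2 M0 (aM' p.2) cf cg fg.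
  move: hp; rewrite !ler_norml => /andP[? ?] /andP[? ?] /andP[? ?].
  by apply/andP; split; lra.
- move=> w w0; have w00 : `|0 : R| <= M by rewrite normr0.
  have [_ h1] := resolvent_mean_cvg w0 w00 aM ha.
  have [_ h2] := resolvent_mean_cvg w0 w00 aM' ha'.
  have E n c : array_mean n c (fun x => w / (x ^+ 2 + w ^+ 2)) =
      Im (cint P setT (fun v => resolvent 0 w (diagform n c v))).
    by apply: eq_Rintegral => v _; rewrite Im_resolvent subr0.
  rewrite (_ : (fun p => _) = (fun p : nat * nat =>
    Im (cint P setT (fun v => resolvent 0 w (diagform p.1 (a p.1) v))) -
    Im (cint P setT (fun v => resolvent 0 w (diagform p.2 (a' p.2) v))))); last first.
    by apply/funext => p; rewrite !E.
  exact: (cvg_sub_prod h1 h2).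
- move=> w w0; have w00 : `|0 : R| <= M by rewrite normr0.
  have [h1 _] := resolvent_mean_cvg w0 w00 aM ha.
  have [h2 _] := resolvent_mean_cvg w0 w00 aM' ha'.
  have E n c : array_mean n c (fun x => x / (x ^+ 2 + w ^+ 2)) =
      Re (cint P setT (fun v => resolvent 0 w (diagform n c v))).
    by apply: eq_Rintegral => v _; rewrite Re_resolvent subr0.
  rewrite (_ : (fun p => _) = (fun p : nat * nat =>
    Re (cint P setT (fun v => resolvent 0 w (diagform p.1 (a p.1) v))) -
    Re (cint P setT (fun v => resolvent 0 w (diagform p.2 (a' p.2) v))))); last first.
    by apply/funext => p; rewrite !E.
  exact: (cvg_sub_prod h1 h2).
Qed.

Lemma array_mean_is_cvg (nu : probability R R) (M : R) (a : nat -> nat -> R) :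
  0 <= M -> (forall n i, `|a n i| <= M) -> array_cvg nu a -> forall f, continuous f ->
  cvg (array_mean n (a n) f @[n --> \oo]).
Proof.
move=> M0 aM ha f cf; apply: cauchy_cvg; apply/cauchy_ballP => e e0.
have /cvgrPdist_lt/(_ _ e0) := array_pair M0 aM aM ha ha cf.
rewrite near_map2; apply: filterS => p.
by rewrite sub0r normrN.
Qed.

(** [mu] is chosen before [a'] and [M']: one array constructs the law, which then serves every array
    with the same nu, in particular the random diagonals realisation by realisation. *)
Lemma array_law (nu : probability R R) (M : R) (a : nat -> nat -> R) :
  0 <= M -> (forall n i, `|a n i| <= M) -> array_cvg nu a ->
  exists mu : probability R R, forall (M' : R) (a' : nat -> nat -> R), (forall n i, `|a' n i| <= M') ->
    array_cvg nu a' -> forall f, bounded_continuous f ->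
    array_mean n (a' n) f @[n --> \oo] --> \int[mu]_x f x.
Proof.
move=> M0 aM ha.
pose L f := lim (array_mean n (a n) f @[n --> \oo]).
have Lc f : continuous f -> array_mean n (a n) f @[n --> \oo] --> L f.
  by move=> cf; exact: (array_mean_is_cvg M0 aM ha cf).
have L_lin c f g : bounded_continuous f -> bounded_continuous g ->
    L (fun x => c * f x + g x) = c * L f + L g.
  move=> [cf _] [cg _]; apply/cvg_lim => //.
  rewrite (_ : (fun n => _) = (fun n => c * array_mean n (a n) f + array_mean n (a n) g)).
    by apply: cvgD; [apply: cvgM; [exact: cvg_cst|exact: Lc]|exact: Lc].
  by apply/funext => n; exact: (array_mean_lin n M0 (aM n)).
have L_mono f g : bounded_continuous f -> bounded_continuous g ->
    (forall t, `|t| <= M -> f t <= g t) -> L f <= L g.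
  move=> [cf _] [cg _] fg; apply: ler_cvg_to (Lc f cf) (Lc g cg) _.
  by apply: nearW => n; exact: (array_mean_le n M0 (aM n)).
have L_one : L (fun=> 1) = 1.
  apply/cvg_lim => //; rewrite (_ : (fun n => _) = (fun=> 1)); first exact: cvg_cst.
  by apply/funext => n; exact: array_mean_cst.
exists (riesz_measure L_lin L_mono L_one) => M' a' aM' ha' f bf.
rewrite riesz_representation//; have cf := bf.1.
have M'0 : 0 <= M' by exact: le_trans (aM' 0 0)%N.
have mM n i : `|a n i| <= Num.max M M' by rewrite le_max aM.
have mM' n i : `|a' n i| <= Num.max M M' by rewrite le_max aM' orbT.
have mM0 : 0 <= Num.max M M' by rewrite le_max M0.
have hp := array_pair mM0 mM' mM ha' ha cf.
have hd : array_mean n (a' n) f - array_mean n (a n) f @[n --> \oo] --> (0 : R).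
  apply: (cvg_comp (fun n => (n, n)) _ _ hp).
  exact: (cvg_pair (@cvg_id _ \oo) (@cvg_id _ \oo)).
rewrite -[X in _ --> X]add0r (_ : (fun n => _) =
  (fun n => array_mean n (a' n) f - array_mean n (a n) f + array_mean n (a n) f)).
  by apply: cvgD => //; exact: Lc.
by apply/funext => n; rewrite subrK.
Qed.

End array_law.

(** * Fubini for independent families *)

Section independent_Fubini.
Context d (T : measurableType d) (R : realType) (P : probability T R).
Variables F G : set (T -> R).
Hypotheses (mF : forall f, F f -> measurable_fun setT f)
  (mG : forall f, G f -> measurable_fun setT f).
Hypothesis FG : independent_families P F G.

(** The sample space with the coarser sigma-algebra generated by [H]. On the product of two such
    spaces the two families can be integrated in separate variables. *)
Definition gen_type (H : set (T -> R)) : Type :=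
  g_sigma_algebraType (\bigcup_(f in H) preimage_set_system setT f measurable).

HB.instance Definition _ (H : set (T -> R)) := Measurable.copy (gen_type H)
  (g_sigma_algebraType (\bigcup_(f in H) preimage_set_system setT f measurable)).

Lemma measurable_gen (H : set (T -> R)) (f : T -> R) : H f ->
  measurable_fun setT (f : gen_type H -> R).
Proof.
move=> Hf _ B mB; apply: sub_sigma_algebra; exists f => //.
by exists B.
Qed.

Lemma measurable_to_gen (H : set (T -> R)) : (forall f, H f -> measurable_fun setT f) ->
  measurable_fun setT (idfun : T -> gen_type H).
Proof.
move=> mH; apply: (@measurability _ _ T (gen_type H) setT idfun
  (\bigcup_(f in H) preimage_set_system setT f measurable)) => //.
move=> _ [A [f Hf [B mB <-]] <-].
by rewrite setTI; apply: mH.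
Qed.

Let idF : T -> gen_type F := idfun.
Let idG : T -> gen_type G := idfun.
Let diag (w : T) : gen_type F * gen_type G := (w, w).

Let midF : measurable_fun setT idF. Proof. exact: measurable_to_gen. Qed.
Let midG : measurable_fun setT idG. Proof. exact: measurable_to_gen. Qed.
Let mdiag : measurable_fun setT diag.
Proof. by apply/measurable_fun_pairP; split; [exact: midF|exact: midG]. Qed.

#[local] HB.instance Definition _ := isMeasurableFun.Build _ _ _ _ idF midF.
#[local] HB.instance Definition _ := isMeasurableFun.Build _ _ _ _ idG midG.
#[local] HB.instance Definition _ := isMeasurableFun.Build _ _ _ _ diag mdiag.

(** Independence says that the image of [P] under w -> (w, w) agrees with the product of its two
    restrictions on rectangles, hence on the product sigma-algebra; Tonelli's theorem then
    applies. *)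
Lemma independent_tonelli (g : gen_type F * gen_type G -> \bar R) :
  measurable_fun setT g -> (forall z, 0 <= g z)%E ->
  (\int[P]_w g (w, w) = \int[P]_w \int[P]_w' g (w, w'))%E.
Proof.
move=> mg g0.
have -> : (\int[P]_w g (w, w) = \int[distribution P diag]_z g z)%E.
  by rewrite ge0_integral_distribution.
have -> : (\int[distribution P diag]_z g z =
    \int[(distribution P idF \x distribution P idG)%E]_z g z)%E.
  apply: eq_measure_integral => A mA _; apply/esym.
  apply: product_measure_unique => // B C mB mC; exact: FG.
rewrite fubini_tonelli1// /fubini_F.
rewrite ge0_integral_distribution//.
- apply: eq_integral => w _ /=; rewrite ge0_integral_distribution//.
  exact: (measurableT_comp mg (measurable_pair1 (w : gen_type F))).
- exact: measurable_fun_fubini_tonelli_F.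
- by move=> w; exact: integral_ge0.
Qed.

Lemma measurable_section_integral (g : gen_type F * gen_type G -> \bar R) :
  measurable_fun setT g -> (forall z, 0 <= g z)%E ->
  measurable_fun setT (fun w : T => \int[P]_w' g (w, w'))%E.
Proof.
move=> mg g0.
have mI : measurable_fun setT (fun w : gen_type F => (\int[P]_w' g (w, w'))%E).
  rewrite (_ : (fun w => _) = (fun w => \int[distribution P idG]_w' g (w, w'))%E).
    exact: (@measurable_fun_fubini_tonelli_F _ _ (gen_type F) (gen_type G) _ (distribution P idG) g).
  apply/funext => w; rewrite ge0_integral_distribution//.
  exact: (measurableT_comp mg (measurable_pair1 (w : gen_type F))).
exact: (measurableT_comp mI midF).
Qed.

Lemma independent_Fubini (h : gen_type F * gen_type G -> R) (B : R) :
  measurable_fun setT h -> (forall z, `|h z| <= B) ->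
  measurable_fun setT (fun w : T => \int[P]_w' h (w, w')) /\
  \int[P]_w h (w, w) = \int[P]_w \int[P]_w' h (w, w').
Proof.
move=> mh hB.
have i2 w : P.-integrable setT (EFin \o (fun w' => h (w, w'))).
  apply: (@integrable_bounded _ _ _ _ _ B) => //.
  exact: (measurableT_comp (measurableT_comp mh (measurable_pair1 (w : gen_type F))) midG).
have id : P.-integrable setT (EFin \o (fun w => h (w, w))).
  apply: (@integrable_bounded _ _ _ _ _ B) => //.
  exact: (measurableT_comp mh mdiag).
have ic c : P.-integrable setT (EFin \o (fun _ : T => c : R)).
  by apply: (@integrable_bounded _ _ _ _ _ `|c|).
(* Adding the bound reduces the claim to Tonelli's theorem for a nonnegative function. *)
have h0 z : 0 <= h z + B by have := hB z; rewrite ler_norml => /andP[]; lra.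
have mS : measurable_fun setT (fun z : gen_type F * gen_type G => (h z + B)%:E).
  by apply/measurable_EFinP; apply: measurable_funD.
have hB0 z : (0 <= (h z + B)%:E)%E by rewrite lee_fin.
have tonelli := independent_tonelli mS hB0.
have E (k : T -> R) : P.-integrable setT (EFin \o k) -> (forall w, 0 <= k w + B) ->
    (\int[P]_w (k w + B)%:E = (\int[P]_w k w + B)%:E)%E.
  move=> ik k0; have iS := integrable_add measurableT ik (ic B).
  rewrite -[LHS]fineK; last exact: (integrable_fin_num measurableT iS).
  congr (_%:E); rewrite -[fine _]/(\int[P]_w (k w + B)) RintegralD//.
  by rewrite Rintegral_prob_cst.
rewrite (E (fun w => h (w, w)))// in tonelli.
have E2 (w : gen_type F) : (\int[P]_w' (h (w, w') + B)%:E = (\int[P]_w' h (w, w') + B)%:E)%E.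
  exact: (E (fun w' => h (w, w'))).
have mI := measurable_section_integral mS hB0.
have im : measurable_fun setT (fun w : T => \int[P]_w' h (w, w')).
  rewrite (_ : (fun w => _) = (fun w => fine (\int[P]_w' (h (w, w') + B)%:E)%E - B)).
    by apply: measurable_funB => //; exact: measurableT_comp.
  by apply/funext => w; rewrite E2 /= addrK.
have iB w : `|\int[P]_w' h (w, w')| <= B.
  apply: le_trans (le_normr_Rintegral measurableT (i2 w)) _.
  rewrite -[leRHS](Rintegral_prob_cst P); apply: le_Rintegral => //.
  exact: integrable_norm.
have ii : P.-integrable setT (EFin \o (fun w => \int[P]_w' h (w, w'))).
  exact: (@integrable_bounded _ _ _ _ _ B).
have e : (\int[P]_w \int[P]_w' (h (w, w') + B)%:E =
    (\int[P]_w \int[P]_w' h (w, w') + B)%:E)%E.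
  rewrite -(E (fun w => \int[P]_w' h (w, w')))//; first by apply: eq_integral => w _; exact: E2.
  by move=> w; have := iB w; rewrite ler_norml => /andP[]; lra.
by split => //; move: tonelli; rewrite e => -[] /addIr.
Qed.

End independent_Fubini.

Lemma bounded_continuousP {R : realType} (f : R -> R) :
  (continuous f /\ bounded_fun f) <-> bounded_continuous f.
Proof.
split=> [[cf [B [_ hB]]]|[cf [B hB]]]; split => //.
  by exists (B + 1) => x; apply: hB => //; rewrite ltrDl.
by exists B; split; [exact: num_real|move=> K BK x _; apply: le_trans (hB x) (ltW BK)].
Qed.

Section diagonal_arrays.
Context {R : realType}.

(** The diagonal continued by 0, so that matrices of growing size form an array indexed by all
    natural numbers with an unchanged bound. *)
Definition diag_seq n (B : 'M[R[i]]_n) (k : nat) : R :=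
  if insub k is Some j then Re (B j j) else 0.

Lemma diag_seqE n (B : 'M[R[i]]_n) (j : 'I_n) : diag_seq B j = Re (B j j).
Proof. by rewrite /diag_seq valK. Qed.

Lemma diag_seq_bound n (B : 'M[R[i]]_n) k :
  `|diag_seq B k| <= \big[Num.max/0]_(i < n) normc (B i i).
Proof.
rewrite /diag_seq; case: insubP => [j _ _|_].
  by apply: le_trans (le_Re_normc _) _; exact: (le_bigmax _ (fun i => normc (B i i))).
by rewrite normr0; exact: bigmax_ge_id.
Qed.

Lemma integral_empirical n (B : 'M[R[i]]_n) (f : R -> R) : continuous f -> (forall x, 0 <= f x) ->
  (\int[empirical_measure (real_diag B)]_x (f x)%:E =
   (n%:R^-1 * \sum_(i < n) f (diag_seq B i))%:E)%E.
Proof.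
move=> cf f0; have sz : size (real_diag B) = n by rewrite size_map size_enum_ord.
have mf : measurable_fun setT (fun x => (f x)%:E).
  by apply/measurable_EFinP; exact: continuous_measurable_fun.
rewrite /empirical_measure ge0_integral_mscale//=; last by move=> x _; rewrite lee_fin.
rewrite ge0_integral_measure_sum//; last by move=> x _; rewrite lee_fin.
rewrite sz EFinM; congr (_ * _)%E; rewrite -sumEFin; apply: eq_bigr => i _.
rewrite integral_dirac//= diracT mul1e; congr ((f _)%:E).
by rewrite diag_seqE (nth_map i) ?size_enum_ord// nth_ord_enum.
Qed.

Variable (nu : probability R R) (B : forall n, 'M[R[i]]_n).

Lemma weakly_cvg_array : weakly_cvg (fun n => empirical_measure (real_diag (B n))) nu ->
  array_cvg nu (fun n => diag_seq (B n)).
Proof.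
move=> h f bf; have [cf [C hC]] := bf.
(* The integral against the empirical measure is computed for nonnegative functions. The shift is
   undone for n > 0 only, as the empirical measure of no points has mass 0. *)
pose g x := f x + C.
have cg : continuous g by move=> x; apply: cvgD; [exact: cf|exact: cvg_cst].
have g0 x : 0 <= g x by have := hC x; rewrite ler_norml /g => /andP[]; lra.
have bg : bounded_fun g.
  apply: ((bounded_continuousP g).2 _).2; split => //; exists (C + `|C|) => x.
  by rewrite (le_trans (ler_normD _ _))// lerD.
have ig : nu.-integrable setT (EFin \o g).
  have [_ [D hD]] := (bounded_continuousP g).1 (conj cg bg).
  by apply: (@integrable_bounded _ _ _ _ _ D) => //; exact: continuous_measurable_fun.
have := h g cg bg.
rewrite -[X in _ --> X -> _]fineK; last exact: integrable_fin_num.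
rewrite (_ : (fun n => _) = (fun n => (n%:R^-1 * \sum_(i < n) g (diag_seq (B n) i))%:E)); last first.
  by apply/funext => n; rewrite integral_empirical.
move=> /fine_cvg; rewrite -[fine _]/(\int[nu]_x g x) => hg.
have -> : \int[nu]_x f x = \int[nu]_x g x - C.
  have i1 : nu.-integrable setT (EFin \o f).
    by apply: (@integrable_bounded _ _ _ _ _ C) => //; exact: continuous_measurable_fun.
  have i2 : nu.-integrable setT (EFin \o (fun _ : R => C)).
    by apply: (@integrable_bounded _ _ _ _ _ `|C|).
  by rewrite RintegralD// Rintegral_prob_cst addrK.
have hg' : (n%:R^-1 * \sum_(i < n) g (diag_seq (B n) i)) - C @[n --> \oo] --> \int[nu]_x g x - C.
  by apply: cvgB; [exact: hg|exact: cvg_cst].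
apply: cvg_trans hg'; apply: near_eq_cvg; near=> n.
have n0 : n%:R != 0 :> R by rewrite pnatr_eq0 -lt0n; near: n; exact: nbhs_infty_gt.
rewrite big_split/= sumr_const card_ord mulrDr -[C *+ n]mulr_natl mulrA mulVf// mul1r.
by rewrite addrK.
Unshelve. all: by end_near. Qed.

(** A finite limit superior bounds all matrices from some index on; the finitely many earlier ones
    are covered by the sum of their own bounds. *)
Lemma limn_esup_bounded :
  (limn_esup (fun n => (\big[Num.max/0]_(i < n) normc (B n i i))%:E) < +oo)%E ->
  exists M, forall n k, `|diag_seq (B n) k| <= M.
Proof.
move=> h; pose u n := \big[Num.max/0]_(i < n) normc (B n i i).
have [N [M hM]] : exists N M, forall n, (N <= n)%N -> u n <= M.
  move: h; rewrite limn_esup_lim (cvg_lim _ (@cvg_esups_inf _ _))// => /ereal_inf_lt.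
  move=> [_ [N _ <-] hN].
  have le n : (N <= n)%N -> ((u n)%:E <= esups (fun n => (u n)%:E) N)%E.
    by move=> Nn; apply: ereal_sup_ubound; exists n.
  exists N, (fine (esups (fun n => (u n)%:E) N)) => n Nn.
  rewrite -lee_fin fineK ?le//.
  by rewrite fin_numElt hN (lt_le_trans _ (le N (leqnn N)))// ltNyr.
exists (M + \sum_(n < N) `|u n|) => n k.
apply: le_trans (diag_seq_bound _ _) _; rewrite -/(u n).
have u0 m : 0 <= u m by exact: bigmax_ge_id.
have M0 : 0 <= M by apply: le_trans (u0 N) (hM N (leqnn N)).
have s0 : 0 <= \sum_(m < N) `|u m| by exact: sumr_ge0.
have [Nn|nN] := leqP N n; first by rewrite (le_trans (hM n Nn))// lerDl.
rewrite (bigD1 (Ordinal nN))//= ger0_norm// addrCA lerDl addr_ge0//.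
exact: sumr_ge0.
Qed.

End diagonal_arrays.

(** * Fourth moments of the self-normalized vector *)

Section gamma2.
Context {R : realType}.
Notation mu := (@lebesgue_measure R).

Lemma sqr_expN_le (u : R) : 0 <= u -> u ^+ 2 * expR (- u) <= 4.
Proof.
move=> u0; rewrite expRN ler_pdivrMr ?expR_gt0//.
have -> : expR u = expR (u / 2) ^+ 2 by rewrite expr2 -expRD -splitr.
have h : u / 2 <= expR (u / 2).
  by apply: le_trans (expR_ge1Dx _); rewrite lerDr.
have h0 : 0 <= u / 2 by rewrite divr_ge0.
have : (u / 2) ^+ 2 <= expR (u / 2) ^+ 2 by rewrite lerXn2r ?nnegrE ?expR_ge0.
rewrite expr_div_n; lra.
Qed.

Variable S : R.
Hypothesis S0 : 0 < S.

Lemma integrable_t_exp : mu.-integrable Rpos (EFin \o (fun t => t * expR (- (t * S)))).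
Proof.
have z01 : 0 <= (0 : R) < 1 by rewrite lexx ltr01.
apply: (le_integrable_norm mRpos _ (integrable_Rpos_pow1_exp z01 S0)).
  apply: measurable_funTS; apply: continuous_measurable_fun => t.
  apply: cvgM; first exact: cvg_id.
  apply: continuous_cvg; first exact: continuous_expR.
  by apply: cvgN; apply: cvgM; [exact: cvg_id|exact: cvg_cst].
move=> t; rewrite RposE => t0.
by rewrite subr0 powRr1 ?(ltW t0)// (mulrC S) ger0_norm// mulr_ge0 ?expR_ge0// ltW.
Qed.

(** Read from right to left, it trades the denominator S^2 of a fourth moment for an exponential of
    S, which is a product over the coordinates. *)
Lemma int_t_exp : \int[mu]_(t in Rpos) (t * expR (- (t * S))) = (S ^+ 2)^-1.
Proof.
pose F t := - ((t / S + (S ^+ 2)^-1) * expR (- (t * S))).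
have dF (t : R) : is_derive t (1 : R) F (t * expR (- (t * S))).
  have d1 : is_derive t (1 : R) (fun u => - (u * S)) (- S).
    have := is_deriveN (is_deriveM (is_derive_id t (1 : R)) (is_derive_cst S t (1 : R))).
    move=> h; apply: (is_derive_eq h); rewrite /GRing.scale /=; ring.
  have d2 := is_derive1_comp (is_derive_expR _) d1.
  have d3 : is_derive t (1 : R) (fun u => u / S + (S ^+ 2)^-1) (S^-1).
    have := is_deriveD (is_deriveM (is_derive_id t (1 : R)) (is_derive_cst S^-1 t (1 : R)))
      (is_derive_cst ((S ^+ 2)^-1) t (1 : R)).
    move=> h; apply: (is_derive_eq h); rewrite /GRing.scale /=; ring.
  have d4 := is_deriveN (is_deriveM d3 d2).
  apply: (is_derive_eq d4); rewrite /GRing.scale /=; field.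
  by rewrite gt_eqF.
have cF (t : R) : {for t, continuous F}.
  apply: differentiable_continuous; apply/derivable1_diffP.
  by have [] := dF t.
rewrite (@improper_FTC _ (fun t => t * expR (- (t * S))) F _ _ (- (S ^+ 2)^-1) 0) ?sub0r ?opprK//.
- move=> t _; apply: cvgM; first exact: cvg_id.
  apply: continuous_cvg; first exact: continuous_expR.
  by apply: cvgN; apply: cvgM; [exact: cvg_id|exact: cvg_cst].
- have -> : - (S ^+ 2)^-1 = F 0 by rewrite /F mul0r add0r mul0r oppr0 expR0 mulr1.
  exact: (cvg_comp _ _ (@cvg_harmonic R) (cF 0)).
- pose C := 4 / S ^+ 3 + 4 / S ^+ 4.
  apply: (@squeeze_cvgr _ _ _ _ (fun n => - (C * n.+1%:R^-1)) (fun=> 0)).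
  + apply: nearW => n; rewrite /F; set t : R := n.+2%:R.
    have t0 : 0 < t by rewrite ltr0n.
    have e0 := expR_ge0 (- (t * S)).
    apply/andP; split; last first.
      by rewrite oppr_le0 mulr_ge0// addr_ge0 ?divr_ge0 ?invr_ge0 ?exprn_ge0 ?ltW.
    rewrite lerN2; apply: (@le_trans _ _ (C / t)); last first.
      rewrite ler_wpM2l ?addr_ge0 ?divr_ge0 ?exprn_ge0 ?(ltW S0)//.
      by rewrite lef_pV2 ?posrE ?ltr0n// ler_nat.
    have h : expR (- (t * S)) <= 4 / (t * S) ^+ 2.
      rewrite ler_pdivlMr ?exprn_gt0 ?mulr_gt0// mulrC.
      by apply: sqr_expN_le; rewrite mulr_ge0// ltW.
    apply: (@le_trans _ _ ((t / S + (S ^+ 2)^-1) * (4 / (t * S) ^+ 2))).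
      by rewrite ler_wpM2l// addr_ge0 ?divr_ge0 ?invr_ge0 ?exprn_ge0 ?ltW.
    rewrite /C mulrDl [leRHS]mulrDl lerD//.
      rewrite le_eqVlt; apply/orP; left; apply/eqP; field.
      by rewrite !gt_eqF.
    have t1 : 1 <= t by rewrite ler1n.
    have -> : (S ^+ 2)^-1 * (4 / (t * S) ^+ 2) = 4 / S ^+ 4 / t * t^-1.
      by field; rewrite !gt_eqF.
    by rewrite ler_piMr ?invf_le1// !divr_ge0 ?exprn_ge0 ?(ltW S0)// ltW.
  + by rewrite -oppr0 -(mulr0 C); apply: cvgN; apply: cvgM; [exact: cvg_cst|exact: cvg_harmonic].
  + exact: cvg_cst.
- exact: integrable_t_exp.
Qed.

End gamma2.

Lemma pow_gauss_bound {R : realType} (t x : R) (m : nat) : 0 < t -> (m <= 4)%N ->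
  `|x ^+ m * expR (- (t * x ^+ 2))| <= 1 + 4 / t ^+ 2.
Proof.
move=> t0 m4.
rewrite normrM (ger0_norm (expR_ge0 _)) normrX.
have e1 : expR (- (t * x ^+ 2)) <= 1 by rewrite expR_le1 oppr_le0 mulr_ge0 ?sqr_ge0// ltW.
have x4 : `|x| ^+ 4 * expR (- (t * x ^+ 2)) <= 4 / t ^+ 2.
  have -> : `|x| ^+ 4 = (x ^+ 2) ^+ 2 by rewrite -(real_normK (num_real x)) -exprM.
  rewrite ler_pdivlMr ?exprn_gt0//.
  apply: le_trans (sqr_expN_le (_ : 0 <= t * x ^+ 2)); last by rewrite mulr_ge0 ?sqr_ge0// ltW.
  by rewrite exprMn le_eqVlt; apply/orP; left; apply/eqP; ring.
have xm : `|x| ^+ m <= 1 + `|x| ^+ 4.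
  have [x1|x1] := leP `|x| 1.
    by apply: (@le_trans _ _ 1); rewrite ?exprn_ile1// lerDl exprn_ge0.
  by apply: (@le_trans _ _ (`|x| ^+ 4)); rewrite ?ler_weXn2l ?(ltW x1)// lerDr.
apply: (@le_trans _ _ ((1 + `|x| ^+ 4) * expR (- (t * x ^+ 2)))).
  by rewrite ler_wpM2r ?expR_ge0.
by rewrite mulrDl mul1r lerD.
Qed.

Section fourth_moments.
Context d (T : measurableType d) (R : realType) (P : probability T R).
Variables (xi : {RV P >-> R}) (X : nat -> {RV P >-> R}).
Hypothesis X_iid : iid_copies P xi X.
Notation mu := (@lebesgue_measure R).

Definition selfnorm n i w := X i w / Num.sqrt (sqsum X n w).

Let S n w := sqsum X n w.
Let y n i w := selfnorm n i w.

Let S_ge0 n w : 0 <= S n w. Proof. exact: sqsum_ge0. Qed.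

Lemma sum_selfnorm2_le1 n w : \sum_(i < n) selfnorm n i w ^+ 2 <= 1.
Proof.
under eq_bigr do rewrite expr_div_n sqr_sqrtr ?sqsum_ge0//.
rewrite -mulr_suml -/(sqsum X n w).
have [->|S0] := eqVneq (sqsum X n w) 0; first by rewrite mul0r.
by rewrite mulfV.
Qed.

Lemma selfnorm_le1 n (i : 'I_n) w : `|selfnorm n i w| <= 1.
Proof.
rewrite -(@ler_pXn2r _ 2) ?nnegrE// expr1n real_normK ?num_real//.
apply: le_trans (sum_selfnorm2_le1 n w).
by rewrite (bigD1 i)//= lerDl; apply: sumr_ge0 => j _; exact: sqr_ge0.
Qed.

Lemma measurable_selfnorm n i : measurable_fun setT (selfnorm n i).
Proof.
rewrite (_ : selfnorm n i = (fun w => X i w * (Num.sqrt (sqsum X n w)) `^ (-1))); last first.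
  by apply/funext => w; rewrite powR_inv1// sqrtr_ge0.
apply: measurable_funM => //.
apply: (measurableT_comp (f := (fun x : R => x `^ (-1)))); first exact: measurable_powR.
apply: (@measurableT_comp _ _ _ _ _ _ (@Num.sqrt R)); last exact: measurable_sqsum.
by apply: continuous_measurable_fun; exact: sqrt_continuous.
Qed.

Variable n : nat.

Definition moment4 (i j k l : 'I_n) : R :=
  \int[P]_w (selfnorm n i w * selfnorm n j w * selfnorm n k w * selfnorm n l w).

(** How often [m] occurs among the four indices, that is, the exponent of X_m in the monomial. *)
Let mult (i j k l m : nat) : nat := ((m == i) + (m == j) + (m == k) + (m == l))%N.

Definition Phi (m : nat) (t : R) : R := \int[P]_w (xi w ^+ m * expR (- (t * xi w ^+ 2))).

(** After 1 / S^2 is written as an integral in t, independence turns the expectation into a product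
    of one-variable moments. Where S = 0, the coordinates and the integrand both vanish. *)
Lemma moment4E i j k l : moment4 i j k l =
  \int[mu]_(t in Rpos) (t * \prod_(m < n) Phi (mult i j k l m) t).
Proof.
pose q w := X i w * X j w * X k w * X l w.
have XS (m : 'I_n) w : `|X m w| <= Num.sqrt (S n w).
  rewrite -sqrtr_sqr ler_wsqrtr// /S /sqsum (bigD1 m)//= lerDl.
  by apply: sumr_ge0 => m' _; exact: sqr_ge0.
have qS w : `|q w| <= S n w ^+ 2.
  have -> : S n w ^+ 2 = Num.sqrt (S n w) * Num.sqrt (S n w) * Num.sqrt (S n w) * Num.sqrt (S n w).
    by rewrite -[in LHS](sqr_sqrtr (S_ge0 n w)); ring.
  by rewrite /q !normrM !ler_pM ?mulr_ge0.
have mq : measurable_fun setT q by do ![apply: measurable_funM => //].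
have mS : measurable_fun setT (S n) by exact: measurable_sqsum.
have prodE t w : q w * expR (- (t * S n w)) =
    \prod_(m < n) (X m w ^+ mult i j k l m * expR (- (t * X m w ^+ 2))).
  have -> : expR (- (t * S n w)) = \prod_(m < n) expR (- (t * X m w ^+ 2)).
    rewrite -(big_morph _ (@expRD R) (@expR0 R)); congr expR.
    by rewrite sumrN -mulr_sumr.
  rewrite big_split/=; congr (_ * _).
  have delta (o : 'I_n) : \prod_(m < n) X m w ^+ (m == o :> nat) = X o w.
    rewrite (bigD1 o)//= eqxx expr1 big1 ?mulr1// => m mo.
    by rewrite -[(m == o :> nat)]/(m == o) (negbTE mo) expr0.
  rewrite /mult; under eq_bigr do rewrite !exprD.
  by rewrite !big_split/= !delta.
pose f (z : measurableTypeR R * T) : R := \1_(Rpos : set R) z.1 * (z.1 * (q z.2 * expR (- (z.1 * S n z.2)))).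
have mf : measurable_fun setT f.
  apply: measurable_funM.
    exact: (measurableT_comp (@measurable_indic _ _ R setT (Rpos : set R) mRpos) measurable_fst).
  apply: measurable_funM => //; apply: measurable_funM.
    exact: (measurableT_comp mq measurable_snd).
  apply: measurableT_comp => //; apply: measurableT_comp => //.
  by apply: measurable_funM => //; exact: (measurableT_comp mS measurable_snd).
have it w : mu.-integrable Rpos (EFin \o (fun t => t * (q w * expR (- (t * S n w))))) /\
    \int[mu]_(t in Rpos) (t * (q w * expR (- (t * S n w)))) =
    selfnorm n i w * selfnorm n j w * selfnorm n k w * selfnorm n l w.
  have E : (fun t => t * (q w * expR (- (t * S n w)))) = (fun t => q w * (t * expR (- (t * S n w)))).
    by apply/funext => t; rewrite mulrCA.
  have [S0|Sn0] := eqVneq (S n w) 0.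
    have q0 : q w = 0 by apply/eqP; rewrite -normr_le0 (le_trans (qS w))// S0 expr0n.
    rewrite (_ : (fun t => _) = cst 0); last by apply/funext => t; rewrite q0 mul0r mulr0.
    split; first exact: integrable0.
    by rewrite /selfnorm -/(S n w) S0 sqrtr0 invr0 !mulr0 /Rintegral integral0.
  have S0 : 0 < S n w by rewrite lt0r Sn0 S_ge0.
  rewrite E; split; first by apply: integrable_scale => //; exact: integrable_t_exp.
  rewrite RintegralZl//; last exact: integrable_t_exp.
  rewrite int_t_exp// /selfnorm -/(S n w) -[in LHS](sqr_sqrtr (S_ge0 n w)) /q; field.
  by rewrite gt_eqF// sqrtr_gt0.
have iw t : Rpos t -> P.-integrable setT (EFin \o (fun w => t * (q w * expR (- (t * S n w))))) /\
    \int[P]_w (t * (q w * expR (- (t * S n w)))) = t * \prod_(m < n) Phi (mult i j k l m) t.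
  rewrite RposE => t0.
  have ii : P.-integrable setT (EFin \o (fun w => q w * expR (- (t * S n w)))).
    apply: (@integrable_bounded _ _ _ _ _ (4 / t ^+ 2)).
      apply: measurable_funM => //; apply: measurableT_comp => //.
      by apply: measurableT_comp => //; exact: measurable_funM.
    move=> w; rewrite normrM (ger0_norm (expR_ge0 _)) ler_pdivlMr ?exprn_gt0//.
    apply: le_trans (sqr_expN_le (_ : 0 <= t * S n w)); last by rewrite mulr_ge0// ltW.
    rewrite mulrAC ler_wpM2r ?expR_ge0// exprMn mulrC ler_wpM2l ?exprn_ge0//.
    exact: ltW.
  split; first exact: integrable_scale.
  rewrite RintegralZl//; congr (_ * _).
  under eq_Rintegral do rewrite prodE.
  pose g (m : nat) (x : R) : R[i] := (x ^+ mult i j k l m * expR (- (t * x ^+ 2)))%:C.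
  have mg m : cmeasurable setT (g m).
    apply: cmeasurable_real; apply: measurable_funM; first exact: measurable_funX.
    apply: measurableT_comp => //; apply: measurableT_comp => //.
    by apply: measurable_funM => //; exact: measurable_funX.
  have gb m x : normc (g m x) <= 1 + 4 / t ^+ 2.
    by rewrite normc_real pow_gauss_bound// /mult; do ![case: (_ == _)].
  have := @cint_prod_independent _ _ _ P X (fun j => @measurable_funPT _ _ _ _ (X j)) X_iid.1
    n g (fun=> 1 + 4 / t ^+ 2) mg gb.
  have -> : (fun w => \prod_(m < n) g m (X m w)) = (fun w =>
     (\prod_(m < n) (X m w ^+ mult i j k l m * expR (- (t * X m w ^+ 2))))%:C).
    by apply/funext => w; rewrite rmorph_prod.
  have -> : \prod_(m < n) cint P setT (fun w => g m (X m w)) =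
      (\prod_(m < n) Phi (mult i j k l m) t)%:C.
    rewrite rmorph_prod; apply: eq_bigr => m _.
    rewrite (same_law_cint (X_iid.2 m) (mg m)).
    by apply: complex_ext => //=; rewrite Rintegral_prob_cst.
  by move=> /(congr1 (@complex.Re R)).
have f_Rpos t w : Rpos t -> f (t, w) = t * (q w * expR (- (t * S n w))).
  by move=> tp; rewrite /f /= indicE mem_set// mul1r.
have f_out t w : ~ Rpos t -> f (t, w) = 0.
  by move=> tp; rewrite /f /= indicE memNset// mul0r.
have fE w : (fun t => f (t, w)) = (fun t => t * (q w * expR (- (t * S n w)))) \_ Rpos.
  apply/funext => t; rewrite patchE; case: (boolP (t \in _)) => [/set_mem tp|/negP tp].
    exact: f_Rpos.
  by apply: f_out => h; apply: tp; apply/mem_set.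
have i2 w : mu.-integrable setT (EFin \o (fun t => f (t, w))).
  by rewrite fE -restrict_EFin; apply/(integrable_mkcond _ mRpos); exact: (it w).1.
have intf w : \int[mu]_t f (t, w) =
    selfnorm n i w * selfnorm n j w * selfnorm n k w * selfnorm n l w.
  by rewrite -(it w).2 [RHS]Rintegral_mkcond -fE.
have [|||_ hF] := @Rintegral_Fubini _ _ _ _ _ mu P f mf.
- rewrite (@fubini_tonelli _ _ _ _ _ mu P (fun z => `|f z|%:E)); last 2 first.
  + by apply/measurable_EFinP; exact: measurableT_comp.
  + by move=> z; rewrite lee_fin.
  apply: (@le_lt_trans _ _ (\int[P]_w 1%:E)%E); last by rewrite integral_prob_cst ltry.
  apply: ge0_le_integral => //.
  + by move=> w _; exact: integral_ge0.
  + apply: (@measurable_fun_fubini_tonelli_G _ _ _ _ _ mu (fun z => `|f z|%:E)).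
      by apply/measurable_EFinP; exact: measurableT_comp.
    by move=> z; rewrite lee_fin.
  move=> w _; have ia := integrable_norm (i2 w).
  rewrite -[X in (X <= _)%E]fineK; last exact: (integrable_fin_num measurableT ia).
  rewrite lee_fin -[fine _]/(\int[mu]_t `|f (t, w)|).
  (* For fixed [w] the integrand keeps the sign of [q w] for all t, so integrating its modulus gives
     the modulus of a product of four self-normalized coordinates, at most 1. *)
  have -> : \int[mu]_t `|f (t, w)| = Num.sg (q w) * \int[mu]_t f (t, w).
    rewrite -RintegralZl//; apply: eq_Rintegral => t _.
    rewrite /f /= indicE; case: (boolP (t \in _)) => [/set_mem|_].
      rewrite RposE => t0; rewrite !mul1r normrM (gtr0_norm t0) normrM (ger0_norm (expR_ge0 _)) normrEsg.
      by ring.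
    by rewrite !mul0r mulr0 normr0.
  have p1 : `|selfnorm n i w * selfnorm n j w * selfnorm n k w * selfnorm n l w| <= 1.
    by rewrite 3!normrM !mulr_ile1 ?mulr_ge0// selfnorm_le1.
  apply: le_trans (ler_norm _) _; rewrite normrM intf mulr_ile1//.
  by rewrite normr_sg; case: (_ != _).
- move=> t; have [tp|tp] := pselect (Rpos t).
    have := (iw t tp).1; congr (P.-integrable setT (EFin \o _)).
    by apply/funext => w; rewrite f_Rpos.
  rewrite (_ : _ \o _ = cst 0%:E); first exact: integrable0.
  by apply/funext => w /=; rewrite f_out.
- exact: i2.
transitivity (\int[P]_w \int[mu]_t f (t, w)).
  by apply: eq_Rintegral => w _; rewrite intf.
rewrite -hF [RHS]Rintegral_mkcond; apply: eq_Rintegral => t _; rewrite patchE.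
case: (boolP (t \in _)) => [/set_mem tp|/negP tp].
  by rewrite -(iw t tp).2; apply: eq_Rintegral => w _; exact: f_Rpos.
transitivity (\int[P]_(w in setT) (0 : R)); last exact: Rintegral_prob_cst.
by apply: eq_Rintegral => w _; apply: f_out => h; apply: tp; apply/mem_set.
Qed.

Lemma Phi_odd m t : symmetric_law P xi -> 0 < t -> (m <= 4)%N -> odd m -> Phi m t = 0.
Proof.
move=> xi_sym t0 m4 om.
have mf : measurable_fun setT (fun x : R => x ^+ m * expR (- (t * x ^+ 2))).
  apply: measurable_funM; first exact: measurable_funX.
  apply: measurableT_comp => //; apply: measurableT_comp => //.
  by apply: measurable_funM => //; exact: measurable_funX.
have := @same_law_Rintegral _ _ _ P xi (- xi)%R xi_sym _ mf.
rewrite -/(Phi m t).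
have -> : \int[P]_w ((- xi)%R w ^+ m * expR (- (t * (- xi)%R w ^+ 2))) = -1 * Phi m t.
  rewrite -RintegralZl//; last first.
    apply: (@integrable_bounded _ _ _ _ _ (1 + 4 / t ^+ 2)) => [|w]; last exact: pow_gauss_bound.
    exact: (measurableT_comp mf).
  apply: eq_Rintegral => w _; have -> : (- xi)%R w = - xi w by [].
  by rewrite sqrrN exprNn -signr_odd om expr1 mulrA.
by rewrite mulN1r => /eqP; rewrite -addr_eq0 -mulr2n mulrn_eq0/= => /eqP.
Qed.

(** The value of E[Y_i^2 Y_j^2] common to all i <> j, in the form given by [moment4E]: two exponents
    2 and n - 2 exponents 0. *)
Definition pair_moment : R :=
  \int[mu]_(t in Rpos) (t * (Phi 2 t * (Phi 2 t * Phi 0 t ^+ n.-2))).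

Let multE (i j k l m : 'I_n) :
  mult i j k l m = ((m == i) + (m == j) + (m == k) + (m == l))%N.
Proof. by []. Qed.

Lemma moment4_pair i j : i != j -> moment4 i j i j = pair_moment /\ moment4 i j j i = pair_moment.
Proof.
move=> ij.
have E k l : (k == i) && (l == j) || (k == j) && (l == i) ->
    forall t, \prod_(m < n) Phi (mult i j k l m) t = Phi 2 t * (Phi 2 t * Phi 0 t ^+ n.-2).
  move=> kl t; rewrite (bigD1 i)//= (bigD1 j)/=; last by rewrite eq_sym.
  have mE (m : 'I_n) : mult i j k l m = if (m == i) || (m == j) then 2%N else 0%N.
    have ab : ~~ ((m == i) && (m == j)).
      by apply/negP => /andP[/eqP mi /eqP mj]; move: ij; rewrite -mi -mj eqxx.
    rewrite multE; case/orP: kl => /andP[/eqP -> /eqP ->];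
      by move: ab; case: (m == i); case: (m == j).
  rewrite !mE eqxx eqxx orbT; congr (_ * (_ * _)).
  rewrite (eq_bigr (fun=> Phi 0 t)); last first.
    by move=> m /andP[mi mj]; rewrite mE (negbTE mi) (negbTE mj).
  rewrite prodr_const; congr (_ ^+ _).
  transitivity #|[predC pred2 i j]|.
    by apply: eq_card => m; rewrite !inE negb_or.
  have := cardC (pred2 i j); rewrite card2 ij card_ord.
  by move/(congr1 (fun k => k.-2)).
split; rewrite moment4E; apply: eq_Rintegral => t _; rewrite E// ?eqxx//.
by rewrite orbT.
Qed.

Lemma moment4_eq0 i j k l : symmetric_law P xi -> i != j -> k != l ->
  (k, l) != (i, j) -> (k, l) != (j, i) -> moment4 i j k l = 0.
Proof.
move=> xi_sym ij kl h1 h2.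
have [m om] : exists m : 'I_n, odd (mult i j k l m).
  have ji : (j == i) = false by rewrite eq_sym (negbTE ij).
  have [|] := boolP ((i == k) || (i == l)); last first.
    rewrite negb_or => /andP[ik il]; exists i.
    by rewrite multE eqxx (negbTE ij) (negbTE ik) (negbTE il).
  have [|] := boolP ((j == k) || (j == l)); last first.
    rewrite negb_or => /andP[jk jl] _; exists j.
    by rewrite multE eqxx ji (negbTE jk) (negbTE jl).
  move=> /orP[/eqP jk|/eqP jl] /orP[/eqP ik|/eqP il].
  - by move: ij; rewrite ik jk eqxx.
  - by move: h2; rewrite jk il eqxx.
  - by move: h1; rewrite jl ik eqxx.
  - by move: ij; rewrite il jl eqxx.
rewrite moment4E; transitivity (\int[mu]_(t in Rpos) (0 : R)); last by rewrite /Rintegral integral0.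
apply: eq_Rintegral => t /set_mem; rewrite RposE => t0; rewrite (bigD1 m)//= Phi_odd//.
  by rewrite mul0r mulr0.
by rewrite /mult; do ![case: (_ == _)].
Qed.

Let integrable_mono (i j k l : 'I_n) : P.-integrable setT (EFin \o (fun w =>
  selfnorm n i w * selfnorm n j w * selfnorm n k w * selfnorm n l w)).
Proof.
apply: (@integrable_bounded _ _ _ _ _ 1) => [|w].
  apply: measurable_funM; last exact: measurable_selfnorm.
  apply: measurable_funM; last exact: measurable_selfnorm.
  by apply: measurable_funM; exact: measurable_selfnorm.
by rewrite 3!normrM !mulr_ile1 ?mulr_ge0// selfnorm_le1.
Qed.

Let int_sum (I : Type) (r : seq I) (F : I -> T -> R) :
  (forall i, P.-integrable setT (EFin \o F i)) ->
  P.-integrable setT (EFin \o (fun w => \sum_(i <- r) F i w)) /\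
  \int[P]_w (\sum_(i <- r) F i w) = \sum_(i <- r) \int[P]_w F i w.
Proof.
move=> iF; elim: r => [|i r [IH1 IH2]].
  rewrite big_nil (_ : (fun w => _) = cst 0); last by apply/funext => w; rewrite big_nil.
  by rewrite Rintegral_prob_cst; split => //; exact: integrable0.
rewrite big_cons (_ : (fun w => _) = (fun w => F i w + \sum_(j <- r) F j w)); last first.
  by apply/funext => w; rewrite big_cons.
by rewrite RintegralD// IH2; split => //; exact: integrable_add.
Qed.

Let pairE (i j : 'I_n) w : selfnorm n i w * selfnorm n j w * selfnorm n i w * selfnorm n j w =
  (selfnorm n i w * selfnorm n j w) ^+ 2.
Proof. ring. Qed.

Lemma pair_moment_ge0 : 0 <= pair_moment.
Proof.
apply: Rintegral_ge0 => t; rewrite RposE => t0.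
have P2 : 0 <= Phi 2 t.
  by apply: Rintegral_ge0 => w _; rewrite mulr_ge0 ?sqr_ge0 ?expR_ge0.
have P0 : 0 <= Phi 0 t.
  by apply: Rintegral_ge0 => w _; rewrite expr0 mul1r expR_ge0.
by rewrite !mulr_ge0 ?exprn_ge0// ltW.
Qed.

(** Each of the n (n - 1) ordered pairs contributes a term Y_i^2 Y_j^2 of (sum_i Y_i^2)^2, which is
    at most 1. *)
Lemma pair_moment_le : (n * n.-1)%:R * pair_moment <= 1.
Proof.
have -> : (n * n.-1)%:R * pair_moment =
    \sum_(p : 'I_n * 'I_n | p.1 != p.2) moment4 p.1 p.2 p.1 p.2.
  rewrite (eq_bigr (fun=> pair_moment)); last by move=> p pp; rewrite (moment4_pair pp).1.
  rewrite -(pair_big_dep xpredT (fun i j => i != j) (fun _ _ => pair_moment))/=.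
  rewrite (eq_bigr (fun=> pair_moment *+ n.-1)); last first.
    move=> i _; rewrite sumr_const; congr (_ *+ _).
    transitivity #|predC1 i|; last by rewrite cardC1 card_ord.
    by apply: eq_card => j; rewrite !inE eq_sym.
  by rewrite sumr_const card_ord -mulrnA mulnC mulr_natl.
rewrite -(Rintegral_prob_cst P 1) big_mkcond/=.
pose g (p : 'I_n * 'I_n) w := if p.1 != p.2 then
  selfnorm n p.1 w * selfnorm n p.2 w * selfnorm n p.1 w * selfnorm n p.2 w else 0.
have ig p : P.-integrable setT (EFin \o g p).
  rewrite /g; case: (_ != _); first exact: integrable_mono.
  by apply: (@integrable_bounded _ _ _ _ _ 0) => // w; rewrite normr0.
have [i1 i2] := int_sum (index_enum ('I_n * 'I_n)%type) ig.
rewrite (eq_bigr (fun p => \int[P]_w g p w)); last first.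
  move=> p _; rewrite /g; case: (_ != _) => //.
  by rewrite Rintegral_prob_cst.
rewrite -i2; apply: le_Rintegral => //.
  by apply: (@integrable_bounded _ _ _ _ _ 1) => // w; rewrite normr1.
move=> w _; apply: (@le_trans _ _ ((\sum_(i < n) selfnorm n i w ^+ 2) ^+ 2)); last first.
  by rewrite exprn_ile1 ?sum_selfnorm2_le1// sumr_ge0// => i _; exact: sqr_ge0.
rewrite expr2 mulr_suml; under [leRHS]eq_bigr do rewrite mulr_sumr.
rewrite pair_big_dep/=; apply: ler_sum => p _; rewrite /g.
case: (_ != _); last by rewrite mulr_ge0 ?sqr_ge0.
by rewrite pairE exprMn.
Qed.

(** In the expansion over ordered pairs p and q, the survivors are q = p and q = p reversed. The
    cross term of a pair with its reverse is at most the mean of the two squares, whence the factor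
    2; no symmetry of [r] is assumed. *)
Lemma quad_moment_le (r : 'I_n -> 'I_n -> R) : symmetric_law P xi ->
  \int[P]_w (\sum_i \sum_(j | j != i) r i j * (selfnorm n i w * selfnorm n j w)) ^+ 2 <=
  2 * pair_moment * \sum_i \sum_(j | j != i) r i j ^+ 2.
Proof.
move=> xi_sym.
pose c (p : 'I_n * 'I_n) := if p.2 != p.1 then r p.1 p.2 else 0.
pose sw (p : 'I_n * 'I_n) := (p.2, p.1).
pose Y (p : 'I_n * 'I_n) w := selfnorm n p.1 w * selfnorm n p.2 w.
have E w : \sum_i \sum_(j | j != i) r i j * (selfnorm n i w * selfnorm n j w) =
    \sum_p c p * Y p w.
  rewrite pair_big_dep/= big_mkcond; apply: eq_bigr => p _.
  by rewrite /c; case: (_ != _); rewrite ?mul0r.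
have E2 : \sum_i \sum_(j | j != i) r i j ^+ 2 = \sum_p c p ^+ 2.
  rewrite pair_big_dep/= big_mkcond; apply: eq_bigr => p _.
  by rewrite /c; case: (_ != _); rewrite ?expr0n.
have iY p q : P.-integrable setT (EFin \o (fun w => c p * c q * (Y p w * Y q w))).
  apply: integrable_scale => //; have := integrable_mono p.1 p.2 q.1 q.2.
  by congr (P.-integrable setT (EFin \o _)); apply/funext => w; rewrite /Y; ring.
have -> : \int[P]_w (\sum_i \sum_(j | j != i) r i j * (selfnorm n i w * selfnorm n j w)) ^+ 2 =
    \sum_p \sum_q c p * c q * moment4 p.1 p.2 q.1 q.2.
  transitivity (\int[P]_w (\sum_p \sum_q c p * c q * (Y p w * Y q w))).
    apply: eq_Rintegral => w _; rewrite E expr2 mulr_suml; apply: eq_bigr => p _.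
    by rewrite mulr_sumr; apply: eq_bigr => q _; ring.
  have i1 p : P.-integrable setT (EFin \o (fun w => \sum_q c p * c q * (Y p w * Y q w))).
    exact: (int_sum _ (iY p)).1.
  rewrite (int_sum _ i1).2; apply: eq_bigr => p _.
  rewrite (int_sum _ (iY p)).2; apply: eq_bigr => q _.
  rewrite RintegralZl//; last first.
    have := integrable_mono p.1 p.2 q.1 q.2.
    by congr (P.-integrable setT (EFin \o _)); apply/funext => w; rewrite /Y; ring.
  by congr (_ * _); apply: eq_Rintegral => w _; rewrite /Y; ring.
rewrite E2 (eq_bigr (fun p => c p * (c p + c (sw p)) * pair_moment)); last first.
  move=> p _; have [cp|cp] := eqVneq (c p) 0.
    by rewrite cp !mul0r big1// => q _; rewrite !mul0r.
  have pp : p.1 != p.2.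
    by apply: contraNneq cp => pp; rewrite /c pp eqxx.
  have swp : sw p != p by case: (p) pp => i j /= ij; apply: contra ij => /eqP[-> _].
  rewrite (bigD1 p)//= (bigD1 (sw p))//= big1 ?addr0.
    by rewrite (moment4_pair pp).1 (moment4_pair pp).2; ring.
  move=> q /andP[qp qs]; have [cq|cq] := eqVneq (c q) 0; first by rewrite cq mulr0 mul0r.
  have qq : q.1 != q.2.
    by apply: contraNneq cq => qq; rewrite /c qq eqxx.
  by rewrite moment4_eq0 ?mulr0//; case: (q) (p) qp qs => [? ?] [? ?].
rewrite -mulr_suml mulrC [2 * _]mulrC -mulrA ler_wpM2l ?pair_moment_ge0//.
have -> : 2 * \sum_p c p ^+ 2 = \sum_p (c p ^+ 2 + (c p ^+ 2 + c (sw p) ^+ 2) / 2).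
  have e : \sum_p c (sw p) ^+ 2 = \sum_p c p ^+ 2.
    rewrite [RHS](reindex_inj (h := sw))// => -[? ?] [? ?] [-> ->] //.
  by rewrite big_split/= -mulr_suml big_split/= e; field.
apply: ler_sum => p _; rewrite mulrDr -expr2 lerD2l.
have := sqr_ge0 (c p - c (sw p)); rewrite sqrrB; lra.
Qed.

End fourth_moments.

(** * Random matrices *)

Section random_matrices.
Context d (T : measurableType d) (R : realType) (P : probability T R).
Variables (xi : {RV P >-> R}) (X : nat -> {RV P >-> R}).
Hypothesis X_iid : iid_copies P xi X.
Variable A : forall n : nat, T -> 'M[R[i]]_n.
Hypothesis A_random : forall n, random_matrix (A n).
Hypothesis A_indep : forall n,
  independent_families P (entries (A n)) (coordinates (self_normalized X n)).

Lemma self_normalizedE n w i : self_normalized X n w i 0 = selfnorm X n i w.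
Proof. by rewrite mxE. Qed.

Lemma diagformE n a w : diagform X n a w = \sum_(i < n) a i * selfnorm X n i w ^+ 2.
Proof.
rewrite /diagform mulr_suml; apply: eq_bigr => i _.
by rewrite expr_div_n sqr_sqrtr ?mulrA// sqsum_ge0.
Qed.

Lemma entries_Re n i j : entries (A n) (fun w => Re (A n w i j)).
Proof. by exists i, j; left. Qed.

Lemma coordinates_measurable n f : coordinates (self_normalized X n) f -> measurable_fun setT f.
Proof.
move=> [j ->]; rewrite (_ : (fun w => _) = selfnorm X n j); first exact: measurable_selfnorm.
by apply/funext => w; rewrite self_normalizedE.
Qed.

Let entry n i j (z : gen_type (entries (A n)) * gen_type (coordinates (self_normalized X n))) : R :=
  Re (A n z.1 i j).
Let coord n j (z : gen_type (entries (A n)) * gen_type (coordinates (self_normalized X n))) : R :=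
  self_normalized X n z.2 j 0.

Let measurable_entry n i j : measurable_fun setT (@entry n i j).
Proof.
apply: (measurableT_comp (f := (fun w => Re (A n w i j)) : gen_type (entries (A n)) -> R)).
  by apply: measurable_gen; exact: entries_Re.
exact: measurable_fst.
Qed.

Let measurable_coord n j : measurable_fun setT (@coord n j).
Proof.
apply: (measurableT_comp
  (f := (fun w => self_normalized X n w j 0) : gen_type (coordinates (self_normalized X n)) -> R)).
  by apply: measurable_gen; exists j.
exact: measurable_snd.
Qed.

Let D n w := diagform X n (diag_seq (A n w)) w.

Lemma array_mean_diag_seq n (f : R -> R) : bounded_continuous f ->
  measurable_fun setT (fun w => array_mean X n (diag_seq (A n w)) f) /\
  \int[P]_w f (D n w) = \int[P]_w array_mean X n (diag_seq (A n w)) f.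
Proof.
move=> [cf [C fC]].
pose h z := f (\sum_(i < n) @entry n i i z * @coord n i z ^+ 2).
have mh : measurable_fun setT h.
  apply: measurableT_comp; first exact: continuous_measurable_fun.
  apply: measurable_sum => i; apply: measurable_funM; first exact: measurable_entry.
  by apply: measurable_funX; exact: measurable_coord.
have hE w w' : h (w, w') = f (diagform X n (diag_seq (A n w)) w').
  rewrite /h diagformE; congr f; apply: eq_bigr => i _.
  by rewrite /entry /coord self_normalizedE diag_seqE.
have [m e] := independent_Fubini (@A_random n) (@coordinates_measurable n) (@A_indep n) mh
  (fun z => fC _).
have E (w : T) : \int[P]_w' h (w, w') = array_mean X n (diag_seq (A n w)) f.
  by apply: eq_Rintegral => w' _; rewrite hE.
split.
  by move: m; congr (measurable_fun setT _); apply/funext => w; exact: E.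
transitivity (\int[P]_w h (w, w)); first by apply: eq_Rintegral => w _; rewrite hE.
by rewrite e; apply: eq_Rintegral => w _; exact: E.
Qed.

Lemma measurable_diag_seq n : measurable_fun setT (D n).
Proof.
rewrite (_ : D n = (fun w => \sum_(i < n) Re (A n w i i) * selfnorm X n i w ^+ 2)); last first.
  by apply/funext => w; rewrite /D diagformE; apply: eq_bigr => i _; rewrite diag_seqE.
apply: measurable_sum => i; apply: measurable_funM; first by apply: A_random; exact: entries_Re.
by apply: measurable_funX; exact: measurable_selfnorm.
Qed.

Lemma diag_mean_cvg (mu : probability R R) f : bounded_continuous f ->
  {ae P, forall w, array_mean X n (diag_seq (A n w)) f @[n --> \oo] --> \int[mu]_x f x} ->
  \int[P]_w f (D n w) @[n --> \oo] --> \int[mu]_x f x.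
Proof.
move=> bf ha; have [cf [C fC]] := bf.
have amC n w : `|array_mean X n (diag_seq (A n w)) f| <= C.
  have mf : measurable_fun setT (fun v => f (diagform X n (diag_seq (A n w)) v)).
    apply: measurableT_comp; first exact: continuous_measurable_fun.
    exact: measurable_diagform.
  have i1 : P.-integrable setT (EFin \o (fun v => f (diagform X n (diag_seq (A n w)) v))).
    by apply: (@integrable_bounded _ _ _ _ _ C).
  apply: le_trans (le_normr_Rintegral measurableT i1) _.
  rewrite -[leRHS](Rintegral_prob_cst P); apply: le_Rintegral => //.
    exact: integrable_norm.
  by apply: (@integrable_bounded _ _ _ _ _ `|C|).
have [||||| _ _ cg] := @dominated_convergence _ T R P setT measurableT
   (fun n => EFin \o (fun w => array_mean X n (diag_seq (A n w)) f))
   (EFin \o (fun=> \int[mu]_x f x)) (EFin \o (fun=> C)).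
- by move=> n; apply/measurable_EFinP; exact: (array_mean_diag_seq n bf).1.
- exact/measurable_EFinP.
- by apply: filterS ha => w hw _; apply: cvg_EFin; [exact: nearW|exact: hw].
- by apply: (@integrable_bounded _ _ _ _ _ `|C|).
- by apply: aeW => w n _; rewrite /= lee_fin; exact: amC.
rewrite (_ : (fun n => _) = (fun n => \int[P]_w array_mean X n (diag_seq (A n w)) f)); last first.
  by apply/funext => n; exact: (array_mean_diag_seq n bf).2.
rewrite -[X in _ --> X](Rintegral_prob_cst P); apply: fine_cvg; rewrite /= fineK; last first.
  by apply: integrable_fin_num => //; apply: (@integrable_bounded _ _ _ _ _ `|\int[mu]_x f x|).
exact: cg.
Qed.

Definition offdiag n w : R :=
  \sum_(i < n) \sum_(j | j != i) Re (A n w i j) * (selfnorm X n i w * selfnorm X n j w).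

Lemma quadratic_formE n w :
  quadratic_form (A n w) (self_normalized X n w) = D n w + offdiag n w.
Proof.
rewrite /quadratic_form mxE.
rewrite (eq_bigr (fun j : 'I_n => \sum_(i < n) (selfnorm X n i w * selfnorm X n j w)%:C * A n w i j)); last first.
  move=> j _; rewrite mxE mulr_suml; apply: eq_bigr => i _.
  have -> : (map_mx (real_complex R) (self_normalized X n w)) j 0 = (selfnorm X n j w)%:C.
    by rewrite mxE self_normalizedE.
  have -> : (map_mx (real_complex R) (self_normalized X n w))^T 0 i = (selfnorm X n i w)%:C.
    by rewrite mxE mxE self_normalizedE.
  have -> : (selfnorm X n i w * selfnorm X n j w)%:C =
      (selfnorm X n i w)%:C * (selfnorm X n j w)%:C by rewrite rmorphM.
  by rewrite mulrAC.
rewrite exchange_big/= Re_sum /D diagformE -big_split/=; apply: eq_bigr => i _.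
rewrite Re_sum (bigD1 i)//= -expr2 diag_seqE; congr (_ + _).
  by rewrite ReZ mulrC.
by apply: eq_bigr => j _; rewrite ReZ mulrC.
Qed.

Lemma measurable_offdiag n : measurable_fun setT (offdiag n).
Proof.
rewrite (_ : offdiag n = (fun w => \sum_(i < n) \sum_(j < n)
   (if j != i then Re (A n w i j) * (selfnorm X n i w * selfnorm X n j w) else 0))); last first.
  by apply/funext => w; apply: eq_bigr => i _; rewrite big_mkcond.
apply: measurable_sum => i; apply: measurable_sum => j; case: (_ != _) => //.
apply: measurable_funM; first by apply: A_random; exact: entries_Re.
by apply: measurable_funM; exact: measurable_selfnorm.
Qed.

Lemma frobenius_offdiag n (M : 'M[R[i]]_n) :
  frobenius_norm (M - diag_part M) ^+ 2 = \sum_i \sum_(j | j != i) normc (M i j) ^+ 2.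
Proof.
rewrite sqr_sqrtr; last by apply: sumr_ge0 => i _; apply: sumr_ge0 => j _; exact: sqr_ge0.
apply: eq_bigr => i _; rewrite (bigD1 i)//= !mxE eqxx mulr1n subrr Normc.normc0 expr0n add0r.
apply: eq_bigr => j ji; rewrite !mxE eq_sym (negbTE ji) mulr0n subr0//.
Qed.

(** With the matrix frozen, [quad_moment_le] bounds the inner integral. The statement is in extended
    reals, as the Frobenius norm may have infinite second moment for some n. *)
Lemma offdiag_mean_le n : symmetric_law P xi ->
  (\int[P]_w (offdiag n w ^+ 2)%:E <= (2 * pair_moment xi n)%:E *
    'E_P[fun w => (frobenius_norm (A n w - diag_part (A n w)) ^+ 2)%R])%E.
Proof.
move=> xi_sym.
pose g z := ((\sum_i \sum_(j | j != i) @entry n i j z * (@coord n i z * @coord n j z)) ^+ 2)%:E.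
have mg : measurable_fun setT g.
  apply/measurable_EFinP; apply: measurable_funX.
  apply: (eq_measurable_fun (fun z => \sum_i \sum_j
    (if j != i then @entry n i j z * (@coord n i z * @coord n j z) else 0))).
    by move=> z _; apply: eq_bigr => i _; rewrite [RHS]big_mkcond.
  apply: measurable_sum => i; apply: measurable_sum => j; case: (_ != _) => //.
  by do ![apply: measurable_funM]; rewrite ?measurable_entry ?measurable_coord//.
have g0 z : (0 <= g z)%E by rewrite lee_fin sqr_ge0.
have := independent_tonelli (@A_random n) (@coordinates_measurable n) (@A_indep n) mg g0.
have -> : (\int[P]_w g (w, w) = \int[P]_w (offdiag n w ^+ 2)%:E)%E.
  apply: eq_integral => w _; congr ((_ ^+ 2)%:E).
  by apply: eq_bigr => i _; apply: eq_bigr => j _; rewrite /entry /coord !self_normalizedE.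
move=> ->.
pose r w (i j : 'I_n) := Re (A n w i j).
pose fr w := frobenius_norm (A n w - diag_part (A n w)) ^+ 2.
have pm0 : 0 <= pair_moment xi n := pair_moment_ge0 xi n.
have gle w : (\int[P]_w' g (w, w') <= (2 * pair_moment xi n * fr w)%:E)%E.
  pose q w' := \sum_i \sum_(j | j != i) r w i j * (selfnorm X n i w' * selfnorm X n j w').
  have -> : (\int[P]_w' g (w, w') = \int[P]_w' (q w' ^+ 2)%:E)%E.
    apply: eq_integral => w' _; congr ((_ ^+ 2)%:E).
    by apply: eq_bigr => i _; apply: eq_bigr => j _; rewrite /entry /coord !self_normalizedE.
  have qB w' : `|q w'| <= \sum_i \sum_(j | j != i) `|r w i j|.
    apply: le_trans (ler_norm_sum _ _ _) _; apply: ler_sum => i _.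
    apply: le_trans (ler_norm_sum _ _ _) _; apply: ler_sum => j _.
    by rewrite normrM ler_piMr// normrM mulr_ile1// selfnorm_le1.
  have mq : measurable_fun setT q.
    rewrite (_ : q = (fun w' => \sum_(i < n) \sum_(j < n)
       (if j != i then r w i j * (selfnorm X n i w' * selfnorm X n j w') else 0))); last first.
      by apply/funext => w'; apply: eq_bigr => i _; rewrite big_mkcond.
    apply: measurable_sum => i; apply: measurable_sum => j; case: (_ != _) => //.
    by apply: measurable_funM => //; apply: measurable_funM; exact: measurable_selfnorm.
  have iq : P.-integrable setT (EFin \o (fun w' => q w' ^+ 2)).
    apply: (@integrable_bounded _ _ _ _ _ ((\sum_i \sum_(j | j != i) `|r w i j|) ^+ 2)).
      exact: measurable_funX.
    by move=> w'; rewrite normrX lerXn2r ?nnegrE// (le_trans _ (qB w')).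
  rewrite -[leLHS]fineK; last exact: (integrable_fin_num measurableT iq).
  rewrite lee_fin; apply: le_trans (quad_moment_le X_iid (r w) xi_sym) _.
  rewrite ler_wpM2l ?mulr_ge0// /fr frobenius_offdiag.
  apply: ler_sum => i _; apply: ler_sum => j _.
  by rewrite -[leLHS]real_normK ?num_real// lerXn2r ?nnegrE ?normc_ge0// le_Re_normc.
have mfr : measurable_fun setT (fun w => (fr w)%:E).
  apply/measurable_EFinP.
  rewrite (_ : fr = (fun w => \sum_(i < n) \sum_(j < n)
    (if j != i then Re (A n w i j) ^+ 2 + Im (A n w i j) ^+ 2 else 0))); last first.
    apply/funext => w; rewrite /fr frobenius_offdiag; apply: eq_bigr => i _.
    by rewrite big_mkcond; apply: eq_bigr => j _; rewrite -sqr_normc_def.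
  apply: measurable_sum => i; apply: measurable_sum => j; case: (_ != _) => //.
  apply: measurable_funD; apply: measurable_funX; apply: A_random; exists i, j; first by left.
  by right.
rewrite unlock.
have fr0 w : 0 <= fr w by exact: sqr_ge0.
rewrite -ge0_integralZl//; last 2 first.
- by move=> w _; rewrite lee_fin; exact: fr0.
- by rewrite lee_fin mulr_ge0.
apply: ge0_le_integral => //.
- by move=> w _; exact: integral_ge0.
- exact: (measurable_section_integral P (@A_random n) (@coordinates_measurable n) mg g0).
- by apply/measurable_EFinP; apply: measurable_funM => //; exact/measurable_EFinP.
Qed.

End random_matrices.

(** * Stability under a perturbation small in mean square *)

Section cutoff.
Context {R : realType}.

(** Continuous, so that convergence of expectations applies to it; 1 - [cutoff M] dominates the
    indicator of |t| >= M + 1 and measures the escaping mass. *)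
Definition cutoff (M t : R) : R := ramp M (M + 1) `|t|.

Lemma bc_cutoff M : bounded_continuous (cutoff M).
Proof.
split=> [t|]; last by exists 1 => x; rewrite ger0_norm ?ramp_ge0// ramp_le1.
exact: (continuous_comp (@norm_continuous _ _ t) (@continuous_ramp _ _ _ _)).
Qed.

Lemma cutoff_eq1 M t : `|t| <= M -> cutoff M t = 1.
Proof. by move=> tM; rewrite /cutoff ramp_eq1// ltrDl. Qed.

Lemma cutoff_eq0 M t : M + 1 <= `|t| -> cutoff M t = 0.
Proof. by move=> tM; rewrite /cutoff ramp_eq0// ltrDl. Qed.

End cutoff.

Lemma integrable_bc d (T : measurableType d) (R : realType) (P : probability T R)
  (f : R -> R) (Y : T -> R) : bounded_continuous f -> measurable_fun setT Y ->
  P.-integrable setT (EFin \o (fun w => f (Y w))).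
Proof.
move=> [cf [B fB]] mY; apply: (@integrable_bounded _ _ _ _ _ B) => //.
by apply: measurableT_comp => //; exact: continuous_measurable_fun.
Qed.

(** No compact interval is assumed to contain all the [D n]. Tightness comes from the limit:
    E[cutoff M (D n)] tends to 1, because [mu] integrates the cutoff to 1. *)
Lemma cvg_in_distribution_perturb d (T : measurableType d) (R : realType) (P : probability T R)
  (D Q : nat -> T -> R) (mu : probability R R) (M : R) :
  (forall n, measurable_fun setT (D n)) -> (forall n, measurable_fun setT (Q n)) ->
  (forall f, bounded_continuous f -> \int[P]_w f (D n w) @[n --> \oo] --> \int[mu]_x f x) ->
  0 <= M -> \int[mu]_x cutoff M x = 1 ->
  (\int[P]_w ((Q n w - D n w) ^+ 2)%:E @[n --> \oo] --> 0)%E ->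
  cvg_in_distribution P Q mu.
Proof.
move=> mD mQ hD M0 chi1 hO f cf bf.
have bcf : bounded_continuous f by apply/bounded_continuousP.
have [_ [B fB]] := bcf.
have B0 : 0 <= B by apply: le_trans (fB 0).
suff h : \int[P]_w f (Q n w) @[n --> \oo] --> \int[mu]_x f x.
  have -> : (\int[mu]_x (f x)%:E)%E = (\int[mu]_x f x)%:E.
    rewrite fineK//; apply: integrable_fin_num => //.
    exact: (integrable_bc mu bcf (@measurable_id _ _ setT)).
  rewrite (_ : (fun n => _) = (fun n => (\int[P]_w f (Q n w))%:E)).
    by apply: cvg_EFin; [exact: nearW|exact: h].
  apply/funext => n; rewrite unlock fineK//; apply: integrable_fin_num => //.
  exact: integrable_bc.
apply/cvgrPdist_le => e e0.
have e4 : 0 < e / 4 by rewrite divr_gt0.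
have [C C0 hC] := uniform_modulus (M + 2) cf e4.
(* Three regimes: for |s| beyond M + 1 the cutoff term alone is 2 B; for s and t in [-M - 2, M + 2]
   the quadratic modulus applies; otherwise |t - s| >= 1 and 2 B (t - s)^2 suffices. *)
have close t s : `|f t - f s| <= e / 4 + (C + 2 * B) * (t - s) ^+ 2 + 2 * B * (1 - cutoff M s).
  have fts : `|f t - f s| <= 2 * B.
    by apply: le_trans (ler_normB _ _) _; have := fB t; have := fB s; lra.
  have c1 : cutoff M s <= 1 by exact: ramp_le1.
  have q0 : 0 <= (t - s) ^+ 2 by exact: sqr_ge0.
  have Cq : 0 <= C * (t - s) ^+ 2 by rewrite mulr_ge0.
  have Bq : 0 <= B * (t - s) ^+ 2 by rewrite mulr_ge0.
  have Bc : 0 <= B * (1 - cutoff M s) by rewrite mulr_ge0 ?subr_ge0.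
  have [sM|sM] := leP `|s| (M + 1); last by rewrite cutoff_eq0 ?ltW//; lra.
  have [tM|tM] := leP `|t| (M + 2).
    have sM' : `|s| <= M + 2 by lra.
    by have := hC s t sM' tM; lra.
  have ts1 : 1 <= `|t - s| by have := lerB_dist t s; lra.
  have q1 : 1 <= (t - s) ^+ 2.
    by rewrite -[leRHS]real_normK ?num_real// -(expr1n _ 2) lerXn2r ?nnegrE.
  have : B <= B * (t - s) ^+ 2 by rewrite ler_peMr.
  lra.
have iO n : (\int[P]_w ((Q n w - D n w) ^+ 2)%:E \is a fin_num)%E ->
    P.-integrable setT (EFin \o (fun w => (Q n w - D n w) ^+ 2)).
  move=> fO; apply/integrableP; split.
    by apply/measurable_EFinP; apply: measurable_funX; exact: measurable_funB.
  under eq_integral do rewrite gee0_abs ?lee_fin ?sqr_ge0//.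
  by rewrite ltey_eq fO.
have key n : (\int[P]_w ((Q n w - D n w) ^+ 2)%:E \is a fin_num)%E ->
    `|\int[P]_w f (Q n w) - \int[P]_w f (D n w)| <=
    e / 4 + (C + 2 * B) * \int[P]_w ((Q n w - D n w) ^+ 2) +
    2 * B * (1 - \int[P]_w cutoff M (D n w)).
  move=> /iO i2; have iQ := integrable_bc P bcf (mQ n); have iD := integrable_bc P bcf (mD n).
  have ic := integrable_bc P (bc_cutoff M) (mD n).
  have i1 c : P.-integrable setT (EFin \o (fun _ : T => c : R)).
    by apply: (@integrable_bounded _ _ _ _ _ `|c|).
  have iQD : P.-integrable setT (EFin \o (fun w => f (Q n w) - f (D n w))).
    have := integrable_add measurableT iQ (integrable_scale (-1) measurableT iD).
    by congr (P.-integrable setT (EFin \o _)); apply/funext => w; rewrite mulN1r.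
  rewrite -RintegralB//.
  apply: le_trans (le_normr_Rintegral measurableT iQD) _.
  have ic1 : P.-integrable setT (EFin \o (fun w => 1 - cutoff M (D n w))).
    have := integrable_add measurableT (i1 1) (integrable_scale (-1) measurableT ic).
    by congr (P.-integrable setT (EFin \o _)); apply/funext => w; rewrite mulN1r.
  have iS1 := integrable_add measurableT (i1 (e / 4)) (integrable_scale (C + 2 * B) measurableT i2).
  have iS2 := integrable_scale (2 * B) measurableT ic1.
  apply: (@le_trans _ _ (\int[P]_w (e / 4 + (C + 2 * B) * (Q n w - D n w) ^+ 2 +
      2 * B * (1 - cutoff M (D n w))))).
    apply: le_Rintegral => //; [exact: integrable_norm|exact: integrable_add].
  rewrite RintegralD// RintegralD//; last exact: integrable_scale.
  by rewrite !RintegralZl// RintegralB// !Rintegral_prob_cst.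
have /fine_cvgP[hfin hlim] := hO.
have Z1 : (C + 2 * B) * \int[P]_w ((Q n w - D n w) ^+ 2) @[n --> \oo] --> (0 : R).
  by rewrite -[X in _ --> X](mulr0 (C + 2 * B)); apply: cvgM; [exact: cvg_cst|exact: hlim].
have Z2 : 2 * B * (1 - \int[P]_w cutoff M (D n w)) @[n --> \oo] --> (0 : R).
  have -> : (0 : R) = 2 * B * (1 - \int[mu]_x cutoff M x) by rewrite chi1 subrr mulr0.
  apply: cvgM; first exact: cvg_cst.
  by apply: cvgB; [exact: cvg_cst|exact: (hD _ (bc_cutoff M))].
near=> n.
have n0 : (\int[P]_w ((Q n w - D n w) ^+ 2)%:E \is a fin_num)%E by near: n; exact: hfin.
have n1 : `|(C + 2 * B) * \int[P]_w ((Q n w - D n w) ^+ 2)| <= e / 4.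
  by near: n; move/cvgr0Pnorm_le: Z1; exact.
have n2 : `|2 * B * (1 - \int[P]_w cutoff M (D n w))| <= e / 4.
  by near: n; move/cvgr0Pnorm_le: Z2; exact.
have n3 : `|\int[mu]_x f x - \int[P]_w f (D n w)| <= e / 4.
  by near: n; move/cvgrPdist_le: (hD f bcf); exact.
move: (key n n0) n1 n2 n3; rewrite !ler_norml.
move=> /andP[? ?] /andP[? ?] /andP[? ?] /andP[? ?]; apply/andP; split; lra.
Unshelve. all: by end_near. Qed.

Section quadratic_form_law.
Context d (T : measurableType d) (R : realType) (P : probability T R).
Variables (xi : {RV P >-> R}) (X : nat -> {RV P >-> R}).
Hypothesis X_iid : iid_copies P xi X.
Hypothesis xi_sym : symmetric_law P xi.
Variable A : forall n : nat, T -> 'M[R[i]]_n.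
Hypothesis A_random : forall n, random_matrix (A n).
Hypothesis A_indep : forall n,
  independent_families P (entries (A n)) (coordinates (self_normalized X n)).
Hypothesis A_offdiag : ((n%:R ^- 2)%:E *
    'E_P[fun w => (frobenius_norm (A n w - diag_part (A n w)) ^+ 2)%R]
  @[n --> \oo] --> 0)%E.

Lemma offdiag_mean_cvg0 : (\int[P]_w (offdiag X A n w ^+ 2)%:E @[n --> \oo] --> 0)%E.
Proof.
(* For n >= 2, n^2 <= 2 n (n - 1), so twice the pair moment is at most 4 / n^2. *)
have Z : (4%:E * ((n%:R ^- 2)%:E *
    'E_P[fun w => (frobenius_norm (A n w - diag_part (A n w)) ^+ 2)%R])
  @[n --> \oo] --> 0)%E.
  by rewrite -[X in _ --> X](mule0 4%:E); exact: cvgeZl.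
apply: (@squeeze_cvge _ _ _ _ (fun=> 0%E) _ _ _ _ _ Z); last exact: cvg_cst.
near=> n; apply/andP; split; first by apply: integral_ge0 => w _; rewrite lee_fin sqr_ge0.
apply: le_trans (offdiag_mean_le X_iid A_random A_indep n xi_sym) _.
rewrite muleA -EFinM; apply: lee_wpmul2r.
  by apply: expectation_ge0 => w; exact: sqr_ge0.
have n2 : (1 < n)%N by near: n; exact: nbhs_infty_gt.
rewrite lee_fin ler_pdivlMr ?exprn_gt0 ?ltr0n 1?ltnW// -natrX.
have h := pair_moment_le X_iid n; have h0 := pair_moment_ge0 xi n.
have : (n ^ 2)%:R <= 2 * (n * n.-1)%:R :> R.
  rewrite -natrM ler_nat mulnCA expnS expn1 leq_mul2l.
  case: (n) n2 => [|[|k]] _ //; rewrite orFb mul2n -addnn -[_.-1]/k.+1.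
  by rewrite addSn ltnS leq_addl.
nra.
Unshelve. all: by end_near. Qed.

Lemma quadratic_form_cvg (mu : probability R R) (M : R) : 0 <= M ->
  \int[mu]_x cutoff M x = 1 ->
  {ae P, forall w, forall f, bounded_continuous f ->
    array_mean X n (diag_seq (A n w)) f @[n --> \oo] --> \int[mu]_x f x} ->
  cvg_in_distribution P (fun n w => quadratic_form (A n w) (self_normalized X n w)) mu.
Proof.
move=> M0 hM hA.
have E n : (fun w => quadratic_form (A n w) (self_normalized X n w)) =
    (fun w => diagform X n (diag_seq (A n w)) w + offdiag X A n w).
  by apply/funext => w; exact: quadratic_formE.
apply: (@cvg_in_distribution_perturb _ _ _ _ (fun n w => diagform X n (diag_seq (A n w)) w) _ _ M) => //.
- exact: measurable_diag_seq.
- move=> n; rewrite E; apply: measurable_funD; first exact: measurable_diag_seq.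
  exact: measurable_offdiag.
- move=> f bf; apply: (diag_mean_cvg A_random A_indep) => //.
  by apply: filterS hA => w; exact.
- rewrite (_ : (fun n => _) = (fun n => (\int[P]_w (offdiag X A n w ^+ 2)%:E)%E)).
    exact: offdiag_mean_cvg0.
  apply/funext => n; apply: eq_integral => w _.
  by rewrite quadratic_formE addrAC subrr add0r.
Qed.

End quadratic_form_law.

(** * Powers with the principal branch *)

Section complex_powers.
Context {R : realType}.

(** Unlike the formula in [carg_upper], this one remains valid on the real axis, cut included, and
    is continuous in v down to v = 0. *)
Lemma carg_quadrant (u v : R) : u != 0 -> 0 <= v ->
  carg (u +i* v) = (if 0 < u then 0 else pi) + atan (v / u).
Proof.
move=> u0 v0; have p0 := pi_gt0 R.
have a1 := atan_gtNpi2 (v / u); have a2 := atan_ltpi2 (v / u).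
have nE : normc (u +i* v) = `|u| * Num.sqrt (1 + (v / u) ^+ 2).
  rewrite -[`|u|]sqrtr_sqr -sqrtrM ?sqr_ge0//=; congr Num.sqrt.
  by field.
have s0 : Num.sqrt (1 + (v / u) ^+ 2) != 0.
  by rewrite gt_eqF// sqrtr_gt0 ltr_pwDl// sqr_ge0.
rewrite /carg nE; set q := Num.sqrt _ in s0 *; rewrite [complex.Re _]/= [complex.Im _]/= v0.
case: ifPn => [up|]; last rewrite -leNgt le_eqVlt (negbTE u0)/= => un.
  have c : u / (`|u| * q) = cos (0 + atan (v / u)).
    by rewrite add0r cos_atan -/q gtr0_norm//; field; rewrite s0 u0.
  rewrite c cosK// in_itv/= add0r -[X in X <= _]atan0 le_atan ?divr_ge0 ?(ltW up)//=.
  lra.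
have c : u / (`|u| * q) = cos (pi + atan (v / u)).
  rewrite addrC cosDpi cos_atan -/q ltr0_norm//; field.
  by rewrite s0 u0.
rewrite c cosK// in_itv/=.
have : atan (v / u) <= 0.
  by rewrite -[X in _ <= X]atan0 le_atan// mulr_ge0_le0// invr_le0 ltW.
lra.
Qed.

Lemma normc_upper (t y : R) : 0 < y -> normc ((- t) +i* y) = expR (Re (clog y t)).
Proof.
by move=> y0; rewrite -normc_cexp cexp_clog//= sqrrN addrC.
Qed.

(** - t + i y = i (y + i t): a quarter turn added to the argument of a point of the right
    half-plane, with no crossing of the cut. *)
Lemma carg_upper (t y : R) : 0 < y -> carg ((- t) +i* y) = pi / 2 + atan (t / y).
Proof.
move=> y0; have p0 := pi_gt0 R.
have a1 := atan_gtNpi2 (t / y); have a2 := atan_ltpi2 (t / y).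
rewrite /carg normc_upper// [complex.Re _]/= [complex.Im _]/= (ltW y0).
have c : - t / expR (Re (clog y t)) = cos (pi / 2 + atan (t / y)).
  have := congr1 (@complex.Im R) (cexp_clog y0 t); rewrite Im_cexp => /= h.
  rewrite [_ + atan _]addrC cosD cos_pihalf sin_pihalf mulr0 mulr1 sub0r mulNr; congr (- _).
  by rewrite -[X in X / _]h mulrAC mulfV ?mul1r// gt_eqF// expR_gt0.
rewrite c cosK// in_itv/=; lra.
Qed.

(** The principal value of i^e, relating the powers of z - a = i p to those of p. *)
Definition rot (e : R) : R[i] := cexp (0 +i* (e * (pi / 2))).

Lemma cpow_upper (re y a e : R) : 0 < y ->
  cpow ((re +i* y) - a%:C) e = rot e * cexp (e%:C * clog y (a - re)).
Proof.
move=> y0; have -> : (re +i* y) - a%:C = (- (a - re)) +i* y.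
  by apply: complex_ext => /=; ring.
rewrite -cexpD /cpow normc_upper// carg_upper// /powR gt_eqF ?expR_gt0// expRK.
have -> : cexp ((0 +i* (e * (pi / 2))) + e%:C * clog y (a - re)) =
  (expR (e * Re (clog y (a - re))) * cos (e * (pi / 2 + atan ((a - re) / y)))) +i*
  (expR (e * Re (clog y (a - re))) * sin (e * (pi / 2 + atan ((a - re) / y)))).
  by rewrite /cexp ReD ImD ReZ ImZ add0r -mulrDr.
by [].
Qed.

Lemma normc_cpow (z : R[i]) e : normc (cpow z e) = normc z `^ e.
Proof.
apply/eqP; rewrite -(@eqrXn2 _ 2) ?normc_ge0 ?powR_ge0// sqr_normc_def.
apply/eqP; rewrite [complex.Re _]/= [complex.Im _]/= !exprMn -mulrDr cos2Dsin2.
by rewrite mulr1.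
Qed.

Lemma cpow_conj (u v e : R) : 0 < v ->
  Re (cpow (u +i* - v) e) = Re (cpow (u +i* v) e) /\
  Im (cpow (u +i* - v) e) = - Im (cpow (u +i* v) e).
Proof.
move=> v0; have n : normc (u +i* - v) = normc (u +i* v) by rewrite /= sqrrN.
have c : carg (u +i* - v) = - carg (u +i* v).
  by rewrite /carg n [complex.Im (_ +i* - v)]/= oppr_ge0 leNgt v0 [complex.Im _]/= (ltW v0).
by rewrite /cpow n c mulrN cosN sinN mulrN.
Qed.

Lemma continuous_powR_gt0 (e x : R) : 0 < x -> {for x, continuous (fun u : R => u `^ e)}.
Proof.
move=> x0; apply: differentiable_continuous; apply/derivable1_diffP.
by apply: derivable_powR; rewrite in_itv/= x0.
Qed.

(** The approach is from above, the side on which the principal argument is continuous up to the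
    negative axis, where it equals pi. *)
Lemma cpow_real_cvg (u e : R) : u != 0 ->
  ccvg (fun n => cpow (u +i* n.+1%:R^-1) e) (cpow u%:C e).
Proof.
move=> u0; pose c := if 0 < u then 0 else pi : R.
have h : (fun n => n.+1%:R^-1 : R) @ \oo --> (0 : R) by exact: cvg_harmonic.
have carg_cvg : carg (u +i* n.+1%:R^-1) @[n --> \oo] --> carg u%:C.
  rewrite carg_quadrant// mul0r.
  rewrite (_ : (fun n => _) = (fun n => c + atan (n.+1%:R^-1 / u))); last first.
    by apply/funext => n; rewrite carg_quadrant.
  apply: cvgD; first exact: cvg_cst.
  apply: continuous_cvg; first exact: continuous_atan.
  rewrite -[X in _ --> X](mul0r u^-1); apply: cvgM; [exact: h|exact: cvg_cst].
have norm_cvg : normc (u +i* n.+1%:R^-1) @[n --> \oo] --> normc u%:C.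
  have hs : u ^+ 2 + n.+1%:R^-1 ^+ 2 @[n --> \oo] --> (u ^+ 2 + 0 ^+ 2 : R).
    by apply: cvgD; [exact: cvg_cst|exact: (cvg_comp _ _ h (@exprn_continuous R 2 0))].
  exact: (cvg_comp _ _ hs (@sqrt_continuous R _)).
have pow_cvg : normc (u +i* n.+1%:R^-1) `^ e @[n --> \oo] --> normc u%:C `^ e.
  have n0 : 0 < normc u%:C by rewrite normc_real normr_gt0.
  exact: (cvg_comp _ _ norm_cvg (@continuous_powR_gt0 e _ n0)).
split; apply: cvgM => //; apply: continuous_cvg.
- exact: continuous_cos.
- by apply: cvgM; [exact: cvg_cst|exact: carg_cvg].
- exact: continuous_sin.
- by apply: cvgM; [exact: cvg_cst|exact: carg_cvg].
Qed.

(** The argument of u^b is 0 or b pi according to the sign of u. Turning by - b pi / 2 makes it - b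
    pi / 2 or b pi / 2, with the same cosine: powers from both sides of a gap of the support then
    add up without cancellation. *)
Lemma Re_rot_cpow_real (u b : R) : u != 0 ->
  Re (rot (- b) * cpow u%:C b) = `|u| `^ b * cos (b * (pi / 2)).
Proof.
move=> u0; have -> : cpow u%:C b = (normc u%:C `^ b)%:C * cexp (0 +i* (b * carg u%:C)).
  rewrite /cexp expR0 !mul1r; apply: complex_ext; rewrite ?ReZ ?ImZ//.
rewrite mulrCA -cexpD ReZ normc_real; congr (_ * _).
rewrite Re_cexp ReD ImD /= addr0 expR0 mul1r carg_quadrant// mul0r atan0 addr0.
case: ifP => _; first by rewrite mulr0 addr0 mulNr cosN.
by rewrite (_ : _ + _ = b * (pi / 2))//; field.
Qed.

End complex_powers.

Lemma measurable_norm_le {R : realType} (M : R) : measurable [set s : R | `|s| <= M].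
Proof.
rewrite (_ : mkset _ = `[- M, M]%classic); first exact: measurable_itv.
by apply/seteqP; split => s /=; rewrite in_itv/= ler_norml.
Qed.

Section null_restriction.
Context d (T : measurableType d) (R : realType) (mu : {measure set T -> \bar R}).

Lemma Rintegral_null_setC (D : set T) (f : T -> R) : measurable D -> mu (~` D) = 0 ->
  measurable_fun setT f -> \int[mu]_(x in setT) f x = \int[mu]_(x in D) f x.
Proof.
move=> mD D0 mf; rewrite [RHS]Rintegral_mkcond /Rintegral; congr fine.
apply: ae_eq_integral => //; first exact/measurable_EFinP.
  apply/measurable_EFinP; apply/(measurable_restrictT _ mD).
  exact: measurable_funTS.
exists (~` D); split => //; first exact: measurableC.
move=> x /= h Dx; apply: h => _; rewrite patchE mem_set//.
Qed.

Lemma cint_null_setC (D : set T) (f : T -> R[i]) : measurable D -> mu (~` D) = 0 ->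
  cmeasurable setT f -> cint mu setT f = cint mu D f.
Proof.
by move=> mD D0 [mR mI]; rewrite /cint !(Rintegral_null_setC mD D0).
Qed.

End null_restriction.

Section conjugation.
Context d (T : measurableType d) (R : realType) (mu : {measure set T -> \bar R}).

Lemma cint_conj (f : T -> R[i]) : cintegrable mu setT f ->
  cint mu setT (fun x => (f x)^*) = (cint mu setT f)^*.
Proof.
have Rc (z : R[i]) : Re z^* = Re z by case: z.
have Ic (z : R[i]) : Im z^* = - Im z by case: z.
move=> [iR iI]; apply: complex_ext; rewrite ?Rc ?Ic /=.
  by apply: eq_Rintegral => x _; rewrite Rc.
rewrite -mulN1r -RintegralZl//; apply: eq_Rintegral => x _.
by rewrite Ic mulN1r.
Qed.

Lemma cmeasurable_conj (f : T -> R[i]) : cmeasurable setT f -> cmeasurable setT (fun x => (f x)^*).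
Proof.
move=> [mR mI]; split.
  by rewrite (_ : (fun x => _) = (fun x => Re (f x)))//; apply/funext => x; case: (f x).
rewrite (_ : (fun x => _) = (fun x => - Im (f x))); first exact: measurableT_comp.
by apply/funext => x; case: (f x).
Qed.

End conjugation.

Section power_means.
Context {R : realType}.
Variables (nu : probability R R) (M : R).
Hypothesis M0 : 0 <= M.
Let K : set R := [set s | `|s| <= M].
Hypothesis nuM : nu (~` K) = 0.

Let mK : measurable K. Proof. exact: measurable_norm_le. Qed.

Let measurable_shift (re : R) : measurable_fun setT (fun s : R => s - re).
Proof. exact: measurable_funB. Qed.

Lemma cmeasurable_cpow_upper (re y e : R) : 0 < y ->
  cmeasurable setT (fun s : R => cpow ((re +i* y) - s%:C) e).
Proof.
move=> y0; rewrite (_ : (fun s => _) = (fun s : R => rot e * cexp (e%:C * clog y (s - re)))).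
  by apply: cmeasurableM; [exact: cmeasurable_cst|exact: cmeasurable_cexp_clog].
by apply/funext => s; exact: cpow_upper.
Qed.

Lemma cint_cpow_upper (re y e M' : R) : 0 < y -> M <= M' ->
  cint nu setT (fun s : R => cpow ((re +i* y) - s%:C) e) = rot e * cpow_mean re y M' nu e.
Proof.
move=> y0 MM'; have M'0 := le_trans M0 MM'.
have ic := @cintegrable_cpow _ re y M' y0 M'0 nu e.
have mc := @cmeasurable_cpow _ re y M' y0 e.
rewrite -cintZ// (cint_null_setC mK nuM); last exact: cmeasurable_cpow_upper.
rewrite [RHS](cint_null_setC mK nuM); last by apply: cmeasurableM => //; exact: cmeasurable_cst.
apply: eq_cint => s Ks; rewrite cpow_upper// clamp_id//.
exact: le_trans MM'.
Qed.

Lemma cint_cpow_lower (re y e : R) : 0 < y ->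
  cint nu setT (fun s : R => cpow ((re +i* - y) - s%:C) e) =
  (cint nu setT (fun s : R => cpow ((re +i* y) - s%:C) e))^*.
Proof.
move=> y0; have ic := @cintegrable_cpow _ re y M y0 M0 nu e.
have mc := @cmeasurable_cpow _ re y M y0 e.
rewrite (cint_cpow_upper _ _ y0 (lexx M)) -cintZ// -cint_conj; last exact: cintegrableZ.
have E s : cpow ((re +i* - y) - s%:C) e = (cpow ((re +i* y) - s%:C) e)^*.
  have -> : (re +i* - y) - s%:C = (re - s) +i* - y by apply: complex_ext; rewrite /= ?subr0.
  have -> : (re +i* y) - s%:C = (re - s) +i* y by apply: complex_ext; rewrite /= ?subr0.
  have [h1 h2] := cpow_conj (re - s) e y0.
  by apply: complex_ext; rewrite ?h1 ?h2//.
transitivity (cint nu setT (fun s : R => (cpow ((re +i* y) - s%:C) e)^*)).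
  by apply: eq_cint => s _; exact: E.
rewrite (cint_null_setC mK nuM); last by apply: cmeasurable_conj; exact: cmeasurable_cpow_upper.
rewrite [RHS](cint_null_setC mK nuM); last first.
  by apply: cmeasurable_conj; apply: cmeasurableM => //; exact: cmeasurable_cst.
by apply: eq_cint => s Ks; rewrite cpow_upper// clamp_id.
Qed.

Section real_point.
Variables (x r : R).
Hypothesis r0 : 0 < r.
Hypothesis nur : nu (ball x r) = 0.

(** nu is carried by this bounded set, which keeps distance r from x, so that powers of x - s of
    either sign are bounded on it. *)
Let D : set R := K `\` ball x r.
Let mD : measurable D. Proof. by apply: measurableD => //; exact: measurable_ball. Qed.
Let nuD : nu (~` D) = 0.
Proof.
apply/eqP; rewrite -measure_le0 setCD (le_trans (measureU2 _ _ _))//.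
- exact: measurableC.
- exact: measurable_ball.
by rewrite [X in (X + _)%E]nuM [X in (_ + X)%E]nur adde0.
Qed.

Let DE s : D s -> `|s| <= M /\ r <= `|x - s|.
Proof. by move=> [Ks]; rewrite /ball/= => /negP; rewrite -leNgt => h. Qed.

Let invS_gt0 n : 0 < n.+1%:R^-1 :> R. Proof. by rewrite invr_gt0. Qed.

Let cpow_shift_cvg (e s : R) : s != x ->
  ccvg (fun n => cpow ((x +i* n.+1%:R^-1) - s%:C) e) (cpow (x%:C - s%:C) e).
Proof.
move=> sx; have -> : x%:C - s%:C = (x - s)%:C :> R[i] by rewrite rmorphB.
rewrite (_ : (fun n => _) = (fun n => cpow ((x - s) +i* n.+1%:R^-1) e)).
  by apply: cpow_real_cvg; rewrite subr_eq0 eq_sym.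
by apply/funext => n; congr (cpow _ _); apply: complex_ext; rewrite /= ?subr0.
Qed.

Let cmeasurable_cpow_real (e : R) : cmeasurable setT (fun s : R => cpow (x%:C - s%:C) e).
Proof.
(* The approximation from above converges off s = x; on the singleton measurability is automatic. *)
have U : [set: R] = [set~ x] `|` [set x] by rewrite setUC setUv.
have m1 : measurable [set x] by exact: measurable_set1.
have mu n : cmeasurable [set~ x] (fun s : R => cpow ((x +i* n.+1%:R^-1) - s%:C) e).
  have [h1 h2] := @cmeasurable_cpow_upper x n.+1%:R^-1 e (invS_gt0 n).
  by split; exact: measurable_funTS.
split; rewrite U; apply/measurable_funU => //; try exact: measurableC; split;
  try exact: measurable_fun_set1.
  apply: (measurable_fun_cvg (h := fun n (s : R) => Re (cpow ((x +i* n.+1%:R^-1) - s%:C) e))).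
    by move=> n; exact: (mu n).1.
  by move=> s /eqP sx; exact: (cpow_shift_cvg e sx).1.
apply: (measurable_fun_cvg (h := fun n (s : R) => Im (cpow ((x +i* n.+1%:R^-1) - s%:C) e))).
  by move=> n; exact: (mu n).2.
by move=> s /eqP sx; exact: (cpow_shift_cvg e sx).2.
Qed.

Let cpow_dct e : cintegrable nu D (fun s : R => cpow (x%:C - s%:C) e) /\
  ccvg (fun n => cint nu D (fun s : R => cpow ((x +i* n.+1%:R^-1) - s%:C) e))
    (cint nu D (fun s : R => cpow (x%:C - s%:C) e)).
Proof.
(* The summand 1 bounds the imaginary part 1 / (n + 1). In the majorant, r^e serves negative
   exponents and C^e nonnegative ones. *)
pose C := `|x| + M + 1.
apply: (@cint_dct _ _ _ _ _ _ _ (fun=> r `^ e + C `^ e)) => //.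
- move=> n; have [h1 h2] := @cmeasurable_cpow_upper x n.+1%:R^-1 e (invS_gt0 n).
  by split; exact: measurable_funTS.
- apply: (@integrableS _ _ _ _ setT) => //.
  exact: (@integrable_bounded _ _ _ _ _ `|r `^ e + C `^ e|).
- move=> n s Ds; have [sM rs] := DE Ds; rewrite normc_cpow.
  set z := (_ - _); have rz : r <= normc z.
    by apply: le_trans rs _; apply: le_trans (le_Re_normc z); rewrite /z /= lexx.
  have zC : normc z <= C.
    apply: le_trans (le_normc_ReIm _) _; rewrite /z /= subr0 lerD//.
      by apply: le_trans (ler_normB _ _) _; rewrite lerD2l.
    by rewrite ger0_norm ?invr_ge0// invf_le1 ?ler1n ?ltr0n.
  have [e0|e0] := leP 0 e.
    by rewrite (le_trans (ge0_ler_powR e0 _ _ zC)) ?nnegrE ?normc_ge0 ?lerDr ?powR_ge0// (le_trans _ zC)// normc_ge0.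
  have z0 : 0 < normc z by exact: lt_le_trans rz.
  apply: (@le_trans _ _ (r `^ e)); last by rewrite lerDl powR_ge0.
  rewrite -[e]opprK [leLHS]powRN [leRHS]powRN lef_pV2 ?posrE ?powR_gt0//.
  by rewrite ge0_ler_powR ?nnegrE ?(ltW r0) ?normc_ge0// oppr_ge0 ltW.
- move=> s Ds; have [sM rs] := DE Ds; apply: cpow_shift_cvg.
  by apply: contraTneq rs => ->; rewrite subrr normr0 -ltNge.
Qed.

Lemma cint_cpow_real_cvg e :
  ccvg (fun n => cint nu setT (fun s : R => cpow ((x +i* n.+1%:R^-1) - s%:C) e))
    (cint nu setT (fun s : R => cpow (x%:C - s%:C) e)).
Proof.
have [_ h] := cpow_dct e.
rewrite (cint_null_setC mD nuD); last exact: cmeasurable_cpow_real.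
rewrite (_ : (fun n => _) = (fun n => cint nu D (fun s : R => cpow ((x +i* n.+1%:R^-1) - s%:C) e)))//.
apply/funext => n; rewrite (cint_null_setC mD nuD)//.
exact: cmeasurable_cpow_upper.
Qed.

(** After the turn by - b pi / 2 the integrand has real part at least r^b cos (b pi / 2) > 0 on
    [D]. *)
Lemma cint_cpow_real_neq0 b : 0 < b < 1 ->
  cint nu setT (fun s : R => cpow (x%:C - s%:C) b) != 0.
Proof.
move=> /andP[b0 b1]; have [ic _] := cpow_dct b.
have p0 := pi_gt0 R.
have cb : 0 < cos (b * (pi / 2)).
  apply: cos_gt0_pihalf; apply/andP; split.
    by apply: (@lt_trans _ _ 0); rewrite ?oppr_lt0 ?mulr_gt0 ?divr_gt0.
  by rewrite gtr_pMl ?divr_gt0.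
have : 0 < Re (rot (- b) * cint nu setT (fun s : R => cpow (x%:C - s%:C) b)).
  rewrite (cint_null_setC mD nuD); last exact: cmeasurable_cpow_real.
  rewrite -cintZ//; apply: (@lt_le_trans _ _ (\int[nu]_(s in D) (r `^ b * cos (b * (pi / 2))))).
    rewrite -(Rintegral_null_setC mD nuD)// Rintegral_prob_cst.
    by rewrite mulr_gt0// powR_gt0.
  apply: le_Rintegral => //.
  - apply: (@integrableS _ _ _ _ setT) => //.
    exact: (@integrable_bounded _ _ _ _ _ `|r `^ b * cos (b * (pi / 2))|).
  - exact: (cintegrableZ _ mD ic).1.
  move=> s Ds; have [sM rs] := DE Ds.
  have -> : x%:C - s%:C = (x - s)%:C :> R[i] by rewrite rmorphB.
  rewrite Re_rot_cpow_real; last by rewrite -normr_gt0 (lt_le_trans r0).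
  by rewrite ler_pM2r// ge0_ler_powR ?nnegrE// ltW.
by apply: contraTneq => ->; rewrite mulr0 ltxx.
Qed.

End real_point.
End power_means.

(** * The Stieltjes transform of the limit law *)

Lemma off_support_ball {R : realType} (nu : probability R R) (x : R) :
  off_support nu x%:C -> exists2 r, 0 < r & nu (ball x r) = 0.
Proof.
move=> off; have ns : ~ msupport nu x by move=> /off.
apply: contrapT => h; apply: ns => e e0; rewrite lt0e measure_ge0 andbT.
by apply/eqP => h0; apply: h; exists e.
Qed.

Section stieltjes_transform.
Context {R : realType}.
Variables (mu nu : probability R R) (M b : R).
Hypothesis M0 : 0 <= M.
Hypothesis nuM : nu (~` [set s : R | `|s| <= M]) = 0.
Hypothesis b01 : 0 < b < 1.
Hypothesis mu_resolvent : forall re y M' : R, 0 < y -> M <= M' -> `|re| <= M' ->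
  cint mu setT (resolvent re y) =
  'i%C * (cpow_mean re y M' nu (b - 1) / cpow_mean re y M' nu b).

Let N (e : R) (z : R[i]) := cint nu setT (fun s : R => cpow (z - s%:C) e).

Let i_neq0 : 'i%C != 0 :> R[i].
Proof. by apply/eqP => /(congr1 (@complex.Im R))/= /eqP; rewrite oner_eq0. Qed.

Let rotD1 : rot b = rot (b - 1) * 'i%C :> R[i].
Proof.
have -> : 'i%C = rot 1 :> R[i].
  by apply: complex_ext; rewrite /= expR0 !mul1r ?cos_pihalf ?sin_pihalf.
by rewrite -cexpD; congr cexp; apply: complex_ext => /=; ring.
Qed.

(** The means of (z - s)^e are i^e times those of p^e. The quotient i^(b-1) / i^b = 1 / i turns i
    Psi / B into the announced ratio with its minus sign. *)
Let upper (re y : R) : 0 < y -> N b (re +i* y) != 0 /\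
  stieltjes mu (re +i* y) = - (N (b - 1) (re +i* y) / N b (re +i* y)).
Proof.
(* The clamp level must exceed |re| as well, since the comparison array sits at re. *)
move=> y0; pose M' := Num.max M `|re|.
have MM' : M <= M' by rewrite le_max lexx.
have reM' : `|re| <= M' by rewrite le_max lexx orbT.
have B0 : cpow_mean re y M' nu b != 0.
  apply: contraTneq (Re_cpow_mean_gt0 nu re b01 y0 (le_trans M0 MM')) => ->.
  by rewrite ltxx.
have r0 := cexp_neq0 (0 +i* ((b - 1) * (pi / 2))) : rot (b - 1) != 0.
rewrite /N !(cint_cpow_upper M0 nuM _ _ y0 MM') rotD1; split.
  by rewrite !mulf_neq0.
rewrite -[LHS]/(cint mu setT (resolvent re y)) (mu_resolvent y0 MM' reM').
transitivity (- (('i%C)^-1 * (cpow_mean re y M' nu (b - 1) / cpow_mean re y M' nu b))).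
  rewrite -mulNr; congr (_ * _); apply: (mulIf i_neq0); rewrite mulNr mulVf//.
  by apply: complex_ext => /=; ring.
by congr (- _); field; rewrite i_neq0 B0.
Qed.

Let cintegrable_resolvent (re y : R) : 0 < y -> cintegrable mu setT (resolvent re y).
Proof.
move=> y0; apply: (@cintegrable_bounded _ _ _ _ _ y^-1); last exact: normc_resolvent.
split; apply: continuous_measurable_fun.
  exact: (bc_Re_resolvent re y0).1.
exact: (bc_Im_resolvent re y0).1.
Qed.

Let lower (re y : R) : 0 < y ->
  stieltjes mu (re +i* - y) = - (N (b - 1) (re +i* - y) / N b (re +i* - y)).
Proof.
move=> y0; have [_ h] := upper re y0.
rewrite /N !(cint_cpow_lower M0 nuM)//.
transitivity (stieltjes mu (re +i* y))^*.
  rewrite -[stieltjes mu (re +i* y)]/(cint mu setT (resolvent re y)) -cint_conj; last first.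
    exact: cintegrable_resolvent.
  apply: eq_cint => s _; rewrite /resolvent conjc_inv; congr (_^-1).
  by apply: complex_ext; rewrite /= ?sub0r ?opprK.
by rewrite h rmorphN rmorphM; congr (- (_ * _)); rewrite fmorphV.
Qed.

Let real_point (x : R) : off_support nu x%:C -> off_support mu x%:C ->
  stieltjes mu x%:C = - (N (b - 1) x%:C / N b x%:C).
Proof.
move=> /off_support_ball[r r0 nur] /off_support_ball[q q0 muq].
have N0 : N b x%:C != 0 by exact: (cint_cpow_real_neq0 nuM r0 nur b01).
pose D := ~` ball x q; have mD : measurable D by apply: measurableC; exact: measurable_ball.
have Dq s : D s -> q <= `|x - s| by rewrite /D /ball /= => /negP; rewrite -leNgt.
have muD : mu (~` D) = 0 by rewrite setCK.
have S_cvg : ccvg (fun n => stieltjes mu (x +i* n.+1%:R^-1)) (stieltjes mu x%:C).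
  have y0 n : 0 < n.+1%:R^-1 :> R by rewrite invr_gt0.
  have mS : cmeasurable setT (fun s : R => (s%:C - x%:C)^-1 : R[i]).
    apply: cmeasurable_inv; apply: cmeasurableD; last exact: cmeasurable_cst.
    by apply: cmeasurable_real.
  have mr n : cmeasurable setT (resolvent x (n.+1%:R^-1 : R)).
    have [[/measurable_int/measurable_EFinP h1] [/measurable_int/measurable_EFinP h2]] :=
      cintegrable_resolvent x (y0 n).
    by split.
  rewrite -[stieltjes mu x%:C]/(cint mu setT (fun s : R => (s%:C - x%:C)^-1)).
  rewrite (cint_null_setC mD muD)//.
  rewrite (_ : (fun n => _) = (fun n => cint mu D (resolvent x (n.+1%:R^-1)))); last first.
    by apply/funext => n; rewrite -(cint_null_setC mD muD).
  apply: (@cint_dct _ _ _ _ _ _ _ (fun=> q^-1) mD _ _ _ _).2.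
  - by move=> n; have [h1 h2] := mr n; split; exact: measurable_funTS.
  - apply: (@integrableS _ _ _ _ setT) => //.
    exact: (@integrable_bounded _ _ _ _ _ `|q^-1|).
  - move=> n s Ds; have sq := Dq s Ds.
    rewrite /resolvent Normc.normcV lef_pV2 ?posrE//.
      apply: le_trans sq _; apply: le_trans (le_Re_normc _).
      by rewrite ReD ReN /= distrC.
    rewrite normc_gt0; apply/eqP => /(congr1 (@complex.Im R)) /= /eqP.
    by rewrite sub0r oppr_eq0 gt_eqF.
  - move=> s Ds; have sx : s - x != 0.
      by rewrite -normr_gt0 distrC (lt_le_trans q0 (Dq s Ds)).
    rewrite -[(_ - _)^-1]/(resolvent x 0 s).
    have h : (fun n => n.+1%:R^-1 : R) @ \oo --> (0 : R) by exact: cvg_harmonic.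
    have hd : ((s - x) ^+ 2 + (n.+1%:R^-1) ^+ 2)^-1 @[n --> \oo] -->
        (((s - x) ^+ 2 + 0 ^+ 2)^-1 : R).
      apply: cvgV; first by rewrite expr0n addr0 expf_neq0.
      by apply: cvgD; [exact: cvg_cst|exact: (cvg_comp _ _ h (@exprn_continuous R 2 0))].
    split.
      rewrite Re_resolvent (_ : (fun n => _) =
        (fun n => (s - x) * ((s - x) ^+ 2 + (n.+1%:R^-1) ^+ 2)^-1)).
        by apply: cvgM; [exact: cvg_cst|exact: hd].
      by apply/funext => n; exact: Re_resolvent.
    rewrite Im_resolvent (_ : (fun n => _) =
      (fun n => (n.+1%:R^-1) * ((s - x) ^+ 2 + (n.+1%:R^-1) ^+ 2)^-1)).
      by apply: cvgM; [exact: h|exact: hd].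
    by apply/funext => n; exact: Im_resolvent.
have N_cvg e : ccvg (fun n => N e (x +i* n.+1%:R^-1)) (N e x%:C).
  exact: (cint_cpow_real_cvg nuM r0 nur).
(* The limit is taken in product form; division comes last, the denominator being nonzero at the
   real point. *)
have h : stieltjes mu x%:C * N b x%:C = -1 * N (b - 1) x%:C.
  apply: (ccvg_unique (ccvgM S_cvg (N_cvg b))).
  rewrite (_ : (fun n => _) = (fun n => -1 * N (b - 1) (x +i* n.+1%:R^-1))).
    by apply: ccvgM => //; exact: ccvg_cst.
  apply/funext => n; have y0 : 0 < n.+1%:R^-1 :> R by rewrite invr_gt0.
  by have [Nn ->] := upper x y0; rewrite mulN1r mulNr mulfVK.
by apply: (mulIf N0); rewrite h mulN1r mulNr mulfVK.
Qed.

Lemma stieltjes_power_ratio (z : R[i]) : off_support nu z -> off_support mu z ->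
  stieltjes mu z = - (cintegral nu (fun x => cpow (z - x%:C) (b - 1)) /
    cintegral nu (fun x => cpow (z - x%:C) b)).
Proof.
case: z => re y; have [y0|y0|->] := ltrgtP y 0.
- move=> _ _; have Ny0 : 0 < - y by rewrite oppr_gt0.
  by have := lower re Ny0; rewrite opprK.
- by move=> _ _; exact: (upper re y0).2.
- exact: real_point.
Qed.

End stieltjes_transform.

(** * Tails of the squared variable *)

Section regular_variation.
Context d (T : measurableType d) (R : realType) (P : probability T R).
Variables (xi : {RV P >-> R}) (alpha : R).
Hypothesis alpha_gt0 : 0 < alpha.
Hypothesis xi_regvar : regularly_varying P alpha xi.
Let U w := xi w ^+ 2.

Lemma regularly_varying_tail_sqr : exists2 L : R -> R, slowly_varying L &
  forall x, 0 < x -> 0 < L (Num.sqrt x) /\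
    tail P U x = Num.sqrt x `^ (- alpha) * L (Num.sqrt x).
Proof.
have [L [L0 Lsv LE]] := xi_regvar; exists L => // x x0.
have s0 : 0 < Num.sqrt x by rewrite sqrtr_gt0.
split; first exact: L0.
rewrite /tail (_ : [set w | _] = [set w | Num.sqrt x < `|xi w|]) ?LE//.
apply/funext => w; apply/propext => /=; rewrite /U -(real_normK (num_real (xi w))).
by rewrite -{1}(sqr_sqrtr (ltW x0)) ltr_pXn2r ?nnegrE// ltW.
Qed.

Lemma tail_sqr_gt0 x : 0 < x -> 0 < tail P U x.
Proof.
have [L _ h] := regularly_varying_tail_sqr => x0; have [L0 ->] := h x x0.
by rewrite mulr_gt0// powR_gt0// sqrtr_gt0.
Qed.

Lemma tail_sqr_rv t : 0 < t ->
  tail P U (t * x) / tail P U x @[x --> +oo] --> t `^ (- (alpha / 2)).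
Proof.
move=> t0; have [L Lsv h] := regularly_varying_tail_sqr.
have st0 : 0 < Num.sqrt t by rewrite sqrtr_gt0.
have s_cvg : Num.sqrt (x : R) @[x --> +oo] --> +oo.
  apply/cvgryPge => A; near=> x; apply: (@le_trans _ _ `|A|); first exact: ler_norm.
  rewrite -sqrtr_sqr ler_wsqrtr//; near: x; exact: nbhs_pinfty_ge.
have hL : L (Num.sqrt t * Num.sqrt x) / L (Num.sqrt x) @[x --> +oo] --> (1 : R).
  exact: (cvg_comp _ _ s_cvg (Lsv _ st0)).
have -> : t `^ (- (alpha / 2)) = Num.sqrt t `^ (- alpha) * 1.
  by rewrite mulr1 -powR12_sqrt ?(ltW t0)// -powRrM; congr (_ `^ _); ring.
have hc : Num.sqrt t `^ (- alpha) * (L (Num.sqrt t * Num.sqrt x) / L (Num.sqrt x))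
    @[x --> +oo] --> Num.sqrt t `^ (- alpha) * 1.
  by apply: cvgM; [exact: cvg_cst|exact: hL].
apply: cvg_trans hc; apply: near_eq_cvg; near=> x.
have x0 : 0 < x by near: x; exact: nbhs_pinfty_gt.
have [L1 ->] := h _ x0; have [L2 ->] := h _ (mulr_gt0 t0 x0).
rewrite sqrtrM ?(ltW t0)// powRM ?sqrtr_ge0//.
have p0 : Num.sqrt x `^ (- alpha) != 0 by rewrite gt_eqF// powR_gt0// sqrtr_gt0.
by field; rewrite p0 gt_eqF.
Unshelve. all: by end_near. Qed.

End regular_variation.

Lemma tail_cvg0 d (T : measurableType d) (R : realType) (P : probability T R) (V : {RV P >-> R}) :
  tail P V x @[x --> +oo] --> (0 : R).
Proof.
have E x : tail P V x = fine (ccdf V x).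
  rewrite /tail /ccdf /distribution /pushforward; congr (fine (P _)).
  by apply/seteqP; split => w /=; rewrite in_itv/= andbT.
rewrite (_ : (fun x => _) = (fun x => fine (ccdf V x))); last exact/funext.
by apply: fine_cvg; exact: cvg_ccdfy0.
Qed.

(** * Limit law of one deterministic diagonal and its transform *)

Section corollary.
Context (R : realType) (d : measure_display) (T : measurableType d) (P : probability T R).
Variables (alpha : R) (xi : {RV P >-> R}) (X : nat -> {RV P >-> R}) (nu : probability R R).
Hypotheses (alpha_gt0 : 0 < alpha) (alpha_lt2 : alpha < 2).
Hypothesis xi_regvar : regularly_varying P alpha xi.
Hypothesis X_iid : iid_copies P xi X.
Variables (M : R) (a : nat -> nat -> R).
Hypotheses (M0 : 0 <= M) (aM : forall n i, `|a n i| <= M) (a_cvg : array_cvg nu a).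

Let b := alpha / 2.
Let b01 : 0 < b < 1.
Proof. by rewrite /b divr_gt0//= ltr_pdivrMr// mul1r. Qed.

Let tail_gt0 (x : R) : 0 < x -> 0 < tail P (fun w => xi w ^+ 2) x.
Proof. exact: tail_sqr_gt0 xi_regvar x. Qed.

Let tail_rv (t : R) : 0 < t -> tail P (fun w => xi w ^+ 2) (t * x) / tail P (fun w => xi w ^+ 2) x
  @[x --> +oo] --> t `^ (- b).
Proof. exact: tail_sqr_rv xi_regvar t. Qed.

Let tail_cvg : tail P (fun w => xi w ^+ 2) x @[x --> +oo] --> (0 : R).
Proof. exact: (tail_cvg0 (xi ^+ 2 : {mfun T >-> R})). Qed.

(** Weak convergence is tested on [cutoff M], which is 1 on the whole array; the margin 1 is the
    width of its ramp. *)
Lemma array_null : nu (~` [set s : R | `|s| <= M + 1]) = 0.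
Proof.
have c1 : \int[nu]_x cutoff M x = 1.
  apply: (cvg_unique _ (a_cvg (bc_cutoff M))) => //.
  have h : (fun=> 1 : R) @ \oo --> (1 : R) by exact: cvg_cst.
  apply: cvg_trans h; apply: near_eq_cvg; near=> n.
  have n0 : n%:R != 0 :> R by rewrite pnatr_eq0 -lt0n; near: n; exact: nbhs_infty_gt.
  rewrite (eq_bigr (fun=> 1)); last by move=> i _; rewrite cutoff_eq1.
  by rewrite sumr_const card_ord -[1 *+ n]mulr_natl mulr1 mulVf.
set K := [set s : R | _].
have mK : measurable (~` K).
  by apply: measurableC; exact: measurable_norm_le.
have ic := integrable_bc nu (bc_cutoff M) (@measurable_id _ _ setT).
have i1 : nu.-integrable setT (EFin \o (fun _ : R => 1 : R)).
  by apply: (@integrable_bounded _ _ _ _ _ 1) => // x; rewrite normr1.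
have iN : nu.-integrable setT (EFin \o (fun x : R => 1 + -1 * cutoff M x)).
  exact: (integrable_add measurableT i1 (integrable_scale (-1) measurableT ic)).
have iK : nu.-integrable setT (EFin \o (\1_(~` K) : R -> R)).
  apply: (@integrable_bounded _ _ _ _ _ 1) => // x.
  by rewrite indicE; case: (_ \in _); rewrite ?normr1 ?normr0.
have le : \int[nu]_x \1_(~` K) x <= \int[nu]_x (1 + -1 * cutoff M x).
  apply: le_Rintegral => // x _; rewrite mulN1r indicE.
  case: (boolP (x \in _)) => [/set_mem /negP|_]; last by rewrite subr_ge0 ramp_le1.
  by rewrite -ltNge => h; rewrite cutoff_eq0 ?subr0// ltW.
move: le; rewrite RintegralD//; last exact: integrable_scale.
rewrite RintegralZl// Rintegral_prob_cst c1 mulr1 subrr.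
rewrite /Rintegral integral_indic// setIT => le.
apply/eqP; rewrite -measure_le0 -[leLHS]fineK ?fin_num_measure//.
Unshelve. all: by end_near. Qed.

(** Besides the transform it records what the random case uses: the cutoff identity as tightness,
    and convergence along every bounded array with the same limit nu. *)
Lemma array_stieltjes : exists mu : probability R R,
  [/\ \int[mu]_x cutoff M x = 1,
      forall (M' : R) (a' : nat -> nat -> R), (forall n i, `|a' n i| <= M') ->
        array_cvg nu a' -> forall f, bounded_continuous f ->
        array_mean X n (a' n) f @[n --> \oo] --> \int[mu]_x f x &
      forall z, off_support nu z -> off_support mu z ->
        stieltjes mu z = - (cintegral nu (fun x => cpow (z - x%:C) (alpha / 2 - 1)) /
          cintegral nu (fun x => cpow (z - x%:C) (alpha / 2)))].
Proof.
have [mu hmu] := array_law X_iid b01 tail_gt0 tail_rv tail_cvg M0 aM a_cvg.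
exists mu; split.
- apply: (cvg_unique _ (hmu M a aM a_cvg _ (bc_cutoff M))) => //.
  rewrite (_ : (fun n => _) = (fun=> 1)); first exact: cvg_cst.
  apply/funext => n; rewrite -[RHS](array_mean_cst X n (a n)).
  by apply: eq_Rintegral => w _; rewrite cutoff_eq1//; exact: diagform_bound.
- exact: hmu.
have M1 : 0 <= M + 1 by rewrite addr_ge0.
move=> z; apply: (stieltjes_power_ratio M1 array_null b01) => re y M' y0 MM' reM'.
have aM' n i : `|a n i| <= M' by apply: le_trans (aM n i) (le_trans _ MM'); rewrite lerDl.
have h1 := resolvent_mean_cvg X_iid b01 tail_gt0 tail_rv tail_cvg y0 reM' aM' a_cvg.
apply: (ccvg_unique _ h1); split.
  exact: (hmu M a aM a_cvg _ (bc_Re_resolvent re y0)).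
exact: (hmu M a aM a_cvg _ (bc_Im_resolvent re y0)).
Qed.

End corollary.

(** The whole space has mass 1 and cannot lie in a null set. A single realisation thus supplies a
    deterministic array from which to build the limit law. *)
Lemma ae_exists d (T : measurableType d) (R : realType) (P : probability T R) (G : T -> Prop) :
  {ae P, forall w, G w} -> exists w, G w.
Proof.
move=> [S [mS S0 GS]]; apply: contrapT => h.
have : (P setT <= P S)%E.
  by apply: le_measure; rewrite ?inE// => w _; apply: GS => Gw; apply: h; exists w.
by rewrite probability_setT S0 leNgt lte_fin ltr01.
Qed.

Theorem corollary3p3 (R : realType) (d : measure_display)
    (T : measurableType d) (P : probability T R)
    (alpha : R) (xi : {RV P >-> R}) (X : nat -> {RV P >-> R})
    (A : forall n : nat, T -> 'M[R[i]]_n) (nu : probability R R)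
    (alpha_gt0 : 0 < alpha) (alpha_lt2 : alpha < 2)
    (xi_sym : symmetric_law P xi)
    (xi_regvar : regularly_varying P alpha xi)
    (X_iid : iid_copies P xi X)
    (A_random : forall n, random_matrix (A n))
    (A_herm : forall n w, A n w \is hermsymmx)
    (A_indep : forall n,
      independent_families P (entries (A n)) (coordinates (self_normalized X n)))
    (A_diag_bounded : {ae P, forall w,
      (limn_esup (fun n =>
         (\big[Num.max/0]_(i < n) Normc.normc (A n w i i))%:E) < +oo)%E})
    (A_diag_cvg : {ae P, forall w,
      weakly_cvg (fun n => empirical_measure (real_diag (A n w))) nu})
    (A_offdiag : ((n%:R ^- 2)%:E *
        'E_P[fun w => (frobenius_norm (A n w - diag_part (A n w)) ^+ 2)%R]
      @[n --> \oo] --> 0)%E) :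
  exists mu : probability R R,
    cvg_in_distribution P
      (fun n w => quadratic_form (A n w) (self_normalized X n w)) mu /\
    forall z : R[i], off_support nu z -> off_support mu z ->
      stieltjes mu z =
      - (cintegral nu (fun x => cpow (z - x%:C) (alpha / 2 - 1)) /
         cintegral nu (fun x => cpow (z - x%:C) (alpha / 2))).
Proof.
have good : {ae P, forall w, (exists M, forall n k, `|diag_seq (A n w) k| <= M) /\
    array_cvg nu (fun n => diag_seq (A n w))}.
  apply: filterS2 A_diag_bounded A_diag_cvg => w hb hc; split.
    exact: limn_esup_bounded.
  exact: weakly_cvg_array.
(* One good realisation fixes [mu]; by [hmu] the same law is reached along the diagonal of almost
   every other realisation, each with its own bound. *)
have [w0 [[M aM] a_cvg]] := ae_exists good.
have M0 : 0 <= M := le_trans (normr_ge0 _) (aM 0 0)%N.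
have [mu [mu1 hmu mu_stieltjes]] :=
  array_stieltjes alpha_gt0 alpha_lt2 xi_regvar X_iid M0 aM a_cvg.
exists mu; split => //.
apply: (quadratic_form_cvg X_iid xi_sym A_random A_indep A_offdiag M0 mu1).
by apply: filterS good => w [[M' aM'] ha] f bf; exact: hmu aM' ha f bf.
Qed.
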